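(* Let $X$ be a second-countable locally compact Abelian group that contains no subgroups topologically isomorphic to the circle group $\mathbb{T}$ and has a finite topological automorphism group $\operatorname{Aut}(X)$. Let $\alpha_j,\beta_j$, $j=1,2,\dots$, be topological automorphisms of $X$, and let $\xi_j$, $j=1,2,\dots$, be independent random variables taking values in $X$ with distributions $\mu_j$. Assume that: (i) the series $L_1=\sum_{j=1}^\infty\alpha_j\xi_j$ and $L_2=\sum_{j=1}^\infty\beta_j\xi_j$ converge in distribution; (ii) the linear forms $L_1$ and $L_2$ are independent; (iii) the characteristic functions $\widehat\mu_{L_1}(y)$ and $\widehat\mu_{L_2}(y)$ of the distributions of $L_1$ and $L_2$ do not vanish at any point. Then all $\mu_j$ are Gaussian distributions on $X$.
   Context: $\operatorname{Aut}(X)$ is the group of all topological automorphisms of $X$ (group automorphisms that are homeomorphisms). $Y$ denotes the character group of $X$, and $(x,y)$ the value of a character $y\in Y$ at $x\in X$. A distribution is a Borel probability measure; the characteristic function of a distribution $\mu$ on $X$ is $\widehat\mu(y)=\int_X(x,y)\,d\mu(x)$, $y\in Y$. A distribution $\gamma$ on $X$ is Gaussian if its characteristic function can be represented as $\widehat\gamma(y)=(x,y)\exp\{-\varphi(y)\}$, $y\in Y$, where $x\in X$ and $\varphi$ is a continuous nonnegative function on $Y$ satisfying $\varphi(u+v)+\varphi(u-v)=2[\varphi(u)+\varphi(v)]$ for all $u,v\in Y$ (so degenerate distributions are Gaussian). Convergence: for independent $X$-valued random variables $\eta_j$, the series $\sum_{j=1}^\infty\eta_j$ converges in distribution if there is an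 $X$-valued random variable $L$ such that the distributions of the partial sums $\sum_{j=1}^N\eta_j$ converge weakly to the distribution of $L$ as $N\to\infty$; one then writes $L=\sum_{j=1}^\infty\eta_j$. For the pair of linear forms, the joint distribution of $(L_1,L_2)$ on $X^2$ is understood to be the weak limit, as $N\to\infty$, of the distributions of the pairs of partial sums $\big(\sum_{j=1}^N\alpha_j\xi_j,\ \sum_{j=1}^N\beta_j\xi_j\big)$; in particular this limit is assumed to exist. Independence of $L_1$ and $L_2$ means that this joint distribution is the product of its marginals. *)

(* Defs.v *)
From HB Require Import structures.
From mathcomp Require Import all_boot all_order all_algebra.
From mathcomp Require Import all_classical all_reals all_analysis.
From mathcomp Require Import finmap complex.

Set Implicit Arguments.
Unset Strict Implicit.
Unset Printing Implicit Defensive.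

Import Order.TTheory GRing.Theory Num.Theory.
Import numFieldNormedType.Exports.

Local Open Scope classical_set_scope.
Local Open Scope ring_scope.
Local Open Scope complex_scope.

(* R[i] seen as a numeric field, so that it carries the usual topology. *)
Definition C (R : realType) : numClosedFieldType := R[i].

Definition circle (R : realType) : set (C R) := [set z | `|z| = 1].
Arguments circle : clear implicits.

Definition subgroup (X : zmodType) (H : set X) : Prop :=
  H 0 /\ forall x y, H x -> H y -> H (x - y).

(* f and g are mutually inverse homeomorphisms between H, with the subspace
   topology, and the circle. *)
Definition isomorphic_to_circle (R : realType) (X : topologicalZmodType)
    (H : set X) : Prop :=
  exists (f : X -> C R) (g : C R -> X),
    [/\ {homo f : x / H x >-> circle R x} /\ {homo g : z / circle R z >-> H z},
        (forall x, H x -> g (f x) = x) /\ (forall z, circle R z -> f (g z) = z),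
        {in H &, {morph f : x y / x + y >-> x * y}},
        {within H, continuous f}
      & {within circle R, continuous g}].

Definition topological_automorphisms (X : topologicalZmodType) : set (X -> X) :=
  [set f : X -> X | {morph f : x y / x + y} /\ continuous f /\
           exists g : X -> X, [/\ cancel f g, cancel g f & continuous g]].
Arguments topological_automorphisms : clear implicits.

Section Characters.
Variables (R : realType) (X : topologicalZmodType).

(* The character group is written additively: (u + v) x = u x * v x. It carries
   the compact-open topology. *)
Record character := Character {
  char_fun :> X -> C R ;
  char_continuous : continuous char_fun ;
  char_norm : forall x, `|char_fun x| = 1 ;
  charD : {morph char_fun : x y / x + y >-> x * y} }.

Lemma char_ext (u v : character) : u =1 v -> u = v.
Proof.
case: u v => [f f1 f2 f3] [g g1 g2 g3] /= /funext fg; subst g.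
by congr Character; exact: Prop_irrelevance.
Qed.

Lemma char_neq0 (u : character) x : u x != 0.
Proof. by rewrite -normr_eq0 char_norm oner_neq0. Qed.

Lemma char_cst1_continuous : continuous (fun _ : X => (1 : C R)).
Proof. by move=> x; exact: cvg_cst. Qed.

Lemma char_cst1D : {morph (fun _ : X => (1 : C R)) : x y / x + y >-> x * y}.
Proof. by move=> x y; rewrite mulr1. Qed.

Definition char_zero : character :=
  Character char_cst1_continuous (fun=> normr1 _) char_cst1D.

Lemma char_mul_continuous (u v : character) : continuous (fun x : X => u x * v x).
Proof. by move=> x; apply: cvgM; exact: char_continuous. Qed.

Lemma char_mul_norm (u v : character) x : `|u x * v x| = 1.
Proof. by rewrite normrM !char_norm mulr1. Qed.

Lemma char_mulD (u v : character) :
  {morph (fun x => u x * v x) : x y / x + y >-> x * y}.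
Proof. by move=> x y /=; rewrite !charD mulrACA. Qed.

Definition char_add (u v : character) : character :=
  Character (@char_mul_continuous u v) (char_mul_norm u v) (char_mulD u v).

Lemma char_inv_continuous (u : character) : continuous (fun x : X => (u x)^-1).
Proof.
by move=> x; apply: cvgV; [exact: char_neq0|exact: char_continuous].
Qed.

Lemma char_inv_norm (u : character) x : `|(u x)^-1| = 1.
Proof. by rewrite normfV char_norm invr1. Qed.

Lemma char_invD (u : character) :
  {morph (fun x => (u x)^-1) : x y / x + y >-> x * y}.
Proof. by move=> x y /=; rewrite charD invfM. Qed.

Definition char_opp (u : character) : character :=
  Character (@char_inv_continuous u) (char_inv_norm u) (char_invD u).

HB.instance Definition _ := gen_eqMixin character.
HB.instance Definition _ := gen_choiceMixin character.

Let char_addA : associative char_add.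
Proof. by move=> u v w; apply: char_ext => x /=; rewrite mulrA. Qed.

Let char_addC : commutative char_add.
Proof. by move=> u v; apply: char_ext => x /=; rewrite mulrC. Qed.

Let char_add0 : left_id char_zero char_add.
Proof. by move=> u; apply: char_ext => x /=; rewrite mul1r. Qed.

Let char_addN : left_inverse char_zero char_opp char_add.
Proof. by move=> u; apply: char_ext => x /=; rewrite mulVf ?char_neq0. Qed.

HB.instance Definition _ :=
  GRing.isZmodule.Build character char_addA char_addC char_add0 char_addN.

HB.instance Definition _ := Topological.copy character
  (initial_topology (char_fun : character -> {compact-open, X -> C R})).

End Characters.

(* X equipped with its Borel sigma-algebra. *)
Definition borel (X : topologicalZmodType) : Type := X.

HB.instance Definition _ (X : topologicalZmodType) :=
  TopologicalZmodule.on (borel X).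
HB.instance Definition _ (X : topologicalZmodType) :=
  isPointed.Build (borel X) 0.
HB.instance Definition _ (X : topologicalZmodType) :=
  Measurable.copy (borel X) (g_sigma_algebraType (@open (borel X))).

(* The product of two such types carries the product topology and the product
   sigma-algebra. On borel X * borel X with X second-countable, the latter is the
   Borel sigma-algebra of the former. *)
#[short(type="topMeasurableType")]
HB.structure Definition TopMeasurable d := {T of Topological T & Measurable d T}.

HB.instance Definition _ (X : topologicalZmodType) := Topological.on (borel X).
HB.instance Definition _ d1 d2 (T1 : topMeasurableType d1)
  (T2 : topMeasurableType d2) := Topological.on (T1 * T2)%type.

Definition weak_cvg (R : realType) d (T : topMeasurableType d)
    (mu : nat -> set T -> \bar R) (nu : set T -> \bar R) : Prop :=
  forall f : T -> R, continuous f -> (exists M, forall x, `|f x| <= M) ->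
    (\int[mu n]_x (f x)%:E)%E @[n --> \oo] --> (\int[nu]_x (f x)%:E)%E.

Definition mutually_independent (R : realType) d d' (T : measurableType d)
    (T' : measurableType d') (P : probability T R)
    (xi : nat -> {RV P >-> T'}) : Prop :=
  forall (J : {fset nat}) (A : nat -> set T'), (forall j, measurable (A j)) ->
    P (\bigcap_(j in [set` J]) (xi j @^-1` A j)) =
    (\prod_(j <- J) P (xi j @^-1` A j))%E.

Definition joint_distribution (R : realType) d d1 d2 (T : measurableType d)
    (T1 : measurableType d1) (T2 : measurableType d2) (P : set T -> \bar R)
    (U : T -> T1) (V : T -> T2) : set (T1 * T2) -> \bar R :=
  pushforward P (fun w => (U w, V w)).

Definition independent_pair (R : realType) d d1 d2 (T : measurableType d)
    (T1 : measurableType d1) (T2 : measurableType d2) (P : probability T R)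
    (U : {RV P >-> T1}) (V : {RV P >-> T2}) : Prop :=
  forall A, measurable A ->
    joint_distribution P U V A = (distribution P U \x distribution P V)%E A.

Section GaussianDistributions.
Variables (R : realType) (X : topologicalZmodType).

Definition characteristic_function (mu : probability (borel X) R)
    (y : character R X) : C R :=
  (\int[mu]_x complex.Re (y x)) +i* (\int[mu]_x complex.Im (y x)).

Definition gaussian (gamma : probability (borel X) R) : Prop :=
  exists (x : X) (phi : character R X -> R),
    [/\ continuous phi,
        forall y, 0 <= phi y,
        forall u v, phi (u + v) + phi (u - v) = 2 * (phi u + phi v)
      & forall y, characteristic_function gamma y = y x * (expR (- phi y))%:C].

End GaussianDistributions.

Section LinearForms.
Variables (R : realType) (X : topologicalZmodType).
Variables (d : measure_display) (T : measurableType d) (P : probability T R).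
Variables (d' : measure_display) (T' : measurableType d') (Q : probability T' R).

Definition partial_sum (alpha : nat -> X -> X)
    (xi : nat -> {RV P >-> borel X}) (N : nat) (w : T) : borel X :=
  \sum_(j < N) alpha j (xi j w).

(* The limiting random variables may live on another probability space. *)
Definition series_cvg_in_distribution (alpha : nat -> X -> X)
    (xi : nat -> {RV P >-> borel X}) (L : {RV Q >-> borel X}) : Prop :=
  weak_cvg (fun N => pushforward P (partial_sum alpha xi N))
    (distribution Q L).

Definition pair_cvg_in_distribution (alpha beta : nat -> X -> X)
    (xi : nat -> {RV P >-> borel X}) (L1 L2 : {RV Q >-> borel X}) : Prop :=
  weak_cvg
    (fun N => joint_distribution P (partial_sum alpha xi N)
                                   (partial_sum beta xi N))
    (joint_distribution Q L1 L2).

End LinearForms.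

(* Main.v *)
Require Import Defs.
From mathcomp Require Import all_boot all_order all_algebra.
From mathcomp Require Import all_classical all_reals all_analysis.
From mathcomp Require Import complex finmap ring lra zify measurable_realfun.

Set Implicit Arguments.
Unset Strict Implicit.
Unset Printing Implicit Defensive.

Import Order.TTheory GRing.Theory Num.Theory.
Import numFieldNormedType.Exports.

Local Open Scope classical_set_scope.
Local Open Scope ring_scope.

(* With [psi_j = - ln |cf mu_j|^2], independence of the two forms becomes an
  additive equation for the limits of [\sum_j psi_j \o alpha_j] and
  [\sum_j psi_j \o beta_j]. Averaged over the finite group Aut(X), their common
  limit [M] satisfies [\sum_i M (u + g_i v) = n (M u + M v)]; by Newton's
  identities [M] is then a polynomial, and [M >= 0] forces the parallelogram law.
  So [mu_j] is, up to a shift, a convolution factor of a Gaussian law [gamma]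
  with form [M]. By Cameron-Martin, [gamma] yields one-parameter subgroups of
  X; finiteness of Aut(X) keeps them in a compact set and the absence of circles
  makes their exponential map injective on coordinates. As [gamma] is
  concentrated on its image, so is a shift of [mu_j], and the one-dimensional
  theorem of Cramer applies to each coordinate. The means come from the law of
  large numbers, the covariance form from comparing pairs of coordinates. *)
Implicit Type R : realType.

Local Tactic Notation "ext" simple_intropattern(x) := apply/funext=> x.
Local Tactic Notation "eqsum" simple_intropattern(i) := apply: eq_bigr=> i _.
Local Tactic Notation "lesum" simple_intropattern(i) := apply: ler_sum=> i _.

Local Notation Re := (@complex.Re _).
Local Notation Im := (@complex.Im _).
Local Notation auts := topological_automorphisms.
Local Notation prob X R := (probability (borel X) R).

(** The normal law in infinitely many coordinates is never built as a measure: it is a functional on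
    bounded functions, a limit of random walks along an ultrafilter, so no measurability question
    arises. It is compared with measures on X only through trigonometric polynomials, whose averages
    depend on characteristic functions alone; hence these polynomials have to be bounded by 1
    everywhere, not just where they approximate something. The coordinates come from Gram-Schmidt
    applied to [M] along a sequence of characters separating the points of X. Such a sequence is
    obtained from an invariant integral, through extreme positive definite eigenfunctions of a
    convolution operator. The complement of [mu_j] in the limit law is not formed either. Partial
    convolutions take its place, symmetrised so that their characteristic functions are real, and
    the theorem of Cramer is proved with a second factor that varies with the truncation level. All
    conclusions concern one separating sequence at a time; as it is arbitrary, any four characters
    may be put in front of it. *)

Lemma cos_bounded R (x : R) : `|cos x| <= 1.
by rewrite ler_norml cos_geN1 cos_le1. Qed.

Lemma sin_bounded R (x : R) : `|sin x| <= 1.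
by rewrite ler_norml sin_geN1 sin_le1. Qed.

Lemma eq_ler (R : numDomainType) (x y : R) : x = y -> x <= y.
by move=> ->. Qed.

Lemma eqC (R : rcfType) (z w : R[i]) : Re z = Re w -> Im z = Im w -> z = w.
by case: z w=> ? ? [? ?] /= -> ->. Qed.

(** * Newton's identities for commuting translations *)

Section Newton.
Variables (R : pzRingType) (Y : zmodType).
Implicit Types (F : Y -> R) (s : seq Y) (u w : Y).

(** With T_w the translation that sends F to u |-> F(u + w), this is the k-th elementary symmetric
    function of the operators T_w, w in [s], applied to F. *)
Fixpoint esf s k F u : R := match s with | [::] => if k is 0 then F u else 0
 | w :: s' => esf s' k F u + if k is k'.+1 then esf s' k' F (u + w) else 0 end.

Definition psum s j F u : R := \sum_(w <- s) F (u + w *+ j).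

Lemma esf0 s F u : esf s 0 F u = F u.
by elim: s u=> //= w s IH u;rewrite addr0. Qed.

Lemma esfS s x k F u : esf (x :: s) k.+1 F u = esf s k.+1 F u + esf s k F (u + x).
by []. Qed.

(** Induction on [s] through e_{k+1}(w :: s) = e_{k+1}(s) + T_w e_k(s). What the hypothesis does not
    cover are the powers of T_w, and their alternating sum collapses to T_w e_k(s); this is
    [T12]. *)
Lemma newton_esym s k F u : (esf s k.+1 F u) *+ k.+1 = \sum_(i < k.+1) (-1) ^+ i * psum s i.+1 (esf s (k - i) F) u.
have psumE w t j H v : psum (w :: t) j H v = H (v + w *+ j) + psum t j H v.
 by rewrite /psum big_cons.
elim: s k u=> [|w s IH] k u.
 rewrite mul0rn big1 // => i;by rewrite /psum big_nil mulr0.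
have psumS t j k' v : psum t j (esf (w :: s) k'.+1 F) v =
  psum t j (esf s k'.+1 F) v + psum t j (esf s k' F) (v + w).
 by rewrite /psum -big_split;eqsum x=> /=;rewrite addrAC.
have psumS0 t j v : psum t j (esf (w :: s) 0 F) v = psum t j (esf s 0 F) v.
 by rewrite /psum;eqsum x=> /=;rewrite addr0.
have T12 : \sum_(i < k.+1) (-1) ^+ i * esf (w :: s) (k - i) F (u + w *+ i.+1) = esf s k F (u + w).
 elim: k {psumS psumS0}=> [|k IHk].
  by rewrite big_ord_recl big_ord0 /= expr0 mul1r !addr0.
 rewrite big_ord_recl mul1r subn0. under eq_bigr do rewrite lift0 subSS exprS mulN1r mulNr.
 rewrite sumrN [esf (w :: s) k.+1 F _]/= -addrA -[RHS]addr0;congr (_ _).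
  apply/eqP;rewrite subr_eq0;apply/eqP.
 case: k IHk=> [|k] IHk.
  by rewrite big_ord_recl big_ord0 /= expr0 mul1r !addr0 -addrA mulr2n.
 pose f (j : nat) : R := esf s (k.+1 - j) F (u + w *+ j.+2).
 have fE (i : nat) : (i < k.+2)%N -> esf (w :: s) (k.+1 - i) F (u + w *+ i.+2) =
   f i + (if (i < k.+1)%N then f i.+1 else 0).
  move=> ik;rewrite /f;case: ltnP=> ik1.
   by rewrite subSS subSn //= -addrA -mulrSr.
  have -> : i = k.+1 by lia. by rewrite subnn /=.
 under eq_bigr=> i do rewrite fE //. under eq_bigr do rewrite mulrDr.
 rewrite big_split big_ord_recl mul1r [X in _ = _ + X]big_ord_recr.
 rewrite [(k.+1 < _)%N]ltnn mulr0 /= addr0 {1}/f subn0. rewrite addrA -[LHS]addr0 -[RHS]addrA;congr (_ _).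
 apply/esym;rewrite -big_split big1 //= => i _. by rewrite /bump add1n ltn_ord exprS mulN1r mulNr addNr.
under eq_bigr do rewrite psumE mulrDr.
rewrite big_split /= T12.
have T3 : \sum_(i < k.+1) (-1) ^+ i * psum s i.+1 (esf (w :: s) (k - i) F) u =
  esf s k.+1 F u *+ k.+1 + esf s k F (u + w) *+ k.
 rewrite big_ord_recr /= subnn psumS0. have -> : \sum_(i < k) (-1) ^+ i * psum s i.+1 (esf (w :: s) (k - i) F) u =
  \sum_(i < k) ((-1) ^+ i * psum s i.+1 (esf s (k - i) F) u) +
  \sum_(i < k) ((-1) ^+ i * psum s i.+1 (esf s (k.-1 - i) F) (u + w)). rewrite -big_split;eqsum i=> /=.
  have -> : (k - i = (k.-1 - i).+1)%N by have := ltn_ord i;lia. by rewrite psumS mulrDr.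
 rewrite addrAC;congr (_ + _).
  by rewrite IH big_ord_recr /= subnn.
 by case: k {T12 psumS psumS0}=> [|k];[rewrite big_ord0 | rewrite IH].
by rewrite T3 /= mulrnDl [in RHS]addrC -addrA -mulrSr.
Qed.

(** The product of the operators T_w - T_x over x in [s]: the monic polynomial with the translations
    as roots, evaluated at T_w. *)
Fixpoint pdiff s w F u : R := match s with | [::] => F u | x :: s' => pdiff s' w F (u + w) - pdiff s' w F (u + x)
 end.

Lemma pdiff_esym s w F u : pdiff s w F u = \sum_(k < (size s).+1) (-1) ^+ k * esf s k F (u + w *+ (size s - k)).
elim: s u=> [|x s IH] u.
 by rewrite big_ord_recl big_ord0 expr0 mul1r /= !addr0.
rewrite [LHS]/= !IH [ RHS]big_ord_recl mul1r subn0 esf0 [size (_ :: _)]/=.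
under [in RHS]eq_bigr do rewrite lift0 subSS esfS mulrDr.
rewrite big_split addrA;congr (_ + _).
 rewrite big_ord_recl mul1r subn0 !esf0 -addrA -mulrS;congr (_ _).
 rewrite [RHS]big_ord_recr [X in _ = _ + X](_ : _ = 0) ?addr0.
  eqsum i;rewrite lift0 -addrA -mulrS. by rewrite /= subnSK.
 suff -> : forall t m H v, (size t < m)%N -> esf t m H v = 0;rewrite ?mulr0 //.
 move=> t;elim: t=> [|y t IHt] [|m] H v //= tm. by rewrite !IHt ?addr0 // ltnW.
rewrite -sumrN;eqsum i;rewrite exprS mulN1r mulNr.
by rewrite addrAC.
Qed.

Lemma pdiff_mem s w F u : w \in s -> pdiff s w F u = 0.
elim: s u=> //= x s IH u;rewrite inE=> /orP[/eqP <-|ws].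
 by rewrite subrr.
by rewrite !IH // subrr.
Qed.

End Newton.

Section NewtonField.
Variables (R : numFieldType) (Y : zmodType).

(* Newton's identities determine the elementary symmetric functions of the
  translations by the elements of [W] from their power sums. *)
Lemma esf_of_psum (W : seq Y) (F : Y -> R) : (forall j u, (0 < j)%N -> psum W j F u = (size W)%:R * F u) ->
 forall k u, esf W k F u = 'C(size W, k)%:R * F u.
move=> pF k;elim/ltn_ind: k=> -[_|k IH] u.
 by rewrite esf0 bin0 mul1r.
(* The series of (1 + X)^n is that of (1 + X)^(n+1) divided by 1 + X. *)
have alt : forall n k, \sum_(i < k.+1) (-1) ^+ i * 'C(n.+1, k - i)%:R = 'C(n, k)%:R :> R.
 move=> n;elim=> [|m IHm];first by rewrite big_ord1 !bin0 mulr1. rewrite big_ord_recl mul1r subn0.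
 under eq_bigr do rewrite lift0 subSS exprS mulN1r mulNr. by rewrite sumrN IHm binS natrD addrK.
have k1 : (k.+1%:R : R) != 0 by [].
apply: (mulfI k1);rewrite [LHS]mulr_natl newton_esym.
have E (i : 'I_k.+1) : (-1) ^+ i * psum W i.+1 (esf W (k - i) F) u =
  ((-1) ^+ i * 'C(size W, k - i)%:R) * ((size W)%:R * F u).
 rewrite -mulrA;congr (_ _). have -> : esf W (k - i) F = fun u => 'C(size W, k - i)%:R * F u.
  by ext v;rewrite IH // ltnS leq_subr.
 by rewrite /psum -mulr_sumr -/(psum _ _ _ _) pF.
under eq_bigr do rewrite E.
rewrite -mulr_suml mulrA mulrA;congr (_ * _).
case: size=> [|n];first by rewrite mulr0 mulr0.
by rewrite alt -!natrM -mul_bin_diag mulnC.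
Qed.

(** The elementary symmetric functions of [W] agree with those of [size W] copies of the identity,
    so the product of all T_w - T_x equals the power of T_w - 1; and it vanishes because of the
    factor with x = w. *)
Lemma pdiff_nilpotent (W : seq Y) (F : Y -> R) (w : Y) :
 (forall j u, (0 < j)%N -> psum W j F u = (size W)%:R * F u) ->
 w \in W -> forall u, pdiff (nseq (size W) 0) w F u = 0.
move=> pF wW u;rewrite -(pdiff_mem F u wW) !pdiff_esym size_nseq.
eqsum i;congr (_ _);rewrite [RHS]esf_of_psum //.
move: (u + _)=> v;move: (size W) (i : nat) v=> n {pF i}.
elim: n=> [|n IH] [|k] v /=.
- by rewrite bin0 mul1r.
- by rewrite mul0r.
- by rewrite addr0 IH !bin0.
- by rewrite !IH addr0 binS natrD mulrDl.
Qed.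

End NewtonField.

(** * Forward and central differences *)

Section DifferenceOperators.
Variables (R : numFieldType) (Y : zmodType).
Implicit Types (F : Y -> R) (u v : Y).

Definition fdiff v F u := F (u + v) - F u.
Definition cdiff v F u := F (u + v) - F (u - v).
(** The second factor in T_v - T_{-v} = (T_v - 1)(1 + T_{-v}). *)
Definition bsum v F u := F u + F (u - v).

Lemma iter_fdiff v F m u : iter m (fdiff v) F u = pdiff (nseq m 0) v F u.
by elim: m u=> //= m IH u;rewrite /fdiff !IH addr0. Qed.

Lemma fdiff_bsum v F : fdiff v (bsum v F) = bsum v (fdiff v F).
by ext u;rewrite /fdiff /bsum addrK subrK;ring. Qed.

Lemma cdiffE v F : cdiff v F = bsum v (fdiff v F).
by ext u;rewrite /fdiff /bsum /cdiff subrK;ring. Qed.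

Lemma iter_comm (A B : (Y -> R) -> Y -> R) k F : (forall H, A (B H) = B (A H)) -> A (iter k B F) = iter k B (A F).
by move=> AB;elim: k=> //= k IH;rewrite AB IH. Qed.

Lemma iter_cdiff v F k : iter k (cdiff v) F = iter k (bsum v) (iter k (fdiff v) F).
elim: k=> //= k ->;rewrite cdiffE;congr bsum.
by rewrite (iter_comm k (A := fdiff v)) // => H;exact: fdiff_bsum.
Qed.

Lemma bsum0 v : bsum v (fun=> 0) = fun=> 0.
by ext u;rewrite /bsum addr0. Qed.

Lemma fdiff0 v : fdiff v (fun=> 0) = fun=> 0.
by ext u;rewrite /fdiff subr0. Qed.

Lemma iter_fix (A : (Y -> R) -> Y -> R) F k : A F = F -> iter k A F = F.
by move=> AF;elim: k=> //= k ->. Qed.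

(** On the generalised kernel of T_v - 1 the operator 1 + T_{-v} is injective: it doubles functions
    invariant under [v], so its cube multiplies them by 8. The exponent [L] is thus lowered one at a
    time. *)
Lemma fdiff_nilpotent v F L : iter L (fdiff v) F = (fun=> 0) -> iter 3 (cdiff v) F = (fun=> 0) ->
 iter 3 (fdiff v) F = fun=> 0.
move=> DL;rewrite iter_cdiff;set r := iter 3 (fdiff v) F=> S3.
have Dr : iter L (fdiff v) r = fun=> 0.
 by rewrite /r -iterD addnC iterD DL iter_fix // fdiff0.
elim: L Dr {DL}=> // L IH Dr;apply: IH.
set s := iter L _ r in Dr *.
have sv : forall u, s (u + v) = s u.
 move=> u;apply: subr0_eq. exact: (congr1 (fun H : Y -> R => H u) Dr).
have sS : forall u, s (u - v) = s u by move=> u;rewrite -[in RHS](subrK v u).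
have S3s : iter 3 (bsum v) s = fun=> 0.
 transitivity (iter L (fdiff v) (iter 3 (bsum v) r)).
  by rewrite /s /= !(iter_comm L (A := bsum v)) // => H;rewrite fdiff_bsum.
 by rewrite S3 iter_fix // fdiff0.
ext u;have := congr1 (fun H : Y -> R => H u) S3s.
rewrite /= /bsum !sS=> s8.
have /eqP : s u *+ 8 = 0 by rewrite -[RHS]s8;ring.
by rewrite mulrn_eq0 /= => /eqP.
Qed.

End DifferenceOperators.

Lemma complex_normE (R : rcfType) (x y : R) : `|(x +i* y)%C| = (Num.sqrt (x ^+ 2 + y ^+ 2))%:C%C.
by rewrite normc_def. Qed.

Lemma bin_le_expn n k : ('C(n, k) <= n ^ k)%N.
have ff : (n ^_ k <= n ^ k)%N.
 by elim: k=> // k IH;rewrite ffactnSr expnSr leq_mul // leq_subr.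
by rewrite (leq_trans _ ff) // -bin_ffact leq_pmulr // fact_gt0.
Qed.

Lemma bin2_mul2 (R : pzSemiRingType) k : ('C(k, 2)%:R : R) * 2 = k%:R * k.-1%:R.
by rewrite -!natrM mulnC -mul_bin_diag bin1. Qed.

(** * From the mean equation to the parallelogram law *)

Section MeanQuadratic.
Variables (R : realType) (Y : zmodType) (n : nat) (g : 'I_n -> Y -> Y).
Variables (i0 i1 : 'I_n) (M : Y -> R).
Hypothesis gD : forall i, {morph g i : u v / u + v}.
Hypothesis g_id : g i0 =1 id.
Hypothesis g_opp : g i1 =1 -%R.
Hypothesis M_ge0 : forall u, 0 <= M u.
Hypothesis MN : forall u, M (- u) = M u.
Hypothesis mean_M : forall u v, \sum_i M (u + g i v) = n%:R * (M u + M v).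

Let gMn i v k : g i (v *+ k) = g i v *+ k.
elim: k=> [|k IH];last by rewrite !mulrS gD IH.
by apply: (addrI (g i 0));rewrite mulr0n -gD !addr0.
Qed.

(** A difference cancels the inhomogeneous term of [mean_M]. Since [g i] is additive, the shifts by
    multiples of [g i v] are instances of the same equation, and so all power sums become known. *)
Lemma fdiff_mean v w j u : \sum_i fdiff w M (u + g i v *+ j) = n%:R * fdiff w M u.
rewrite /fdiff sumrB.
under eq_bigr do rewrite -gMn addrAC.
under [X in _ - X]eq_bigr do rewrite -gMn.
by rewrite !mean_M;ring.
Qed.

Lemma fdiff_iter0 v : iter n.+1 (fdiff v) M = fun=> 0.
rewrite -addn1 iterD;ext u.
pose W := [seq g i v | i <- enum 'I_n].
have sW : size W = n by rewrite size_map size_enum_ord.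
rewrite iter_fdiff -sW;apply: pdiff_nilpotent.
 move=> j x _;rewrite /psum big_map big_enum sW;exact: fdiff_mean.
by rewrite -[v]g_id;apply: map_f;rewrite mem_enum.
Qed.

Section kernel.
Variables (v : Y).

Let b k := iter k (cdiff v) M.

Let b0 k : (n < k)%N -> b k = fun=> 0.
move=> nk;rewrite /b iter_cdiff -{2}(subnK nk) iterD fdiff_iter0.
by rewrite (iter_fix _ (fdiff0 _ v)) (iter_fix _ (bsum0 _ v)).
Qed.

Let b_mean k u : \sum_i b k.+1 (u + g i v) = n%:R * b k.+1 u.
have st (F : Y -> R) c : (forall u, \sum_i F (u + g i v) = n%:R * (F u + c)) ->
  forall u, \sum_i (cdiff v F) (u + g i v) = n%:R * (cdiff v F u + 0).
 move=> Fc x;rewrite /cdiff sumrB. under eq_bigr do rewrite addrAC. under [X in - X]eq_bigr do rewrite addrAC.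
 by rewrite !Fc;ring.
rewrite -[b k.+1 u]addr0;elim: k u=> [|k IH] u;first exact: st.
exact: (st _ 0).
Qed.

Let psi (i : 'I_n) : R := (i == i0)%:R - (i == i1)%:R.

Variable eps : R.

(** The mean operator with i eps added to the weight of the identity and subtracted from that of the
    inversion: the sum of the translations by [g i v] plus i eps times the central difference. The
    moduli of the weights exceed 1 only to second order in [eps], while the effect on [M] is of
    first order. *)
Let K (H : Y -> R[i]) u := \sum_i (1 +i* (eps * psi i))%C * H (u + g i v).

Let KC F u : K (fun u => (F u)%:C%C) u = (\sum_i F (u + g i v))%:C%C + (0 +i* eps)%C * (cdiff v F u)%:C%C.
have -> : cdiff v F u = \sum_i psi i * F (u + g i v).
 under eq_bigr do rewrite mulrBl. rewrite sumrB (bigD1 i0) //= (bigD1 i1 (P := predT)) //= !eqxx !mul1r g_id g_opp.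
 by rewrite !big1 ?addr0 // => i /negPf ->;rewrite mul0r.
rewrite /K !raddf_sum /= mulr_sumr -big_split;eqsum i=> /=.
by apply: eqC=> /=;ring.
Qed.

Let KD H H' u : K (fun u => H u + H' u) u = K H u + K H' u.
by rewrite /K -big_split;eqsum i;rewrite mulrDr. Qed.

Let KZ c H u : K (fun u => c * H u) u = c * K H u.
by rewrite /K mulr_sumr;eqsum i;rewrite mulrCA. Qed.

Let a : R[i] := (0 +i* (eps / n%:R))%C.

Let n0 : (n%:R : R[i]) != 0.
by rewrite pnatr_eq0 -lt0n;case: (n) i0=> // -[]. Qed.

Let aE : n%:R * a = (0 +i* eps)%C.
have nR : (n%:R : R) != 0 by case: (n) i0=> -[].
have -> : (n%:R : R[i]) = (n%:R)%:C%C by ring.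
by apply/eqP;rewrite eq_complex /= !mul0r !mulr0 subr0 addr0 eqxx /= mulrC divfK.
Qed.

(** Each [b k] with k >= 1 is reproduced by the mean with eigenvalue [n], so on these functions [K]
    acts as n (1 + a D) with D the central difference. The iterate expands binomially, and the sum
    stops at [n] because the later [b] vanish. *)
Let iterK N u : iter N K (fun u => (M u)%:C%C) u = n%:R ^+ N * ((M u + N%:R * M v)%:C%C +
  \sum_(k < n) 'C(N, k.+1)%:R * a ^+ k.+1 * (b k.+1 u)%:C%C).
elim: N u=> [|N IH] u.
 rewrite /= mul1r mul0r big1 ?addr0 // => k _. by rewrite bin0n mul0r mul0r.
rewrite iterS.
have -> : iter N K (fun u => (M u)%:C%C) = (fun u => n%:R ^+ N * ((M u)%:C%C + ((N%:R * M v)%:C%C +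
  \sum_(k < n) 'C(N, k.+1)%:R * a ^+ k.+1 * (b k.+1 u)%:C%C))).
 by ext x;rewrite IH rmorphD /= addrA.
rewrite KZ exprS [n%:R * _]mulrC -mulrA;congr (_ _).
rewrite !KD KC mean_M KC sumr_const card_ord.
rewrite {1 2}/cdiff subrr mulr0 addr0.
have -> : K (fun u => \sum_(k < n) 'C(N, k.+1)%:R * a ^+ k.+1 * (b k.+1 u)%:C%C) u =
  n%:R * \sum_(k < n) 'C(N, k.+1)%:R * a ^+ k.+1 * ((b k.+1 u)%:C%C + a * (b k.+2 u)%:C%C).
 rewrite /K;under eq_bigr do rewrite mulr_sumr. rewrite exchange_big /= mulr_sumr;eqsum k.
 transitivity ('C(N, k.+1)%:R * a ^+ k.+1 * K (fun u => (b k.+1 u)%:C%C) u).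
  by rewrite -KZ.
 rewrite KC b_mean -aE rmorphM /= rmorph_nat. by ring.
have -> : \sum_(k < n) 'C(N.+1, k.+1)%:R * a ^+ k.+1 * (b k.+1 u)%:C%C =
 \sum_(k < n) 'C(N, k.+1)%:R * a ^+ k.+1 * (b k.+1 u)%:C%C + \sum_(k < n) 'C(N, k)%:R * a ^+ k.+1 * (b k.+1 u)%:C%C.
 by rewrite -big_split;eqsum k;rewrite binS natrD !mulrDl.
have -> : \sum_(k < n) 'C(N, k)%:R * a ^+ k.+1 * (b k.+1 u)%:C%C = a * (b 1 u)%:C%C +
  \sum_(k < n) 'C(N, k.+1)%:R * a ^+ k.+1 * (a * (b k.+2 u)%:C%C).
 pose f k : R[i] := 'C(N, k)%:R * a ^+ k.+1 * (b k.+1 u)%:C%C. have fn : f n = 0 by rewrite /f b0 // mulr0.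
 transitivity (\sum_(k < n.+1) f k);first by rewrite big_ord_recr /= fn addr0.
 rewrite big_ord_recl /f /= bin0 mul1r;congr (_ _). by eqsum k;rewrite /bump /= add1n [a ^+ k.+2]exprSr !mulrA.
under eq_bigr do rewrite mulrDr.
rewrite big_split /= -aE -[N%:R * M v *+ n]mulr_natl.
rewrite -[in N.+1%:R]addn1 !(rmorphM, rmorphD, rmorphB) /= !rmorph_nat.
by rewrite /b /= /cdiff;ring.
Qed.

Let rho := Num.sqrt (1 + eps ^+ 2).

Let psi_le i : `|(1 +i* (eps * psi i))%C| <= rho%:C%C.
rewrite lecR ler_wsqrtr // expr1n lerD2l exprMn.
rewrite ler_piMr ?sqr_ge0 // /psi.
by case: eqP=> _;case: eqP=> _;rewrite ?subrr ?subr0 ?sub0r ?sqrrN ?expr1n ?expr0n.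
Qed.

Let norm_iterK N u : `|iter N K (fun u => (M u)%:C%C) u| <= (rho ^+ N * (n%:R ^+ N * (M u + N%:R * M v)))%:C%C.
elim: N u=> [|N IH] u.
 by rewrite /= !expr0 !mul1r mul0r addr0 complex_normE expr0n /= addr0 sqrtr_sqr ger0_norm.
rewrite iterS /K (le_trans (ler_norm_sum _ _ _)) //.
have -> : rho ^+ N.+1 * (n%:R ^+ N.+1 * (M u + N.+1%:R * M v)) =
  \sum_i rho * (rho ^+ N * (n%:R ^+ N * (M (u + g i v) + N%:R * M v))).
 rewrite -!mulr_sumr big_split /= mean_M sumr_const card_ord. rewrite -addn1 natrD addn1 -mulr_natl !exprS;ring.
rewrite raddf_sum /=;lesum i.
rewrite normrM rmorphM /=;apply: ler_pM=> //;exact: IH.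
Qed.

(** Two views of one iterate: its binomial expansion, and its estimate by [rho ^+ N] times the
    iterate with unit weights. The latter rests on [M >= 0]. *)
Lemma kernel_bound N u : `|\sum_(k < n) 'C(N, k.+1)%:R * a ^+ k.+1 * (b k.+1 u)%:C%C| <=
 ((rho ^+ N + 1) * (M u + N%:R * M v))%:C%C.
have MM : 0 <= M u + N%:R * M v by rewrite addr_ge0 // mulr_ge0.
have nN : 0 < `|(n%:R : R[i]) ^+ N| by rewrite normr_gt0 expf_neq0.
rewrite -(ler_pM2l nN) -normrM.
have -> : n%:R ^+ N * \sum_(k < n) 'C(N, k.+1)%:R * a ^+ k.+1 * (b k.+1 u)%:C%C =
  iter N K (fun u => (M u)%:C%C) u - n%:R ^+ N * (M u + N%:R * M v)%:C%C.
 by rewrite iterK;ring.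
rewrite (le_trans (ler_normB _ _)) //.
have -> : `|n%:R ^+ N| * ((rho ^+ N + 1) * (M u + N%:R * M v))%:C%C =
  (rho ^+ N * (n%:R ^+ N * (M u + N%:R * M v)))%:C%C + `|n%:R ^+ N * (M u + N%:R * M v)%:C%C|.
 rewrite normrM (_ : `|(M u + N%:R * M v)%:C%C| = (M u + N%:R * M v)%:C%C);last first.
  by rewrite complex_normE expr0n addr0 sqrtr_sqr ger0_norm.
 rewrite ger0_norm // !(rmorphM, rmorphD) !rmorphXn /= (rmorph_nat (real_complex R) n). by rewrite rmorph1;ring.
by rewrite lerD2r norm_iterK.
Qed.

End kernel.

(* Taking [eps = 1 / m] and [N = m ^ 2], the left-hand side of [kernel_bound] is
  a polynomial in [m] whose leading term must be at most quadratic. *)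
Lemma cdiff_iter0 v : iter 3 (cdiff v) M = fun=> 0.
ext u;pose b k := iter k (cdiff v) M u.
(* Downward induction on the order of the difference, from above [n], where [fdiff_iter0] applies,
   down to 3. *)
suff H K : (n < K)%N -> forall j, (3 <= K - j)%N -> b (K - j)%N = 0.
 have [n3|n3] := leqP 3 n;last by exact: (H 3 n3 0%N). have E : (n.+1 - (n - 2) = 3)%N by lia.
 by have := H n.+1 (ltnSn n) (n - 2)%N;rewrite E;apply.
move=> nK;elim/ltn_ind=> j IH Kj.
have bL k : (K - j < k)%N -> b k = 0.
 move=> jk;have [kK|Kk] := leqP k K.
  by rewrite -(subKn kK);apply: IH;lia.
 rewrite /b iter_cdiff -{2}(subnK (ltn_trans nK Kk)) iterD fdiff_iter0.
 by rewrite (iter_fix _ (fdiff0 _ v)) (iter_fix _ (bsum0 _ v)).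
move: {IH nK} Kj bL;move: (K - j)%N=> {K j} K K3 bL.
have [nK|Kn] := leqP n.+1 K.
 rewrite /b iter_cdiff -{2}(subnK nK) iterD fdiff_iter0.
 by rewrite (iter_fix _ (fdiff0 _ v)) (iter_fix _ (bsum0 _ v)).
rewrite ltnS in Kn.
have nR : 0 < (n%:R : R) by rewrite ltr0n;case: (n) i0=> // -[].
pose S := \sum_(k < n) `|b k.+1| / n%:R ^+ k.+1.
pose Q := S + (2 + expR 1) * (M u + M v).
have Q0 : 0 <= Q.
 apply: addr_ge0;first by apply: sumr_ge0=> i _;rewrite divr_ge0 // exprn_ge0 // ltW.
 by rewrite mulr_ge0 ?addr_ge0 // expR_ge0.
have main m : (0 < m)%N -> (2 * K <= m ^ 2)%N -> m%:R * `|b K| <= Q * (K`!%:R * 2 ^+ K * n%:R ^+ K).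
 move=> m0 mK;have mR : 0 < (m%:R : R) by rewrite ltr0n. have m1 : 1 <= (m%:R : R) by rewrite ler1n.
 pose rho : R := Num.sqrt (1 + m%:R^-1 ^+ 2). pose a : R[i] := (0 +i* (m%:R^-1 / n%:R))%C.
 have rho2 : rho ^+ (m ^ 2) + 1 <= 2 + expR 1.
  have r0 : 0 <= rho ^+ (m ^ 2) by rewrite exprn_ge0 // sqrtr_ge0. have : (rho ^+ (m ^ 2)) ^+ 2 <= expR 1.
   rewrite -exprM mulnC exprM sqr_sqrtr ?addr_ge0 ?sqr_ge0 //.
   have m2 : ((m ^ 2)%:R : R) != 0 by rewrite pnatr_eq0 expn_eq0 andbT -lt0n. rewrite -[X in expR X](mulfV m2).
   rewrite mulrC expRM_natr lerXn2r ?nnegrE ?addr_ge0 ?sqr_ge0 ?expR_ge0 //. by rewrite natrX exprVn expR_ge1Dx.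
  by nra.
 have na k : `|a ^+ k| = ((m%:R * n%:R) ^- k)%:C%C.
  rewrite normrX complex_normE expr0n add0r sqrtr_sqr ger0_norm.
   by rewrite -rmorphXn /= -invfM -exprVn.
  by rewrite divr_ge0 ?invr_ge0 // ltW.
 have nb k : `|(b k)%:C%C| = (`|b k|)%:C%C.
  by rewrite complex_normE expr0n addr0 sqrtr_sqr.
 pose t k : R[i] := 'C(m ^ 2, k.+1)%:R * a ^+ k.+1 * (b k.+1)%:C%C.
 have nt k : `|t k| = ('C(m ^ 2, k.+1)%:R / (m%:R * n%:R) ^+ k.+1 * `|b k.+1|)%:C%C.
  by rewrite /t !normrM na nb normr_nat !rmorphM /= rmorph_nat.
 have K1n : (K.-1 < n)%N by lia. have bnd : `|\sum_(k < n) t k| <=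
   ((rho ^+ (m ^ 2) + 1) * (M u + (m ^ 2)%:R * M v))%:C%C.
  exact: (kernel_bound v (m%:R^-1) (m ^ 2) u).
 rewrite (bigD1 (Ordinal K1n)) // in bnd. have {bnd} : `|t K.-1| <= \sum_(k < n | k != Ordinal K1n) `|t k| +
    ((rho ^+ (m ^ 2) + 1) * (M u + (m ^ 2)%:R * M v))%:C%C.
  apply: le_trans (lerD (ler_norm_sum _ _ _) bnd).
  by rewrite addrC -{1}(addrK (\sum_(k < n | k != Ordinal K1n) t k) (t K.-1)) ler_normB.
 under eq_bigr do rewrite nt. rewrite nt -raddf_sum -rmorphD lecR prednK //;last by lia. move=> bnd.
 have rhs : \sum_(i < n | i != Ordinal K1n) 'C(m ^ 2, i.+1)%:R / (m%:R * n%:R) ^+ i.+1 * `|b i.+1| +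
   (rho ^+ (m ^ 2) + 1) * (M u + (m ^ 2)%:R * M v) <= m%:R ^+ K.-1 * Q.
  rewrite /Q [leRHS]mulrDr;apply: lerD.
   rewrite /S mulr_sumr [leRHS](bigD1 (Ordinal K1n)) //=.
   rewrite ler_wpDl ?mulr_ge0 ?divr_ge0 ?exprn_ge0 ?(ltW nR) //. apply: ler_sum=> i iK. have [Ki|iK1] := leqP K i.
    by rewrite bL ?ltnS // normr0 mulr0 mul0r mulr0.
   have iK2 : (i < K.-1)%N.
    rewrite ltn_neqAle;apply/andP;split;last by lia. by apply: contra iK=> /eqP iE;apply/eqP/val_inj.
   have Cm : ('C(m ^ 2, i.+1)%:R : R) <= m%:R ^+ i.+1 * m%:R ^+ i.+1.
    rewrite -exprD addnn -mul2n exprM -!natrX ler_nat. exact: bin_le_expn.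
   have -> : 'C(m ^ 2, i.+1)%:R / (m%:R * n%:R) ^+ i.+1 * `|b i.+1| =
     'C(m ^ 2, i.+1)%:R / m%:R ^+ i.+1 * (`|b i.+1| / n%:R ^+ i.+1).
    by rewrite exprMn;field;rewrite !expf_neq0 ?gt_eqF.
   apply: ler_pM;rewrite ?divr_ge0 ?exprn_ge0 ?(ltW nR) //.
   rewrite ler_pdivrMr ?exprn_gt0 // (le_trans Cm) // ler_pM2r ?exprn_gt0 //. by rewrite ler_weXn2l.
  (* Here the order must be at least 3: the summand [m ^ 2 * M v] has to be dominated by m^(K-1). *)
  have mm : ((m ^ 2)%:R : R) <= m%:R ^+ K.-1.
   by rewrite natrX ler_weXn2l //;lia.
  have mm1 : 1 <= (m%:R : R) ^+ K.-1 by rewrite exprn_ege1. rewrite mulrCA;apply: ler_pM=> //.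
  - by rewrite addr_ge0 // exprn_ge0 // sqrtr_ge0.
  - by rewrite addr_ge0 // mulr_ge0.
  - by rewrite mulrDr lerD // ?ler_peMl // ler_wpM2r.
 (* The binomial coefficient is at least (m^2 - K)^K / K!, and m^2 - K is at least m^2 / 2 by the
    size of [m]. *)
 have lhs : m%:R ^+ K * (m%:R ^+ K / (K`!%:R * 2 ^+ K)) <= ('C(m ^ 2, K)%:R : R).
  rewrite mulrA ler_pdivrMr ?mulr_gt0 ?exprn_gt0 ?ltr0n ?fact_gt0 //.
  rewrite -exprD addnn -mul2n exprM -!natrX -!natrM ler_nat mulnA bin_ffact.
  have m2K : (m ^ 2 <= (m ^ 2 - K) * 2)%N by lia. have K0 : (0 < K)%N by lia.
  apply: (leq_trans (n := ((m ^ 2 - K) * 2) ^ K));first by rewrite leq_exp2r.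
  rewrite !expnMn leq_mul2r;apply/orP;right. have [k kE] : exists k, k = K by exists K.
  rewrite -{2 3}kE;have : (k <= K)%N by rewrite kE. elim: k {kE}=> [//|k IH] kK;rewrite ffactnSr expnSr leq_mul //.
   by rewrite IH // ltnW.
  by lia.
 have X : m%:R ^+ K * (m%:R ^+ K / (K`!%:R * 2 ^+ K)) / (m%:R * n%:R) ^+ K * `|b K| <= m%:R ^+ K.-1 * Q.
  apply: le_trans (le_trans bnd rhs);rewrite ler_wpM2r // ler_wpM2r //.
 have mK1 : 0 < (m%:R : R) ^+ K.-1 by rewrite exprn_gt0. rewrite -(ler_pM2l mK1);rewrite mulrA in X *.
 rewrite [leRHS]mulrA -ler_pdivrMr;last first.
  apply: mulr_gt0;last by rewrite exprn_gt0. by apply: mulr_gt0;[rewrite ltr0n fact_gt0 | rewrite exprn_gt0].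
 apply: le_trans X;apply: eq_ler. have K0 : (0 < K)%N by rewrite (leq_trans _ K3).
 rewrite exprMn;have -> : (m%:R : R) ^+ K = m%:R ^+ K.-1 * m%:R by rewrite -exprSr prednK.
 have f0 : (K`!%:R : R) != 0 by rewrite pnatr_eq0 -lt0n fact_gt0.
 have k0 : (2 : R) ^+ K != 0 by rewrite expf_neq0 // pnatr_eq0.
 have n0 : (n%:R : R) ^+ K != 0 by rewrite expf_neq0 // gt_eqF. have e0 : (m%:R : R) ^+ K.-1 != 0 by rewrite gt_eqF.
 move: f0 k0 n0 e0 (gt_eqF mR);move: K`!%:R (2 ^+ K) (n%:R ^+ K) (m%:R ^+ K.-1). move=> f k n' e f0 k0 n0 e0 m0'.
 by field;rewrite f0 k0 n0 e0 m0'.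
apply/eqP;rewrite -normr_le0 leNgt;apply/negP=> bK.
pose c := Q * (K`!%:R * 2 ^+ K * n%:R ^+ K) / `|b K|.
have [m mc] : exists m : nat, c < m%:R.
 by exists (Num.trunc c).+1;exact: truncnS_gt.
pose p := maxn m (2 * K).+1.
have mp : (m <= p)%N by rewrite leq_maxl.
have p0 : (0 < p)%N by rewrite leq_max orbT.
have Kp : (2 * K <= p ^ 2)%N.
 by rewrite (@leq_trans p) ?leq_max ?leqnSn ?orbT // expnS expn1 leq_pmull.
have := main p p0 Kp;rewrite leNgt=> /negP;apply.
rewrite -ltr_pdivrMr //;apply: lt_le_trans mc _;by rewrite ler_nat.
Qed.

Lemma fdiff_iter3 v : iter 3 (fdiff v) M = fun=> 0.
exact: fdiff_nilpotent (fdiff_iter0 v) (cdiff_iter0 v). Qed.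

(* The second difference of [M] is nonnegative, because [M] is quadratic along
  lines and nonnegative; since it is also harmonic for every step, it is bounded along lines, hence constant. *)
Lemma mean_parallelogram u v : M (u + v) + M (u - v) = 2 * (M u + M v).
have newton (F : Y -> R) (w x : Y) k : iter 3 (fdiff w) F = (fun=> 0) -> F (x + w *+ k) = F x + k%:R * fdiff w F x +
   'C(k, 2)%:R * fdiff w (fdiff w F) x.
 move=> F3;set H := fdiff w (fdiff w F). have Hw y : H (y + w) = H y.
  by apply: subr0_eq;exact: (congr1 (fun f : Y -> R => f y) F3).
 have Hk j : H (x + w *+ j) = H x.
  by elim: j=> [|j IH];rewrite ?mulr0n ?addr0 // mulrSr addrA Hw.
 have F1k j : fdiff w F (x + w *+ j) = fdiff w F x + j%:R * H x.
  elim: j=> [|j IH];first by rewrite mulr0n addr0 mul0r addr0.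
  have E : fdiff w F (x + w *+ j + w) - fdiff w F (x + w *+ j) = H x := Hk j.
  rewrite mulrSr addrA;move/eqP: E;rewrite subr_eq=> /eqP ->. by rewrite IH -[j.+1]addn1 natrD;ring.
 elim: k=> [|k IH];first by rewrite mulr0n bin0n !mul0r !addr0.
 have E : F (x + w *+ k + w) - F (x + w *+ k) = _ := F1k k.
 rewrite mulrSr addrA;move/eqP: E;rewrite subr_eq=> /eqP ->. by rewrite IH binS bin1 natrD -[k.+1]addn1 natrD;ring.
have M0 : M 0 = 0.
 have := mean_M 0 0;under eq_bigr=> i _.
  rewrite (_ : g i 0 = 0) ?addr0;last by rewrite -[0](mulr0n v) gMn mulr0n. over.
 rewrite sumr_const card_ord -[X in X = _]mulr_natl=> /mulfI.
 have n0' : (n%:R : R) != 0 by rewrite pnatr_eq0 -lt0n;case: (n) i0=> // -[]. by move=> /(_ n0');lra.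
pose H := fdiff v (fdiff v M).
have H_ge0 x : 0 <= H x.
 rewrite leNgt;apply/negP=> Hx. pose c := M x + `|fdiff v M x|. have c0 : 0 <= c by rewrite addr_ge0.
 pose k := (Num.trunc (2 * c / - H x)).+2. have k2 : 2 * c / - H x < k.-1%:R by exact: truncnS_gt.
 have := M_ge0 (x + v *+ k);rewrite newton ?fdiff_iter3 // -/H. rewrite ltr_pdivrMr ?oppr_gt0 // in k2.
 have kC := bin2_mul2 R k. have k1 : 1 <= (k%:R : R) by rewrite ler1n.
 have := ler_norm (fdiff v M x);move: k1 k2 kC;rewrite /c.
 have := M_ge0 x;move: (fdiff v M x) (M x) (H x) ('C(k, 2)%:R) k%:R k.-1%:R Hx. by move=> f m h C k' k1' *;nra.
have H_mean x w k : \sum_i H (x + g i (w *+ k)) = n%:R * H x.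
 have E y : H y = M (y + v + v) - 2 * M (y + v) + M y by rewrite /H /fdiff;ring. under eq_bigr do rewrite E.
 rewrite big_split sumrB -mulr_sumr /=. under eq_bigr do rewrite (addrAC x) (addrAC (x + v)).
 under [X in _ - 2 * X]eq_bigr do rewrite (addrAC x). by rewrite !mean_M E;ring.
have H_cst x w : H (x + w) = H x.
 have H3 : iter 3 (fdiff w) H = fun=> 0.
  have fC F : fdiff w (fdiff v F) = fdiff v (fdiff w F) :> (Y -> R).
   by ext y;rewrite /fdiff (addrAC y w v);ring.
  rewrite /H /= !fC;have -> : fdiff w (fdiff w (fdiff w M)) = fun=> 0.
   exact: fdiff_iter3.
  by rewrite !fdiff0.
 have bnd k : 0 <= H x + k%:R * fdiff w H x + 'C(k, 2)%:R * fdiff w (fdiff w H) x <= n%:R * H x.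
  rewrite -newton // H_ge0 /= -(H_mean x w k) (bigD1 i0) //= g_id lerDl. by rewrite sumr_ge0.
 (* A quadratic polynomial bounded on the naturals is constant; only its linear coefficient matters
    below. *)
 have quad0 (a b c B : R) : (forall k : nat, 0 <= a + k%:R * b + 'C(k, 2)%:R * c <= B) -> b = 0.
  move=> kB;have B0 : 0 <= B by have /andP[/le_trans] := kB 0%N;apply.
  have kC k : 'C(k, 2)%:R = k%:R * (k%:R - 1) / 2 :> R.
   apply: (canRL (mulfK _));rewrite ?pnatr_eq0 // bin2_mul2.
   by case: k=> [|k];rewrite ?mul0r // -[k.+1]addn1 natrD addrK addn1.
  have step k : `|b + k%:R * c| <= B.
   have /andP[l1 l2] := kB k;have /andP[r1 r2] := kB k.+1.
   rewrite !kC -[k.+1]addn1 natrD in r1 r2;rewrite kC in l1 l2. rewrite ler_norml;apply/andP;split;nra.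
  have arch (x' y' : R) : (forall k : nat, k%:R * `|x'| <= y') -> x' = 0.
   move=> H';apply/eqP;rewrite -normr_le0 leNgt;apply/negP=> x0. have := truncnS_gt (y' / `|x'|).
   by rewrite ltr_pdivrMr // ltNge H'.
  have c0 : c = 0.
   apply: (arch _ (B + `|b|)) => k;rewrite -[k%:R]ger0_norm // -normrM.
   by rewrite -[_ * c](addrK b) (le_trans (ler_normB _ _)) // lerD2r addrC step.
  apply: (arch _ (B + `|a|)) => k;rewrite -[k%:R]ger0_norm // -normrM.
  rewrite -[_ * b](addrK a) (le_trans (ler_normB _ _)) // lerD2r addrC.
  by have /andP[l1 l2] := kB k;rewrite c0 mulr0 addr0 in l1 l2;rewrite ger0_norm.
 have := newton H w x 1%N H3;rewrite mulr1n=> ->.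
 by rewrite (quad0 _ _ _ _ bnd) mulr0 addr0 bin_small // mul0r addr0.
(* The values of [H] at u - v and at - v are M(u + v) - 2 M(u) + M(u - v) and 2 M(v), as [M] is even
   and vanishes at 0. *)
have := H_cst (- v) (u - v + v);rewrite addrC addrNK.
rewrite /H /fdiff !subrK addNr M0 add0r MN;lra.
Qed.

End MeanQuadratic.

(** * Formal power series *)

Section FormalSeries.
Variable S : comNzRingType.
Implicit Types a b c : nat -> S.

Definition cauchy_prod a b n := \sum_(i < n.+1) a i * b (n - i)%N.
Definition sdiff a n := a n.+1 *+ n.+1.

(** Truncation to polynomials, from which the laws of the Cauchy product are inherited. *)
Let P N a : {poly S} := \poly_(i < N) a i.

Lemma cauchy_prodE N a b n : (n < N)%N -> cauchy_prod a b n = (P N a * P N b)`_n.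
move=> nN;rewrite coefM;eqsum i;rewrite !coef_poly.
by rewrite (leq_ltn_trans (leq_subr _ _) nN) (leq_ltn_trans _ nN) // -ltnS.
Qed.

Lemma cauchy_prodC a b : cauchy_prod a b = cauchy_prod b a.
by ext n;rewrite !(cauchy_prodE _ _ (ltnSn n)) mulrC. Qed.

Lemma cauchy_prodA a b c : cauchy_prod a (cauchy_prod b c) = cauchy_prod (cauchy_prod a b) c.
ext n;transitivity (P n.+1 a * (P n.+1 b * P n.+1 c))`_n.
 rewrite coefM;eqsum i;rewrite coef_poly ltn_ord;congr (_ _). by rewrite (@cauchy_prodE n.+1) // ltnS leq_subr.
rewrite mulrA coefM;eqsum i;rewrite coef_poly ltnS leq_subr.
by congr (_ * _);rewrite (@cauchy_prodE n.+1).
Qed.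

Lemma cauchy_prodDl a b c : cauchy_prod (fun n => a n + b n) c = fun n => cauchy_prod a c n + cauchy_prod b c n.
ext n;rewrite -big_split;eqsum i.
by rewrite mulrDl.
Qed.

Lemma sdiff_cauchy_prod a b : sdiff (cauchy_prod a b) =
 fun n => cauchy_prod (sdiff a) b n + cauchy_prod a (sdiff b) n.
have dP N c : (P N.+1 c)^`() = P N (sdiff c).
 apply/polyP=> i;rewrite coef_deriv !coef_poly ltnS. by case: ltnP=> //;rewrite mul0rn.
ext n;rewrite /sdiff (@cauchy_prodE n.+2) // -coef_deriv derivM !dP coefD.
have Pc N c j : (j < N)%N -> (P N c)`_j = c j by move=> jN;rewrite coef_poly jN.
rewrite !coefM;congr (_ + _);eqsum i;have := ltn_ord i=> ni.
 by rewrite !Pc //;lia.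
by rewrite !Pc //;lia.
Qed.

Definition sone (n : nat) : S := (n == 0%N)%:R.

Lemma cauchy_prod1 a : cauchy_prod a sone = a.
ext n;rewrite /cauchy_prod big_ord_recr /= subnn /sone mulr1.
rewrite big1 ?add0r // => i;rewrite subn_eq0 leqNgt ltn_ord mulr0 //.
Qed.

End FormalSeries.

(** * The Gaussian power series *)

Section GaussCoeff.
Variable R : realType.

(** The Taylor coefficients of exp(c x^2). *)
Definition gauss_coeff (c : R) n : R := if odd n then 0 else c ^+ n./2 / (n./2)`!%:R.

Lemma gauss_coeffS c n : gauss_coeff c n.+2 *+ n.+2 = 2 * c * gauss_coeff c n.
rewrite /gauss_coeff /= negbK;case: ifPn=> on;first by lra.
have nE : n = (n./2 + n./2)%N by lia.
rewrite -[_ n.+2]mulr_natr.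
have -> : (n.+2%:R : R) = 2 * (n./2).+1%:R by rewrite -natrM;congr (_%:R);lia.
have k1 : ((n./2).+1%:R : R) != 0 by [].
have f0 : ((n./2)`!%:R : R) != 0 by [].
rewrite exprS natrM;move: _.+1%:R _`!%:R k1 f0=> k f k1 f0.
by field;rewrite k1 f0.
Qed.

Lemma gauss_coeff_rec (c : R) (a : nat -> R) : a 0%N = 1 -> a 1%N = 0 ->
 (forall n, a n.+2 *+ n.+2 = 2 * c * a n) -> a = gauss_coeff c.
move=> a0 a1 aS;ext n.
have : a n = gauss_coeff c n /\ a n.+1 = gauss_coeff c n.+1.
 elim: n=> [|n [IH1 IH2]].
  by rewrite a0 a1 /gauss_coeff /= fact0 expr0 divr1.
 split=> //;apply: (@mulfI _ (n.+2%:R));first by []. by rewrite !mulr_natl aS gauss_coeffS IH1.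
by case.
Qed.

(** The formal derivative of exp(c x^2) exp(- c x^2) is 0, which leaves the constant term 1. *)
Lemma gauss_coeff_inv c : cauchy_prod (gauss_coeff c) (gauss_coeff (- c)) = @sone R.
set E := gauss_coeff c;set F := gauss_coeff (- c).
have E0 d : gauss_coeff d 0 = 1 by rewrite /gauss_coeff divr1.
have dE d : sdiff (gauss_coeff d) = fun n => if n is m.+1 then 2 * d * gauss_coeff d m else 0.
 apply/funext=> -[|n];first by []. exact: gauss_coeffS.
have sh (x : R) (u v : nat -> R) n : cauchy_prod (fun n => if n is m.+1 then x * u m else 0) v n =
  if n is m.+1 then x * cauchy_prod u v m else 0.
 rewrite /cauchy_prod big_ord_recl mul0r add0r;case: n=> [|n];first by rewrite big_ord0.
 by rewrite mulr_sumr;eqsum i;rewrite /= /bump /= add1n subSS mulrA.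
apply/funext=> -[|n];first by rewrite /cauchy_prod big_ord1 /E /F !E0 mulr1.
apply: (@mulfI _ (n.+1%:R));first by [].
rewrite mulr0 mulr_natl -/(sdiff _ n) sdiff_cauchy_prod.
rewrite (cauchy_prodC E) !dE !sh;case: n=> [|n];rewrite ?addr0 //.
by rewrite (cauchy_prodC F) -mulrDl mulrN subrr mul0r.
Qed.

End GaussCoeff.

(** * Entire power series on the real line *)

Section Entire.
Variable R : realType.
Implicit Types (a b : nat -> R) (x r : R).

(** Bounded terms at every radius amount to an infinite radius of convergence; this form gives
    explicit tails. *)
Definition entire a := forall r, 0 < r -> exists C, forall n, `|a n| * r ^+ n <= C.

Definition psum_at a x : R := limn (pseries a x).

Lemma entire_ge0 a r C : 0 < r -> (forall n, `|a n| * r ^+ n <= C) -> 0 <= C.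
by move=> r0 /(_ 0%N);apply: le_trans;rewrite mulr1. Qed.

Lemma entire_geometric a x C : (forall n, `|a n| * (2 * (`|x| + 1)) ^+ n <= C) ->
 forall n, `|a n * x ^+ n| <= C * 2^-1 ^+ n.
move=> aC n;rewrite exprVn ler_pdivlMr //.
rewrite normrM normrX (le_trans _ (aC n)) // -mulrA ler_wpM2l //.
rewrite mulrC -exprMn lerXn2r ?nnegrE ?mulr_ge0 ?addr_ge0 //.
by rewrite ler_pM2l // lerDl.
Qed.

Lemma geometric_part N m (C : R) : 0 <= C -> \sum_(N <= n < N + m) C * 2^-1 ^+ n <= C * 2 * 2^-1 ^+ N.
move=> C0;apply: (@le_trans _ _ (C * 2 * 2^-1 ^+ N * (1 - 2^-1 ^+ m))).
 elim: m=> [|m IH];first by rewrite addn0 big_geq // subrr mulr0.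
 rewrite addnS big_nat_recr ?leq_addr //= (le_trans (lerD IH (lexx _))) //. rewrite exprD exprS;apply: eq_ler.
 by rewrite -[2^-1 ^+ m]/(2^-1 ^+ m);field.
by rewrite ler_piMr ?mulr_ge0 ?exprn_ge0 ?invr_ge0 // lerBlDr lerDl exprn_ge0 // invr_ge0.
Qed.

(** Terms bounded by [C] at radius 2 (|x| + 1) are at most C 2^-n at [x], so the tail is
    geometric. *)
Lemma entire_tail a x C : (forall n, `|a n| * (2 * (`|x| + 1)) ^+ n <= C) -> cvgn (pseries a x) /\
 forall N, `|psum_at a x - \sum_(n < N) a n * x ^+ n| <= C * 2 * 2^-1 ^+ N.
move=> aC;have g := entire_geometric aC.
have x0 : 0 < 2 * (`|x| + 1) by [].
have C0 := entire_ge0 x0 aC.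
have part N m : `|\sum_(N <= n < N + m) a n * x ^+ n| <= C * 2 * 2^-1 ^+ N.
 rewrite (le_trans (ler_norm_sum _ _ _)) // (le_trans _ (geometric_part N m C0)) //. by lesum n.
have cv : cvgn (pseries a x).
 apply: normed_cvg;apply: (@series_le_cvg _ _ (fun n => C * 2^-1 ^+ n)).
 - by move=> n;exact: normr_ge0.
 - by move=> n;rewrite mulr_ge0.
 - exact: g.
 apply: is_cvg_geometric_series;by rewrite ger0_norm // invf_lt1 // ltr1n.
split=> // N.
have cvN : (fun m => pseries a x (m + N)%N - \sum_(n < N) a n * x ^+ n) @ \oo
  --> psum_at a x - \sum_(n < N) a n * x ^+ n.
 by apply: cvgB;[rewrite (cvg_shiftn N);exact: cv | exact: cvg_cst].
apply: (cvgr_to_le (cvg_norm cvN)).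
near=> m;rewrite /pseries /series /= addnC (@big_cat_nat _ _ _ N) ?leq_addr //=.
by rewrite big_mkord addrAC subrr add0r.
Unshelve. all: by end_near. Qed.

Lemma entire_cvg a x : entire a -> cvgn (pseries a x).
move=> ea;have [|C aC] := ea (2 * (`|x| + 1));first by [].
by have [] := entire_tail aC.
Qed.

Lemma nat_le_exp2 n : (n.+1%:R : R) <= 2 ^+ n.
by rewrite -natrX ler_nat ltn_expl. Qed.

Lemma entire_sdiff a : entire a -> entire (sdiff a).
move=> ea r r0;have [|C aC] := ea (2 * r);first by lra.
exists (C / r)=> n;rewrite ler_pdivlMr // -mulrA -exprSr normrMn -mulr_natr.
rewrite (le_trans _ (aC n.+1)) // exprMn -mulrA ler_wpM2l // ler_wpM2r ?exprn_ge0 ?(ltW r0) //.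
by rewrite (le_trans (nat_le_exp2 n)) // ler_eXn2l // ltr1n.
Qed.

Lemma entire_cauchy_prod a b : entire a -> entire b -> entire (cauchy_prod a b).
move=> ea eb r r0;have r2 : 0 < 2 * r by lra.
have [C aC] := ea _ r2;have [D bD] := eb _ r2.
exists (C * D)=> n.
have C0 := entire_ge0 r2 aC;have D0 := entire_ge0 r2 bD.
have : `|cauchy_prod a b n| * (2 * r) ^+ n <= n.+1%:R * (C * D).
 rewrite (le_trans (ler_wpM2r _ (ler_norm_sum _ _ _))) ?exprn_ge0 ?(ltW r2) //.
 rewrite mulr_suml (_ : _ (C * D) = \sum_(i < n.+1) C * D);last first.
  by rewrite sumr_const card_ord mulr_natl.
 lesum i. have -> : (2 * r) ^+ n = (2 * r) ^+ i * (2 * r) ^+ (n - i).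
  by rewrite -exprD subnKC // -ltnS.
 by rewrite normrM mulrACA ler_pM // mulr_ge0 // exprn_ge0 // ltW.
rewrite exprMn mulrCA=> H.
rewrite -(ler_pM2l (exprn_gt0 n (ltr0n R 2))) (le_trans H) // ler_wpM2r ?mulr_ge0 //.
exact: nat_le_exp2.
Qed.

Lemma psum_at0 a : psum_at a 0 = a 0%N.
apply/cvg_lim=> //;rewrite -cvg_shiftS.
apply: cvg_near_cst;near=> n;rewrite /pseries /series /= big_nat_recl //=.
by rewrite expr0 mulr1 big1 ?addr0 // => i _;rewrite expr0n mulr0.
Unshelve. all: by end_near. Qed.

Lemma is_derive_psum_at a x : entire a -> is_derive x (1 : R) (psum_at a) (psum_at (sdiff a) x).
move=> ea.
have dE c : pseries_diffs c = sdiff c.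
 by ext n;rewrite /pseries_diffs /sdiff mulr_natl.
rewrite -dE;apply: (@pseries_snd_diffs _ a (`|x| + 1)).
- exact: entire_cvg.
- by rewrite dE;apply: entire_cvg;exact: entire_sdiff.
- by rewrite !dE;apply: entire_cvg;do 2 apply: entire_sdiff.
- by rewrite [ltRHS]ger0_norm ?addr_ge0 // ltrDl.
Qed.

Lemma entire_eq0 a : entire a -> (forall x, psum_at a x = 0) -> a = fun=> 0.
move=> ea a0;ext n;elim: n a ea a0=> [|n IH] a ea a0.
 by rewrite -psum_at0.
have da x : psum_at (sdiff a) x = 0.
 have := @derive_val _ _ _ _ _ _ _ (is_derive_psum_at x ea)=> <-.
 by rewrite (_ : psum_at a = cst 0) ?derive_cst //;apply/funext.
by have /eqP := IH _ (entire_sdiff ea) da;rewrite /sdiff mulrn_eq0=> /eqP.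
Qed.

(** The product of two partial sums differs from the partial sum of the product only in degrees from
    N to 2N. The radius 4 (|x| + 1) leaves a factor 2 per degree for the n + 1 summands of a
    coefficient and another for the decay. *)
Lemma psum_at_prod a b x : entire a -> entire b -> psum_at (cauchy_prod a b) x = psum_at a x * psum_at b x.
move=> ea eb;apply/cvg_lim=> //.
pose ab N := pseries a x N * pseries b x N.
have cab : ab @ \oo --> psum_at a x * psum_at b x.
 by apply: cvgM;exact: entire_cvg.
pose y := 4 * (`|x| + 1).
have y0 : 0 < y by rewrite mulr_gt0 // ltr_wpDl.
pose P N c : {poly R} := \poly_(i < N) c i.
have [C aC] := ea _ y0;have [D bD] := eb _ y0.
have C0 := entire_ge0 y0 aC;have D0 := entire_ge0 y0 bD.
have PE c N : pseries c x N = (P N c).[x].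
 by rewrite horner_poly /pseries /series /= big_mkord.
have abE N : ab N - pseries (cauchy_prod a b) x N = \sum_(N <= n < N + N) (P N a * P N b)`_n * x ^+ n.
 rewrite /ab !PE -hornerM (@horner_coef_wide _ (N + N));last first.
  rewrite (leq_trans (size_polyMleq _ _)) // (leq_trans (leq_pred _)) //. by rewrite leq_add // size_poly.
 rewrite -(big_mkord predT (fun n => (P N a * P N b)`_n * x ^+ n)).
 rewrite (@big_cat_nat _ _ _ N) ?leq_addr //= horner_poly big_mkord.
 rewrite addrAC -[RHS]add0r;congr (_ + _);apply/eqP;rewrite subr_eq0;apply/eqP.
 by eqsum i;rewrite (@cauchy_prodE _ N).
have term N n : `|(P N a * P N b)`_n * x ^+ n| <= C * D * 2^-1 ^+ n.
 have Pc c K j : (forall n, `|c n| * y ^+ n <= K) -> 0 <= K -> `|(P N c)`_j| * y ^+ j <= K.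
  by move=> cK K0;rewrite coef_poly;case: ifP=> // _;rewrite normr0 mul0r.
 have : `|(P N a * P N b)`_n| * y ^+ n <= n.+1%:R * (C * D).
  rewrite coefM (le_trans (ler_wpM2r _ (ler_norm_sum _ _ _))) ?exprn_ge0 ?(ltW y0) //.
  rewrite mulr_suml (_ : _ (C * D) = \sum_(i < n.+1) C * D);last first.
   by rewrite sumr_const card_ord mulr_natl.
  lesum i. have -> : y ^+ n = y ^+ i * y ^+ (n - i) by rewrite -exprD subnKC // -ltnS.
  by rewrite normrM mulrACA ler_pM ?Pc // mulr_ge0 // exprn_ge0 // ltW.
 rewrite normrM normrX exprVn ler_pdivlMr // => H. rewrite -(ler_pM2l (exprn_gt0 n (ltr0n R 2))).
 apply: (@le_trans _ _ (n.+1%:R * (C * D)));last first.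
  by rewrite ler_wpM2r ?mulr_ge0 // nat_le_exp2.
 apply: le_trans H;rewrite [leLHS](_ : _ = `|(P N a * P N b)`_n| * (4 * `|x|) ^+ n).
  rewrite ler_wpM2l // lerXn2r ?nnegrE ?mulr_ge0 // ler_wpM2l //. by rewrite lerDl.
 by rewrite exprMn (_ : 4 = 2 * 2 :> R) ?exprMn;[ring|rewrite -natrM].
have small N : `|ab N - pseries (cauchy_prod a b) x N| <= C * D * 2 * 2^-1 ^+ N.
 rewrite abE (le_trans (ler_norm_sum _ _ _)) // (le_trans _ (geometric_part N N (mulr_ge0 C0 D0))) //. by lesum n.
have geo : (fun N => C * D * 2 * 2^-1 ^+ N) @ \oo --> (0 : R).
 rewrite -[X in _ --> X](mulr0 (C * D * 2));apply: cvgMr;apply: cvg_expr.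
 by rewrite ger0_norm ?invr_ge0 // invf_lt1 // ltr1n.
have d0 : (fun N => ab N - pseries (cauchy_prod a b) x N) @ \oo --> (0 : R).
 apply: norm_cvg0;apply: (@squeeze_cvgr _ _ _ _ (fun=> 0) (fun N => C * D * 2 * 2^-1 ^+ N)).
 - by near=> N;rewrite normr_ge0 small.
 - exact: cvg_cst.
 - exact: geo.
rewrite -[X in _ --> X]subr0;apply: cvg_trans (cvgB cab d0).
by apply: near_eq_cvg;near=> N;rewrite /= opprB addrC subrK.
Unshelve. all: by end_near. Qed.

End Entire.

(** * The unit circle and roots of unity *)

Section Cis.
Variable R : realType.
Implicit Types x y : R.

Definition cis x : R[i] := (cos x +i* sin x)%C.

Lemma cis0 : cis 0 = 1.
by rewrite /cis cos0 sin0. Qed.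

Lemma cisD x y : cis (x + y) = cis x * cis y.
by apply/eqP;rewrite eq_complex /= cosD sinD;apply/andP;split;apply/eqP;ring. Qed.

Lemma cisMn x n : cis (x *+ n) = cis x ^+ n.
by elim: n=> [|n IH];rewrite ?cis0 // mulrSr cisD IH exprSr. Qed.

Lemma norm_cis x : `|cis x| = 1.
by rewrite /cis complex_normE cos2Dsin2 sqrtr1. Qed.

Lemma cis2pi : cis (pi *+ 2) = 1.
by rewrite /cis cos2pi sin2pi. Qed.

Lemma cis_eq1 x : 0 < x < pi *+ 2 -> cis x != 1.
move=> /andP[x0 x2];apply/negP=> /eqP/eqP;rewrite /= => /andP[/eqP c1 _].
have [xpi|pix] := leP x pi.
 have : x = 0 by apply: cos_inj;rewrite ?in_itv /= ?lexx ?pi_ge0 ?(ltW x0) ?xpi ?cos0.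
 by move=> x00;rewrite x00 ltxx in x0.
have : pi *+ 2 - x = 0.
 apply: cos_inj;rewrite ?in_itv /= ?lexx ?pi_ge0 ?subr_ge0 ?(ltW x2) //=.
  by rewrite mulr2n lerBlDr lerD2l ltW.
 by rewrite cosB cos2pi sin2pi c1 cos0 mul0r addr0 mulr1.
by move=> x00;rewrite -subr_gt0 x00 ltxx in x2.
Qed.

Definition root_unity L (j : nat) : R[i] := cis (pi *+ 2 / L%:R) ^+ j.

Lemma sum_root_unity L n : (0 < n < L)%N -> \sum_(j < L) root_unity L j ^+ n = 0.
move=> /andP[n0 nL];have L0 : (L%:R : R) != 0 by rewrite pnatr_eq0 -lt0n (leq_ltn_trans _ nL).
set w := cis (pi *+ 2 / L%:R).
have wL : w ^+ L = 1 by rewrite -cisMn -[_ L]mulr_natr divfK // cis2pi.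
have wn : w ^+ n != 1.
 rewrite -cisMn;apply: cis_eq1;have pi2 : 0 < (pi : R) *+ 2 by rewrite pmulrn_lgt0 // pi_gt0.
 rewrite -[_ n]mulr_natr -mulrA pmulr_rgt0 // mulr_gt0 ?invr_gt0 ?ltr0n //=;last by lia.
 rewrite gtr_pMr // mulrC ltr_pdivrMr ?mul1r ?ltr_nat //. by rewrite ltr0n;lia.
have := subrX1 (w ^+ n) L.
rewrite -exprM mulnC exprM wL expr1n subrr=> /esym/eqP;rewrite mulf_eq0.
rewrite subr_eq0 (negPf wn)=> /eqP {2}<-.
by eqsum j;rewrite /root_unity -!exprM mulnC.
Qed.

Lemma norm_root_unity L j : `|root_unity L j| = 1.
by rewrite normrX norm_cis expr1n. Qed.

Lemma sum_Re_root_unity L n : (0 < n < L)%N -> \sum_(j < L) Re (root_unity L j ^+ n) = 0.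
by move=> nL;rewrite -(raddf_sum (@complex.Re R)) sum_root_unity.
Qed.

End Cis.

(** * Zero-free entire functions of order at most two *)

Section Cramer.
Variable R : realType.

Lemma unit_complexE (w : R[i]) : `|w| = 1 -> Re w ^+ 2 + Im w ^+ 2 = 1.
case: w=> x y;rewrite complex_normE /= => /eqP.
rewrite eq_complex /= eqxx andbT=> /eqP H;rewrite -[RHS](expr1n _ 2) -H sqr_sqrtr //.
by rewrite addr_ge0 ?sqr_ge0.
Qed.

Lemma unit_Re_le1 (w : R[i]) : `|w| = 1 -> `|Re w| <= 1.
move=> /unit_complexE w1;rewrite -(@ler_pXn2r _ 2) ?nnegrE // expr1n -normrX ger0_norm ?sqr_ge0 //.
by rewrite -w1 lerDl sqr_ge0.
Qed.

Lemma unit_ReM (w : R[i]) n m : `|w| = 1 -> (m <= n)%N ->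
 2 * (Re (w ^+ n) * Re (w ^+ m)) = Re (w ^+ (n + m)) + Re (w ^+ (n - m)).
move=> w1 mn;have wm1 : `|w ^+ m| = 1 by rewrite normrX w1 expr1n.
have wE : w ^+ n = w ^+ (n - m) * w ^+ m by rewrite -exprD subnK.
rewrite exprD wE;have := unit_complexE wm1.
case: (w ^+ (n - m))=> a b;case: (w ^+ m)=> c d /= cd1.
rewrite [X in _ = _ X](_ : a = a * (c ^+ 2 + d ^+ 2));last by rewrite cd1 mulr1.
by ring.
Qed.

Lemma modulus_coeff_le (a : nat -> R) (w : R[i]) n : `|w| = 1 ->
 `|Re (cauchy_prod (fun k => (a k)%:C%C * w ^+ k) (fun k => (a k)%:C%C * w^-1 ^+ k) n)| <=
 \sum_(i < n.+1) `|a i| * `|a (n - i)%N|.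
move=> w1;rewrite (raddf_sum (@complex.Re R)) (le_trans (ler_norm_sum _ _ _)) //.
lesum i.
rewrite [X in `|X|](_ : _ = a i * a (n - i)%N * Re (w ^+ i * w^-1 ^+ (n - i)));last first.
 by case: (w ^+ i)=> x y;case: (w^-1 ^+ _)=> z t /=;ring.
rewrite normrM normrM ler_piMr ?mulr_ge0 // unit_Re_le1 // normrM !normrX normfV w1.
by rewrite invr1 !expr1n mulr1.
Qed.

Lemma log_coeff_le (q : nat -> R) (w : R[i]) n : `|w| = 1 -> `|2 * (q n / n.+1%:R) * Re (w ^+ n.+1)| <= 2 * `|q n|.
move=> w1;rewrite -mulrA normrM ger0_norm // ler_wpM2l // normrM (@le_trans _ _ `|q n / n.+1%:R|) //.
 by rewrite ler_piMr // unit_Re_le1 // normrX w1 expr1n.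
by rewrite normrM ler_piMr // normfV normr_nat invf_le1 ?ltr0n // ler1n.
Qed.

(* [F] is the power series in [r] of [|f (r w)|^2], where [f] has the real
  coefficients [a]; it is the exponential of the series of [2 Re (log f (r w))]. *)
Lemma modulus_exp (a b : nat -> R) (w : R[i]) : entire a -> entire b -> cauchy_prod a b = @sone R -> `|w| = 1 ->
 let q := cauchy_prod (sdiff a) b in let F n := Re (cauchy_prod (fun k => (a k)%:C%C * w ^+ k)
               (fun k => (a k)%:C%C * w^-1 ^+ k) n) in
 let G n := if n is k.+1 then 2 * (q k / k.+1%:R) * Re (w ^+ k.+1) else 0 in a 0%N = 1 ->
 forall r, psum_at F r = expR (psum_at G r).
move=> ea eb ab w1 q F G a0 r.
have eq : entire q by apply: entire_cauchy_prod=> //;exact: entire_sdiff.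
have aq : sdiff a = cauchy_prod a q.
 by rewrite /q cauchy_prodA (cauchy_prodC a) -cauchy_prodA ab cauchy_prod1.
have wV k : Re (w^-1 ^+ k) = Re (w ^+ k).
 rewrite exprVn;have wk1 : `|w ^+ k| = 1 by rewrite normrX w1 expr1n.
 have := unit_complexE wk1;case: (w ^+ k)=> x y /= xy. by rewrite xy divr1.
have eF : entire F.
 have ea' : entire (fun n => `|a n|).
  by move=> t t0;have [C aC] := ea t t0;exists C=> n;rewrite normr_id.
 move=> s s0;have [C aC] := entire_cauchy_prod ea' ea' s0.
 exists C=> n;apply: le_trans (aC n);rewrite ler_wpM2r ?exprn_ge0 ?(ltW s0) //.
 exact: le_trans (modulus_coeff_le a n w1) (ler_norm _).
have eG : entire G.
 move=> s s0;have [C qC] := eq s s0;exists (2 * C * s + `|G 0%N|) => -[|n].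
  by rewrite expr0 mulr1 lerDr mulr_ge0 ?(ltW s0) ?mulr_ge0 // (entire_ge0 s0 qC).
 have Gq : `|G n.+1| <= 2 * `|q n| := log_coeff_le q n w1.
 rewrite ler_wpDr // exprSr [leLHS]mulrA ler_wpM2r ?(ltW s0) //.
 rewrite (le_trans (ler_wpM2r _ Gq)) ?exprn_ge0 ?(ltW s0) //. by rewrite -mulrA ler_wpM2l.
(* The logarithmic derivatives of f(r w) and of its conjugate are [Q w] and [Q w^-1]; their sum is
   real because [w] has modulus 1. *)
have FG : sdiff F = cauchy_prod (sdiff G) F.
 pose al k : R[i] := (a k)%:C%C * w ^+ k. pose be k : R[i] := (a k)%:C%C * w^-1 ^+ k.
 pose Q (v : R[i]) k : R[i] := (q k)%:C%C * v ^+ k.+1. have tw v : sdiff (fun k => (a k)%:C%C * v ^+ k) =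
   cauchy_prod (fun k => (a k)%:C%C * v ^+ k) (Q v).
  ext n;rewrite /sdiff -mulrnAl -rmorphMn /= -/(sdiff a n) aq. rewrite rmorph_sum mulr_suml;eqsum i=> /=.
  rewrite rmorphM -!mulrA;congr (_ _);rewrite mulrCA;congr (_ _). by rewrite -exprD addnS subnKC // -ltnS.
 have abE : sdiff (cauchy_prod al be) = cauchy_prod (fun n => Q w n + Q w^-1 n) (cauchy_prod al be).
  rewrite sdiff_cauchy_prod !tw -/al -/be cauchy_prodDl;ext n.
  congr (_ _);first by rewrite (cauchy_prodC al) -cauchy_prodA.
  by rewrite (cauchy_prodC be) cauchy_prodA (cauchy_prodC al) -cauchy_prodA.
 have QG n : Q w n + Q w^-1 n = (sdiff G n)%:C%C.
  apply: eqC.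
   have n1 : (n.+1%:R : R) != 0 by []. rewrite /sdiff /G /Q -mulr_natr;have := wV n.+1.
   case: (w ^+ n.+1)=> x y;case: (w^-1 ^+ n.+1)=> z t /= ->. by field.
  rewrite /Q exprVn;have := unit_complexE (w := w ^+ n.+1). rewrite normrX w1 expr1n=> /(_ erefl).
  by case: (w ^+ n.+1)=> x y /= ->;rewrite divr1;ring.
 ext n;have := congr1 (fun f : nat -> R[i] => Re (f n)) abE. rewrite /sdiff -/(sdiff G) raddfMn=> ->.
 rewrite /cauchy_prod raddf_sum;eqsum i=> /=.
 have ReZ (x : R) (z : R[i]) : Re (x%:C%C * z) = x * Re z by case: z=> u v /=;ring. by rewrite QG ReZ.
(* This function has derivative 0 and value 1 at 0. *)
pose H := psum_at F * (expR \o fun x => - psum_at G x).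
have dF x := is_derive_psum_at x eF;have dG x := is_derive_psum_at x eG.
have dH x : is_derive x (1 : R) H 0.
 have dE : is_derive x (1 : R) (expR \o (fun x => - psum_at G x)) (- psum_at (sdiff G) x * expR (- psum_at G x)).
  rewrite mulrC;apply: is_derive1_comp.
 apply: is_derive_eq. rewrite FG psum_at_prod //;last exact: entire_sdiff. rewrite /GRing.scale /=;ring.
have := is_derive_0_is_cst r 0 dH;rewrite /H /GRing.mul /= !psum_at0.
rewrite {3}/G oppr0 expR0 mulr1 {2}/F /cauchy_prod big_ord1 a0 /= => HH.
have : psum_at F r * expR (- psum_at G r) = 1 by rewrite [LHS]HH;ring.
by rewrite expRN=> /(canRL (mulfVK (lt0r_neq0 (expR_gt0 _))));rewrite mul1r.
Qed.

Lemma le_of_geometric (x y K : R) m : (forall L, (m < L)%N -> x <= y + K * 2^-1 ^+ L) -> x <= y.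
move=> H;apply/ler_addgt0Pr=> e e0.
pose L := maxn m.+1 (Num.trunc (`|K| / e)).+1.
have mL : (m < L)%N by lia.
apply: le_trans (H _ mL) _;rewrite lerD2l exprVn ler_pdivrMr //.
rewrite (le_trans (ler_norm _)) // mulrC -ler_pdivrMr // (le_trans (ltW (truncnS_gt _))) //.
rewrite (le_trans _ (nat_le_exp2 R L)) // ler_nat (leq_trans _ (leqnSn _)) //.
by rewrite leq_max leqnn orbT.
Qed.

(* Borel-Caratheodory: averaging [2 Re (log f)] over the [L]-th roots of unity
  with the nonnegative weights [1 +- Re (w ^ m)] isolates its [m]-th coefficient,
  up to aliasing errors that vanish as [L] grows. *)
Lemma cramer_coeff (a b : nat -> R) (C c : R) : entire a -> entire b ->
 cauchy_prod a b = @sone R -> a 0%N = 1 -> a 1%N = 0 -> 0 <= c ->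
 (forall r n, 0 <= r -> `|a n| * r ^+ n <= C * expR (c * r ^+ 2)) -> a = gauss_coeff (a 2%N).
move=> ea eb ab a0 a1 c0 growth.
pose q := cauchy_prod (sdiff a) b.
have eq : entire q by apply: entire_cauchy_prod=> //;exact: entire_sdiff.
have aq : sdiff a = cauchy_prod a q.
 by rewrite /q cauchy_prodA (cauchy_prodC a) -cauchy_prodA ab cauchy_prod1.
have C1 : 1 <= C.
 by have := growth 0 0%N (lexx _);rewrite a0 normr1 !expr0n /= mulr0 expR0 !mulr1.
have C0 : 0 < C by rewrite (lt_le_trans ltr01).
pose F w n := Re (cauchy_prod (fun k => (a k)%:C%C * w ^+ k) (fun k => (a k)%:C%C * w^-1 ^+ k) n).
pose G (w : R[i]) n := if n is k.+1 then 2 * (q k / k.+1%:R) * Re (w ^+ k.+1) else 0.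
(* The logarithm of a bound for |f(r w)|^2: coefficients are estimated at radius 4 r, so each of the
   two factors contributes 16 c r^2 to the exponent. *)
pose H r := ln (2 * C ^+ 2) + 32 * c * r ^+ 2.
have GH w r : `|w| = 1 -> 0 <= r -> psum_at (G w) r <= H r.
 move=> w1 r0;rewrite -ler_expR -(modulus_exp ea eb ab w1 a0) expRD lnK ?posrE;last first.
  by rewrite mulr_gt0 // exprn_gt0.
 pose D := C * expR (c * (4 * r) ^+ 2). have D0 : 0 <= D by rewrite mulr_ge0 ?expR_ge0 // ltW.
 have -> : 2 * C ^+ 2 * expR (32 * c * r ^+ 2) = D ^+ 2 * 2 * 2^-1 ^+ 0.
  have -> : 32 * c * r ^+ 2 = c * (4 * r) ^+ 2 + c * (4 * r) ^+ 2 by ring. by rewrite expRD /D;ring.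
 have FD n : `|F w n * r ^+ n| <= D ^+ 2 * 2^-1 ^+ n.
  have F1 := modulus_coeff_le a n w1;rewrite -/(F w n) in F1. have F2 : `|F w n| * (4 * r) ^+ n <= n.+1%:R * D ^+ 2.
   rewrite (le_trans (ler_wpM2r _ F1)) ?exprn_ge0 ?mulr_ge0 // mulr_suml.
   rewrite (_ : _ * D ^+ 2 = \sum_(i < n.+1) D ^+ 2);last first.
    by rewrite sumr_const card_ord mulr_natl.
   lesum i;have -> : (4 * r) ^+ n = (4 * r) ^+ i * (4 * r) ^+ (n - i).
    by rewrite -exprD subnKC // -ltnS.
   rewrite mulrACA expr2 ler_pM ?growth ?mulr_ge0 ?exprn_ge0 ?mulr_ge0 //.
  rewrite normrM (ger0_norm (exprn_ge0 n r0)) exprVn ler_pdivlMr ?exprn_gt0 //.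
  rewrite -(ler_pM2l (exprn_gt0 n (ltr0n R 2))). apply: (@le_trans _ _ (n.+1%:R * D ^+ 2));last first.
   by rewrite ler_wpM2r ?exprn_ge0 ?nat_le_exp2.
  apply: le_trans F2;apply: eq_ler. by rewrite exprMn (_ : 4 = 2 * 2 :> R) ?exprMn;[ring|rewrite -natrM].
 have cF : cvgn (pseries (F w) r).
  apply: normed_cvg;apply: (@series_le_cvg _ _ (fun n => D ^+ 2 * 2^-1 ^+ n)).
  - by move=> n;exact: normr_ge0.
  - by move=> n;rewrite mulr_ge0 ?exprn_ge0 ?invr_ge0.
  - exact: FD.
  by apply: is_cvg_geometric_series;rewrite ger0_norm ?invr_ge0 // invf_lt1 // ltr1n.
 apply: limr_le=> //;near=> m;rewrite /pseries /series /=.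
 apply: le_trans (geometric_part 0 m (exprn_ge0 2 D0));lesum n. exact: le_trans (ler_norm _) (FD n).
have key m r (sg : bool) : 0 < r -> (-1) ^+ sg * (q m / m.+1%:R) * r ^+ m.+1 <= H r.
 move=> r0;pose rho := 2 * (`|r| + 1). have rho0 : 0 < rho by rewrite mulr_gt0 // ltr_wpDl.
 have [Cq qC] := eq _ rho0;have Cq0 := entire_ge0 rho0 qC. pose K0 := 2 * Cq * rho.
 have GK w : `|w| = 1 -> forall n, `|G w n| * rho ^+ n <= K0.
  move=> w1 [|n];first by rewrite normr0 mul0r !mulr_ge0 // ltW.
  have Gq : `|G w n.+1| <= 2 * `|q n| := log_coeff_le q n w1. rewrite exprSr [leLHS]mulrA ler_wpM2r ?(ltW rho0) //.
  rewrite (le_trans (ler_wpM2r _ Gq)) ?exprn_ge0 ?(ltW rho0) //. by rewrite -mulrA ler_wpM2l.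
 apply: (@le_of_geometric _ _ (2 * (K0 * 2) * 2 ^+ m.+1) (2 * m.+1))=> L mL.
 have L0 : 0 < (L%:R : R) by rewrite ltr0n (leq_ltn_trans _ mL).
 pose w (j : 'I_L) := root_unity R L j;have w1 j : `|w j| = 1 by exact: norm_root_unity.
 pose W j := 1 + (-1) ^+ sg * Re (w j ^+ m.+1). have Wle j : 0 <= W j <= 2.
  have : `|Re (w j ^+ m.+1)| <= 1 by rewrite unit_Re_le1 // normrX w1 expr1n.
  by rewrite ler_norml /W=> /andP[];case: (sg);rewrite ?expr1 ?expr0;lra.
 have sumW n : (0 < n < L - m.+1)%N -> \sum_j W j * Re (w j ^+ n) =
   if n == m.+1 then (-1) ^+ sg * (L%:R / 2) else 0.
  move=> /andP[n0 nL];rewrite /W;under eq_bigr do rewrite mulrDl mul1r -mulrA.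
  rewrite big_split /= sum_Re_root_unity ?add0r -?mulr_sumr;last by lia.
  have prodE k l : (0 < k)%N -> (k <= l)%N -> (l + k < L)%N ->
    \sum_j Re (w j ^+ k) * Re (w j ^+ l) = if k == l then L%:R / 2 else 0.
   move=> k0 kl klL;apply: (@mulfI _ 2);first by rewrite pnatr_eq0. rewrite mulr_sumr.
   under eq_bigr=> j _ do rewrite (mulrC (Re (w j ^+ k))) (unit_ReM (w1 j) kl).
   rewrite big_split /= sum_Re_root_unity ?add0r;last by lia. case: eqP=> [->|/eqP kl'].
    rewrite subnn;under eq_bigr do rewrite expr0. by rewrite sumr_const card_ord mulrCA mulfV ?mulr1 ?pnatr_eq0.
   by rewrite mulr0 sum_Re_root_unity //;lia.
  have [nm|mn] := leqP n m.+1.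
   under eq_bigr do rewrite mulrC. by rewrite prodE //;[case: ifP=> // _;rewrite mulr0 | lia].
  rewrite prodE //;[|lia|lia]. by rewrite eq_sym;case: ifP=> // _;rewrite mulr0.
 (* Only degrees below L - (m + 1) are kept: their sums with m + 1 stay below [L], so the
    root-of-unity averages alias nothing. *)
 pose K := (L - m.+1)%N. have part : \sum_j W j * \sum_(n < K) G (w j) n * r ^+ n =
   L%:R * ((-1) ^+ sg * (q m / m.+1%:R) * r ^+ m.+1).
  under eq_bigr do rewrite mulr_sumr. rewrite exchange_big /=. have mK : (m.+1 < K)%N by rewrite /K;lia.
  rewrite (bigD1 (Ordinal mK)) //= [X in _ + X]big1 ?addr0=> [|n nm];last first.
   case: n nm=> -[|n] nK nm /=;first by rewrite big1 // => j _;rewrite mul0r mulr0.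
   transitivity (2 * (q n / n.+1%:R) * r ^+ n.+1 * \sum_j W j * Re (w j ^+ n.+1)).
    by rewrite mulr_sumr;eqsum j;rewrite /G;ring.
   by rewrite sumW // ifN ?mulr0.
  transitivity (2 * (q m / m.+1%:R) * r ^+ m.+1 * \sum_j W j * Re (w j ^+ m.+1)).
   by rewrite mulr_sumr;eqsum j;rewrite /G;ring.
  by rewrite sumW // eqxx;move: (q m / _)=> x;field.
 rewrite -(ler_pM2l L0) -part. have tail j : W j * \sum_(n < K) G (w j) n * r ^+ n <=
   W j * H r + 2 * (K0 * 2) * 2^-1 ^+ K.
  have /andP[W0 W2] := Wle j. have [_ /(_ K)] := entire_tail (GK _ (w1 j));rewrite ler_norml=> /andP[t1 _].
  have g0 := GH (w j) r (w1 j) (ltW r0). have K00 : 0 <= K0 * 2 * 2^-1 ^+ K.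
   by rewrite !mulr_ge0 ?exprn_ge0 ?invr_ge0 // ltW.
  move: t1 g0 K00;set P := psum_at _ _;set S := \sum_(n < K) _;move: (_ ^+ K) (H r).
  move=> e h t1 g0 K00;rewrite -!mulrA in K00 t1 *;nra.
 apply: le_trans (ler_sum _ (fun j _ => tail j)) _. have sW : \sum_j W j = L%:R.
  rewrite /W big_split /= -mulr_sumr sum_Re_root_unity;last by lia. by rewrite mulr0 addr0 sumr_const card_ord.
 rewrite big_split /= -mulr_suml sW sumr_const card_ord [leRHS]mulrDr lerD //.
 rewrite -[leLHS]mulr_natl ler_wpM2l ?(ltW L0) //.
 have -> : 2^-1 ^+ L = 2^-1 ^+ m.+1 * 2^-1 ^+ K :> R by rewrite -exprD subnKC //;lia.
 rewrite [leRHS](_ : _ = 2 * (K0 * 2) * 2^-1 ^+ K * (2 ^+ m.+1 * 2^-1 ^+ m.+1));last by ring.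
 by rewrite -exprMn mulfV ?pnatr_eq0 // expr1n mulr1.
(* Term number m + 1 of the logarithm is at most [H r], which is quadratic in r; so the logarithmic
   derivative has no terms beyond degree 1. *)
have q0 m : (2 <= m)%N -> q m = 0.
 move=> m2;apply/eqP;rewrite -normr_le0 leNgt;apply/negP=> qm. pose h := `|ln (2 * C ^+ 2)| + 32 * c.
 have gm : 0 < `|q m| / m.+1%:R by rewrite divr_gt0 ?ltr0n. have bnd (r : R) : 1 <= r -> `|q m| / m.+1%:R * r <= h.
  move=> r1;have r0 : 0 < r by rewrite (lt_le_trans ltr01). have k : `|q m| / m.+1%:R * r ^+ m.+1 <= H r.
   have := key m r (q m < 0) r0;congr (_ <= _);congr (_ * _);rewrite mulrA. by congr (_ * _);rewrite normrEsign.
  have r2 : 0 < r ^+ 2 by rewrite exprn_gt0.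
  rewrite -(ler_pM2r r2) (_ : _ * r * r ^+ 2 = `|q m| / m.+1%:R * r ^+ 3);last by ring.
  apply: (@le_trans _ _ (H r)).
   apply: le_trans k;rewrite ler_wpM2l ?(ltW gm) //. by rewrite ler_weXn2l.
  rewrite /H /h [leRHS]mulrDl lerD // (le_trans (ler_norm _)) //. by rewrite ler_peMr // exprn_ege1.
 have := bnd (1 + h / (`|q m| / m.+1%:R)). have h0 : 0 <= h by rewrite addr_ge0 // mulr_ge0.
 rewrite lerDl divr_ge0 ?(ltW gm) // => /(_ isT). rewrite mulrDr mulr1 mulrCA mulfV ?gt_eqF // mulr1.
 by rewrite -lerBrDr subrr leNgt gm.
have q0E : q 0%N = 0.
 have := congr1 (@^~ 0%N) aq;rewrite /sdiff /cauchy_prod big_ord1 a0 a1 mul0rn mul1r. by move=> <-.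
have aS n : a n.+2 *+ n.+2 = q 1%N * a n.
 have := congr1 (@^~ n.+1) aq;rewrite /sdiff=> ->.
 rewrite /cauchy_prod big_ord_recr big_ord_recr /= subnn q0E mulr0 addr0 subSnn.
 rewrite big1=> [|i _];first by rewrite add0r mulrC. by rewrite q0 ?mulr0 //;have := ltn_ord i;lia.
apply: gauss_coeff_rec=> // n;rewrite aS;congr (_ * _).
by have := aS 0%N;rewrite a0 mulr1 mulr2n=> <-;ring.
Unshelve. all: by end_near. Qed.

End Cramer.

(** Limits along an ultrafilter replace subsequences: a single filter serves all bounded sequences
    at once, and the limit is linear. *)
Lemma ultra_fmap_cvg (T : Type) (U : set_system T) (Y : topologicalType)
  (K : set Y) (f : T -> Y) : UltraFilter U -> compact K -> (forall x, K (f x)) ->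
 exists p : Y, f x @[x --> U] --> p.
move=> UU cK Kf;have [|p [_ clp]] := cK (f @ U) _.
 have : U (f @^-1` K) by apply: filterS filterT=> x _;exact: Kf. by [].
exists p=> N Np;have [//|UN] := in_ultra_setVsetC (f @^-1` N).
have UN' : (f @ U) (~` N) by [].
by have [y []] := clp _ _ UN' Np.
Qed.

(** * Invariant averages over an abelian group *)

Section Averaging.
Variables (R : realType) (X : zmodType) (B : set (X -> R)) (L : (X -> R) -> R).
Hypothesis B_shift : forall f a, B f -> B (fun x => f (x + a)).
Hypothesis L_add : forall f g, B f -> B g -> L (fun x => f x + g x) = L f + L g.
Hypothesis L_scale : forall c f, B f -> L (fun x => c * f x) = c * L f.
Hypothesis L_bounded : forall f, B f -> exists C : R, forall a, `|L (fun x => f (x + a))| <= C.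

(** The mean of [L] over the translates of f by all k_1 a_1 + ... + k_m a_m with 0 <= k_i <= n,
    where [t] lists the a_i: a Folner box. *)
Fixpoint box n (t : seq X) (f : X -> R) : R := if t is a :: t' then
  n.+1%:R^-1 * \sum_(k < n.+1) box n t' (fun x => f (x + a *+ k)) else L f.

Lemma box_add n t f g : B f -> B g -> box n t (fun x => f x + g x) = box n t f + box n t g.
elim: t f g=> [|a t IH] f g Bf Bg /=;first exact: L_add.
rewrite -mulrDr -big_split /=;congr (_ _);eqsum k.
by rewrite IH //;exact: B_shift.
Qed.

Lemma box_scale n t c f : B f -> box n t (fun x => c * f x) = c * box n t f.
elim: t f=> [|a t IH] f Bf /=;first exact: L_scale.
under eq_bigr=> k _.
 rewrite IH;last exact: B_shift. over.
by rewrite -mulr_sumr mulrCA.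
Qed.

Lemma box_between n t f lo hi : B f -> (forall a, lo <= L (fun x => f (x + a)) <= hi) ->
 forall a, lo <= box n t (fun x => f (x + a)) <= hi.
elim: t f=> [|b t IH] f Bf H a //=.
have n0 : 0 < (n.+1%:R : R) by [].
rewrite mulrC ler_pdivlMr // ler_pdivrMr //.
have S c : c * n.+1%:R = \sum_(k < n.+1) c :> R.
 by rewrite sumr_const card_ord mulr_natr.
apply/andP;split;rewrite S;lesum k.
 have /andP[+ _] := IH f Bf H (b *+ k + a). by under eq_fun do rewrite addrA.
have /andP[_ +] := IH f Bf H (b *+ k + a).
by under eq_fun do rewrite addrA.
Qed.

Lemma box_bounded f : B f -> exists C : R, forall n t a, `|box n t (fun x => f (x + a))| <= C.
move=> Bf;have [C HC] := L_bounded Bf;exists C=> n t a;rewrite ler_norml.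
by apply: box_between=> // b;rewrite -ler_norml.
Qed.

(** In the direction of a generator the sum telescopes and leaves two of its n + 1 terms. *)
Lemma box_shift n t a f C : a \in t -> B f -> (forall t b, `|box n t (fun x => f (x + b))| <= C) ->
 `|box n t (fun x => f (x + a)) - box n t f| <= n.+1%:R^-1 * (2 * C).
elim: t f=> // b t IH f;rewrite inE=> /orP[/eqP <-|at_] Bf HC /=.
 rewrite -mulrBr normrM ger0_norm // ler_wpM2l //. have -> : \sum_(k < n.+1) box n t (fun x => f (x + a *+ k + a)) -
   \sum_(k < n.+1) box n t (fun x => f (x + a *+ k)) =
   box n t (fun x => f (x + a *+ n.+1)) - box n t (fun x => f (x + 0)).
  rewrite -sumrB;under eq_bigr=> k do under eq_fun do rewrite -addrA -mulrSr.
  rewrite -(big_mkord xpredT (fun k => box n t (fun x => f (x + a *+ k.+1)) -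
    box n t (fun x => f (x + a *+ k)))) telescope_sumr //=.
 by rewrite (le_trans (ler_normB _ _)) // mulr2n mulrDl mul1r lerD.
rewrite -mulrBr -sumrB normrM ger0_norm //.
rewrite ler_pdivrMl // (le_trans (ler_norm_sum _ _ _)) //.
have -> : n.+1%:R * (n.+1%:R^-1 * (2 * C)) =
  \sum_(k < n.+1) n.+1%:R^-1 * (2 * C) by rewrite sumr_const card_ord mulr_natl.
lesum k.
have := IH (fun x => f (x + b *+ k)) at_ (B_shift _ Bf).
under eq_fun do rewrite addrAC.
apply=> t' c;under eq_fun do rewrite -addrA.
exact: HC.
Qed.

Let base (p : nat * seq X) : set (nat * seq X) := [set q : nat * seq X | (p.1 <= q.1)%N /\ {subset p.2 <= q.2}].

(** Along this ultrafilter [n] grows beyond all bounds and every element of X eventually becomes a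
    generator. *)
Lemma box_filter : exists U : set_system (nat * seq X), UltraFilter U /\ forall p, U (base p).
pose F := filter_from [set: nat * seq X] base.
have FF : ProperFilter F.
 apply: filter_from_proper;last by move=> p _;exists p;split. apply: filter_from_filter;first by exists (0%N, [::]).
 move=> p q _ _;exists (maxn p.1 q.1, p.2 ++ q.2)=> // r [].
 rewrite geq_max=> /andP[h1 h2] h3;split;split=> // x xp;apply: h3; by rewrite mem_cat xp ?orbT.
have [U [UU FU]] := ultraFilterLemma FF;exists U;split=> // p.
by apply: FU;exists p.
Qed.

(** The limit of the box averages. [box_shift] makes it invariant, and a lower bound valid for all
    translates under [L] passes to the limit. *)
Lemma invariant_average : exists I : (X -> R) -> R, [/\
 (forall f g, B f -> B g -> I (fun x => f x + g x) = I f + I g),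
 (forall c f, B f -> I (fun x => c * f x) = c * I f), (forall f a, B f -> I (fun x => f (x + a)) = I f) &
 (forall f c, B f -> (forall a, c <= L (fun x => f (x + a))) -> c <= I f)].
have [U [UU HU]] := box_filter.
have cv f : B f -> cvg ((fun p => box p.1 p.2 f) @ U).
 move=> Bf;have [C HC] := box_bounded Bf. have [|x Hx] := ultra_fmap_cvg (f := fun p => box p.1 p.2 f) UU
  (@segment_compact R (-C) C). move=> p /=;rewrite in_itv -ler_norml.
  by have := HC p.1 p.2 0;under eq_fun do rewrite addr0.
 by apply/cvg_ex;exists x.
pose I f := lim ((fun p => box p.1 p.2 f) @ U).
exists I;split.
- move=> f g Bf Bg;rewrite /I -limD;try exact: cv.
 rewrite (_ : (fun p => _) = (fun p => box p.1 p.2 f) + (fun p => box p.1 p.2 g)) //. by ext p;exact: box_add.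
- move=> c f Bf;apply/cvg_lim=> //.
 rewrite (_ : (fun p => _) = (fun p => c * box p.1 p.2 f)).
  by apply: cvgMr;exact: cv.
 by ext p;exact: box_scale.
- move=> f a Bf;apply: subr0_eq.
 have Bfa := B_shift a Bf. rewrite -limB;try exact: cv. apply/cvg_lim=> //;apply/cvgrPdist_le=> e e0.
 have [C HC] := box_bounded Bf. have [n Hn] : exists n, forall m, (n <= m)%N -> m.+1%:R^-1 * (2 * C) <= e.
  exists (Num.truncn (2 * C / e))=> m nm. rewrite ler_pdivrMl // -ler_pdivrMr //.
  by rewrite ltW // (lt_le_trans (truncnS_gt _)) // ler_nat.
 apply: filterS (HU (n, [:: a]))=> -[m t] [/= nm at_]. rewrite sub0r normrN (le_trans _ (Hn _ nm)) // box_shift //.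
 by apply: at_;rewrite inE.
- move=> f c Bf H;apply: limr_ge;first exact: cv.
 apply: filterS filterT=> p _. have [C HC] := L_bounded Bf.
 have H' a : c <= L (fun x => f (x + a)) <= C by rewrite H (le_trans (ler_norm _)).
 have /andP[+ _] := box_between p.1 p.2 Bf H' 0. by under eq_fun do rewrite addr0.
Qed.

End Averaging.

(** * Neighbourhoods and compact sets in topological groups *)

Section GroupTopology.
Variables (X : topologicalZmodType).

Lemma shift_continuous (a : X) : continuous (fun x : X => x + a).
by move=> x;exact: cvg_comp2 cvg_id (cvg_cst a) (@add_continuous X (x, a)).
Qed.

Lemma nbhs_shift (x a : X) (U : set X) : nbhs (x + a) U -> nbhs x [set z | U (z + a)].
by move=> Ux;exact: (@shift_continuous a x _ Ux). Qed.

Lemma nbhs_opp (x : X) (U : set X) : nbhs (- x) U -> nbhs x [set z | U (- z)].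
by move=> Ux;exact: (@opp_continuous X x _ Ux). Qed.

Lemma nbhs0_sub (U : set X) : nbhs 0 U -> exists W : set X,
 [/\ nbhs 0 W, (forall x, W x -> W (- x)) & forall x y, W x -> W y -> U (x - y)].
move=> U0;have := @sub_continuous X (0, 0).
rewrite /continuous_at subr0=> /(_ _ U0) [[A B] [/= A0 B0] AB].
exists (A `&` B `&` [set x | (A `&` B) (- x)]);split.
- apply: filterI;first exact: filterI.
 by apply: nbhs_opp;rewrite oppr0;exact: filterI.
- by move=> x [[Ax Bx] [A'x B'x]];rewrite /= opprK.
- by move=> x y [[Ax Bx] _] [[Ay By] _];exact: (AB (x, y)).
Qed.

Lemma compact_shift (K : set X) a : compact K -> compact [set x | K (x + a)].
move=> cK;have -> : [set x | K (x + a)] = (fun x => x - a) @` K.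
 apply/seteqP;split=> [x Kx|x [y Ky <-]] /=;last by rewrite subrK. by exists (x + a)=> //;rewrite addrK.
apply: continuous_compact=> //;apply: continuous_subspaceT.
exact: shift_continuous.
Qed.

Lemma compact_opp (K : set X) : compact K -> compact [set x | K (- x)].
move=> cK;have -> : [set x | K (- x)] = -%R @` K.
 apply/seteqP;split=> [x Kx|x [y Ky <-]] /=;last by rewrite opprK. by exists (- x)=> //;rewrite opprK.
apply: continuous_compact=> //;apply: continuous_subspaceT=> x.
exact: opp_continuous.
Qed.

Lemma compact_add (K L : set X) : compact K -> compact L -> compact [set x + y | x in K & y in L].
move=> cK cL;have -> : [set x + y | x in K & y in L] = (fun p => p.1 + p.2) @` (K `*` L).
 apply/seteqP;split=> [_ [x Kx [y Ky <-]]|_ [[x y] [/= Kx Ly] <-]].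
  by exists (x, y).
 by exists x=> //;exists y.
apply: continuous_compact;last exact: compact_setX.
by apply: continuous_subspaceT;exact: add_continuous.
Qed.

Lemma compact_cover_shifts (K U : set X) : compact K -> nbhs 0 U ->
 exists s : seq X, forall x, K x -> exists2 z, z \in s & U (x - z).
move=> /compact_near_coveringP cK U0.
pose F := filter_from [set: seq X] (fun s => [set t : seq X | {subset s <= t}]).
have FF : Filter F.
 apply: filter_from_filter;first by exists [::]. move=> s t _ _;exists (s ++ t)=> //;split=> x xs;apply: H;
 by rewrite mem_cat xs ?orbT.
have [|s _ Hs] := cK _ F (fun s x => exists2 z, z \in s & U (x - z)).
 move=> x _;exists ([set z | U (z - x)], [set t : seq X | {subset [:: x] <= t}]).
  split;last by exists [:: x]. by apply: (@nbhs_shift x (- x));rewrite subrr.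
 by move=> [y t] /= [Uyx xt];exists x=> //;apply: xt;rewrite inE.
by exists s=> x Kx;exact: (Hs s).
Qed.

End GroupTopology.

(** * An invariant integral on a locally compact group *)

Section Haar.
Variables (R : realType) (X : topologicalZmodType).
Implicit Types (f g : X -> R) (S V K : set X).

(** The domain of the integral: bounded functions supported in a compact set, measurable or not. *)
Definition bcs f := exists2 K, compact K & exists M : R, forall x, `|f x| <= M /\ (f x != 0 -> K x).

Lemma bcs_shift f a : bcs f -> bcs (fun x => f (x + a)).
move=> [K cK [M H]];exists [set x | K (x + a)];first exact: compact_shift.
by exists M=> x;exact: H.
Qed.

Lemma bcs_opp f : bcs f -> bcs (fun x => f (- x)).
move=> [K cK [M H]];exists [set x | K (- x)];first exact: compact_opp.
by exists M=> x;exact: H.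
Qed.

Lemma bcs_add f g : bcs f -> bcs g -> bcs (fun x => f x + g x).
move=> [K cK [M H]] [K' cK' [M' H']];exists (K `|` K');first exact: compactU.
exists (M + M')=> x;have [h1 h2] := H x;have [h3 h4] := H' x.
split;first by rewrite (le_trans (ler_normD _ _)) // lerD.
have [->|/h2 Kx _] := eqVneq (f x) 0;last by left.
by rewrite add0r=> /h4;right.
Qed.

Lemma bcs_mull f g : bcs f -> (exists M : R, forall x, `|g x| <= M) -> bcs (fun x => g x * f x).
move=> [K cK [M H]] [M' H'];exists K=> //;exists (M' * M)=> x.
have [h1 h2] := H x;rewrite normrM ler_pM //;split=> //.
by rewrite mulf_eq0 negb_or=> /andP[_].
Qed.

Lemma bcs_scale c f : bcs f -> bcs (fun x => c * f x).
by move=> /bcs_mull;apply;exists `|c|. Qed.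

Lemma bcs_mul f g : bcs f -> bcs g -> bcs (fun x => f x * g x).
move=> [K _ [M H]] Bg;apply: bcs_mull=> //.
by exists M=> x;have [] := H x.
Qed.

Lemma bcs_norm f : bcs f -> bcs (fun x => `|f x|).
move=> [K cK [M H]];exists K=> //;exists M=> x;have [h1 h2] := H x.
by rewrite normr_id normr_eq0.
Qed.

Lemma bcs_dom f g : bcs g -> (forall x, `|f x| <= `|g x|) -> bcs f.
move=> [K cK [M H]] fg;exists K=> //;exists M=> x;have [h1 h2] := H x.
split;first exact: le_trans.
move=> fx;apply: h2;rewrite -normr_gt0 (lt_le_trans _ (fg x)) //.
by rewrite normr_gt0.
Qed.

Section NetSum.
Variables (S V W : set X).
Hypothesis S_sep : forall s t, S s -> S t -> s != t -> ~ V (s - t).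
Hypothesis W0 : nbhs 0 W.
Hypothesis WV : forall x y, W x -> W y -> V (x - y).

(** Two net points in one translate of [W] coincide, so the size of a cover of [K] by such
    translates bounds the number of net points in every translate of [K]. *)
Lemma net_card K : compact K -> exists n, forall a (D : seq X), uniq D ->
 (forall x, x \in D -> S x /\ K (x + a)) -> (size D <= n)%N.
move=> cK;have [s Hs] := compact_cover_shifts cK W0;exists (size s)=> a D uD HD.
have /choice [z Hz] : forall x, exists z, x \in D -> z \in s /\ W (x + a - z).
 move=> x;case: (boolP (x \in D))=> [/HD [_ /Hs [z zs Wz]]|];last by exists 0. by exists z.
rewrite -(size_map z);apply: uniq_leq_size.
 rewrite map_inj_in_uniq // => x y xD yD zxy.
 have [_ hx] := Hz _ xD;have [_ hy] := Hz _ yD;apply/eqP/negPn/negP=> xy. apply: (S_sep (HD _ xD).1 (HD _ yD).1 xy).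
 have := WV hx hy;rewrite zxy;congr V. by rewrite opprB addrA subrK opprD addrACA subrr addr0.
by move=> _ /mapP [x xD ->];have [] := Hz _ xD.
Qed.

Lemma net_finite K a : compact K -> finite_set (S `&` [set x | K (x + a)]).
move=> cK;have [n Hn] := net_card cK;apply: contrapT=> inf.
have [B BS] := infinite_set_fset n.+1 inf.
apply/negP;rewrite -leqNgt;apply: (Hn a);first exact: fset_uniq.
by move=> x xB;exact: BS.
Qed.

Definition net_sum f : R := \sum_(s \in S) f s.

Lemma net_sumE f (D : set X) : finite_set (S `&` D) -> (forall x, f x != 0 -> D x) ->
 net_sum f = \sum_(s <- fset_set (S `&` D)) f s.
move=> fD fD0;rewrite -fsbig_finite //;apply/esym/fsbig_widen;first by [].
move=> x [Sx] nD;apply: contra_notP nD=> /eqP;split=> //;exact: fD0.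
Qed.

Lemma net_finite0 K : compact K -> finite_set (S `&` K).
move=> /(net_finite 0);congr (finite_set (S `&` _)).
by apply/seteqP;split=> x /=;rewrite addr0.
Qed.

Lemma net_sum_add f g : bcs f -> bcs g -> net_sum (fun x => f x + g x) = net_sum f + net_sum g.
move=> [K cK [M H]] [K' cK' [M' H']].
have fin := net_finite0 (compactU cK cK').
rewrite !(net_sumE fin) ?big_split // => x.
- by move=> /(H' x).2;right.
- by move=> /(H x).2;left.
- have [->|/(H x).2 Kx _] := eqVneq (f x) 0;last by left.
 by rewrite add0r=> /(H' x).2;right.
Qed.

Lemma net_sum_scale c f : bcs f -> net_sum (fun x => c * f x) = c * net_sum f.
move=> [K cK [M H]];have fin := net_finite0 cK.
rewrite !(net_sumE fin) ?mulr_sumr // => x;first by move/(H x).2.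
by rewrite mulf_eq0 negb_or=> /andP[_ /(H x).2].
Qed.

Lemma net_sum_bounded f : bcs f -> exists C : R, forall a, `|net_sum (fun x => f (x + a))| <= C.
move=> [K cK [M H]];have [n Hn] := net_card cK;exists (n%:R * M)=> a.
have M0 : 0 <= M by rewrite (le_trans _ (H 0).1).
rewrite (net_sumE (net_finite a cK));last by move=> x /(H _).2.
rewrite (le_trans (ler_norm_sum _ _ _)) //.
rewrite (le_trans (ler_sum _ (fun s _ => (H (s + a)).1))) //.
rewrite big_const_seq count_predT iter_addr_0 -[M *+ _]mulr_natl ler_wpM2r // ler_nat.
apply: (Hn a);first exact: fset_uniq.
move=> x;rewrite in_fset_set;last exact: net_finite.
by move/set_mem.
Qed.

Lemma net_sum_ge1 f : bcs f -> (forall x, 0 <= f x) -> (exists2 s, S s & 1 <= f s) -> 1 <= net_sum f.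
move=> [K cK [M H]] f0 [s Ss fs].
rewrite (net_sumE (net_finite0 cK));last by move=> x /(H x).2.
have sK : s \in fset_set (S `&` K).
 rewrite in_fset_set;last exact: net_finite0. apply/mem_set;split=> //;apply: (H s).2.
 by rewrite gt_eqF // (lt_le_trans _ fs).
by rewrite (big_fsetD1 s) //= (le_trans fs) // lerDl sumr_ge0.
Qed.

End NetSum.

(** A maximal set without V-close pairs; a point that it fails to cover could be added. *)
Lemma net_exists V : V 0 -> exists S, (forall s t, S s -> S t -> s != t -> ~ V (s - t)) /\
 forall x, exists2 s, S s & (V (s - x) \/ V (x - s)).
move=> V0.
pose Q S := forall s t, S s -> S t -> s != t -> ~ V (s - t).
have [F FQ Ftot|S [QS maxS]] := @Zorn_bigcup X Q.
 move=> s t [A FA As] [B FB Bt];have [AB|BA] := Ftot _ _ FA FB.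
  by apply: (FQ _ FB)=> //;exact: AB.
 by apply: (FQ _ FA)=> //;exact: BA.
exists S;split=> // x;apply: contrapT=> nx.
have nSx : ~ S x by move=> Sx;apply: nx;exists x=> //;rewrite subrr;left.
apply: (maxS (S `|` [set x])).
 by split;[move=> y;left|move=> /(_ x (or_intror erefl))].
move=> s t [Ss|->] [St|->];[exact: QS| | |by rewrite eqxx].
 by move=> _ Vsx;apply: nx;exists s=> //;left.
by move=> _ Vxt;apply: nx;exists t=> //;right.
Qed.

(** Summation over a net is positive, bounded uniformly over translates, and at least 1 on functions
    that are at least 1 on [V], again for all translates. Averaging makes it invariant and keeps the
    lower bound; the half-sum with the reflected functional is invariant under inversion too. *)
Lemma haar V : nbhs 0 V -> exists I : (X -> R) -> R,
 [/\ [/\ (forall f g, bcs f -> bcs g -> I (fun x => f x + g x) = I f + I g),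
    (forall c f, bcs f -> I (fun x => c * f x) = c * I f) & (forall f, bcs f -> (forall x, 0 <= f x) -> 0 <= I f)],
 (forall f a, bcs f -> I (fun x => f (x + a)) = I f), (forall f, bcs f -> I (fun x => f (- x)) = I f) &
 (forall f, bcs f -> (forall x, 0 <= f x) -> (forall x, V x -> 1 <= f x) -> 1 <= I f)].
move=> V0;have [U [U0 Usym UV]] := nbhs0_sub V0.
have UsubV x : U x -> V x.
 by move=> Ux;rewrite -(subr0 x);apply: UV=> //;exact: nbhs_singleton.
have [W [W0 Wsym WU]] := nbhs0_sub U0.
have [S [sepS covS]] := net_exists (nbhs_singleton U0).
have covS' x : exists2 s, S s & U (s - x).
 have [s Ss [|/Usym]] := covS x;first by exists s. by rewrite opprB;exists s.
have [I [Iadd Iscale Ishift Ige]] := invariant_average bcs_shift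
 (net_sum_add sepS W0 WU) (net_sum_scale sepS W0 WU) (net_sum_bounded sepS W0 WU).
have I0 f : bcs f -> (forall x, 0 <= f x) -> 0 <= I f.
 by move=> Bf f0;apply: Ige=> // a;apply: fsumr_ge0=> *;exact: f0.
exists (fun f => (I f + I (fun x => f (- x))) / 2);split;[split|..].
- move=> f g Bf Bg;rewrite !Iadd //;try exact: bcs_opp.
 by rewrite -mulrDl addrACA.
- move=> c f Bf;have /= E := Iscale c _ (bcs_opp Bf).
 rewrite Iscale // E. by rewrite -mulrDr mulrA.
- move=> f Bf f0;rewrite divr_ge0 // addr_ge0 ?I0 //;exact: bcs_opp.
- move=> f a Bf;rewrite Ishift //;congr ((_ + _) / _).
 rewrite -[RHS](Ishift _ (- a));last exact: bcs_opp. by congr I;ext x;rewrite opprD opprK.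
- move=> f Bf;rewrite addrC;congr ((I _ + _) / _).
 by ext x;rewrite opprK.
- move=> f Bf f0 f1;have H g : bcs g -> (forall x, 0 <= g x) ->
   (forall x, U x -> 1 <= g x) -> 1 <= I g.
  move=> Bg g0 g1;apply: Ige=> // a. apply: (net_sum_ge1 sepS W0 )=> //;first exact: bcs_shift.
  have [s Ss Us] := covS' (- a);exists s=> //;apply: g1. by rewrite opprK in Us.
 have h1 : 1 <= I f by apply: H=> // x /UsubV;exact: f1. have h2 : 1 <= I (fun x => f (- x)).
  by apply: H=> //;[exact: bcs_opp|move=> x /Usym /UsubV;exact: f1].
 by rewrite ler_pdivlMr // mul1r;apply: le_trans (lerD h1 h2);rewrite -[2%R]/(1+1).
Qed.

End Haar.
Lemma discriminant_le R (a b c : R) : (forall s t, 0 <= s ^+ 2 * a + 2 * s * t * b + t ^+ 2 * c) -> b ^+ 2 <= a * c.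
move=> H;have a0 : 0 <= a by have := H 1 0;nra.
have c0 : 0 <= c by have := H 0 1;nra.
have [a1|a1] := ltP 0 a;first by have := H b (- a);nra.
have [c1|c1] := ltP 0 c;first by have := H c (- b);nra.
have := H 1 1;have := H 1 (-1);nra.
Qed.

(** * Complex limits and limits along ultrafilters *)

Section ComplexConvergence.
Variable R : realType.

Lemma complex_gt0E (e : C R) : 0 < e -> e = (Re e)%:C%C /\ 0 < Re e.
by case: e=> a b;rewrite ltcE /= => /andP[/eqP -> a0]. Qed.

Lemma complex_norm_le (a b : R) : `|(a +i* b)%C : C R| <= (`|a| + `|b|)%:C%C.
rewrite lecR -[leRHS]ger0_norm // -sqrtr_sqr ler_sqrt //.
rewrite sqrrD !real_normK ?num_real // -addrA lerD // lerDr.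
by rewrite mulrn_wge0 // mulr_ge0.
Qed.

Lemma cvg_complex (T : Type) (F : set_system T) (FF : Filter F) (f g : T -> R) (a b : R) :
 f x @[x --> F] --> a -> g x @[x --> F] --> b -> ((f x +i* g x)%C : C R) @[x --> F] --> ((a +i* b)%C : C R).
move=> fa gb;apply/cvgrPdist_le=> e /complex_gt0E [-> e0].
have e2 : 0 < Re e / 2 by lra.
move/cvgrPdist_le : fa=> /(_ _ e2) fa;move/cvgrPdist_le : gb=> /(_ _ e2) gb.
apply: filterS2 fa gb=> x fx gx.
have -> : (a +i* b)%C - (f x +i* g x)%C = ((a - f x) +i* (b - g x))%C by [].
by rewrite (le_trans (complex_norm_le _ _)) // lecR [leRHS]splitr lerD.
Qed.

Lemma Re_continuous : continuous (@complex.Re R : C R -> R).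
move=> z;have FF := @nbhs_filter (C R) z;apply/cvgrPdist_le=> e e0.
have := @cvg_id _ (nbhs z)=> /cvgrPdist_le /(_ e%:C%C);rewrite ltcR=> /(_ e0).
apply: filterS=> w;clear FF;case: z w=> [a b] [c d] /=.
have -> : (a +i* b)%C - (c +i* d)%C = ((a - c) +i* (b - d))%C by [].
rewrite complex_normE lecR;apply: le_trans.
by rewrite -sqrtr_sqr ler_sqrt ?addr_ge0 ?sqr_ge0 // lerDl sqr_ge0.
Qed.

Lemma Im_continuous : continuous (@complex.Im R : C R -> R).
move=> z;have FF := @nbhs_filter (C R) z;apply/cvgrPdist_le=> e e0.
have := @cvg_id _ (nbhs z)=> /cvgrPdist_le /(_ e%:C%C);rewrite ltcR=> /(_ e0).
apply: filterS=> w;clear FF;case: z w=> [a b] [c d] /=.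
have -> : (a +i* b)%C - (c +i* d)%C = ((a - c) +i* (b - d))%C by [].
rewrite complex_normE lecR;apply: le_trans.
by rewrite -sqrtr_sqr ler_sqrt ?addr_ge0 ?sqr_ge0 // lerDr sqr_ge0.
Qed.

End ComplexConvergence.

Section UltraLimits.
Variables (R : realType) (U : set_system nat).
Hypotheses (UU : UltraFilter U) (Uoo : forall n, U [set m | (n <= m)%N]).

Lemma ultra_lim (u : nat -> R) M : (forall n, `|u n| <= M) -> exists l : R, u n @[n --> U] --> l.
move=> H;apply: (ultra_fmap_cvg (K := `[- M, M]%classic))=> //.
 exact: segment_compact.
by move=> n;rewrite /= in_itv /= -ler_norml.
Qed.

Lemma cvg_along (u : nat -> R) (l : R) : u n @[n --> \oo] --> l -> u n @[n --> U] --> l.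
move=> H A Al;have [N _ HN] := H _ Al.
have : U (u @^-1` A) by apply: filterS (Uoo N)=> n;exact: HN.
by [].
Qed.

Lemma ultra_ge (u : nat -> R) (l c : R) : u n @[n --> U] --> l -> (forall n, c <= u n) -> c <= l.
by move=> cu H;apply: (cvgr_to_ge cu);apply: nearW. Qed.

Lemma ultra_le (u : nat -> R) (l c : R) : u n @[n --> U] --> l -> (forall n, u n <= c) -> l <= c.
by move=> cu H;apply: (cvgr_to_le cu);apply: nearW. Qed.

Lemma ultra_eq (u : nat -> R) (l l' : R) : u n @[n --> U] --> l -> u n @[n --> U] --> l' -> l = l'.
by move=> h1 h2;exact: (cvg_unique _ h1 h2). Qed.

Lemma ultra_sum T (s : seq T) (u : nat -> T -> R) (l : T -> R) : (forall i, u n i @[n --> U] --> l i) ->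
 \sum_(i <- s) u n i @[n --> U] --> \sum_(i <- s) l i.
move=> H;elim: s=> [|i s IH].
 by under eq_fun do rewrite big_nil;rewrite big_nil;exact: cvg_cst.
under eq_fun do rewrite big_cons;rewrite big_cons.
by apply: cvgD=> //;exact: H.
Qed.

(** A maximiser over [K] of the strictly convex functional J(F) = sum_i 2^-i F(x_i)^2; it exists
    because [K] is closed under limits along the ultrafilter and the tails of J are uniformly small.
    For F = t A + (1 - t) B, the identity J(F) = t J(A) + (1 - t) J(B) - t (1 - t) J(A - B) forces
    J(A - B) = 0. *)
Lemma extreme_exists (X : Type) (K : set (X -> R)) (x_ : nat -> X) :
 K !=set0 -> (forall F, K F -> forall x, `|F x| <= 1) -> (forall (F : nat -> X -> R) G, (forall n, K (F n)) ->
   (forall x, F n x @[n --> U] --> G x) -> K G) -> exists2 F, K F & forall A B t, K A -> K B -> 0 < t < 1 ->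
  (forall x, F x = t * A x + (1 - t) * B x) -> forall i, A (x_ i) = B (x_ i).
move=> [F0 KF0] K1 Kclosed.
pose w i : R := 2^-1 ^+ i.
have w0 i : 0 < w i by rewrite exprn_gt0.
pose J N (F : X -> R) := \sum_(i < N) w i * F (x_ i) ^+ 2.
have sq F i : K F -> 0 <= F (x_ i) ^+ 2 <= 1.
 move=> KF;rewrite sqr_ge0 /= -(real_normK (num_real _)). by rewrite expr_le1 // K1.
have J_mono F N M : (N <= M)%N -> J N F <= J M F.
 move=> NM;rewrite /J -!(big_mkord xpredT (fun i => w i * F (x_ i) ^+ 2)).
 rewrite [leRHS](@big_cat_nat _ _ _ N) //= lerDl sumr_ge0 // => i _. by rewrite mulr_ge0 ?sqr_ge0 ?(ltW (w0 i)).
have J_tail F N M : K F -> J M F <= J N F + 2 * w N.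
 move=> KF;have [MN|/ltnW NM] := leqP M N.
  by rewrite (le_trans (J_mono F _ _ MN)) // lerDl mulr_ge0 ?(ltW (w0 N)).
 have -> : M = (N + (M - N))%N by rewrite subnKC.
 move: (M - N)%N=> m;suff : J (N + m)%N F <= J N F + 2 * w N - 2 * w (N + m)%N.
  by have := w0 (N + m)%N;lra.
 elim: m=> [|m IH];first by rewrite addn0 addrK.
 rewrite addnS (_ : J (N + m).+1 F = J (N + m)%N F + w (N + m)%N * F (x_ (N + m)%N) ^+ 2);last first.
  by rewrite /J big_ord_recr.
 have : w (N + m)%N * F (x_ (N + m)%N) ^+ 2 <= w (N + m)%N.
  by rewrite ger_pMr ?w0 //;have /andP[] := sq F (N + m)%N KF.
 have : w (N + m).+1 = w (N + m)%N / 2 by rewrite /w exprSr. by move: IH;lra.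
pose E := [set J p.1 p.2 | p in [set p : nat * (X -> R) | K p.2]].
have E_ub : has_ubound E.
 exists 2=> _ [[N F] /= KF <-];have := J_tail F 0%N N KF. by rewrite /J big_ord0 add0r /w expr0 mulr1.
have E0 : E !=set0 by exists (J 0%N F0), (0%N, F0).
pose S := sup E.
have JS F N : K F -> J N F <= S.
 by move=> KF;apply: ub_le_sup=> //;exists (N, F).
have /choice [p Hp] : forall n, exists p : nat * (X -> R), K p.2 /\ S - n.+1%:R^-1 <= J p.1 p.2.
 move=> n;have [] := @sup_adherent _ E n.+1%:R^-1 _ (conj E0 E_ub).
  by rewrite invr_gt0 ltr0n.
 by move=> _ [q Kq <-] H;exists q;split=> //;exact: ltW.
have /choice [F HF] : forall x, exists l : R, (p n).2 x @[n --> U] --> l.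
 by move=> x;apply: (@ultra_lim _ 1)=> n;exact: (K1 _ (Hp n).1).
have KF : K F by apply: (Kclosed (fun n => (p n).2))=> // n;exact: (Hp n).1.
have FS N : S <= J N F + 2 * w N.
 have c1 : J N (p n).2 + 2 * w N + n.+1%:R^-1 @[n --> U] --> J N F + 2 * w N + 0.
  apply: cvgD;last by apply: cvg_along;exact: cvg_harmonic. apply: cvgD;last exact: cvg_cst.
  apply: ultra_sum=> i;apply: cvgMr;under eq_fun do rewrite expr2. by rewrite expr2;apply: cvgM;exact: HF.
 rewrite addr0 in c1;apply: (ultra_ge c1)=> n. have [Kp H] := Hp n;have := J_tail _ N (p n).1 Kp.
 by move=> h;rewrite -lerBlDr;exact: (le_trans H).
exists F=> // A B t KA KB /andP[t0 t1] FAB i.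
have d0 : t * (1 - t) * (w i * (A (x_ i) - B (x_ i)) ^+ 2) <= 0.
 rewrite -[leRHS]addr0;apply/ler_addgt0Pr=> e e0. have [N [iN Ne]] : exists N, (i < N)%N /\ 2 * w N <= e.
  have /cvgrPdist_le/(_ (e / 2)) : w n @[n --> \oo] --> (0 : R).
   by apply: cvg_expr;rewrite gtr0_norm ?invr_gt0 // invf_lt1 // ltr1n.
  case;first by rewrite divr_gt0. move=> N _ HN;exists (maxn N i.+1);split;first by rewrite leq_max leqnn orbT.
  have := HN (maxn N i.+1);rewrite /= leq_maxl=> /(_ isT). by rewrite sub0r normrN gtr0_norm //;lra.
 have EJ : J N F = t * J N A + (1 - t) * J N B - t * (1 - t) * \sum_(j < N) w j * (A (x_ j) - B (x_ j)) ^+ 2.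
  rewrite /J !mulr_sumr -big_split /= -sumrB;eqsum j. by rewrite FAB;ring.
 have le1 : w i * (A (x_ i) - B (x_ i)) ^+ 2 <= \sum_(j < N) w j * (A (x_ j) - B (x_ j)) ^+ 2.
  rewrite (bigD1 (Ordinal iN)) //= lerDl sumr_ge0 // => j _. by rewrite mulr_ge0 ?sqr_ge0 ?(ltW (w0 j)).
 have tt0 : 0 < t * (1 - t) by rewrite mulr_gt0 ?subr_gt0.
 have := ler_wpM2l (ltW tt0) le1;have := FS N;have := JS _ N KA;have := JS _ N KB. rewrite EJ=> h1 h2 h3 h4.
 have t1' : 0 < 1 - t by rewrite subr_gt0. have := ler_wpM2l (ltW t1') h1;have := ler_wpM2l (ltW t0) h2.
 by rewrite add0r;move: h3 h4 Ne;lra.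
have tt0 : 0 < t * (1 - t) * w i by rewrite !mulr_gt0 ?subr_gt0.
move: d0;rewrite mulrA pmulr_rle0 // => d1.
have : (A (x_ i) - B (x_ i)) ^+ 2 == 0 by rewrite eq_le d1 sqr_ge0.
by rewrite sqrf_eq0 subr_eq0=> /eqP.
Qed.

End UltraLimits.

(** * Correlations and positive definite functions *)

Section InvariantIntegral.
Variables (R : realType) (X : topologicalZmodType) (I : (X -> R) -> R).
Implicit Types (f g h k F : X -> R).
Hypothesis Iadd : forall f g, bcs f -> bcs g -> I (fun x => f x + g x) = I f + I g.
Hypothesis Iscale : forall c f, bcs f -> I (fun x => c * f x) = c * I f.
Hypothesis Ipos : forall f, bcs f -> (forall x, 0 <= f x) -> 0 <= I f.
Hypothesis Ishift : forall f a, bcs f -> I (fun x => f (x + a)) = I f.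
Hypothesis Iopp : forall f, bcs f -> I (fun x => f (- x)) = I f.

Lemma bcs0 : bcs (fun _ : X => 0 : R).
exists set0;first exact: compact0.
by exists 0=> x;rewrite normr0 eqxx.
Qed.

Lemma bcs_opp_val f : bcs f -> bcs (fun x => - f x).
by move=> /bcs_dom;apply=> x;rewrite normrN. Qed.

Lemma bcs_sub f g : bcs f -> bcs g -> bcs (fun x => f x - g x).
by move=> Bf Bg;apply: bcs_add=> //;exact: bcs_opp_val. Qed.

Lemma bcs_mulr f F : bcs f -> (exists M : R, forall x, `|F x| <= M) -> bcs (fun x => f x * F x).
by move=> Bf BF;under eq_fun do rewrite mulrC;exact: bcs_mull. Qed.

Lemma I0 : I (fun=> 0) = 0.
rewrite -[RHS](mul0r (I (fun=> 0))) -Iscale;last exact: bcs0.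
congr I.
by ext x;rewrite mul0r.
Qed.

Lemma Iopp_val f : bcs f -> I (fun x => - f x) = - I f.
move=> Bf;rewrite -mulN1r -Iscale //;congr I.
by ext x;rewrite mulN1r.
Qed.

Lemma Isub f g : bcs f -> bcs g -> I (fun x => f x - g x) = I f - I g.
by move=> Bf Bg;rewrite Iadd ?Iopp_val //;exact: bcs_opp_val. Qed.

Lemma Imono f g : bcs f -> bcs g -> (forall x, f x <= g x) -> I f <= I g.
move=> Bf Bg fg;rewrite -subr_ge0 -Isub //;apply: Ipos;first exact: bcs_sub.
by move=> x;rewrite subr_ge0.
Qed.

Lemma Inorm f : bcs f -> `|I f| <= I (fun x => `|f x|).
move=> Bf;have Bn := bcs_norm Bf;rewrite ler_norml;apply/andP;split.
 rewrite -Iopp_val //;apply: Imono=> //;first exact: bcs_opp_val. by move=> x;rewrite lerNl -normrN ler_norm.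
by apply: Imono=> // x;exact: ler_norm.
Qed.

Definition l1 f := I (fun x => `|f x|).

Lemma l1_ge0 f : bcs f -> 0 <= l1 f.
by move=> Bf;apply: Ipos=> //;exact: bcs_norm. Qed.

Lemma Imul_le f F M : bcs f -> (forall x, f x != 0 -> `|F x| <= M) -> `|I (fun x => f x * F x)| <= M * l1 f.
move=> Bf HF;have fF x : `|f x * F x| <= M * `|f x|.
 have [->|fx] := eqVneq (f x) 0;first by rewrite !(mul0r, normr0, mulr0). by rewrite normrM mulrC ler_wpM2r // HF.
have B1 : bcs (fun x => M * `|f x|) by apply/bcs_scale/bcs_norm.
have B2 : bcs (fun x => f x * F x).
 by apply: (bcs_dom B1)=> x;rewrite (le_trans (fF x)) ?ler_norm.
rewrite (le_trans (Inorm B2)) // -Iscale;last exact: bcs_norm.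
by apply: Imono=> //;exact: bcs_norm.
Qed.

Lemma Isum T (s : seq T) (f : T -> X -> R) : (forall i, bcs (f i)) -> bcs (fun x => \sum_(i <- s) f i x) /\
 I (fun x => \sum_(i <- s) f i x) = \sum_(i <- s) I (f i).
move=> Bf;elim: s=> [|i s [IH1 IH2]].
 under eq_fun do rewrite big_nil;rewrite big_nil I0;split=> //;exact: bcs0.
under eq_fun do rewrite big_cons;rewrite big_cons;split;first exact: bcs_add.
by rewrite Iadd // IH2.
Qed.

Definition varies_le (U : set X) (e : R) F := forall x u, U u -> `|F (x + u) - F x| <= e.

(** The support of [h] is cut along a finite cover by translates of [U], one piece at a time. The
    sample points and weights depend on [h] and [U] only, so the error bound is uniform in [F]. *)
Lemma riemann h (U : set X) : bcs h -> nbhs 0 U -> exists s : seq (X * R), \sum_(p <- s) `|p.2| <= l1 h /\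
 forall F e, (exists M : R, forall x, `|F x| <= M) -> varies_le U e F ->
 `|I (fun x => h x * F x) - \sum_(p <- s) p.2 * F p.1| <= e * l1 h.
move=> Bh U0;have [K cK [M HM]] := Bh.
have [t Ht] := compact_cover_shifts cK U0.
have {K cK M HM Ht} Ht x : h x != 0 -> exists2 z, z \in t & U (x - z).
 by move=> /(HM x).2;exact: Ht.
elim: t h Bh Ht=> [|z t IH] h Bh Ht.
 have h0 x : h x = 0 by apply/eqP/negPn/negP=> /Ht []. exists [::];split;first by rewrite big_nil l1_ge0.
 move=> F e [M FM] _;rewrite big_nil subr0. rewrite (_ : (fun x => h x * F x) = fun=> 0);last first.
  by ext x;rewrite h0 mul0r.
 rewrite (_ : l1 h = 0) ?I0 ?normr0 ?mulr0 // /l1.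
 by rewrite (_ : (fun x => `|h x|) = fun=> 0) ?I0 //;ext x;rewrite h0 normr0.
pose h1 x := if `[< U (x - z) >] then h x else 0.
pose h2 x := if `[< U (x - z) >] then 0 else h x.
have B1 : bcs h1.
 by apply: (bcs_dom Bh)=> x;rewrite /h1;case: ifP;rewrite ?normr0.
have B2 : bcs h2.
 by apply: (bcs_dom Bh)=> x;rewrite /h2;case: ifP;rewrite ?normr0.
have l1E : l1 h = l1 h1 + l1 h2.
 rewrite /l1 -Iadd;try exact: bcs_norm. by congr I;ext x;rewrite /h1 /h2;case: ifP;rewrite normr0 ?addr0 ?add0r.
have [|s [s1 s2]] := IH h2 B2.
 move=> x;rewrite /h2;case: ifP=> [|/asboolPn nU /Ht [y]];first by lra.
 by rewrite inE=> /orP[/eqP ->//|yt Uy];exists y.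
exists ((z, I h1) :: s);split.
 by rewrite big_cons l1E lerD //;exact: Inorm.
move=> F e BF vF;rewrite big_cons /=.
have -> : I (fun x => h x * F x) = I (fun x => h1 x * F x) + I (fun x => h2 x * F x).
 rewrite -Iadd;try exact: bcs_mulr. congr I;ext x;rewrite /h1 /h2. by case: ifP;rewrite !(mul0r, addr0, add0r).
rewrite opprD addrACA l1E mulrDr (le_trans (ler_normD _ _)) // lerD //;last exact: s2.
rewrite mulrC -Iscale // -Isub;last exact: bcs_scale.
 have -> : (fun x => h1 x * F x - F z * h1 x) = (fun x => h1 x * (F x - F z)).
  by ext x;rewrite mulrBr [F z * _]mulrC.
 apply: Imul_le=> // x;rewrite /h1;case: ifP=> [/asboolP Uxz _|];last by lra.
 by have := vF z _ Uxz;rewrite [z + _]addrC subrK.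
exact: bcs_mulr.
Qed.

Definition uc f := forall e, 0 < e -> exists2 U, nbhs 0 U & varies_le U e f.

Lemma uc_add f g : uc f -> uc g -> uc (fun x => f x + g x).
move=> uf ug e e0;have e2 : 0 < e / 2 by lra.
have [U U0 HU] := uf _ e2;have [V V0 HV] := ug _ e2.
exists (U `&` V);first exact: filterI.
move=> x u [Uu Vu];rewrite opprD addrACA (le_trans (ler_normD _ _)) //.
by rewrite [leRHS]splitr lerD ?HU ?HV.
Qed.

Lemma uc_scale c f : uc f -> uc (fun x => c * f x).
move=> uf e e0;have c0 : 0 < `|c| + 1 by [].
have [U U0 HU] := uf (e / (`|c| + 1)) (divr_gt0 e0 c0);exists U=> // x u Uu.
rewrite -mulrBr normrM (le_trans (ler_wpM2l _ (HU x u Uu))) //.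
by rewrite mulrCA ger_pMr // ler_pdivrMr // mul1r lerDl.
Qed.

Lemma uc_shift f a : uc f -> uc (fun x => f (x + a)).
move=> uf e e0;have [U U0 HU] := uf _ e0;exists U=> // x u Uu.
by rewrite addrAC;exact: HU.
Qed.

(** The convolution of f with the reflection of g. *)
Definition corr f g (y : X) := I (fun x => f (x + y) * g x).

Definition bounded f := exists M : R, forall x, `|f x| <= M.

Lemma bcs_bounded f : bcs f -> bounded f.
by move=> [K _ [M H]];exists M=> x;have [] := H x. Qed.

Lemma bounded_shift f a : bounded f -> bounded (fun x => f (x + a)).
by move=> [M H];exists M=> x. Qed.

Lemma bcs_corr_arg f g y : bounded f -> bcs g -> bcs (fun x => f (x + y) * g x).
by move=> Bf Bg;apply: bcs_mull=> //;exact: bounded_shift. Qed.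

Lemma corrE f g y : corr f g y = I (fun x => g x * f (x + y)).
by congr I;ext x;rewrite mulrC. Qed.

Lemma corr_le f g M y : bcs g -> (forall x, `|f x| <= M) -> `|corr f g y| <= M * l1 g.
by move=> Bg fM;rewrite corrE Imul_le. Qed.

Lemma corr_bounded f g : bounded f -> bcs g -> bounded (corr f g).
by move=> [M H] Bg;exists (M * l1 g)=> y;exact: corr_le. Qed.

Lemma corr_varies U e f g : bounded f -> bcs g -> varies_le U e f -> varies_le U (e * l1 g) (corr f g).
move=> Bf Bg vf y u Uu;rewrite -Isub;try exact: bcs_corr_arg.
have -> : (fun x => f (x + (y + u)) * g x - f (x + y) * g x) = (fun x => g x * (f (x + y + u) - f (x + y))).
 by ext x;rewrite -mulrBl mulrC addrA.
by apply: Imul_le=> // x _;exact: vf.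
Qed.

Lemma corr_uc f g : bounded f -> bcs g -> uc f -> uc (corr f g).
move=> Bf Bg uf e e0;have c0 : 0 < l1 g + 1 by rewrite ltr_wpDl // l1_ge0.
have [U U0 HU] := uf (e / (l1 g + 1)) (divr_gt0 e0 c0);exists U=> // x u Uu.
rewrite (le_trans (corr_varies Bf Bg HU x Uu)) //.
by rewrite mulrAC ler_pdivrMr // ler_pM2l // lerDl.
Qed.

Lemma corr_bcs f g : bcs f -> bcs g -> bcs (corr f g).
move=> Bf Bg;have [K cK [M HM]] := Bf;have [K' cK' [M' HM']] := Bg.
exists [set x + y | x in K & y in [set x | K' (- x)]].
 by apply: compact_add=> //;exact: compact_opp.
exists (M * l1 g)=> y;split;first by apply: corr_le=> // x;have [] := HM x.
move=> ne;apply: contrapT=> nK;move/eqP: ne;apply.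
rewrite /corr (_ : (fun => _) = fun=> 0) ?I0 //;ext x.
have [->|gx] := eqVneq (g x) 0;first by lra.
have [->|fx] := eqVneq (f (x + y)) 0;first by lra.
exfalso;apply: nK;exists (x + y);first exact: (HM (x + y)).2.
exists (- x);first by rewrite /= opprK;exact: (HM' x).2.
by rewrite addrAC subrr add0r.
Qed.

Lemma corr_shift f g a y : corr f g (y + a) = corr (fun x => f (x + a)) g y.
by congr I;ext x;rewrite addrA. Qed.

Lemma corr_add f1 f2 g y : bounded f1 -> bounded f2 -> bcs g ->
 corr (fun x => f1 x + f2 x) g y = corr f1 g y + corr f2 g y.
move=> B1 B2 Bg;rewrite /corr -Iadd;try exact: bcs_corr_arg.
by congr I;ext x;rewrite mulrDl.
Qed.

Lemma corr_scale c f g y : bounded f -> bcs g -> corr (fun x => c * f x) g y = c * corr f g y.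
move=> B1 Bg;rewrite /corr -Iscale;last exact: bcs_corr_arg.
by congr I;ext x;rewrite mulrA.
Qed.

Lemma corr_opp f g y : bcs f -> bcs g -> corr f g (- y) = corr g f y.
move=> Bf Bg;rewrite /corr -(Ishift y);last by apply: bcs_corr_arg=> //;exact: bcs_bounded.
by congr I;ext x;rewrite addrK mulrC.
Qed.

(** As [I] is a functional rather than a measure, one of the integrals is replaced by a Riemann sum;
    uniform continuity of [f] makes the error uniform in the other variable. *)
Lemma fubini f g h : bounded f -> uc f -> bcs g -> bcs h ->
 I (fun x => corr f h x * g x) = I (fun x => corr f g x * h x).
move=> Bf uf Bg Bh;apply/eqP;rewrite -subr_eq0 -normr_le0.
apply/ler_addgt0Pl=> e e0;rewrite addr0.
set c := l1 g * l1 h;have c0 : 0 <= c by rewrite mulr_ge0 ?l1_ge0.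
have c1 : 0 < 2 * c + 1 by lra.
have [U U0 HU] := uf (e / (2 * c + 1)) (divr_gt0 e0 c1).
set e' := e / _ in HU.
have [s [_ Hs]] := riemann Bh U0.
have BS : forall p : X * R, bcs (fun x => p.2 * (f (x + p.1) * g x)).
 by move=> p;apply/bcs_scale/bcs_corr_arg.
have [B2 E2] := Isum s BS.
have h1 : `|I (fun x => corr f h x * g x) - \sum_(p <- s) p.2 * corr f g p.1| <= e' * c.
 have -> : \sum_(p <- s) p.2 * corr f g p.1 = I (fun x => \sum_(p <- s) p.2 * (f (x + p.1) * g x)).
  by rewrite E2;eqsum p;rewrite Iscale //;exact: bcs_corr_arg.
 rewrite -Isub //;last by apply: bcs_mull=> //;exact: corr_bounded.
 have -> : (fun x => corr f h x * g x - \sum_(p <- s) p.2 * (f (x + p.1) * g x)) =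
   (fun x => g x * (corr f h x - \sum_(p <- s) p.2 * f (x + p.1))).
  ext x;rewrite mulrBr mulrC;congr (_ - _). by rewrite mulr_sumr;eqsum p;ring.
 rewrite /c [l1 g * _]mulrC mulrA;apply: Imul_le=> // x _. rewrite corrE. under eq_bigr do rewrite [x + _]addrC.
 have := Hs (fun y => f (y + x)) e' (bounded_shift x Bf);apply=> y u Uu. by rewrite addrAC;exact: HU.
have h2 : `|I (fun x => corr f g x * h x) - \sum_(p <- s) p.2 * corr f g p.1| <= e' * c.
 rewrite mulrA. have -> : (fun x => corr f g x * h x) = (fun x => h x * corr f g x).
  by ext x;rewrite mulrC.
 by apply: Hs;[exact: corr_bounded|exact: corr_varies].
rewrite (le_trans (ler_distD (\sum_(p <- s) p.2 * corr f g p.1) _ _)) //.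
rewrite distrC in h2;rewrite (le_trans (lerD h1 h2)) //.
by rewrite -mulr2n -mulr_natl mulrCA /e' mulrAC ler_pdivrMr // ler_pM2l // lerDl.
Qed.

Lemma corrAC f g h y : bounded f -> uc f -> bcs g -> bcs h -> corr (corr f g) h y = corr (corr f h) g y.
move=> Bf uf Bg Bh;rewrite /corr.
have E g' x : I (fun x0 => f (x0 + (x + y)) * g' x0) = corr (fun x => f (x + y)) g' x.
 by congr I;ext z;rewrite addrA.
under eq_fun do rewrite E;under [in RHS]eq_fun do rewrite E.
by apply/fubini=> //;[exact: bounded_shift|exact: uc_shift].
Qed.

Definition ip f g := I (fun x => f x * g x).

Lemma ipC f g : ip f g = ip g f.
by congr I;ext x;rewrite mulrC. Qed.

Lemma ip_shift f g a : bcs f -> bcs g -> ip (fun x => f (x + a)) (fun x => g (x + a)) = ip f g.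
by move=> Bf Bg;apply: (Ishift a (f := fun x => f x * g x));exact: bcs_mul. Qed.

Lemma ip_ge0 f : bcs f -> 0 <= ip f f.
by move=> Bf;apply: Ipos;[exact: bcs_mul|move=> x;rewrite -expr2 sqr_ge0].
Qed.

Lemma ip_lin a b f g h : bcs f -> bcs g -> bcs h -> ip (fun x => a * f x + b * g x) h = a * ip f h + b * ip g h.
move=> Bf Bg Bh;rewrite /ip -!Iscale;try exact: bcs_mul.
rewrite -Iadd;try by apply: bcs_scale;exact: bcs_mul.
by congr I;ext x;ring.
Qed.

Lemma ip_sqr a b f g : bcs f -> bcs g -> ip (fun x => a * f x + b * g x) (fun x => a * f x + b * g x) =
 a ^+ 2 * ip f f + 2 * a * b * ip f g + b ^+ 2 * ip g g.
move=> Bf Bg;have Bc : bcs (fun x => a * f x + b * g x).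
 by apply: bcs_add;exact: bcs_scale.
rewrite ip_lin // ![ip _ (fun => _ + _)]ipC !ip_lin // [ip g f]ipC;ring.
Qed.

Lemma cauchy_schwarz f g : bcs f -> bcs g -> ip f g ^+ 2 <= ip f f * ip g g.
move=> Bf Bg;apply: discriminant_le=> s t;rewrite -ip_sqr //.
by apply: ip_ge0;apply: bcs_add;exact: bcs_scale.
Qed.

Lemma corr_sqr_le f g y : bcs f -> bcs g -> corr f g y ^+ 2 <= ip f f * ip g g.
move=> Bf Bg;rewrite -(ip_shift y Bf Bf);apply: cauchy_schwarz=> //.
exact: bcs_shift.
Qed.

Definition pos_def (F : X -> R) := forall s : seq (X * R),
 0 <= \sum_(p <- s) \sum_(q <- s) p.2 * q.2 * F (p.1 - q.1).

Lemma corr_pos_def f : bcs f -> pos_def (corr f f).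
move=> Bf s.
pose F x := \sum_(p <- s) p.2 * f (x + p.1).
have BF : bcs F by apply: (Isum s _).1=> p;apply/bcs_scale/bcs_shift.
suff -> : \sum_(p <- s) \sum_(q <- s) p.2 * q.2 * corr f f (p.1 - q.1) = ip F F.
 exact: ip_ge0.
rewrite /ip /F;under [in RHS]eq_fun do rewrite mulr_suml.
have B1 p q : bcs (fun x => p.2 * q.2 * (f (x + p.1) * f (x + q.1))).
 by apply/bcs_scale/bcs_mul;exact: bcs_shift.
have -> : (fun x => \sum_(i <- s) i.2 * f (x + i.1) * (\sum_(p <- s) p.2 * f (x + p.1))) =
  (fun x => \sum_(p <- s) \sum_(q <- s) p.2 * q.2 * (f (x + p.1) * f (x + q.1))).
 ext x;eqsum p;rewrite mulr_sumr;eqsum q. by ring.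
rewrite (Isum s _).2;last by move=> p;exact: (Isum s _).1.
eqsum p;rewrite (Isum s _).2 //;eqsum q.
rewrite Iscale;last by apply: bcs_mul;exact: bcs_shift.
congr (_ _);rewrite /corr -(Ishift q.1);last first.
 by apply: bcs_corr_arg=> //;exact: bcs_bounded.
by congr I;ext x;rewrite addrACA subrr addr0.
Qed.

(** If f had norm 0, so would all its translates. Finitely many of their squares dominate the given
    [g] up to a constant, because |f| >= |f 0| / 2 near 0. *)
Lemma ip_gt0 f : bcs f -> uc f -> f 0 != 0 -> (exists g, [/\ bcs g, (forall x, 0 <= g x) & 0 < I g]) -> 0 < ip f f.
move=> Bf uf f0 [g [Bg g0 Ig]];rewrite lt_neqAle ip_ge0 // andbT.
apply: contraTN isT=> /eqP ff0.
have c0 : 0 < `|f 0| / 2 by rewrite divr_gt0 ?normr_gt0.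
have [U U0 HU] := uf _ c0.
have [K cK [M HM]] := Bg.
have [s Hs] := compact_cover_shifts cK U0.
have M0 : 0 <= M by rewrite (le_trans _ (HM 0).1).
have B1 z : bcs (fun x => (f (x - z) * f (x - z))).
 by apply: bcs_mul;exact: bcs_shift.
have B2 : bcs (fun x => \sum_(z <- s) (f (x - z) * f (x - z))) by exact: (Isum s _).1.
have : I g <= I (fun x => M / (`|f 0| / 2) ^+ 2 * \sum_(z <- s) (f (x - z) * f (x - z))).
 apply: Imono=> // [|x];first exact: bcs_scale. have S0 : 0 <= \sum_(z <- s) f (x - z) * f (x - z).
  by apply: sumr_ge0=> z _;rewrite -expr2 sqr_ge0.
 have [->|gx] := eqVneq (g x) 0.
  by rewrite mulr_ge0 // divr_ge0 // sqr_ge0.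
 rewrite mulrAC ler_pdivlMr ?exprn_gt0 // ler_pM ?sqr_ge0 //.
  by rewrite (le_trans (ler_norm _)) //;exact: (HM x).1.
 have [z zs Uxz] := Hs x ((HM x).2 gx). have := HU 0 _ Uxz;rewrite add0r=> H. have h : `|f 0| / 2 <= `|f (x - z)|.
  have := ler_distD (f (x - z)) (f 0) 0;rewrite !subr0 distrC=> h. by have := le_trans h (lerD H (lexx _));lra.
 rewrite (big_rem z) //= (le_trans (y := f (x - z) * f (x - z))) //.
  by rewrite -expr2 -(real_normK (num_real (f (x - z)))) ler_sqr // nnegrE // divr_ge0.
 by rewrite lerDl sumr_ge0 // => y _;rewrite -expr2 sqr_ge0.
rewrite Iscale // (Isum s _).2 // big1=> [|z _];first by lra.
by rewrite (Ishift (- z) (f := fun x => f x * f x)) //;exact: bcs_mul.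
Qed.

(** * Power iteration for a self-adjoint convolution operator *)

Section CharacteristicEigenfunctions.
Variable h : X -> R.
Hypotheses (Bh : bcs h) (uh : uc h) (h_even : forall x, h (- x) = h x).

Let T F := corr F h.

Lemma conv_sym f g : bcs f -> uc f -> bcs g -> uc g -> ip (T f) g = ip f (T g).
move=> Bf uf Bg ug;have bf := bcs_bounded Bf;have bg := bcs_bounded Bg.
rewrite [RHS]ipC /ip /T fubini // [RHS]fubini //.
rewrite -[RHS]Iopp;last first.
 by apply: bcs_mull=> //;exact: corr_bounded.
by congr I;ext y;rewrite h_even corr_opp.
Qed.

Variable k : X -> R.
Hypotheses (Bk : bcs k) (uk : uc k).
Let v n := iter n T k.
Let b n := ip (v n) (v n).

Lemma orbit_bcs n : bcs (v n) /\ uc (v n).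
elim: n=> [//|n [IH1 IH2]];rewrite /v iterS.
by split;[exact: corr_bcs|apply: corr_uc => //;exact: bcs_bounded].
Qed.

Lemma orbit_ipE n : ip (v n.+2) (v n) = b n.+1.
have [B1 u1] := orbit_bcs n;have [B2 u2] := orbit_bcs n.+1.
by rewrite /b {1}/v iterS conv_sym.
Qed.

(** Self-adjointness turns the inner product of T^(n+2) k and T^n k into b (n+1); Cauchy-Schwarz
    does the rest. *)
Lemma orbit_logconvex n : b n.+1 ^+ 2 <= b n * b n.+2.
have [B1 u1] := orbit_bcs n;have [B2 u2] := orbit_bcs n.+2.
by rewrite -orbit_ipE mulrC;exact: cauchy_schwarz.
Qed.

Lemma orbit_growth n : b n.+1 <= l1 h ^+ 2 * b n.
have [B1 u1] := orbit_bcs n;have [B2 u2] := orbit_bcs n.+1.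
have b0 : 0 <= b n.+1 by exact: ip_ge0.
have bn0 : 0 <= b n by exact: ip_ge0.
have L0 : 0 <= l1 h by exact: l1_ge0.
have E : b n.+1 = I (fun y => h y * corr (v n) (v n.+1) y).
 rewrite /b {1}/v iterS -/(v n) /ip fubini //;last exact: bcs_bounded. by congr I;ext y;rewrite mulrC.
have H : b n.+1 <= Num.sqrt (b n * b n.+1) * l1 h.
 rewrite {1}E (le_trans (ler_norm _)) //;apply: Imul_le=> // y _.
 rewrite -sqrtr_sqr ler_sqrt ?mulr_ge0 //;exact: corr_sqr_le.
have [b1|b1] := ltP 0 (b n.+1);last by rewrite (le_trans b1) // mulr_ge0 // exprn_ge0.
have : b n.+1 ^+ 2 <= b n * b n.+1 * l1 h ^+ 2.
 rewrite -[X in X * l1 h ^+ 2]sqr_sqrtr ?mulr_ge0 // -exprMn. by rewrite ler_sqr // nnegrE // mulr_ge0 // sqrtr_ge0.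
by rewrite expr2 mulrAC ler_pM2r // mulrC.
Qed.

Hypothesis b0_gt0 : 0 < b 0.
Hypothesis b1_gt0 : 0 < b 1.

Lemma orbit_gt0 n : 0 < b n.
elim/ltn_ind: n=> -[//|[//|n]] IH.
have := orbit_logconvex n;have h1 := IH n.+1 (ltnSn _).
have h0 := IH n (leqnSn _).
have : 0 < b n.+1 ^+ 2 by rewrite exprn_gt0.
by move=> h2 h3;rewrite -(pmulr_rgt0 _ h0) (lt_le_trans h2).
Qed.

Let r n := b n.+1 / b n.

(** Log-convexity makes the ratios nondecreasing and [orbit_growth] bounds them. The limit is going
    to be an eigenvalue of T^2. *)
Lemma ratio_cvg : exists2 L : R, 0 < L & r n @[n --> \oo] --> L.
have r_mono : nondecreasing_seq r.
 apply/nondecreasing_seqP=> n;rewrite ler_pdivrMr ?orbit_gt0 // mulrAC.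
 by rewrite ler_pdivlMr ?orbit_gt0 // -expr2 [leRHS]mulrC orbit_logconvex.
have r_bd : has_ubound (range r).
 exists (l1 h ^+ 2)=> _ [n _ <-];rewrite ler_pdivrMr ?orbit_gt0 //. exact: orbit_growth.
have cr := nondecreasing_cvgn r_mono r_bd.
exists (sup (range r))=> //.
have r0 : 0 < r 0 by rewrite divr_gt0.
by rewrite (lt_le_trans r0) // ub_le_sup //;exists 0%N.
Qed.

(** Normalised autocorrelations instead of the iterates themselves: they are positive definite with
    value 1 at 0, and both properties survive pointwise limits. *)
Let Phi n x := (b n)^-1 * corr (v n) (v n) x.

(** By Cauchy-Schwarz the defect at any point is at most the norm of T^2 v - L v relative to that of
    v = T^n k. When the ratios tend to [L], the right-hand side tends to L^2 - 2 L^2 + L^2 = 0. *)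
Lemma orbit_eigen (L : R) n x : (T (T (Phi n)) x - L * Phi n x) ^+ 2 <= r n.+1 * r n - 2 * L * r n + L ^+ 2.
have [B1 u1] := orbit_bcs n;have [B2 u2] := orbit_bcs n.+1;have [B3 u3] := orbit_bcs n.+2.
have bd := bcs_bounded B1;have bd2 := bcs_bounded B2.
have Bc := corr_bounded bd B1.
have -> : T (T (Phi n)) x - L * Phi n x = (b n)^-1 * corr (fun y => 1 * v n.+2 y + (- L) * v n y) (v n) x.
 have E1 : T (Phi n) = fun x => (b n)^-1 * corr (v n.+1) (v n) x.
  ext y;rewrite /T corr_scale //;congr (_ _). by rewrite corrAC.
 rewrite E1 /T corr_scale //;last exact: corr_bounded. rewrite corrAC // corr_add ?corr_scale //;last 2 first.
 - by apply: bcs_bounded;exact: bcs_scale.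
 - by apply: bcs_bounded;exact: bcs_scale.
 - by rewrite /Phi /v /T /=;ring.
 - exact: bcs_bounded.
have b0 := orbit_gt0 n;have b1 := orbit_gt0 n.+1.
rewrite exprMn exprVn.
have Bs : bcs (fun y => 1 * v n.+2 y + (- L) * v n y) by apply: bcs_add;exact: bcs_scale.
have := corr_sqr_le x Bs B1.
rewrite ip_sqr // orbit_ipE -/(b n) -/(b n.+2)=> H.
rewrite mulrC ler_pdivrMr ?exprn_gt0 // (le_trans H) //;apply: eq_ler.
by rewrite /r;field;rewrite !gt_eqF.
Qed.

Lemma orbit_corr1 n : [/\ Phi n 0 = 1, forall x, Phi n (- x) = Phi n x & pos_def (Phi n)].
have [B1 u1] := orbit_bcs n;have b0 := orbit_gt0 n;split.
- rewrite /Phi /corr;under eq_fun do rewrite addr0.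
 by rewrite -[I _]/(b n) mulVf // gt_eqF.
- by move=> x;rewrite /Phi corr_opp.
- move=> s;have := corr_pos_def B1 s.
 set S := \sum_(p <- s) _ => S0.
 rewrite (_ : \sum_(p <- s) _ = (b n)^-1 * S);first by rewrite mulr_ge0 // invr_ge0 ltW.
 rewrite mulr_sumr;eqsum p;rewrite mulr_sumr;eqsum q. by rewrite /Phi;ring.
Qed.

End CharacteristicEigenfunctions.

Lemma pos_def_le F : pos_def F -> (forall x, F (- x) = F x) -> forall x, `|F x| <= F 0.
move=> pF ev x;rewrite ler_norml.
have := pF [:: (x, 1);(0, 1)];have := pF [:: (x, 1);(0, -1)].
rewrite !big_cons !big_nil /= !subrr subr0 sub0r ev.
by move=> *;apply/andP;split;lra.
Qed.

(** * The cone of positive definite eigenfunctions, and characters *)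

Section Eigencone.
Variables (U : set_system nat) (h : X -> R) (L : R).
Hypothesis UU : UltraFilter U.
Hypotheses (Bh : bcs h) (uh : uc h) (L0 : 0 < L).
Hypothesis Xlc : exists2 C : set X, nbhs 0 C & compact C.

Let T F := corr F h.

Definition eventually_equicontinuous (F : nat -> X -> R) := forall e : R, 0 < e ->
 exists2 V, nbhs 0 V & U [set n | varies_le V e (F n)].

Lemma conv_cvg (F : nat -> X -> R) (G : X -> R) M :
 eventually_equicontinuous F -> (forall n x, `|F n x| <= M) -> uc G -> bounded G ->
 (forall x, F n x @[n --> U] --> G x) -> forall x, T (F n) x @[n --> U] --> T G x.
move=> eF FM uG bG FG x;apply/cvgrPdist_le=> e e0.
have c0 : 0 < 2 * l1 h + 1 by have := l1_ge0 Bh;lra.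
pose d := e / 2 / (2 * l1 h + 1).
have d0 : 0 < d by rewrite !divr_gt0.
have [V V0 HV] := eF _ d0;have [W W0 HW] := uG _ d0.
have [s [_ Hs]] := riemann Bh (filterI V0 W0).
have c1 : \sum_(p <- s) p.2 * F n (p.1 + x) @[n --> U] --> \sum_(p <- s) p.2 * G (p.1 + x).
 by apply: ultra_sum=> p;apply: cvgMr;exact: FG.
have e2 : 0 < e / 2 by lra.
move/cvgrPdist_le : c1=> /(_ _ e2) U1.
apply: filterS (filterI HV U1)=> n [/= vF dF].
have h1 := Hs (fun y => F n (y + x)) d.
have h2 := Hs (fun y => G (y + x)) d.
rewrite /T !corrE.
have {}h1 : `|I (fun y => h y * F n (y + x)) - \sum_(p <- s) p.2 * F n (p.1 + x)| <= d * l1 h.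
 by apply: h1;[exists M=> y|move=> y u [Vu _];rewrite addrAC;exact: vF].
have {}h2 : `|I (fun y => h y * G (y + x)) - \sum_(p <- s) p.2 * G (p.1 + x)| <= d * l1 h.
 by apply: h2;[exact: bounded_shift|move=> y u [_ Wu];rewrite addrAC;exact: HW].
rewrite distrC in h1.
have := ler_distD (\sum_(p <- s) p.2 * G (p.1 + x)) (I (fun y => h y * G (y + x))) (I (fun y => h y * F n (y + x))).
have := ler_distD (\sum_(p <- s) p.2 * F n (p.1 + x)) (\sum_(p <- s) p.2 * G (p.1 + x))
 (I (fun y => h y * F n (y + x))).
have : 2 * (d * l1 h) <= e / 2.
 rewrite mulrCA mulrAC ler_pdivrMr // ler_pM2l ?divr_gt0 //;lra.
lra.
Qed.

Lemma conv_equicontinuous (F : nat -> X -> R) (M : R) : eventually_equicontinuous F ->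
 (forall n x, `|F n x| <= M) -> eventually_equicontinuous (fun n => T (F n)).
move=> eF FM e e0;have c0 : 0 < l1 h + 1 by have := l1_ge0 Bh;lra.
have [V V0 HV] := eF (e / (l1 h + 1)) (divr_gt0 e0 c0);exists V=> //.
apply: filterS HV=> n vF x u Vu.
have Fb : bounded (F n) by exists M=> y.
rewrite (le_trans (corr_varies Fb Bh vF x Vu)) //.
by rewrite mulrAC ler_pdivrMr // ler_pM2l // lerDl.
Qed.

Lemma conv_varies F u x M : (forall x, `|F x| <= M) -> `|T F (x + u) - T F x| <= M * l1 (fun y => h (y - u) - h y).
move=> FM;have bF : bounded F by exists M.
have Bs : bcs (fun y => h (y - u)) by exact: bcs_shift.
have -> : T F (x + u) = corr F (fun y => h (y - u)) x.
 rewrite /T /corr -(Ishift u (f := fun y => F (y + x) * h (y - u))).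
  by congr I;ext y;rewrite addrK -addrA [u + x]addrC.
 by apply: bcs_corr_arg.
have -> : corr F (fun y => h (y - u)) x - T F x = corr F (fun y => h (y - u) - h y) x.
 rewrite /corr -Isub //;try exact: bcs_corr_arg. by congr I;ext y;rewrite mulrBr.
by apply: corr_le=> //;exact: bcs_sub.
Qed.

Lemma l1_shift_small (e : R) : 0 < e -> exists2 V, nbhs 0 V & forall u, V u -> l1 (fun y => h (y - u) - h y) <= e.
move=> e0;have [K cK [M HM]] := Bh;have [C C0 cC] := Xlc.
pose K' := [set x + y | x in K & y in C].
pose one x : R := if `[< K' x >] then 1 else 0.
have B1 : bcs one.
 exists K';first exact: compact_add. exists 1=> x;rewrite /one;case: ifP=> [/asboolP //|_];rewrite ?normr1 //.
 by rewrite normr0 eqxx.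
have J0 : 0 <= I one by apply: Ipos=> // x;rewrite /one;case: ifP.
have c0 : 0 < I one + 1 by lra.
have [V V0 HV] := uh (divr_gt0 e0 c0);set d := e / _ in HV.
exists ((V `&` C) `&` [set u | (V `&` C) (- u)]).
 by apply: filterI;[exact: filterI|apply: nbhs_opp;rewrite oppr0;exact: filterI].
have C00 := nbhs_singleton C0.
move=> u [[Vu Cu] [Vu' Cu']];rewrite (le_trans (y := I (fun x => d * one x))) //.
 apply: (Imono)=> //;first by apply/bcs_norm/bcs_sub=> //;exact: bcs_shift.
  exact: bcs_scale.
 move=> x;rewrite /one;case: ifP=> [_|/asboolPn nK].
  by rewrite mulr1;exact: HV.
 have -> : h x = 0.
  apply/eqP/negPn/negP=> /(HM x).2 Kx;apply: nK. by exists x=> //;exists 0=> //;rewrite addr0.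
 have -> : h (x - u) = 0.
  apply/eqP/negPn/negP=> /(HM (x - u)).2 Kx;apply: nK. by exists (x - u)=> //;exists u=> //;rewrite subrK.
 by rewrite subr0 normr0 mulr0.
rewrite Iscale // /d mulrAC ler_pdivrMr // ler_pM2l //;lra.
Qed.

Lemma ultra_norm_le (u : nat -> R) (l c : R) : u n @[n --> U] --> l ->
 (forall e, 0 < e -> U [set n | `|u n| <= c + e]) -> `|l| <= c.
move=> ul H;apply/ler_addgt0Pr=> e e0;apply: (cvgr_to_le (cvg_norm ul)).
by apply: filterS (H e e0)=> n.
Qed.

(** Convolution with [h] makes bounded families equicontinuous ([conv_varies]). The approximate
    eigenvalue equation with L > 0 hands this on to [F n], and then convolution commutes with the
    pointwise limit. *)
Lemma eigen_limit (F : nat -> X -> R) (G : X -> R) (delta : nat -> R) :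
 (forall n x, `|F n x| <= 1) -> delta n @[n --> U] --> (0 : R) ->
 (forall n x, `|T (T (F n)) x - L * F n x| <= delta n) -> (forall x, F n x @[n --> U] --> G x) ->
 uc G /\ forall x, T (T G) x = L * G x.
move=> F1 d0 HF FG.
have bF n : bounded (F n) by exists 1.
have TF n x : `|T (F n) x| <= l1 h by rewrite -[leRHS]mul1r;exact: corr_le.
have eF : eventually_equicontinuous F.
 move=> e e0;have l0 := l1_ge0 Bh. have c0 : 0 < L * e / 2 / (l1 h + 1) by rewrite !divr_gt0 ?mulr_gt0 //;lra.
 have [V V0 HV] := l1_shift_small c0;exists V=> //. move/cvgrPdist_le : d0=> /(_ (L * e / 4)) d0.
 have {}d0 := d0;apply: filterS (d0 _);last by rewrite ?mulr_gt0. move=> n;rewrite sub0r normrN=> dn x u Vu.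
 have := HF n x;have := HF n (x + u);have := conv_varies u x (TF n).
 have h1 : l1 h * l1 (fun y => h (y - u) - h y) <= L * e / 2.
  have := HV u Vu;rewrite ler_pdivlMr;last lra. have := l1_ge0 (bcs_sub (bcs_shift (- u) Bh) Bh).
  by rewrite -/(l1 _);set q := l1 _;nra.
 have dn' : delta n <= L * e / 4 by rewrite (le_trans (ler_norm _)). move: h1;set a := l1 h * _ => h1.
 rewrite !ler_norml=> /andP[p1 p2] /andP[p3 p4] /andP[p5 p6].
 rewrite -(ler_pM2l L0) -[X in _ && X](ler_pM2l L0);apply/andP;split;lra.
have uG : uc G.
 move=> e e0;have [V V0 HV] := eF e e0;exists V=> // x u Vu.
 have c1 : F n (x + u) - F n x @[n --> U] --> G (x + u) - G x.
  by apply: cvgB;exact: FG.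
 apply: (cvgr_to_le (cvg_norm c1));apply: filterS HV=> n vF;exact: vF.
have G1 x : `|G x| <= 1.
 by apply: (cvgr_to_le (cvg_norm (FG x)));apply: nearW=> n;exact: F1.
have bG : bounded G by exists 1.
split=> // x.
have c1 : T (T (F n)) x @[n --> U] --> T (T G) x.
 apply: conv_cvg=> //.
 - exact: conv_equicontinuous eF F1.
 - exact: corr_uc.
 - exact: corr_bounded.
 - by apply: conv_cvg eF F1 uG bG FG.
have c2 : T (T (F n)) x - L * F n x @[n --> U] --> T (T G) x - L * G x.
 by apply: cvgB=> //;apply: cvgMr;exact: FG.
apply/eqP;rewrite -subr_eq0 -normr_le0;apply: (ultra_norm_le c2)=> e e0.
move/cvgrPdist_le : d0=> /(_ e e0);apply: filterS=> n /=.
rewrite sub0r normrN add0r=> dn;rewrite (le_trans (HF n x)) //.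
by rewrite (le_trans (ler_norm _)).
Qed.

Definition eigencone : set (X -> R) := [set F |
 [/\ forall x, F (- x) = F x, pos_def F & forall x, T (T F) x = L * F x]].

Lemma eigencone_limit (F : nat -> X -> R) G :
 (forall n, eigencone (F n) /\ F n 0 = 1) -> (forall x, F n x @[n --> U] --> G x) -> eigencone G /\ G 0 = 1.
move=> HF FG.
have F1 n x : `|F n x| <= 1 by have [[e p _] <-] := HF n;exact: pos_def_le.
have [|n x|_ TG] := eigen_limit F1 (delta := fun=> 0) _ _ FG;first exact: cvg_cst.
 by have [[_ _ ->] _] := HF n;rewrite subrr normr0.
split;[split=> //|].
- move=> x;apply: (ultra_eq UU (FG (- x))).
 rewrite (_ : (fun n => F n (- x)) = fun n => F n x);first exact: FG. by ext n;have [[-> _ _] _] := HF n.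
- move=> s;apply: (@ultra_ge _ _ UU (fun n => \sum_(p <- s) \sum_(q <- s) p.2 * q.2 * F n (p.1 - q.1))).
  by apply: ultra_sum=> p;apply: ultra_sum=> q;apply: cvgMr;exact: FG.
 by move=> n;have [[_ p _] _] := HF n;exact: p.
- apply: (ultra_eq UU (FG 0));rewrite (_ : (fun n => F n 0) = fun=> 1);first exact: cvg_cst.
 by ext n;have [_ ->] := HF n.
Qed.

Lemma eigencone_scale c F : 0 <= c -> bounded F -> eigencone F -> eigencone (fun x => c * F x).
move=> c0 bF [ev pF TF];split.
- by move=> x;rewrite ev.
- move=> s;rewrite (_ : \sum_(p <- s) _ = c * \sum_(p <- s) \sum_(q <- s) p.2 * q.2 * F (p.1 - q.1)).
  by rewrite mulr_ge0.
 rewrite mulr_sumr;eqsum p;rewrite mulr_sumr;eqsum q;ring.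
- move=> x;have E : T (fun x => c * F x) = fun x => c * T F x.
  by ext y;exact: corr_scale.
 transitivity (c * T (T F) x);last by rewrite TF mulrCA. by rewrite E;apply: corr_scale=> //;exact: corr_bounded.
Qed.

(** On the real part of a character this acts as multiplication by (1 + e F(a)) / 2. It is used with
    e = 1 and e = -1, whose parts add up to [F]. *)
Definition split_part (e : R) (a : X) F x := 4^-1 * (2 * F x + e * (F (x + a) + F (x - a))).

Lemma split_part_cone (e : R) a F : e ^+ 2 = 1 -> bounded F -> eigencone F -> eigencone (split_part e a F).
move=> e1 bF [ev pF TF];have bs b : bounded (fun x => F (x + b)) by exact: bounded_shift.
have badd f g : bounded f -> bounded g -> bounded (fun x => f x + g x).
 move=> [M HM] [N HN];exists (M + N)=> x. by rewrite (le_trans (ler_normD _ _)) // lerD.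
have bsc c f : bounded f -> bounded (fun x => c * f x).
 by move=> [M HM];exists (`|c| * M) => x;rewrite normrM ler_wpM2l.
split.
- move=> x;rewrite /split_part ev (_ : F (- x + a) = F (x - a));last by rewrite -ev opprD opprK.
 by rewrite -opprD ev [F (x - a) + _]addrC.
(* Positive definiteness of [F], tested on each point together with its translate by [a] of relative
   weight [e]. *)
- move=> s;have := pF (s ++ [seq (p.1 + a, e * p.2) | p <- s]).
 rewrite big_cat /= big_map. under eq_bigr do rewrite big_cat big_map /=.
 under [X in _ + X]eq_bigr do rewrite big_cat big_map /=. rewrite -!big_split /= => H.
 rewrite (_ : \sum_(p <- s) _ = 4^-1 * \sum_(i <- s) (\sum_(i0 <- s) i.2 * i0.2 * F (i.1 - i0.1) +
   \sum_(i0 <- s) i.2 * (e * i0.2) * F (i.1 - (i0.1 + a)) + (\sum_(i0 <- s) e * i.2 * i0.2 * F (i.1 + a - i0.1) +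
   \sum_(i0 <- s) e * i.2 * (e * i0.2) * F (i.1 + a - (i0.1 + a))))).
  by rewrite mulr_ge0 // invr_ge0.
 rewrite mulr_sumr;eqsum p. rewrite -!big_split /= mulr_sumr;eqsum q.
 have -> : p.1 + a - (q.1 + a) = p.1 - q.1 by rewrite opprD addrACA subrr addr0.
 rewrite /split_part opprD [p.1 + (_ - _)]addrA [p.1 + a - _]addrAC.
 have -> : e * p.2 * (e * q.2) = e ^+ 2 * (p.2 * q.2) by ring. by rewrite e1;ring.
- have TE f : bounded f -> T (fun x => 4^-1 * (2 * f x + e * (f (x + a) + f (x - a)))) =
   split_part e a (T f).
  move=> bf;have bs' b : bounded (fun x => f (x + b)) by exact: bounded_shift.
  ext x;rewrite /T /split_part !corr_shift corr_scale //;last first.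
   by apply: (badd)=> //;[exact: bsc|apply: bsc;exact: badd].
  rewrite corr_add ?corr_scale ?corr_add //;try exact: bsc.
   exact: badd.
  by apply: bsc;exact: badd.
 move=> x;rewrite /split_part TE // TE;last exact: corr_bounded. by rewrite /split_part !TF;ring.
Qed.

End Eigencone.

End InvariantIntegral.

(** [F] is a sum of two members of the cone; being extreme it is proportional to each of them, with
    the factor read off at 0. A part with value 0 at 0 vanishes identically because it is positive
    definite. *)
Lemma extreme_dalembert R (X : topologicalZmodType) (I : (X -> R) -> R) (h : X -> R) (L : R) (F : X -> R) :
 (forall f g, bcs f -> bcs g -> I (fun x => f x + g x) = I f + I g) ->
 (forall c f, bcs f -> I (fun x => c * f x) = c * I f) ->
 (forall f, bcs f -> (forall x, 0 <= f x) -> 0 <= I f) -> bcs h -> eigencone I h L F -> F 0 = 1 ->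
 (forall A B t, eigencone I h L A -> A 0 = 1 -> eigencone I h L B -> B 0 = 1 ->
  0 < t < 1 -> (forall x, F x = t * A x + (1 - t) * B x) -> A = B) ->
 forall x a, F (x + a) + F (x - a) = 2 * F a * F x.
move=> Iadd Iscale Ipos Bh coneF F0 ext x a.
have [ev pF TF] := coneF.
have F1 y : `|F y| <= 1 by rewrite -F0;exact: pos_def_le.
have bF : bounded F by exists 1.
have e1 : (1 : R) ^+ 2 = 1 by lra.
have e2 : (-1 : R) ^+ 2 = 1 by lra.
have c1 := split_part_cone Iadd Iscale Ipos Bh a e1 bF coneF.
have c2 := split_part_cone Iadd Iscale Ipos Bh a e2 bF coneF.
have v1 : split_part 1 a F 0 = (1 + F a) / 2.
 by rewrite /split_part F0 add0r sub0r ev;field.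
have v2 : split_part (-1) a F 0 = (1 - F a) / 2.
 by rewrite /split_part F0 add0r sub0r ev;field.
have E y : F y = split_part 1 a F y + split_part (-1) a F y by rewrite /split_part;field.
pose t := (1 + F a) / 2.
suff H : split_part 1 a F x = t * F x.
 by move: H;rewrite /split_part /t mul1r=> H;lra.
have bS e : eigencone I h L (split_part e a F) -> forall y, `|split_part e a F y| <= split_part e a F 0.
 by move=> [ev' p' _] y;exact: pos_def_le.
have := F1 a;rewrite ler_norml=> /andP[Fa1 Fa2].
have [t0|t0] := eqVneq t 0.
 have := bS 1 c1 x;rewrite v1 -/t t0 normr_le0 mul0r=> /eqP ->//.
have [t1|t1] := eqVneq t 1.
 have := bS _ c2 x;rewrite v2 (_ : (1 - F a) / 2 = 0);last by move: t1;rewrite /t;lra.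
 by rewrite normr_le0=> /eqP z0;have := E x;rewrite z0 t1 addr0 mul1r.
have t01 : 0 < t < 1.
 by rewrite !lt_neqAle [0 == _]eq_sym t0 t1 /=;apply/andP;split;rewrite /t;lra.
have /andP[t0' t1'] := t01.
have bb e : eigencone I h L (split_part e a F) -> bounded (split_part e a F).
 by move=> c;exists (split_part e a F 0)=> y;exact: bS.
have h1 : 0 <= t^-1 by rewrite invr_ge0 ltW.
have h2 : 0 <= (1 - t)^-1 by rewrite invr_ge0 subr_ge0 ltW.
have k1 := eigencone_scale Iadd Iscale Ipos Bh h1 (bb _ c1) c1.
have k2 := eigencone_scale Iadd Iscale Ipos Bh h2 (bb _ c2) c2.
have nt : 1 - t != 0 by lra.
have AB := ext _ _ t k1 _ k2 _ t01.
have {}AB : (fun x => t^-1 * split_part 1 a F x) = (fun x => (1 - t)^-1 * split_part (-1) a F x).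
 apply: AB.
 - by rewrite v1 -/t mulVf.
 - by rewrite v2 (_ : (1 - F a) / 2 = 1 - t) ?mulVf // /t;field.
 - by move=> y;rewrite !mulVKf.
have := congr1 (fun f => f x) AB;rewrite /= => AB'.
have : split_part 1 a F x = t * ((1 - t)^-1 * split_part (-1) a F x).
 by rewrite -AB' mulrA divff // mul1r.
move=> h3;have h4 : (1 - t) * split_part 1 a F x = t * split_part (-1) a F x.
 by rewrite {1}h3 mulrCA mulVKf.
by have := E x;move: h4;rewrite mulrBl mul1r=> h4 ->;rewrite mulrDr;lra.
Qed.

(** [K] becomes the real part of a character. Its imaginary part is a difference of two translates
    of [K] by a point [a] with K(a)^2 != 1, divided by twice the square root of 1 - K(a)^2; if no
    such point exists, [K] is itself a character with values 1 and -1. *)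
Lemma dalembert_character R (X : topologicalZmodType) (K : X -> R) (x0 : X) :
 uc K -> (forall x, `|K x| <= 1) -> K 0 = 1 -> K x0 != 1 -> (forall x a, K (x + a) + K (x - a) = 2 * K a * K x) ->
 exists y : character R X, y x0 != 1.
move=> uK K1 K0 Kx0 dal.
have uc_cont (f : X -> R) : uc f -> continuous f.
 move=> uf x;apply/cvgrPdist_le=> e e0;have [U U0 HU] := uf e e0.
 have := @nbhs_shift X x (- x) U;rewrite subrr=> /(_ U0);apply: filterS=> z /= Uz.
 by have := HU x _ Uz;rewrite [x + _]addrC subrK distrC.
have even x : K (- x) = K x by have := dal 0 x;rewrite add0r sub0r K0;lra.
suff [s [us hs1 hs2 hs3]] : exists s : X -> R, [/\ uc s, forall x, K x ^+ 2 + s x ^+ 2 = 1,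
  forall x y, K (x + y) = K x * K y - s x * s y & forall x y, s (x + y) = s x * K y + K x * s y].
 have cy : continuous (fun x => (K x +i* s x)%C : C R).
  by move=> x;apply: cvg_complex;exact: uc_cont.
 have ny x : `|(K x +i* s x)%C : C R| = 1.
  by rewrite complex_normE hs1 sqrtr1.
 have hy : {morph (fun x => (K x +i* s x)%C : C R) : x y / x + y >-> x * y}.
  by move=> x y;rewrite hs2 hs3;simpc;congr (_ +i* _)%C;ring.
 exists (Character cy ny hy)=> /=;apply: contra Kx0=> /eqP [-> _];exact/eqP.
have [[a Ka]|allK] := pselect (exists a, K a ^+ 2 != 1).
 have Ka1 : 0 < 1 - K a ^+ 2.
  rewrite subr_gt0 lt_neqAle Ka -(real_normK (num_real _)) expr_le1 //;exact: K1.
 pose g := Num.sqrt (1 - K a ^+ 2). have g0 : 0 < g by rewrite sqrtr_gt0.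
 have g2 : g ^+ 2 = 1 - K a ^+ 2 by rewrite sqr_sqrtr // ltW. pose s x := (2 * g)^-1 * (K (x - a) - K (x + a)).
 have sg x : K (x - a) - K (x + a) = 2 * g * s x.
  by rewrite /s mulrA divff ?mul1r // mulf_neq0 ?gt_eqF.
 have K2a : K (a + a) = 2 * K a ^+ 2 - 1 by have := dal a a;rewrite subrr;lra.
 have d2 x : K (x + a + a) + K (x - a - a) = 2 * (2 * K a ^+ 2 - 1) * K x.
  by rewrite -K2a -dal opprD !addrA.
 have ss x y : 2 * s x * s y = K (x - y) - K (x + y).
  have := dal (x - a) (y - a);have := dal (x - a) (y + a). have := dal (x + a) (y - a);have := dal (x + a) (y + a).
  have -> : x - a + (y - a) = x + y - a - a by rewrite addrACA addrA.
  have -> : x - a - (y - a) = x - y by rewrite opprB addrA subrK.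
  have -> : x - a + (y + a) = x + y by rewrite addrACA addNr addr0.
  have -> : x - a - (y + a) = x - y - a - a by rewrite opprD addrA [x - a - y]addrAC.
  have -> : x + a + (y - a) = x + y by rewrite addrACA subrr addr0.
  have -> : x + a - (y - a) = x - y + a + a by rewrite opprB addrA [x + a + a - y]addrAC [x + a - y]addrAC.
  have -> : x + a + (y + a) = x + y + a + a by rewrite addrACA addrA.
  have -> : x + a - (y + a) = x - y by rewrite opprD addrACA subrr addr0. move=> h1 h2 h3 h4.
  have h5 := d2 (x + y);have h6 := d2 (x - y).
  have : (2 * g * s x) * (2 * g * s y) = 2 * g ^+ 2 * (K (x - y) - K (x + y)).
   by rewrite -!sg g2;move: h1 h2 h3 h4 h5 h6;nra.
  have -> : 2 * g * s x * (2 * g * s y) = 2 * g ^+ 2 * (2 * s x * s y) by ring.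
  by apply: mulfI;rewrite mulf_neq0 // expf_neq0 // gt_eqF.
 have Kadd x y : K (x + y) = K x * K y - s x * s y.
  by have := ss x y;have := dal x y;nra.
 exists s;split=> //.
 - apply/uc_scale/uc_add;first exact: uc_shift.
  have -> : (fun x => - K (x + a)) = (fun x => (-1) * K (x + a)).
   by ext x;rewrite mulN1r.
  by apply/uc_scale/uc_shift.
 - move=> x;have := Kadd x x;have := dal x x;rewrite subrr;nra.
 - move=> x y;have h1 := sg (x + y).
  have h2 : s (y - a) - s (y + a) = - (2 * g * K y).
   have h3 : 2 * g * (s (y - a) - s (y + a)) = 2 * g * - (2 * g * K y).
    rewrite mulrBr -!sg subrK addrK;have := d2 y.
    rewrite (_ : 2 * g * - (2 * g * K y) = - 4 * g ^+ 2 * K y);last ring. by rewrite g2;lra.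
   by move: h3;apply: mulfI;rewrite mulf_neq0 // gt_eqF.
  have e1 : K (x + y - a) = K x * K (y - a) - s x * s (y - a) by rewrite -addrA.
  have e2 : K (x + y + a) = K x * K (y + a) - s x * s (y + a) by rewrite -addrA.
  have h4 : 2 * g * s (x + y) = 2 * g * (s x * K y + K x * s y).
   have -> : 2 * g * s (x + y) = K x * (K (y - a) - K (y + a)) - s x * (s (y - a) - s (y + a)).
    by rewrite -h1 e1 e2;ring.
   by rewrite sg h2;ring.
  by move: h4;apply: mulfI;rewrite mulf_neq0 // gt_eqF.
have K2 x : K x ^+ 2 = 1.
 by apply/eqP/negPn/negP=> H;apply: allK;exists x.
have Kadd x y : K (x + y) = K x * K y.
 have := dal x y;have := K2 (x + y);have := K2 (x - y);have := K2 x;have := K2 y.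
 set A := K (x + y);set B := K (x - y);set c := K x;set d := K y. move=> e1 e2 e3 e4 e5. have : (A - B) ^+ 2 = 0.
  have : (A + B) ^+ 2 = 4 by rewrite e5;rewrite !exprMn e1 e2;ring. by nra.
 by move/eqP;rewrite sqrf_eq0=> /eqP;lra.
exists (fun=> 0);split.
- by move=> e e0;exists setT;[exact: filterT|move=> x u _;rewrite subrr normr0 ltW].
- by move=> x;rewrite K2 expr0n addr0.
- by move=> x y;rewrite mulr0 subr0.
- by move=> x y;rewrite mul0r mulr0 addr0.
Qed.

Lemma continuous_uc R (X : topologicalZmodType) (f : X -> R) (K : set X) :
 compact K -> (forall x, f x != 0 -> K x) -> continuous f -> uc f.
move=> /compact_near_coveringP cK fK cf e e0.
have H := cK X (nbhs 0) (fun u x => `|f (x + u) - f x| <= e).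
have {}H : \forall u \near (0 : X), K `<=` (fun x => `|f (x + u) - f x| <= e).
 apply: H=> x Kx. have c1 : f (p.1 + p.2) - f p.1 @[p --> (x, 0 : X)] --> f (x + 0) - f x.
  apply: cvgB;last by apply: cvg_comp cvg_fst _;exact: cf.
  apply: (@cvg_comp _ _ _ (fun p : X * X => p.1 + p.2));last exact: cf. exact: (@add_continuous X (x, 0)).
 move/cvgrPdist_le : c1=> /(_ e e0);rewrite addr0 subrr. by apply: filterS=> p;rewrite sub0r normrN.
exists [set u | K `<=` (fun x => `|f (x + u) - f x| <= e) /\ K `<=` (fun x => `|f (x - u) - f x| <= e)].
 apply: filterI=> //. apply: (@nbhs_opp X 0 [set u | K `<=` (fun x => `|f (x + u) - f x| <= e)]). by rewrite oppr0.
move=> x u [h1 h2];have [|nK] := pselect (K x);first exact: h1.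
have [Kxu|nKu] := pselect (K (x + u)).
 by have := h2 _ Kxu;rewrite addrK distrC.
have z y : ~ K y -> f y = 0 by move=> nKy;apply/eqP/negPn/negP=> /fK.
by rewrite !z // subrr normr0 ltW.
Qed.

Lemma dense_sequence (X : topologicalZmodType) : @second_countable X ->
 exists x_ : nat -> X, forall W, open W -> W !=set0 -> exists i, W (x_ i).
move=> [B /countable_injP [f finj] [Bo Bb]].
have /choice [x_ Hx] : forall n, exists x : X, forall W, B W -> f W = n -> W !=set0 -> W x.
 move=> n;have [[W [BW fW [x Wx]]]|nW] := pselect (exists W, [/\ B W, f W = n & W !=set0]).
  exists x=> W' BW' fW';have -> // : W' = W. by apply: finj;[exact: mem_set|exact: mem_set|rewrite fW fW'].
 by exists 0=> W BW fW W0;exfalso;apply: nW;exists W.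
exists x_ => W oW [x Wx].
have [V [BV Vx] VW] := Bb x W (open_nbhs_nbhs (conj oW Wx)).
by exists (f V);apply: VW;apply: Hx=> //;exists x.
Qed.

Lemma bump_function R (X : topologicalZmodType) (x0 : X) :
 hausdorff_space X -> locally_compact [set: X] -> x0 != 0 ->
 exists phi : X -> R, [/\ bcs phi, uc phi, phi 0 = 1 & phi x0 = 0].
move=> hX lX x00.
have [C [C0 cC clC]] : exists C : set X, [/\ nbhs 0 C, compact C & closed C].
 have [C C0 [cC clC]] := lX 0 I;exists C;split=> //. have : nbhs (0 : X) (fun t => [set: X] t -> C t) := C0.
 by apply: filterS=> t;apply.
pose B := ~` C° `|` [set x0].
have clB : closed B.
 apply: closedU;first by apply: open_closedC;exact: open_interior.
 exact: (accessible_closed_set1 (hausdorff_accessible hX)).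
have nB0 : ~ B 0.
 by move=> [|/= E];[apply;exact: C0|move: x00;rewrite -E eqxx].
have /(@uniform_separatorP _ R)[f [cf f01 f0 fB]] := @locally_compact_completely_regular X R lX hX 0 B clB nB0.
have f1 x : B x -> f x = 1 by move=> Bx;apply: fB.
have fle x : 0 <= f x <= 1 by have := f01 (f x) (ex_intro2 _ _ x Logic.I erefl).
have supp x : 1 - f x != 0 -> C x.
 move=> fx;apply: contrapT=> nC;move/eqP: fx;rewrite f1 ?subrr //;left. by move=> /interior_subset.
exists (fun x => 1 - f x);split.
- exists C=> //;exists 1=> x;split;last exact: supp.
 by have := fle x;rewrite ler_norml=> /andP[? ?];lra.
- apply: (continuous_uc cC supp)=> x;apply: cvgB;[exact: cvg_cst|exact: cf].
- by rewrite (f0 (f 0)) ?subr0 //;exists 0.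
- by rewrite f1 ?subrr //;right.
Qed.

(** The kernel [h] is the autocorrelation of phi - phi(. + x0), that is, a second difference in the
    direction [x0]. A solution of d'Alembert's equation with value 1 at [x0] is harmonic in that
    direction and is annihilated by [h], against the eigenvalue L > 0. *)
Lemma characters_separate R (X : topologicalZmodType) (x0 : X) :
 hausdorff_space X -> locally_compact [set: X] -> @second_countable X -> x0 != 0 ->
 exists y : character R X, y x0 != 1.
move=> hX lX cX x00.
have [phi [Bp up p0 px0]] := bump_function R hX lX x00.
pose k x := phi x - phi (x + x0).
have Bk : bcs k by apply: bcs_sub=> //;exact: bcs_shift.
have uk : uc k.
 apply: uc_add=> //;have -> : (fun x => - phi (x + x0)) = fun x => (-1) * phi (x + x0).
  by ext x;rewrite mulN1r.
 by apply/uc_scale/uc_shift.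
have k0 : k 0 = 1 by rewrite /k add0r px0 subr0.
have Xlc : exists2 C : set X, nbhs 0 C & compact C.
 have [C C0 [cC _]] := lX 0 Logic.I;exists C=> //. have : nbhs (0 : X) (fun t => [set: X] t -> C t) := C0.
 by apply: filterS=> t;apply.
have [V V0 HV] := uk (1 / 2) (divr_gt0 ltr01 (ltr0Sn _ _)).
have [I [[Iadd Iscale Ipos] Ishift Iopp Ige]] := haar R V0.
have Ig : exists g, [/\ bcs g, (forall x, 0 <= g x) & 0 < I g].
 (* 4 k^2 is at least 1 on [V], where [k] differs from k(0) = 1 by at most 1/2. *)
 have B4 : bcs (fun x => 4 * (k x * k x)) by apply/bcs_scale/bcs_mul.
 have k4 x : 0 <= 4 * (k x * k x) by rewrite mulr_ge0 // sqr_ge0.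
 exists (fun x => 4 * (k x * k x));split=> //;apply: lt_le_trans (Ige _ B4 k4 _)=> //.
 move=> x Vx;have := HV 0 x Vx;rewrite add0r ler_norml=> /andP[ ];nra.
pose h := corr I k k.
have Bh : bcs h by exact: corr_bcs.
have uh : uc h by apply: corr_uc=> //;exact: bcs_bounded.
have ev x : h (- x) = h x by rewrite /h corr_opp.
have ipk : 0 < ip I k k by apply: ip_gt0=> //;rewrite k0.
have h0 : h 0 = ip I k k by rewrite /h /corr;under eq_fun do rewrite addr0.
have iph : 0 < ip I h h by apply: ip_gt0=> //;rewrite h0 gt_eqF.
have b1 : 0 < ip I (corr I k h) (corr I k h).
 have Bkh : bcs (corr I k h) by exact: corr_bcs. have := cauchy_schwarz Iadd Iscale Ipos Bkh Bk.
 have -> : ip I (corr I k h) k = ip I h h.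
  by rewrite /ip fubini //;exact: bcs_bounded.
 move=> H;have h2 : 0 < ip I h h ^+ 2 by rewrite exprn_gt0. by rewrite -(pmulr_lgt0 _ ipk) (lt_le_trans h2).
have [L L0 rL] := ratio_cvg Iadd Iscale Ipos Ishift Iopp Bh ev Bk uk ipk b1.
have [U [UU Uoo]] : exists U : set_system nat, UltraFilter U /\ forall n, U [set m | (n <= m)%N].
 have [U [UU HU]] := @ultraFilterLemma _ \oo;exists U;split=> // n;apply: HU. by exists n.
have [F0 [cF0 F00]] : exists F, eigencone I h L F /\ F 0 = 1.
 pose v n := iter n (fun F => corr I F h) k. pose b n := ip I (v n) (v n).
 pose Phi n x := (b n)^-1 * corr I (v n) (v n) x. pose r n := b n.+1 / b n.
 pose delta n := Num.sqrt (r n.+1 * r n - 2 * L * r n + L ^+ 2).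
 have P1 n := orbit_corr1 Iadd Iscale Ipos Ishift Iopp Bh ev Bk uk ipk b1 n.
 have Pe n x := orbit_eigen Iadd Iscale Ipos Ishift Iopp Bh ev Bk uk ipk b1 L n x. have P1' n x : `|Phi n x| <= 1.
  by have [p1 p2 p3] := P1 n;rewrite -p1;exact: pos_def_le.
 have /choice [G HG] : forall x, exists l : R, Phi n x @[n --> U] --> l.
  by move=> x;exact: (@ultra_lim _ _ _ _ 1).
 have [|n x|uG TG] := eigen_limit Iadd Iscale Ipos Ishift UU Bh uh L0 Xlc P1' (delta := delta) _ _ HG.
 - have -> : (0 : R) = Num.sqrt (L * L - 2 * L * L + L ^+ 2).
   by rewrite (_ : _ + _ = 0) ?sqrtr0 //;ring.
  apply: (cvg_along UU Uoo). apply: (@cvg_comp _ _ _ _ Num.sqrt);last exact: sqrt_continuous.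
  apply: cvgD;last exact: cvg_cst. have rL' : r n.+1 @[n --> \oo] --> L by rewrite cvg_shiftS.
  by apply: cvgB;[exact: cvgM|apply: cvgMr].
 - by rewrite -sqrtr_sqr ler_wsqrtr //;exact: Pe.
 exists G;split;first split=> //.
 - move=> x;apply: (ultra_eq UU (HG (- x))).
  rewrite (_ : (fun n => Phi n (- x)) = fun n => Phi n x);first exact: HG. by ext n;have [_ p2 _] := P1 n;exact: p2.
 - move=> s;apply: (@ultra_ge _ _ UU (fun n => \sum_(p <- s) \sum_(q <- s) p.2 * q.2 * Phi n (p.1 - q.1))).
   by apply: ultra_sum=> p;apply: ultra_sum=> q;apply: cvgMr;exact: HG.
  by move=> n;have [_ _ p3] := P1 n;exact: p3.
 - apply: (ultra_eq UU (HG 0));rewrite (_ : (fun n => Phi n 0) = fun=> 1);first exact: cvg_cst.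
  by ext n;have [p1 _ _] := P1 n;exact: p1.
have cone1 F : eigencone I h L F -> F 0 = 1 -> forall x, `|F x| <= 1.
 by move=> [e p _] F1 x;rewrite -F1;exact: pos_def_le.
(* Uniform continuity is a case of [eigen_limit], for a constant sequence. *)
have cone_uc F : eigencone I h L F -> F 0 = 1 -> uc F.
 move=> cF F1;have [_ _ TF] := cF. have [] // := eigen_limit Iadd Iscale Ipos Ishift UU Bh uh L0 Xlc
  (F := fun=> F) (G := F) (delta := fun=> 0).
 - by move=> _;exact: cone1.
 - exact: cvg_cst.
 - by move=> _ x;rewrite TF subrr normr0.
 - by move=> x;exact: cvg_cst.
have [x_ Hx_] := dense_sequence cX.
have [F [cF F1] extF] := @extreme_exists R U UU Uoo X
 [set F | eigencone I h L F /\ F 0 = 1] x_ (ex_intro _ F0 (conj cF0 F00)) (fun F HF => cone1 F HF.1 HF.2)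
 (fun F G HF FG => eigencone_limit Iadd Iscale Ipos Ishift UU Bh uh L0 Xlc HF FG).
have dal := extreme_dalembert Iadd Iscale Ipos Bh cF F1.
(* Extremality was obtained on a dense sequence only; uniform continuity extends it to X. *)
have {}dal : forall x a, F (x + a) + F (x - a) = 2 * F a * F x.
 apply: dal=> A B t cA A1 cB B1' t01 FAB. have AB := extF A B t (conj cA A1) (conj cB B1') t01 FAB.
 ext x;apply/eqP;rewrite -subr_eq0 -normr_le0. apply/ler_addgt0Pr=> e e0;rewrite add0r. have e2 : 0 < e / 2 by lra.
 have [V1 V10 H1] := cone_uc _ cA A1 _ e2;have [V2 V20 H2] := cone_uc _ cB B1' _ e2.
 have [|i Wi] := Hx_ [set z | (V1 `&` V2) (z - x)]° (open_interior _).
  by exists x;apply: (@nbhs_shift X x (- x));rewrite subrr;exact: filterI.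
 have [/= W1 W2] := interior_subset Wi.
 have := H1 x _ W1;have := H2 x _ W2;rewrite [x + _]addrC subrK AB distrC=> h1 h2.
 rewrite distrC in h2;rewrite (le_trans (ler_distD (B (x_ i)) _ _)) //. by rewrite [leRHS]splitr lerD // distrC.
apply: (dalembert_character _ _ F1 _ dal).
- exact: cone_uc.
- exact: cone1.
- apply/negP=> /eqP Fx0.
 have per y : F (y + x0) + F (y - x0) = 2 * F y by rewrite dal Fx0 mulr1. have TF0 : corr I F h = fun=> 0.
  ext x;pose c := corr I phi phi. have bF : bounded F by exists 1;exact: cone1. have Bc : bcs c by exact: corr_bcs.
  have hE y : h y = 2 * c y - c (y + x0) - c (y - x0).
   have B1 : bcs (fun x => phi (x + y) * phi x) by apply: bcs_mul=> //;exact: bcs_shift.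
   have B2 : bcs (fun x => phi (x + y) * phi (x + x0)) by apply: bcs_mul=> //;exact: bcs_shift.
   have B3 : bcs (fun x => phi (x + (y + x0)) * phi x) by apply: bcs_mul=> //;exact: bcs_shift.
   have B4 : bcs (fun x => phi (x + x0 + y) * phi (x + x0)).
    exact: (bcs_shift x0 B1).
   have E4 : c y = I (fun x => phi (x + x0 + y) * phi (x + x0)).
    by rewrite (Ishift _ x0 B1).
   have E2 : c (y - x0) = I (fun x => phi (x + y) * phi (x + x0)).
    rewrite -(Ishift _ (- x0) B2);congr I;ext z. by rewrite subrK addrA [z - x0 + y]addrAC.
   have -> : h y = I (fun x => (phi (x + y) * phi x + phi (x + x0 + y) * phi (x + x0)) -
     (phi (x + (y + x0)) * phi x + phi (x + y) * phi (x + x0))).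
    congr I;ext z;rewrite /k. have -> : z + x0 + y = z + y + x0 by rewrite addrAC.
    have -> : z + (y + x0) = z + y + x0 by rewrite addrA. by ring.
   rewrite Isub ?Iadd -?E4 -?E2 //;try exact: bcs_add. rewrite -[I (fun x1 => phi (x1 + y) * phi x1)]/(c y).
   by rewrite -[I (fun x1 => phi (x1 + (y + x0)) * phi x1)]/(c (y + x0));ring.
  have Ba a : bcs (fun y => F (y + x) * c (y + a)).
   by apply: bcs_mull;[exact: bcs_shift|exact: bounded_shift].
  have Ba0 : bcs (fun y => F (y + x) * c y).
   by apply: bcs_mull=> //;exact: bounded_shift.
  have Bb a : bcs (fun y => F (y + a + x) * c y).
   apply: bcs_mull=> //;have [M HM] := bF;exists M=> y;exact: HM.
  have Ia a : I (fun y => F (y + x) * c (y + a)) = I (fun y => F (y - a + x) * c y).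
   rewrite -(Ishift _ (- a) (Ba a));congr I;ext y. by rewrite subrK.
  have -> : corr I F h x = I (fun y => 2 * (F (y + x) * c y) - (F (y + x) * c (y + x0) + F (y + x) * c (y - x0))).
   by congr I;ext y;rewrite hE;ring.
  rewrite Isub ?Iadd ?Iscale ?Ia //;[|exact: bcs_scale|exact: bcs_add].
  rewrite -Iadd // -Iscale // -Isub //;[|exact: bcs_scale|exact: bcs_add].
  rewrite (_ : (fun => _) = fun=> 0) ?I0 //;ext y.
  by rewrite opprK -mulrDl mulrA -per [y - x0 + x]addrAC [y + x0 + x]addrAC;ring.
 have := cF;case=> _ _ /(_ 0);rewrite TF0 F1 mulr1 /corr.
 rewrite (_ : (fun => _) = 0) ?I0 //;last by ext z;rewrite mul0r. by move=> L00;move: L0;rewrite -L00 ltxx.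
Qed.

(** * Elementary trigonometric and exponential estimates *)

Lemma sin_le_id R (x : R) : `|sin x| <= `|x|.
have pos (y : R) : 0 <= y -> `|sin y| <= y.
 move=> y0;have [->|y1] := eqVneq y 0;first by rewrite sin0 normr0. have {}y0 : 0 < y by lra.
 have [|c _] := @MVT _ sin cos 0 y y0 (fun x _ => is_derive_sin x).
  by apply: continuous_subspaceT;exact: continuous_sin.
 rewrite sin0 !subr0=> ->;rewrite normrM (gtr0_norm y0) ger_pMl //. by exact: cos_bounded.
have [x0|/ltW x0] := leP 0 x;first by rewrite (ger0_norm x0) pos.
by rewrite -normrN -sinN (le_trans (pos (- x) _)) ?oppr_ge0 // ler0_norm.
Qed.

Lemma cos_sub1_le R (x : R) : `|1 - cos x| <= x ^+ 2 / 2.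
have -> : 1 - cos x = 2 * sin (x / 2) ^+ 2.
 have := cosD (x / 2) (x / 2);rewrite -splitr -!expr2=> ->. by have := cos2Dsin2 (x / 2);lra.
rewrite normrM ger0_norm // normrX.
have := sin_le_id (x / 2);rewrite normrM (@ger0_norm _ 2^-1) // => h.
have h2 : `|sin (x / 2)| ^+ 2 <= (`|x| / 2) ^+ 2 by rewrite ler_sqr // nnegrE.
by move: h2;rewrite expr_div_n (real_normK (num_real x))=> h2;lra.
Qed.

Lemma sin_sub_id_le R (x : R) : `|sin x - x| <= `|x| ^+ 3 / 2.
have pos (y : R) : 0 < y -> `|sin y - y| <= y ^+ 3 / 2.
 move=> y0;have D (z : R) : is_derive z 1 (fun z => sin z - z) (cos z - 1).
  by apply: is_deriveB.
 have [|c c0y] := @MVT _ (fun z => sin z - z) (fun z => cos z - 1) 0 y y0.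
  apply: continuous_subspaceT=> z;apply: cvgB;[exact: continuous_sin|exact: cvg_id].
 rewrite sin0 !subr0=> ->;rewrite normrM (gtr0_norm y0) distrC.
 have := cos_sub1_le c;move: c0y;rewrite in_itv /= => /andP[c0 cy] h.
 have c2 : c ^+ 2 <= y ^+ 2 by rewrite ler_sqr ?nnegrE ltW. have -> : y ^+ 3 / 2 = y ^+ 2 / 2 * y by lra.
 by rewrite ler_wpM2r // ?(ltW y0) // (le_trans h) // ler_wpM2r.
have [x0|x0|->] := ltgtP x 0;last by rewrite sin0 subrr !normr0.
 by rewrite -normrN opprD -sinN (ltr0_norm x0);apply: pos;rewrite oppr_gt0.
by rewrite (gtr0_norm x0) pos.
Qed.

Lemma cos_quartic_le R (x : R) : `|cos x - (1 - x ^+ 2 / 2)| <= x ^+ 4 / 8.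
have -> : cos x - (1 - x ^+ 2 / 2) = - (2 * ((sin (x / 2) - x / 2) * (sin (x / 2) + x / 2))).
 have := cosD (x / 2) (x / 2);rewrite -splitr -!expr2=> ->. by have := cos2Dsin2 (x / 2);lra.
have h1 := sin_sub_id_le (x / 2).
have h2 : `|sin (x / 2) + x / 2| <= 2 * `|x / 2|.
 by rewrite (le_trans (ler_normD _ _)) // mulr2n mulrDl mul1r lerD2r sin_le_id.
rewrite normrN normrM ger0_norm // normrM.
rewrite (le_trans (ler_wpM2l _ (ler_pM _ _ h1 h2))) //.
have -> : 2 * (`|x / 2| ^+ 3 / 2 * (2 * `|x / 2|)) = 2 * (`|x / 2| ^+ 2) ^+ 2 by field.
by rewrite real_normK ?num_real //;apply: eq_ler;field.
Qed.

Lemma expRN_le R (u : R) : 0 <= u -> `|expR (- u) - (1 - u)| <= u ^+ 2.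
move=> u0;have h1 := expR_ge1Dx (- u).
have h2 : expR (- u) <= 1 - u + u ^+ 2.
 rewrite expRN;have h3 := expR_ge1Dx u. have u1 : 0 < 1 + u by lra. rewrite (le_trans (y := (1 + u)^-1)) //.
  by rewrite lef_pV2 // posrE ?expR_gt0.
 by rewrite -[leLHS]mul1r ler_pdivrMr //;nra.
by rewrite ger0_norm;lra.
Qed.

Lemma complex_expr_sub_le R (w v : R[i]) n : `|w| <= 1 -> `|v| <= 1 -> `|w ^+ n - v ^+ n| <= n%:R * `|w - v|.
move=> w1 v1;rewrite subrXX normrM mulrC ler_wpM2r //.
rewrite (le_trans (ler_norm_sum _ _ _)) //.
have -> : n%:R = \sum_(i < n) (1 : R[i]) by rewrite sumr_const card_ord.
lesum i;rewrite normrM !normrX -[leRHS]mulr1.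
by rewrite ler_pM ?exprn_ge0 // exprn_ile1.
Qed.

(** * Biased random walks *)

Section BiasedWalk.
Variable R : realType.
Implicit Types (f g : R -> R) (b h x t c e : R).

(** The mean of f after [K] independent steps of size [h], upwards with probability (1 + b) / 2. *)
Fixpoint walk b h K f x : R := if K is K'.+1 then
  2^-1 * ((1 + b) * walk b h K' f (x + h) + (1 - b) * walk b h K' f (x - h)) else f x.

Lemma walk_lin b h K u v f g x :
 walk b h K (fun y => u * f y + v * g y) x = u * walk b h K f x + v * walk b h K g x.
by elim: K x=> [//|K IH] x /=;rewrite !IH;ring. Qed.

Lemma walk_cst b h K c x : walk b h K (fun=> c) x = c.
by elim: K x=> [//|K IH] x /=;rewrite !IH;field. Qed.

Lemma walk_le b h K f g x : `|b| <= 1 -> (forall y, f y <= g y) -> walk b h K f x <= walk b h K g x.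
rewrite ler_norml=> /andP[b1 b2] fg;elim: K x=> [//|K IH] x /=.
rewrite ler_pM2l ?invr_gt0 // lerD // ler_wpM2l //;lra.
Qed.

Lemma walk_norm_le b h K f M x : `|b| <= 1 -> (forall y, `|f y| <= M) -> `|walk b h K f x| <= M.
move=> b1 fM;have H y : - M <= f y <= M by rewrite -ler_norml.
rewrite ler_norml -(walk_cst b h K (- M) x) -[in X in _ && X](walk_cst b h K M x).
by apply/andP;split;apply: walk_le=> // y;have /andP[] := H y.
Qed.

(** Cauchy-Schwarz against the density of the biased walk with respect to the symmetric one: a step
    has density 1 + b or 1 - b, with second moment 1 + b^2. *)
Lemma walk_sqr_le b h K f x : walk b h K f x ^+ 2 <= (1 + b ^+ 2) ^+ K * walk 0 h K (fun y => f y ^+ 2) x.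
elim: K x=> [|K IH] x /=;first by lra.
have := IH (x + h);have := IH (x - h).
set A := walk b h K f _;set B := walk b h K f _.
set A' := walk 0 _ _ _ _;set B' := walk 0 _ _ _ _ => h1 h2.
have b0 : 0 < 1 + b ^+ 2 by rewrite ltr_wpDr ?sqr_ge0.
rewrite [(1 + b ^+ 2) ^+ K.+1]exprS addr0 subr0 !mul1r.
rewrite (le_trans (y := (1 + b ^+ 2) * (2^-1 * (B ^+ 2 + A ^+ 2)))) //;last first.
 by rewrite -[leRHS]mulrA ler_pM2l // [leRHS]mulrCA ler_pM2l ?invr_gt0 // mulrDr lerD.
by have := sqr_ge0 ((1 + b) * A - (1 - b) * B);nra.
Qed.

Lemma walk_quadratic h K u v x : walk 0 h K (fun y => u + v * y ^+ 2) x = u + v * (x ^+ 2 + K%:R * h ^+ 2).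
elim: K x=> [|K IH] x /=;first by lra.
by rewrite !IH -natr1;field.
Qed.

(** With q = s h, a step multiplies the exponential by cosh q, and cosh q <= 1 / (1 - q^2) <= exp(2
    q^2) as long as q^2 <= 1/2. *)
Lemma walk_exp_le h K f u s x : (s * h) ^+ 2 <= 2^-1 -> 0 <= u -> (forall y, f y <= u * expR (s * y)) ->
 walk 0 h K f x <= u * expR (s * x + 2 * s ^+ 2 * h ^+ 2 * K%:R).
move=> sh u0 fu;elim: K x=> [|K IH] x /=;first by rewrite mulr0 addr0.
set q := s * h in sh.
rewrite addr0 subr0 !mul1r.
have ch : expR q + expR (- q) <= 2 * expR (2 * q ^+ 2).
 have q1 : `|q| < 1.
  rewrite -ltr_sqr ?nnegrE //. by rewrite real_normK ?num_real // expr1n (le_lt_trans sh) // invf_lt1 ?ltr1n.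
 move: q1;rewrite ltr_norml=> /andP[q1 q2]. have e1 : expR q <= (1 - q)^-1.
  rewrite -[q]opprK expRN lef_pV2 ?posrE ?expR_gt0 //;last lra. by have := expR_ge1Dx (- q);lra.
 have e2 : expR (- q) <= (1 + q)^-1.
  by rewrite expRN lef_pV2 ?posrE ?expR_gt0 ?expR_ge1Dx //;lra.
 have e3 := expR_ge1Dx (2 * q ^+ 2). rewrite (le_trans (lerD e1 e2)) //.
 have -> : (1 - q)^-1 + (1 + q)^-1 = 2 / (1 - q ^+ 2).
  by field;rewrite ?subr_eq0 ?addr_eq0;apply/and3P;split;apply/eqP=> H;nra.
 by rewrite ler_pM2l // -[leLHS]mul1r ler_pdivrMr;nra.
rewrite (le_trans (y := 2^-1 * (u * expR (s * (x + h) + 2 * s ^+ 2 * h ^+ 2 * K%:R) +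
  u * expR (s * (x - h) + 2 * s ^+ 2 * h ^+ 2 * K%:R)))) //.
 by rewrite ler_pM2l ?invr_gt0 // lerD.
set E := 2 * s ^+ 2 * h ^+ 2.
have -> : s * (x + h) + E * K%:R = s * x + E * K%:R + q by rewrite /q;ring.
have -> : s * (x - h) + E * K%:R = s * x + E * K%:R - q by rewrite /q;ring.
have -> : s * x + E * K.+1%:R = s * x + E * K%:R + 2 * q ^+ 2.
 by rewrite /E /q -natr1;ring.
rewrite ![expR (s * x + E * K%:R + _)]expRD.
set Y := expR (s * x + E * K%:R);have Y0 : 0 < Y by exact: expR_gt0.
by have := mulr_ge0 u0 (ltW Y0);nra.
Qed.

Lemma walk_cos b h K c e x : walk b h K (fun y => cos (c + e * y)) x =
 Re ((cos (e * h) +i* (b * sin (e * h)))%C ^+ K * cis (c + e * x)).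
elim: K x=> [|K IH] x;first by rewrite mul1r.
rewrite [LHS]/=.
rewrite !IH exprSr;set W := _ K.
have -> : c + e * (x + h) = c + e * x + e * h by ring.
have -> : c + e * (x - h) = c + e * x - e * h by ring.
case: W=> W1 W2 /=.
rewrite cosD (cosD (c + e * x) ).
rewrite (sinD (c + e * x) ) (sinD (c + e * x) ) !cosN !sinN.
by simpc=> /=;field.
Qed.

(** With this step size K + 1 symmetric steps have variance 1, and the bias [t * h K] gives them the
    mean [t]. *)
Let h K : R := (Num.sqrt K.+1%:R)^-1.

Lemma step_gt0 K : 0 < h K.
by rewrite invr_gt0 sqrtr_gt0 ltr0n. Qed.

Lemma step_sqr K : K.+1%:R * h K ^+ 2 = 1.
by rewrite exprVn sqr_sqrtr // divff // pnatr_eq0. Qed.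

Lemma step_le1 K : h K <= 1.
rewrite invf_le1 // -[leLHS]sqrtr1 ler_sqrt //.
by rewrite ler1n.
Qed.

Lemma cvg_step : h K @[K --> \oo] --> (0 : R).
rewrite -[0]sqrtr0;have -> : (fun K => h K) = fun K => Num.sqrt (K.+1%:R^-1).
 by ext K;rewrite /h sqrtrV.
apply: cvg_comp;last exact: sqrt_continuous.
exact: cvg_harmonic.
Qed.

(** The central limit theorem by comparison of single steps: [w] and [v] differ by O(h^4), and the
    power K + 1 of numbers of modulus at most 1 magnifies this by h^-2 at most. *)
Lemma walk_cos_cvg t c e : `|t| <= 1 -> walk (t * h K) (h K) K.+1 (fun y => cos (c + e * y)) 0 @[K --> \oo] -->
 expR (- (e ^+ 2 / 2)) * cos (c + t * e).
(* Taylor remainders of the real part of a step, then, in parentheses, of its imaginary part. *)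
move=> t1;pose D := e ^+ 4 / 8 + e ^+ 4 / 4 + (t * e) ^+ 2 / 2 +
 (`|t| * `|e| ^+ 3 / 2 + `|t * e| ^+ 3 / 2 + e ^+ 2 / 2 * `|t * e|).
have e4 : 0 <= e ^+ 4 by rewrite exprn_even_ge0.
have D0 : 0 <= D.
 have p1 : 0 <= (t * e) ^+ 2 by exact: sqr_ge0. have p2 : 0 <= `|t| * `|e| ^+ 3 by [].
 have p3 : 0 <= `|t * e| ^+ 3 by [].
 have p4 : 0 <= e ^+ 2 / 2 * `|t * e| by apply: mulr_ge0 => //;apply: mulr_ge0=> //;exact: sqr_ge0.
 by rewrite /D;lra.
suff H K : `|walk (t * h K) (h K) K.+1 (fun y => cos (c + e * y)) 0 -
  expR (- (e ^+ 2 / 2)) * cos (c + t * e)| <= D * h K.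
 apply/cvgrPdist_le=> eps eps0. have D1 : 0 < D + 1 by lra. move/cvgrPdist_le: cvg_step=> /(_ _ (divr_gt0 eps0 D1)).
 apply: filterS=> K;rewrite sub0r normrN (gtr0_norm (step_gt0 K))=> hK.
 rewrite distrC (le_trans (H K));move: hK;rewrite ler_pdivlMr // mulrDr mulr1 mulrC. by have := step_gt0 K;lra.
have hh := step_gt0 K;have h1 := step_le1 K;have hK := step_sqr K.
set hh' := h K in hh h1 hK *;move: hh' hh h1 hK=> a a0 a1 aK.
rewrite walk_cos mulr0 addr0.
set w : R[i] := (_ +i* _)%C.
pose E := expR (- ((e * a) ^+ 2 / 2)).
pose v : R[i] := E%:C%C * cis (t * e * a ^+ 2).
have vK : v ^+ K.+1 = (expR (- (e ^+ 2 / 2)))%:C%C * cis (t * e).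
 rewrite exprMn -rmorphXn /= -expRM_natl -cisMn -[t * e * a ^+ 2 *+ _]mulr_natl.
 congr ((expR _)%:C%C * _);last by rewrite mulrCA aK mulr1.
 transitivity (- (K.+1%:R * a ^+ 2 * e ^+ 2 / 2));first by ring. by rewrite aK mul1r.
have E1 : E <= 1 by rewrite -expR0 ler_expR oppr_le0 mulr_ge0 ?sqr_ge0.
have E0 : 0 < E by exact: expR_gt0.
have cs x : `|cos x| <= 1 by exact: cos_bounded.
have w1 : `|w| <= 1.
 rewrite lecR -[leRHS]sqrtr1 ler_sqrt // -(cos2Dsin2 (e * a)) lerD2l. rewrite exprMn ler_piMl ?sqr_ge0 //.
 rewrite -(real_normK (num_real _)) expr_le1 // normrM. by rewrite mulr_ile1 // gtr0_norm.
have v1 : `|v| <= 1.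
 rewrite normrM norm_cis mulr1 complex_normE expr0n addr0 sqrtr_sqr gtr0_norm //. by rewrite lecR.
have dRe : `|cos (e * a) - E * cos (t * e * a ^+ 2)| <= (e ^+ 4 / 8 + e ^+ 4 / 4 + (t * e) ^+ 2 / 2) * a ^+ 4.
 have k1 := cos_quartic_le (e * a). have k2 : `|E - (1 - (e * a) ^+ 2 / 2)| <= ((e * a) ^+ 2 / 2) ^+ 2.
  by apply: expRN_le;rewrite mulr_ge0 ?sqr_ge0.
 have k3 : `|E * cos (t * e * a ^+ 2) - E| <= (t * e * a ^+ 2) ^+ 2 / 2.
  rewrite -[X in - X]mulr1 -mulrBr normrM (gtr0_norm E0) distrC.
  by rewrite (le_trans _ (cos_sub1_le _)) // ler_piMl.
 move: k1 k2 k3;rewrite !ler_norml=> /andP[? ?] /andP[? ?] /andP[? ?]. apply/andP;split;nra.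
have dIm : `|t * a * sin (e * a) - E * sin (t * e * a ^+ 2)| <=
  (`|t| * `|e| ^+ 3 / 2 + `|t * e| ^+ 3 / 2 + e ^+ 2 / 2 * `|t * e|) * a ^+ 4.
 have k1 : `|t * a * sin (e * a) - t * e * a ^+ 2| <= `|t| * `|e| ^+ 3 / 2 * a ^+ 4.
  have -> : t * a * sin (e * a) - t * e * a ^+ 2 = t * a * (sin (e * a) - e * a) by ring.
  rewrite !normrM (gtr0_norm a0). have := sin_sub_id_le (e * a);rewrite normrM (gtr0_norm a0)=> k.
  by rewrite (le_trans (ler_wpM2l _ k)) ?mulr_ge0 ?(ltW a0) //;apply: eq_ler;ring.
 have k2 : `|sin (t * e * a ^+ 2) - t * e * a ^+ 2| <= `|t * e| ^+ 3 / 2 * a ^+ 4.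
  rewrite (le_trans (sin_sub_id_le _)) // normrM (@ger0_norm _ (a ^+ 2)) ?sqr_ge0 //.
  rewrite (_ : _ / 2 = `|t * e| ^+ 3 / 2 * a ^+ 6);last by field.
  by rewrite ler_wpM2l ?divr_ge0 ?exprn_ge0 // ler_wiXn2l // ltW.
 have k3 : `|E * sin (t * e * a ^+ 2) - sin (t * e * a ^+ 2)| <= e ^+ 2 / 2 * `|t * e| * a ^+ 4.
  rewrite -[X in - X]mul1r -mulrBl normrM distrC (@ger0_norm _ (1 - E)) ?subr_ge0 //.
  have u1 : 1 - E <= e ^+ 2 / 2 * a ^+ 2.
   by have := expR_ge1Dx (- ((e * a) ^+ 2 / 2));rewrite -/E exprMn;lra.
  have u2 : `|sin (t * e * a ^+ 2)| <= `|t * e| * a ^+ 2.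
   by rewrite (le_trans (sin_le_id _)) // normrM (@ger0_norm _ (a ^+ 2)) ?sqr_ge0.
  rewrite (le_trans (ler_pM _ _ u1 u2)) ?subr_ge0 //. by apply: eq_ler;ring.
 move: k1 k2 k3;rewrite !mulrDl !ler_norml=> /andP[? ?] /andP[? ?] /andP[? ?]. apply/andP;split;lra.
have wv : `|w - v| <= (D * a ^+ 4)%:C%C.
 have -> : w - v = ((cos (e * a) - E * cos (t * e * a ^+ 2)) +i*
 (t * a * sin (e * a) - E * sin (t * e * a ^+ 2)))%C by simpc.
 by rewrite (le_trans (complex_norm_le _ _)) // lecR /D mulrDl lerD.
have -> : expR (- (e ^+ 2 / 2)) * cos (c + t * e) = Re (v ^+ K.+1 * cis c).
 by rewrite vK -mulrA -cisD /cis addrC;simpc.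
rewrite -(raddfB (@complex.Re R)) -mulrBl.
have : `|(w ^+ K.+1 - v ^+ K.+1) * cis c| <= (D * a)%:C%C.
 rewrite normrM norm_cis mulr1 (le_trans (complex_expr_sub_le _ w1 v1)) //.
 rewrite (le_trans (ler_wpM2l _ wv)) // -[K.+1%:R](rmorph_nat (@real_complex R)) -rmorphM lecR.
 have -> : K.+1%:R * (D * a ^+ 4) = D * (a ^+ 2 * (K.+1%:R * a ^+ 2)) by ring.
 by rewrite aK mulr1 ler_wpM2l // expr2 ger_pMl.
case: (_ * cis c)=> p q;rewrite lecR /=;apply: le_trans.
by rewrite -sqrtr_sqr ler_sqrt ?addr_ge0 ?sqr_ge0 // lerDl sqr_ge0.
Qed.

End BiasedWalk.

Lemma ler_lim_ultra R (U : set_system nat) (UU : UltraFilter U) (u v : nat -> R) (a b : R) :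
 u n @[n --> U] --> a -> v n @[n --> U] --> b -> (forall n, u n <= v n) -> a <= b.
move=> ua vb uv;rewrite -subr_ge0;apply: (ultra_ge UU (cvgB vb ua))=> n.
by rewrite /= subr_ge0.
Qed.

Definition bdd R T (f : T -> R) := exists M : R, forall x, `|f x| <= M.

Lemma bdd_lin R T (u v : R) (f g : T -> R) : bdd f -> bdd g -> bdd (fun x => u * f x + v * g x).
move=> [M HM] [N HN];exists (`|u| * M + `|v| * N) => x.
by rewrite (le_trans (ler_normD _ _)) // !normrM lerD // ler_wpM2l.
Qed.

(** * The Gaussian functional *)

Section GaussianFunctional.
Variables (R : realType) (U : set_system nat).
Hypotheses (UU : UltraFilter U) (Uoo : forall n, U [set m | (n <= m)%N]).
Implicit Types (f g : R -> R) (t c e s x : R).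

Let step K : R := (Num.sqrt K.+1%:R)^-1.
Let walk_at t f K := walk (t * step K) (step K) K.+1 f 0.

(* The normal law with mean [t], as a limit of random walks along an ultrafilter:
  a functional on all bounded functions, measurable or not. *)
Definition gauss1 t f : R := lim (walk_at t f K @[K --> U]).

Let bias_le1 t K : `|t| <= 1 -> `|t * step K| <= 1.
move=> t1;rewrite normrM mulr_ile1 // gtr0_norm;first exact: step_le1.
exact: step_gt0.
Qed.

Lemma gauss1_cvg t f : `|t| <= 1 -> bdd f -> walk_at t f K @[K --> U] --> gauss1 t f.
move=> t1 [M HM];have [l Hl] := @ultra_lim _ _ UU (walk_at t f) M
 (fun K => walk_norm_le (step K) K.+1 0 (bias_le1 K t1) HM).
by apply/cvg_ex;exists l.
Qed.

Lemma gauss1_lin t u v f g : `|t| <= 1 -> bdd f -> bdd g ->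
 gauss1 t (fun x => u * f x + v * g x) = u * gauss1 t f + v * gauss1 t g.
move=> t1 bf bg;apply: (ultra_eq UU (gauss1_cvg t1 (bdd_lin u v bf bg))).
rewrite (_ : walk_at t _ = fun K => u * walk_at t f K + v * walk_at t g K).
 by apply: cvgD;apply: cvgMr;exact: gauss1_cvg.
by ext K;exact: walk_lin.
Qed.

Lemma gauss1_cst t c : `|t| <= 1 -> gauss1 t (fun=> c) = c.
move=> t1;have bc : bdd (fun _ : R => c) by exists `|c|.
apply: (ultra_eq UU (gauss1_cvg t1 bc)).
rewrite (_ : walk_at t _ = fun=> c);first exact: cvg_cst.
by ext K;exact: walk_cst.
Qed.

Lemma gauss1_le t f g : `|t| <= 1 -> bdd f -> bdd g -> (forall x, f x <= g x) -> gauss1 t f <= gauss1 t g.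
move=> t1 bf bg fg;apply: (ler_lim_ultra UU (gauss1_cvg t1 bf) (gauss1_cvg t1 bg))=> K.
by apply: walk_le=> //;exact: bias_le1.
Qed.

Lemma gauss1_sqr_le t f : `|t| <= 1 -> bdd f -> gauss1 t f ^+ 2 <= expR (t ^+ 2) * gauss1 0 (fun x => f x ^+ 2).
move=> t1 bf;have [M HM] := bf.
have bf2 : bdd (fun x => f x ^+ 2).
 by exists (M ^+ 2)=> x;rewrite normrX ler_sqr ?nnegrE // (le_trans _ (HM x)).
have o1 : `|0 : R| <= 1 by rewrite normr0.
have c1 : walk_at t f K ^+ 2 @[K --> U] --> gauss1 t f ^+ 2.
 by rewrite expr2;under eq_fun do rewrite expr2;apply: cvgM;exact: gauss1_cvg.
have c2 : expR (t ^+ 2) * walk_at 0 (fun x => f x ^+ 2) K @[K --> U] -->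
  expR (t ^+ 2) * gauss1 0 (fun x => f x ^+ 2).
 by apply: cvgMr;exact: gauss1_cvg.
apply: (ler_lim_ultra UU c1 c2)=> K;rewrite /walk_at (le_trans (walk_sqr_le _ _ _ _ _)) //.
rewrite mul0r ler_wpM2r //.
 have := @walk_le R 0 (step K) K.+1 (fun=> 0) (fun y => f y ^+ 2) 0 o1.
 by rewrite walk_cst;apply=> y;exact: sqr_ge0.
rewrite exprMn (_ : expR (t ^+ 2) = expR (step K ^+ 2 * t ^+ 2) ^+ K.+1);last first.
 by rewrite -expRM_natl mulrA step_sqr mul1r.
rewrite lerXn2r ?nnegrE //;first by rewrite addr_ge0 // mulr_ge0 ?sqr_ge0.
by rewrite mulrC expR_ge1Dx.
Qed.

Lemma gauss1_cos t c e : `|t| <= 1 -> gauss1 t (fun x => cos (c + e * x)) = expR (- (e ^+ 2 / 2)) * cos (c + t * e).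
move=> t1;have bc : bdd (fun x : R => cos (c + e * x)).
 by exists 1=> x;exact: cos_bounded.
apply: (ultra_eq UU (gauss1_cvg t1 bc));apply: (cvg_along UU Uoo).
exact: walk_cos_cvg.
Qed.

Lemma gauss1_quadratic u v f : bdd f -> (forall x, f x <= u + v * x ^+ 2) -> gauss1 0 f <= u + v.
have o1 : `|0 : R| <= 1 by rewrite normr0.
move=> bf H;apply: (ultra_le UU (gauss1_cvg o1 bf))=> K.
rewrite /walk_at mul0r (le_trans (walk_le _ _ _ o1 H)) //.
by rewrite walk_quadratic expr0n add0r step_sqr mulr1.
Qed.

Lemma gauss1_exp u s f : 0 <= u -> bdd f -> (forall x, f x <= u * expR (s * x)) ->
 gauss1 0 f <= u * expR (2 * s ^+ 2).
have o1 : `|0 : R| <= 1 by rewrite normr0.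
move=> u0 bf H;have c1 := gauss1_cvg o1 bf.
apply: (cvgr_to_le c1);pose N := Num.truncn (2 * s ^+ 2).
(* From K >= 2 s^2 on, the step size meets the requirement (s h)^2 <= 1/2 of [walk_exp_le]. *)
apply: filterS (Uoo N)=> K /= NK.
rewrite /walk_at mul0r (le_trans (walk_exp_le _ _ _ u0 H)) //.
 have h1 : 2 * s ^+ 2 <= K.+1%:R.
  by rewrite (le_trans (ltW (truncnS_gt _))) // ler_nat ltnS;exact: NK.
 have := step_sqr R K;rewrite -/(step K) exprMn;have := sqr_ge0 (step K).
 by move: h1;set q := step K ^+ 2;set k := K.+1%:R;nra.
by rewrite mulr0 add0r -mulrA [step K ^+ 2 * _]mulrC step_sqr mulr1.
Qed.

Implicit Types (F G : (nat -> R) -> R) (ts : nat -> R).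

Definition set_coord n x (z : nat -> R) k := if k == n then x else z k.

(** Independent normal coordinates of variance 1 with means [ts k], integrated one after the other;
    the coordinates from [n] on are 0. *)
Fixpoint gauss n ts F : R := if n is n'.+1 then
  gauss1 (ts n') (fun x => gauss n' ts (fun z => F (set_coord n' x z))) else F (fun=> 0).

Lemma gauss_prop n ts : (forall k, `|ts k| <= 1) -> [/\ forall F M, (forall z, `|F z| <= M) -> `|gauss n ts F| <= M,
   forall u v F G, bdd F -> bdd G -> gauss n ts (fun z => u * F z + v * G z) = u * gauss n ts F + v * gauss n ts G,
   forall F G, bdd F -> bdd G -> (forall z, F z <= G z) -> gauss n ts F <= gauss n ts G &
   forall c, gauss n ts (fun=> c) = c].
move=> t1;elim: n=> [|n [IH1 IH2 IH3 IH4]].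
 by split=> //=.
have bx F x : bdd F -> bdd (fun z => F (set_coord n x z)) by move=> [M H];exists M.
have bg F : bdd F -> bdd (fun x => gauss n ts (fun z => F (set_coord n x z))).
 by move=> [M H];exists M=> x;exact: IH1.
split=> [F M FM|u v F G bF bG|F G bF bG FG|c] /=.
- have bF : bdd F by exists M.
 have H x : - M <= gauss n ts (fun z => F (set_coord n x z)) <= M.
  by rewrite -ler_norml;apply: IH1.
 have bc a : bdd (fun _ : R => a) by exists `|a|.
 rewrite ler_norml -(gauss1_cst (- M) (t1 n)) -[in X in _ && X](gauss1_cst M (t1 n)).
 by apply/andP;split;apply: gauss1_le=> //;try exact: bg;move=> x;have /andP[] := H x.
- rewrite -gauss1_lin //;try exact: bg.
 by congr gauss1;ext x;rewrite IH2 //;exact: bx.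
- by apply: gauss1_le=> //;try exact: bg;move=> x;apply: IH3=> //;exact: bx.
- by under eq_fun do rewrite IH4;exact: gauss1_cst.
Qed.

(** The quantitative form of absolute continuity under a shift of the mean: the density has second
    moment exp(|ts|^2). All later uses of Cameron-Martin rest on this. *)
Lemma gauss_sqr_le n ts F : (forall k, `|ts k| <= 1) -> bdd F ->
 gauss n ts F ^+ 2 <= expR (\sum_(k < n) ts k ^+ 2) * gauss n (fun=> 0) (fun z => F z ^+ 2).
move=> t1;have o1 k : `|(fun _ : nat => 0 : R) k| <= 1 by rewrite normr0.
elim: n F=> [|n IH] F bF /=;first by rewrite big_ord0 expR0 mul1r.
have [p1 p2 p3 p4] := gauss_prop n t1;have [q1 q2 q3 q4] := gauss_prop n o1.
have [M HM] := bF.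
have M0 : 0 <= M by rewrite (le_trans _ (HM ( 0))).
have b1 : bdd (fun x => gauss n ts (fun z => F (set_coord n x z))).
 by exists M=> x;exact: p1.
have F2 z : `|F z ^+ 2| <= M ^+ 2 by rewrite normrX ler_sqr.
have b2 : bdd (fun x => gauss n ts (fun z => F (set_coord n x z)) ^+ 2).
 by exists (M ^+ 2)=> x;rewrite normrX ler_sqr // p1.
have b3 : bdd (fun x => gauss n (fun=> 0) (fun z => F (set_coord n x z) ^+ 2)).
 by exists (M ^+ 2)=> x;apply: q1.
rewrite (le_trans (gauss1_sqr_le (t1 n) b1)) //.
rewrite big_ord_recr /= expRD [expR (\sum_(i < n) _) * _]mulrC -mulrA ler_wpM2l //.
have z1 : `|0 : R| <= 1 by rewrite normr0.
pose Es := expR (\sum_(k < n) ts k ^+ 2).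
have := gauss1_lin Es 0 z1 b3 b3;rewrite mul0r addr0=> <-.
apply: gauss1_le=> //;first exact: bdd_lin.
by move=> x;rewrite mul0r addr0;apply: IH;exists M.
Qed.

Lemma gauss_cos n ts c (e : nat -> R) : (forall k, `|ts k| <= 1) ->
 gauss n ts (fun z => cos (c + \sum_(k < n) z k * e k)) =
 expR (- (\sum_(k < n) e k ^+ 2 / 2)) * cos (c + \sum_(k < n) ts k * e k).
move=> t1;elim: n c=> [|n IH] c /=;first by rewrite !big_ord0 oppr0 expR0 mul1r.
have E x : gauss n ts (fun z => cos (c + \sum_(k < n.+1) set_coord n x z k * e k)) =
  expR (- (\sum_(k < n) e k ^+ 2 / 2)) * cos ((c + \sum_(k < n) ts k * e k) + e n * x).
 rewrite addrAC -IH;congr gauss;ext z;rewrite big_ord_recr /=.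
 rewrite {2}/set_coord eqxx addrA addrAC [x * _]mulrC;congr (cos (_ _)). by eqsum k;rewrite /set_coord ltn_eqF.
under eq_fun do rewrite E.
have bc a b : bdd (fun x : R => cos (a + b * x)).
 by exists 1=> x;exact: cos_bounded.
have := gauss1_lin (expR (- \sum_(k < n) e k ^+ 2 / 2)) 0 (t1 n) (bc (c + \sum_(k < n) ts k * e k) (e n)) (bc 0 0).
under eq_fun do rewrite mul0r addr0;move=> ->;rewrite mul0r addr0 gauss1_cos //.
by rewrite mulrA -expRD !big_ord_recr /= opprD addrA.
Qed.

Let zero1 k : `|(fun _ : nat => 0 : R) k| <= 1. by rewrite normr0. Qed.

Lemma gauss_quadratic n F u (v : nat -> R) : bdd F -> (forall z, F z <= u + \sum_(k < n) v k * z k ^+ 2) ->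
 gauss n (fun=> 0) F <= u + \sum_(k < n) v k.
elim: n F u=> [|n IH] F u bF H /=;first by rewrite (le_trans (H _)) // !big_ord0.
have [q1 q2 q3 q4] := gauss_prop n zero1.
have [M HM] := bF;rewrite big_ord_recr /= addrA.
apply: gauss1_quadratic;first by exists M=> x;exact: q1.
move=> x;rewrite -addrA [_ + v n * _]addrC addrA;apply: IH;first by exists M.
move=> z;rewrite (le_trans (H _)) // big_ord_recr /= {2}/set_coord eqxx.
rewrite -addrA lerD2l addrC lerD2l;lesum k.
by rewrite /set_coord ltn_eqF.
Qed.

Lemma gauss_exp n F c (e : nat -> R) : bdd F -> (forall z, F z <= expR (c + \sum_(k < n) z k * e k)) ->
 gauss n (fun=> 0) F <= expR (c + 2 * \sum_(k < n) e k ^+ 2).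
elim: n F c=> [|n IH] F c bF H /=.
 by rewrite (le_trans (H _)) // !big_ord0 mulr0.
have [q1 q2 q3 q4] := gauss_prop n zero1;have [M HM] := bF.
rewrite big_ord_recr /= mulrDr addrA expRD.
apply: gauss1_exp;[exact: expR_ge0|by exists M => x;exact: q1|move=> x].
rewrite -expRD addrAC;apply: IH;first by exists M.
move=> z;rewrite (le_trans (H _)) // big_ord_recr /= {2}/set_coord eqxx ler_expR.
rewrite -addrA lerD2l addrC [x * _]mulrC lerD2l;lesum k.
by rewrite /set_coord ltn_eqF.
Qed.

End GaussianFunctional.

(** * Trigonometric approximation with a global bound *)

Section TrigonometricApproximation.
Variables (R : realType) (Y : zmodType) (S : set Y).
Hypothesis S_subgroup : subgroup S.
Implicit Type chi : Y -> R[i].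

(** Characters of [Y] as an abstract group, so as to cover both evaluations at points of X and
    exponentials of arbitrary additive functions on [Y]. *)
Definition unitary_hom chi := (forall y, `|chi y| = 1) /\ {morph chi : x y / x + y >-> x * y}.

Definition trig_eval (L : seq (R[i] * Y)) chi := \sum_(p <- L) Re (p.1 * chi p.2).

Definition trig_poly (f : (Y -> R[i]) -> R) := exists L,
 (forall p, p \in L -> S p.2) /\ forall chi, unitary_hom chi -> f chi = trig_eval L chi.

Lemma unitary_hom0 chi : unitary_hom chi -> chi 0 = 1.
move=> [n1 cD];have c0 : chi 0 != 0 by rewrite -normr_eq0 n1.
by apply: (mulfI c0);rewrite -cD addr0 mulr1.
Qed.

Lemma unitary_homN chi y : unitary_hom chi -> chi (- y) = (chi y)^*.
move=> hc;have [n1 cD] := hc;have c0 : chi y != 0 by rewrite -normr_eq0 n1.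
apply: (mulfI c0);rewrite -cD subrr unitary_hom0 //.
by rewrite -normCK n1 expr1n.
Qed.

Lemma S0 : S 0. by case: S_subgroup. Qed.
Lemma SN y : S y -> S (- y).
by move=> Sy;rewrite -sub0r;apply: S_subgroup.2=> //;exact: S0. Qed.
Lemma SD x y : S x -> S y -> S (x + y).
by move=> Sx Sy;rewrite -[y]opprK;apply: S_subgroup.2=> //;exact: SN. Qed.

Lemma trig_poly_cst c : trig_poly (fun=> c).
exists [:: (c%:C%C, 0)];split;first by move=> p;rewrite inE=> /eqP ->;exact: S0.
by move=> chi hc;rewrite /trig_eval big_seq1 /= unitary_hom0 // mulr1.
Qed.

Lemma trig_poly_char (u : R[i]) y : S y -> trig_poly (fun chi => Re (u * chi y)).
move=> Sy;exists [:: (u, y)];split;first by move=> p;rewrite inE=> /eqP ->.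
by move=> chi _;rewrite /trig_eval big_seq1.
Qed.

Lemma trig_poly_add f g : trig_poly f -> trig_poly g -> trig_poly (fun chi => f chi + g chi).
move=> [L [L1 L2]] [L' [L1' L2']];exists (L ++ L');split.
 by move=> p;rewrite mem_cat=> /orP[/L1|/L1'].
by move=> chi hc;rewrite /trig_eval big_cat /= L2 // L2'.
Qed.

Lemma trig_poly_sum I (s : seq I) (f : I -> (Y -> R[i]) -> R) :
 (forall i, trig_poly (f i)) -> trig_poly (fun chi => \sum_(i <- s) f i chi).
move=> tf;elim: s=> [|i s IH].
 by under eq_fun do rewrite big_nil;exact: trig_poly_cst.
by under eq_fun do rewrite big_cons;exact: trig_poly_add.
Qed.

Lemma trig_poly_ext f g : trig_poly f -> (forall chi, unitary_hom chi -> g chi = f chi) -> trig_poly g.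
by move=> [L [L1 L2]] gf;exists L;split=> // chi hc;rewrite gf // L2. Qed.

Lemma Re_mul (a b : R[i]) : Re a * Re b = 2^-1 * (Re (a * b) + Re (a * b^*)).
by case: a b=> [a1 a2] [b1 b2] /=;field. Qed.

Lemma trig_poly_mul_in f g : trig_poly f -> trig_poly g -> trig_poly (fun chi => f chi * g chi).
move=> [L [L1 L2]] [L' [L1' L2']].
exists (flatten [seq flatten [seq [:: (2^-1 * (p.1 * q.1), p.2 + q.2);
              (2^-1 * (p.1 * q.1^*), p.2 - q.2)] | q <- L'] | p <- L]);split.
 move=> r /flattenP [_ /mapP [p pL ->] /flattenP [_ /mapP [q qL ->]]].
 rewrite !inE=> /orP[] /eqP -> /=;first by apply: SD;[exact: L1|exact: L1'].
 by apply: S_subgroup.2;[exact: L1|exact: L1'].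
move=> chi hc;have [n1 cD] := hc;rewrite L2 // L2' // /trig_eval big_flatten big_map mulr_suml.
eqsum p;rewrite big_flatten big_map mulr_sumr;eqsum q.
rewrite !big_cons big_nil /= addr0 !cD unitary_homN // Re_mul.
have R2 (z : R[i]) : 2^-1 * Re z = Re (2^-1 * z).
 rewrite (_ : 2^-1 = (2^-1 : R)%:C%C);first by case: z=> a b /=;rewrite mul0r subr0. by rewrite fmorphV rmorph_nat.
rewrite mulrDr !R2;congr (Re _ + Re _);first by ring.
by rewrite rmorphM;ring.
Qed.

Lemma trig_poly_prod I (s : seq I) (f : I -> (Y -> R[i]) -> R) :
 (forall i, trig_poly (f i)) -> trig_poly (fun chi => \prod_(i <- s) f i chi).
move=> tf;elim: s=> [|i s IH].
 by under eq_fun do rewrite big_nil;exact: trig_poly_cst.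
by under eq_fun do rewrite big_cons;exact: trig_poly_mul_in.
Qed.

Definition cos_poly k (f : R[i] -> R) := exists c : nat -> R, forall w : R[i],
 `|w| = 1 -> f w = \sum_(m < k.+1) c m * Re (w ^+ m).

Lemma cos_poly_lin k a b f g : cos_poly k f -> cos_poly k g -> cos_poly k (fun w => a * f w + b * g w).
move=> [c Hc] [d Hd];exists (fun m => a * c m + b * d m)=> w w1.
rewrite Hc // Hd // !mulr_sumr -big_split /=;eqsum m;ring.
Qed.

Lemma cos_poly_mono k m : (m <= k)%N -> cos_poly k (fun w => Re (w ^+ m)).
move=> mk;exists (fun j => (j == m)%:R)=> w _.
have mk' : (m < k.+1)%N by [].
rewrite (bigD1 (Ordinal mk')) //= eqxx mul1r big1 ?addr0 // => j jm.
by rewrite -(inj_eq val_inj) /= in jm;rewrite (negPf jm) mul0r.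
Qed.

Lemma cos_poly_sum k (I : Type) (s : seq I) (f : I -> R[i] -> R) :
 (forall i, cos_poly k (f i)) -> cos_poly k (fun w => \sum_(i <- s) f i w).
move=> H;elim: s=> [|i s [c Hc]].
 exists 0=> w;rewrite big_nil big1 // => j _;exact: mul0r.
have [d Hd] := cos_poly_lin 1 1 (H i) (ex_intro _ c Hc);exists d=> w w1.
by rewrite -Hd // big_cons !mul1r.
Qed.

Lemma one_add_Re_pow k : cos_poly k (fun w => (1 + Re w) ^+ k).
elim: k=> [|k [c Hc]].
 by exists (fun=> 1)=> w _;rewrite expr0 big_ord_recl big_ord0 expr0 mulr1 addr0.
have H (m : 'I_k.+1) : cos_poly k.+1 (fun w => Re (w ^+ m) * (1 + Re w)).
 have mk := ltn_ord m;case: m mk=> -[|m] mk0 mk /=.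
  have [d Hd] := cos_poly_lin 1 1 (@cos_poly_mono k.+1 0 isT) (@cos_poly_mono k.+1 1 isT).
  by exists d=> w w1;rewrite -Hd // expr0 expr1 !mul1r.
 have [d Hd] := cos_poly_lin 2^-1 2^-1 (@cos_poly_mono k.+1 m.+2 mk)
  (@cos_poly_mono k.+1 m (leq_trans (leqnSn _) (ltnW mk))).
 have [d' Hd'] := cos_poly_lin 1 1 (@cos_poly_mono k.+1 m.+1 (ltnW mk)) (ex_intro _ d Hd).
 exists d'=> w w1;rewrite -Hd' //. have := unit_ReM (n := m.+1) (m := 1) w1 isT;rewrite expr1 addn1 subn1 /= => E.
 by rewrite !mul1r mulrDr mulr1;move: E;lra.
have [d Hd] := cos_poly_sum (index_enum 'I_k.+1) (fun m : 'I_k.+1 => cos_poly_lin (c m) 0 (H m) (H m)).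
exists d=> w w1;rewrite -Hd // exprSr Hc // mulr_suml;eqsum m.
by rewrite mul0r addr0 mulrA.
Qed.

(** A de la Vallee-Poussin kernel. (1 + Re w)^k has degree [k], so its sum over rotations by all
    (k+1)-st roots of unity is constant; dividing by that constant, which is at least 2^k, gives a
    partition of unity. *)
Lemma kernel_exists (k : nat) : exists kap : R[i] -> R, [/\ forall w, `|w| = 1 -> 0 <= kap w,
   forall w, `|w| = 1 -> \sum_(j < k.+1) kap (w * (root_unity R k.+1 j)^*) = 1,
   forall w, `|w| = 1 -> kap w <= ((1 + Re w) / 2) ^+ k & cos_poly k kap].
have [c Hc] := one_add_Re_pow k.
have n1 (w : R[i]) j : `|w| = 1 -> `|w * (root_unity R k.+1 j)^*| = 1.
 by move=> w1;rewrite normrM w1 norm_conjC norm_root_unity mulr1.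
have sumE w : `|w| = 1 -> \sum_(j < k.+1) (1 + Re (w * (root_unity R k.+1 j)^*)) ^+ k = k.+1%:R * c 0%N.
 move=> w1;under eq_bigr=> j do rewrite Hc ?n1 //.
 rewrite exchange_big (bigD1 ord0) //= [X in _ + X]big1 ?addr0=> [|m m0].
  by rewrite sumr_const card_ord mulr1 mulr_natl.
 rewrite -mulr_sumr;under eq_bigr do rewrite exprMn.
 rewrite -raddf_sum -mulr_sumr (_ : \sum_(i < k.+1) _ = 0) ?mulr0 //. under eq_bigr do rewrite -rmorphXn /=.
 rewrite -rmorph_sum sum_root_unity ?rmorph0 // ltn_ord andbT lt0n. by rewrite -(inj_eq val_inj) /= in m0.
have Re0 (w : R[i]) : `|w| = 1 -> 0 <= 1 + Re w.
 by move=> /unit_Re_le1;rewrite ler_norml=> /andP[];lra.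
pose s := k.+1%:R * c 0%N.
have s2 : 2 ^+ k <= s.
 rewrite /s -(sumE 1) ?normr1 // big_ord_recl (_ : root_unity R k.+1 ord0 = 1);last first.
  by rewrite /root_unity expr0.
 rewrite conjC1 mulr1 lerDl sumr_ge0 // => j;rewrite exprn_ge0 // Re0 // mul1r norm_conjC. exact: norm_root_unity.
have s0 : 0 < s by rewrite (lt_le_trans _ s2) // exprn_gt0.
exists (fun w => s^-1 * (1 + Re w) ^+ k);split.
- by move=> w w1;rewrite mulr_ge0 ?invr_ge0 ?exprn_ge0 ?Re0 // ltW.
- by move=> w w1;rewrite -mulr_sumr sumE // mulVf // gt_eqF.
- move=> w w1;rewrite expr_div_n mulrC ler_wpM2l ?exprn_ge0 ?Re0 //.
 by rewrite lef_pV2 // posrE exprn_gt0.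
- exists (fun m => s^-1 * c m)=> w w1;rewrite Hc // mulr_sumr.
 by eqsum m;rewrite mulrA.
Qed.

Lemma small_geometric (x c e : R) : 0 < x <= 1 -> 0 <= c -> 0 < e -> exists k, c * k.+1%:R * (1 - x) ^+ k <= e.
move=> /andP[x0 x1] c0 e0;pose k := (Num.truncn (8 * c / (x ^+ 2 * e))).+1.
exists k;have k0 : 0 < (k%:R : R) by [].
have q : (1 - x) ^+ k <= 4 / (k%:R * x) ^+ 2.
 have h1 : 1 - x <= expR (- x) by exact: expR_ge1Dx. rewrite (le_trans (lerXn2r k _ _ h1)) ?nnegrE //;first by lra.
 rewrite -expRM_natl mulrN expRN ler_pdivlMr ?mulr_gt0 //.
 rewrite mulrC ler_pdivrMr ?expR_gt0 // [k%:R * x]splitr expRD.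
 have := expR_ge1Dx (k%:R * x / 2);set E := expR _;set v := k%:R * x / 2.
 have v0 : 0 < v by rewrite !mulr_gt0 // invr_gt0. by nra.
have k2 : (k.+1%:R : R) <= 2 * k%:R.
 by rewrite -natr1 mulr2n mulrDl mul1r lerD2l ler1n.
have kc : 8 * c <= k%:R * (x ^+ 2 * e).
 by rewrite -ler_pdivrMr ?mulr_gt0 ?exprn_gt0 // ltW // truncnS_gt.
rewrite (le_trans (ler_wpM2l _ q)) ?mulr_ge0 //.
rewrite mulrA ler_pdivrMr ?mulr_gt0 //.
rewrite (le_trans (y := c * (2 * k%:R) * 4)) //.
 by rewrite ler_wpM2r // ler_wpM2l.
by rewrite exprMn;move: kc;nra.
Qed.

Lemma unit_dist_le (z w : R[i]) (d : R) : 0 <= d -> `|z| = 1 -> `|w| = 1 ->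
 1 - d ^+ 2 / 2 <= Re (z * w^*) -> `|z - w| <= d%:C%C.
move=> d0 /unit_complexE;case: z=> a b /= zE /unit_complexE;case: w=> p q /= wE.
rewrite mulrN opprK=> H.
have -> : (a +i* b)%C - (p +i* q)%C = ((a - p) +i* (b - q))%C by [].
rewrite lecR -[leRHS]ger0_norm // -sqrtr_sqr ler_sqrt ?sqr_ge0 //.
by move: H;nra.
Qed.

(** Interpolation on a grid of phases: a cell carries a value of [F] at some point of [Bs] in it, or
    0, and product kernels form the partition of unity. Convexity then gives the bound 1 at every
    unitary homomorphism, also far from [Bs], where exceptional sets of small mass have to be
    controlled later. *)
Lemma trig_approx (n : nat) (ys : 'I_n -> Y) (Bs : set (Y -> R[i]))
  (F : (Y -> R[i]) -> R) (d e : R) : 0 < d <= 1 -> 0 < e ->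
 (forall i, S (ys i)) -> (forall chi, Bs chi -> unitary_hom chi) -> (forall chi, Bs chi -> `|F chi| <= 1) ->
 (forall chi chi', Bs chi -> Bs chi' ->
   (forall i, `|chi (ys i) - chi' (ys i)| <= d%:C%C) -> `|F chi - F chi'| <= e) ->
 exists p, [/\ trig_poly p, forall chi, unitary_hom chi -> `|p chi| <= 1 &
  forall chi, Bs chi -> `|p chi - F chi| <= 2 * e].
(* A phase whose real part relative to a root of unity is at least 1 - 2 x lies within d / 2 of it;
   two points of one cell are therefore within [d]. *)
move=> /andP[d0 d1] e0 ysS Bh F1 Fd;pose x := d ^+ 2 / 16.
have x01 : 0 < x <= 1.
 by apply/andP;split;[rewrite divr_gt0 ?exprn_gt0|rewrite /x;nra].
have e4 : 0 < e / 2 by lra.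
have [k Hk] := small_geometric x01 (ler0n R n) e4.
have [kap [kap0 kap1 kapq [c Hc]]] := kernel_exists k.
pose rt (j : 'I_k.+1) := root_unity R k.+1 j.
pose cl (chi : Y -> R[i]) i j := 1 - 2 * x <= Re (chi (ys i) * (rt j)^*).
have n1 chi i j : unitary_hom chi -> `|chi (ys i) * (rt j)^*| = 1.
 by move=> [h1 _];rewrite normrM h1 norm_conjC norm_root_unity mulr1.
pose K chi (u : {ffun 'I_n -> 'I_k.+1}) := \prod_i kap (chi (ys i) * (rt (u i))^*).
have K0 chi u : unitary_hom chi -> 0 <= K chi u.
 by move=> hc;rewrite prodr_ge0 // => i _;apply/kap0/n1.
have K1 chi : unitary_hom chi -> \sum_u K chi u = 1.
 move=> hc;have [h1 _] := hc. have := bigA_distr_bigA (fun i j => kap (chi (ys i) * (rt j)^*)).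
 rewrite /K=> <-;rewrite big1 // => i _;exact: kap1.
have /choice [a Ha] : forall u : {ffun 'I_n -> 'I_k.+1}, exists a : R, `|a| <= 1 /\
  forall chi, Bs chi -> (forall i, cl chi i (u i)) -> `|a - F chi| <= e.
 move=> u;have [[chi [Bc Hu]]|no] := pselect (exists chi, Bs chi /\ forall i, cl chi i (u i)).
  exists (F chi);split;first exact: F1. move=> chi' Bc' Hu';apply: Fd=> // i.
  have rn : `|rt (u i)| = 1 by exact: norm_root_unity. have dd : (d / 2) ^+ 2 / 2 = 2 * x by rewrite /x;field.
  have d2 : 0 <= d / 2 by lra. have hh phi : Bs phi -> cl phi i (u i) -> `|phi (ys i) - rt (u i)| <= (d / 2)%:C%C.
   by move=> Bp Hp;apply: unit_dist_le=> //;[exact: (Bh _ Bp).1|rewrite dd].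
  rewrite (le_trans (ler_distD (rt (u i)) _ _)) //.
  rewrite [X in X%:C%C]splitr rmorphD lerD ?hh // distrC;exact: hh.
 exists 0;split;first by rewrite normr0. by move=> chi Bc Hu;exfalso;apply: no;exists chi.
exists (fun chi => \sum_u a u * K chi u);split.
- apply: trig_poly_sum=> u;apply: trig_poly_mul_in;first exact: trig_poly_cst.
 apply: trig_poly_prod=> i. apply: (@trig_poly_ext (fun chi => \sum_(m < k.+1)
   c m * Re ((rt (u i))^* ^+ m * chi (ys i *+ m)))).
  apply: trig_poly_sum=> m;apply: trig_poly_mul_in;first exact: trig_poly_cst.
  apply: trig_poly_char;elim: (m : nat)=> [|q IH];first by rewrite mulr0n;exact: S0. by rewrite mulrS;exact: SD.
 move=> chi hc;rewrite Hc ?n1 //;eqsum m;congr (_ * Re _).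
 rewrite exprMn mulrC;congr (_ _);elim: (m : nat)=> [|q IH].
  by rewrite mulr0n unitary_hom0.
 by have [_ cD] := hc;rewrite exprS mulrS cD IH.
- move=> chi hc;rewrite (le_trans (ler_norm_sum _ _ _)) // -(K1 chi hc).
 apply: ler_sum=> u;rewrite normrM (ger0_norm (K0 chi u hc)) ler_piMl ?K0 //. by have [] := Ha u.
move=> chi Bc;have hc := Bh _ Bc;have [h1 _] := hc.
(* Indicates that node [j] is far from [chi] in coordinate [i]; there the kernel is at most (1 -
   x)^k. *)
pose far i j : R := (~~ cl chi i j)%:R.
have farK i : \sum_(u : {ffun 'I_n -> 'I_k.+1}) far i (u i) * K chi u <= k.+1%:R * (1 - x) ^+ k.
 have E : \sum_(u : {ffun 'I_n -> 'I_k.+1}) far i (u i) * K chi u = \sum_(j < k.+1) far i j * kap (chi (ys i) * (rt j)^*).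
  pose G i' j := (if i' == i then far i j else 1) * kap (chi (ys i') * (rt j)^*).
  transitivity (\sum_(u : {ffun 'I_n -> 'I_k.+1}) \prod_i' G i' (u i')).
   eqsum u;rewrite big_split /=;congr (_ * _). by rewrite (bigD1 i) //= eqxx big1 ?mulr1 // => i' /negPf ->.
  rewrite -bigA_distr_bigA (bigD1 i) //= [X in _ * X]big1 ?mulr1.
   by eqsum j;rewrite /G eqxx.
  move=> i' /negPf ii';rewrite /G ii';under eq_bigr do rewrite mul1r. exact: kap1.
 rewrite E;have -> : k.+1%:R * (1 - x) ^+ k = \sum_(j < k.+1) (1 - x) ^+ k.
  by rewrite sumr_const card_ord mulr_natl.
 have x1 : 0 <= 1 - x by lra. lesum j;rewrite /far;have [_|] := boolP (cl chi i j).
  by rewrite mul0r exprn_ge0.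
 rewrite -ltNge mul1r=> Hlt. rewrite (le_trans (kapq _ (n1 chi i j hc))) // lerXn2r ?nnegrE //.
  have := unit_Re_le1 (n1 chi i j hc);rewrite ler_norml=> /andP[];lra.
 by move: Hlt;lra.
have -> : \sum_u a u * K chi u - F chi = \sum_u (a u - F chi) * K chi u.
 by rewrite -[F chi in LHS]mulr1 -(K1 chi hc) mulr_sumr -sumrB;eqsum u;rewrite mulrBl.
rewrite (le_trans (ler_norm_sum _ _ _)) //.
have ub u : `|(a u - F chi) * K chi u| <= e * K chi u + 2 * \sum_i far i (u i) * K chi u.
 rewrite normrM (ger0_norm (K0 _ _ hc)).
 have S0' : 0 <= \sum_i far i (u i) * K chi u by rewrite sumr_ge0 // => i;rewrite mulr_ge0 ?K0.
 have [au Hu] := Ha u. have [all|] := pselect (forall i, cl chi i (u i)).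
  by rewrite ler_wpDr ?mulr_ge0 // ler_wpM2r ?K0 // Hu.
 move=> /existsNP [i /negP ncl]. rewrite ler_wpDl ?mulr_ge0 ?K0 ?(ltW e0) // (le_trans (y := 2 * K chi u)) //.
  rewrite ler_wpM2r ?K0 // (le_trans (ler_normB _ _)) // -[leRHS]/(1 + 1). by rewrite lerD // F1.
 rewrite ler_wpM2l // (bigD1 i) //= /far ncl mul1r lerDl sumr_ge0 // => i' _. by rewrite mulr_ge0 ?K0.
rewrite (le_trans (ler_sum _ (fun u _ => ub u))) // big_split /= -mulr_sumr K1 // mulr1.
rewrite -mulr_sumr exchange_big /= (_ : 2 * e = e + e) ?lerD2l;last by ring.
rewrite (le_trans (ler_wpM2l _ (ler_sum _ (fun i _ => farK i)))) //.
by rewrite sumr_const card_ord -[X in 2 * X]mulr_natl;move: Hk;rewrite -mulrA;lra.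
Qed.

End TrigonometricApproximation.

(** * Expectations of bounded measurable functions *)

Section BoundedExpectation.
Context {d : measure_display} {T : measurableType d} {R : realType}.
Implicit Types (P : probability T R) (f g : T -> R).

Definition bm f := measurable_fun setT f /\ bdd f.

Lemma bm_integrable P f : bm f -> P.-integrable setT (EFin \o f).
move=> [mf [M HM]];apply: measurable_bounded_integrable=> //.
 by rewrite (le_lt_trans (probability_le1 _ _)) // ltry.
exists M;split;first exact: num_real.
by move=> x Mx y _ /=;rewrite (le_trans (HM y)) // ltW.
Qed.

Lemma bm_cst c : bm (fun _ : T => c).
by split;[exact: measurable_cst|exists `|c|]. Qed.

Lemma bm_lin u v f g : bm f -> bm g -> bm (fun x => u * f x + v * g x).
move=> [mf bf] [mg bg];split;last exact: bdd_lin.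
by apply: measurable_funD;apply: measurable_funM=> //;exact: measurable_cst.
Qed.

Lemma bm_mul f g : bm f -> bm g -> bm (fun x => f x * g x).
move=> [mf [M HM]] [mg [N HN]];split;first exact: measurable_funM.
by exists (M * N)=> x;rewrite normrM ler_pM.
Qed.

Lemma bm_ind (A : set T) : measurable A -> bm (fun x => \1_A x : R).
move=> mA;split;first exact: measurable_indic.
by exists 1=> x;rewrite indicE ger0_norm // lern1 leq_b1.
Qed.

Definition Ex P f := (\int[P]_x f x)%R.

Lemma Ex_lin P u v f g : bm f -> bm g -> Ex P (fun x => u * f x + v * g x) = u * Ex P f + v * Ex P g.
move=> bf bg;have bu : bm (fun x => u * f x).
 have := bm_lin u 0 bf bf;under eq_fun do rewrite mul0r addr0;exact.
have bv : bm (fun x => v * g x).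
 have := bm_lin v 0 bg bg;under eq_fun do rewrite mul0r addr0;exact.
rewrite /Ex RintegralD //;try exact: bm_integrable.
by rewrite !RintegralZl //;exact: bm_integrable.
Qed.

Lemma Ex_cst P c : Ex P (fun=> c) = c.
rewrite /Ex Rintegral_cst // -[RHS]mulr1;congr (_ _).
by rewrite -[RHS]/(fine 1%E);congr fine;exact: probability_setT.
Qed.

Lemma Ex_le P f g : bm f -> bm g -> (forall x, f x <= g x) -> Ex P f <= Ex P g.
by move=> bf bg fg;apply: le_Rintegral=> //;exact: bm_integrable. Qed.

Lemma Ex_norm_le P f M : bm f -> (forall x, `|f x| <= M) -> `|Ex P f| <= M.
move=> bf fM;have H x : - M <= f x <= M by rewrite -ler_norml.
rewrite ler_norml -[leLHS](Ex_cst P) -[X in _ _ <= X](Ex_cst P).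
by apply/andP;split;apply: Ex_le=> //;try exact: bm_cst;move=> x;have /andP[] := H x.
Qed.

Lemma Ex_ind P (A : set T) : measurable A -> Ex P (fun x => \1_A x) = fine (P A).
by move=> mA;rewrite /Ex /Rintegral integral_indic // setIT. Qed.

Lemma Ex_dominated P (f_ : nat -> T -> R) f M : (forall n, bm (f_ n)) ->
 (forall n x, `|f_ n x| <= M) -> (forall x, f_ n x @[n --> \oo] --> f x) ->
 bm f /\ Ex P (f_ n) @[n --> \oo] --> Ex P f.
move=> bf fM cf.
have mf : measurable_fun setT f.
 by apply: (measurable_fun_cvg (fun n => (bf n).1))=> x _;exact: cf.
have fM' x : `|f x| <= M.
 by apply: (cvgr_to_le (cvg_norm (cf x)));apply: nearW=> n;exact: fM.
have bmf : bm f by split=> //;exists M.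
split=> //.
have cE : (\int[P]_x (f_ n x)%:E)%E @[n --> \oo] --> (\int[P]_x (f x)%:E)%E.
 apply: (@dominated_cvg _ T R P setT measurableT (fun n x => (f_ n x)%:E) (fun x => (f x)%:E) (fun=> M%:E))=> //.
 - by move=> n;apply/measurable_EFinP;exact: (bf n).1.
 - by move=> x _;apply: cvg_EFin;[exact: nearW|exact: cf].
 - exact: (bm_integrable P (bm_cst M)).
 - by move=> n x _;rewrite abse_EFin lee_fin.
have fE g : bm g -> (\int[P]_x (g x)%:E)%E = (Ex P g)%:E.
 move=> bg;rewrite fineK //. exact: (integrable_fin_num _ (bm_integrable P bg)).
move: cE;rewrite fE // (_ : (fun n => _) = (fun n => (Ex P (f_ n))%:E));last first.
 by ext n;rewrite fE.
by move/fine_cvgP=> [].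
Qed.

Lemma ExZ P c f : bm f -> Ex P (fun x => c * f x) = c * Ex P f.
move=> bf;have := Ex_lin P c 0 bf bf;rewrite mul0r addr0=> <-.
by congr Ex;ext x;rewrite mul0r addr0.
Qed.

Lemma ExD P f g : bm f -> bm g -> Ex P (fun x => f x + g x) = Ex P f + Ex P g.
move=> bf bg;have := Ex_lin P 1 1 bf bg;rewrite !mul1r=> <-.
by congr Ex;ext x;rewrite !mul1r.
Qed.

Lemma ExB P f g : bm f -> bm g -> Ex P (fun x => f x - g x) = Ex P f - Ex P g.
move=> bf bg;have := Ex_lin P 1 (-1) bf bg;rewrite mul1r mulN1r=> <-.
by congr Ex;ext x;rewrite mul1r mulN1r.
Qed.

Lemma bmD f g : bm f -> bm g -> bm (fun x => f x + g x).
by move=> bf bg;have := bm_lin 1 1 bf bg;under eq_fun do rewrite !mul1r.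
Qed.

Lemma bmB f g : bm f -> bm g -> bm (fun x => f x - g x).
by move=> bf bg;have := bm_lin 1 (-1) bf bg;under eq_fun do rewrite mul1r mulN1r.
Qed.

Lemma bm_sum (I : Type) (s : seq I) (f : I -> T -> R) : (forall i, bm (f i)) -> bm (fun x => \sum_(i <- s) f i x).
move=> bf;elim: s=> [|i s IH].
 by under eq_fun do rewrite big_nil;exact: bm_cst.
by under eq_fun do rewrite big_cons;exact: bmD.
Qed.

Lemma Ex_sum P (I : Type) (s : seq I) (f : I -> T -> R) :
 (forall i, bm (f i)) -> Ex P (fun x => \sum_(i <- s) f i x) = \sum_(i <- s) Ex P (f i).
move=> bf;elim: s=> [|i s IH].
 by under eq_fun do rewrite big_nil;rewrite big_nil Ex_cst.
by under eq_fun do rewrite big_cons;rewrite big_cons ExD ?IH //;exact: bm_sum.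
Qed.

Lemma Ex_ge0 P f : bm f -> (forall x, 0 <= f x) -> 0 <= Ex P f.
by move=> bf f0;rewrite -(Ex_cst P 0);apply: Ex_le=> //;exact: bm_cst. Qed.

End BoundedExpectation.

Section Transport.
Context {d d' : measure_display} {T : measurableType d} {T' : measurableType d'} {R : realType}.

Lemma bm_comp (X : T -> T') (f : T' -> R) : measurable_fun setT X -> bm f -> bm (fun x => f (X x)).
move=> mX [mf [M HM]];split;first exact: measurableT_comp.
by exists M=> x;exact: HM.
Qed.

Lemma Ex_distribution (P : probability T R) (X : {RV P >-> T'}) (f : T' -> R) : bm f ->
 Ex (distribution P X) f = Ex P (fun x => f (X x)).
move=> bf;rewrite /Ex /Rintegral integral_distribution //.
 by apply/measurable_EFinP;exact: bf.1.
by apply: (bm_integrable P);apply: bm_comp=> //;exact: measurable_funPT.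
Qed.

Lemma Ex_pushforward (P : probability T R) (X : T -> T') (f : T' -> R) : measurable_fun setT X -> bm f ->
 (\int[pushforward P X]_x (f x)%:E)%E = (Ex P (fun x => f (X x)))%:E.
move=> mX bf;rewrite integral_pushforward //.
- rewrite fineK //.
 exact: (integrable_fin_num _ (bm_integrable P (bm_comp mX bf))).
- by apply/measurable_EFinP;exact: bf.1.
- by rewrite preimage_setT;exact: (bm_integrable P (bm_comp mX bf)).
Qed.

Lemma Ex_prod (P : probability T R) (Q : probability T' R) (f : T * T' -> R) : bm f ->
 bm (fun x => Ex Q (fun y => f (x, y))) /\ Ex (P \x Q)%E f = Ex P (fun x => Ex Q (fun y => f (x, y))).
move=> bf;have If : (P \x Q)%E.-integrable setT (EFin \o f) by exact: bm_integrable.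
have bx x : bm (fun y => f (x, y)).
 have [mf [M HM]] := bf;split;last by exists M=> y. exact: (measurableT_comp mf (pair1_measurable x)).
have FE x : fubini_F Q (EFin \o f) x = (Ex Q (fun y => f (x, y)))%:E.
 rewrite /Ex fineK //. exact: (integrable_fin_num _ (bm_integrable Q (bx x))).
have bF : bm (fun x => Ex Q (fun y => f (x, y))).
 have mF := measurable_fubini_F If;split.
  by apply/measurable_EFinP;move: mF;congr measurable_fun;ext x;rewrite /= FE.
 by have [_ [M HM]] := bf;exists M=> x;apply: Ex_norm_le.
split=> //;rewrite {1}/Ex /Rintegral -(integral12_prod_meas1 If).
by under eq_integral do rewrite FE.
Qed.

Lemma Ex_swap (P : probability T R) (Q : probability T' R) (f : T * T' -> R) : bm f ->
 Ex P (fun x => Ex Q (fun y => f (x, y))) = Ex Q (fun y => Ex P (fun x => f (x, y))).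
move=> bf;have If : (P \x Q)%E.-integrable setT (EFin \o f) by exact: bm_integrable.
rewrite -(Ex_prod P Q bf).2.
have bx y : bm (fun x => f (x, y)).
 have [mf [M HM]] := bf;split;last by exists M=> x. exact: (measurableT_comp mf (pair2_measurable y)).
have FE y : fubini_G P (EFin \o f) y = (Ex P (fun x => f (x, y)))%:E.
 rewrite /Ex fineK //. exact: (integrable_fin_num _ (bm_integrable P (bx y))).
rewrite {1}/Ex /Rintegral -(integral21_prod_meas1 If).
by under eq_integral do rewrite FE.
Qed.

End Transport.

Lemma countable_bigcup_measurable d (T : measurableType d) (I : Type) (D : set I) (F : I -> set T) :
 countable D -> (forall i, D i -> measurable (F i)) -> measurable (\bigcup_(i in D) F i).
move=> /countable_injP [f finj] mF.
have -> : \bigcup_(i in D) F i = \bigcup_n \bigcup_(i in [set i | D i /\ f i = n]) F i.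
 apply/seteqP;split=> [x [i Di Fx]|x [n _ [i [ ] ]]];last by exists i. by exists (f i)=> //;exists i.
apply: bigcupT_measurable=> n.
have [[i [Di fi]]|ni] := pselect (exists i, D i /\ f i = n);last first.
 by rewrite bigcup0 // => i Hi;exfalso;apply: ni;exists i.
rewrite (_ : [set i | _] = [set i]) ?bigcup_set1;first exact: mF.
apply/seteqP;split=> [j [Dj fj]|j -> //].
by apply: (finj j i);[exact: mem_set|exact: mem_set|rewrite fi fj].
Qed.

Section BorelGroup.
Context {R} {X : topologicalZmodType}.
Hypothesis cX : @second_countable X.

Lemma continuous_borel_real (f : borel X -> R) : continuous f -> measurable_fun setT f.
move=> cf;apply: (measurability _ (RGenOpens.measurableE R))=> _ [_ [a [b ->] <-]].
rewrite setTI;apply: sub_sigma_algebra;apply: open_comp;last exact: interval_open.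
by move=> x _;exact: cf.
Qed.

Lemma continuous_borel (f : borel X -> borel X) : continuous f -> measurable_fun setT f.
move=> cf;apply: (measurability (@open (borel X)) erefl)=> _ [V oV <-].
rewrite setTI;apply: sub_sigma_algebra;by apply: open_comp=> // x _;exact: cf.
Qed.

Lemma open_borel (V : set X) : open V -> measurable (V : set (borel X)).
by move=> oV;exact: sub_sigma_algebra. Qed.

Lemma closed_borel (V : set X) : closed V -> measurable (V : set (borel X)).
by move=> cV;rewrite -[V]setCK;apply: measurableC;apply: open_borel;exact: closed_openC. Qed.

(** A countable base writes the preimage of an open set as a countable union of open rectangles,
    which belong to the product sigma-algebra. *)
Lemma measurable_borel_add : measurable_fun setT (fun p : borel X * borel X => (p.1 + p.2 : borel X)).
apply: (measurability (@open (borel X)) erefl)=> _ [V oV <-];rewrite setTI.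
have [B cB [Bo Bb]] := cX.
pose D : set (set X * set X) := [set p | B p.1 /\ B p.2 /\ forall x y, p.1 x -> p.2 y -> V (x + y)].
have cD : countable D.
 apply: (@sub_countable _ _ _ (B `*` B));last exact: countableX. by apply: subset_card_le=> p [? []].
suff -> : (fun p : borel X * borel X => p.1 + p.2) @^-1` V =
  \bigcup_(p in D) ((p.1 : set (borel X)) `*` (p.2 : set (borel X))).
 apply: countable_bigcup_measurable=> // p [B1 [B2 _]]. by apply: measurableX;apply: open_borel;exact: Bo.
apply/seteqP;split=> [[x y] /= Vxy|[x y] [p [_ [_ H]]] [ ]];last exact: H.
have [[U1 U2] /= [n1 n2] H] : nbhs ((x, y) : X * X) [set p : X * X | V (p.1 + p.2)].
 apply: add_continuous;exact: open_nbhs_nbhs.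
have [B1 [bB1 B1x sB1]] := Bb _ _ n1.
have [B2 [bB2 B2y sB2]] := Bb _ _ n2.
exists (B1, B2);last by [].
split=> //;split=> // a b /= Ba Bb'.
by apply: (H (a, b));split=> /=;[exact: sB1|exact: sB2].
Qed.

Lemma measurable_borelD d (T : measurableType d) (f g : T -> borel X) :
 measurable_fun setT f -> measurable_fun setT g -> measurable_fun setT (fun w => f w + g w : borel X).
move=> mf mg;apply: (measurableT_comp measurable_borel_add (g := fun w => (f w, g w))).
exact: measurable_fun_pair.
Qed.

End BorelGroup.

(** * Complex expectations and independence *)

Section ComplexExpectation.
Context {R}.
Local Notation C := (R[i]).

Section OneSpace.
Context {d : measure_display} {T : measurableType d}.
Implicit Types (P : probability T R) (Z W : T -> C).

Definition bmC Z := bm (fun x => Re (Z x)) /\ bm (fun x => Im (Z x)).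
Definition Cx P Z : C := Complex (Ex P (fun x => Re (Z x))) (Ex P (fun x => Im (Z x))).

Lemma bmC_cst (c : C) : bmC (fun=> c).
by split;exact: bm_cst. Qed.

Lemma bmC_mul Z W : bmC Z -> bmC W -> bmC (fun x => Z x * W x).
move=> [Z1 Z2] [W1 W2];split.
 have := bmB (bm_mul Z1 W1) (bm_mul Z2 W2). by congr bm;ext x;case: (Z x)=> a b;case: (W x).
have := bmD (bm_mul Z1 W2) (bm_mul Z2 W1).
congr bm;ext x;case: (Z )=> a b;case: (W )=> a' b' /=.
by rewrite [b * a']mulrC.
Qed.

Lemma CxZ P (c : C) Z : bmC Z -> Cx P (fun x => c * Z x) = c * Cx P Z.
move=> [Z1 Z2];case: c=> a b;apply: eqC=> /=.
 have := Ex_lin P a (- b) Z1 Z2;rewrite mulNr=> <-;congr Ex;ext x. by case: (Z x)=> a' b' /=;rewrite mulNr.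
have := Ex_lin P b a Z1 Z2;rewrite addrC=> <-;congr Ex;ext x.
by case: (Z x)=> a' b' /=;rewrite addrC.
Qed.

Lemma Cx_cst P (c : C) : Cx P (fun=> c) = c.
by rewrite /Cx !Ex_cst;case: c. Qed.

Lemma CxJ P Z : bmC Z -> Cx P (fun x => conjc (Z x)) = conjc (Cx P Z).
move=> [_ Z2];rewrite /= -mulN1r -(ExZ P (-1) Z2);congr Complex.
 by congr Ex;ext x;case: (Z x).
by congr Ex;ext x;case: (Z x)=> a b /=;rewrite mulN1r.
Qed.

(** Rotation by the conjugate of the mean c: |c|^2 is the mean of Re(conj(c) Z), which is at most
    |c|. *)
Lemma Cx_norm_le1 P Z : bmC Z -> (forall x, `|Z x| = 1) -> `|Cx P Z| <= 1.
move=> bZ Z1;set c := Cx P Z.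
have cc : Re (conjc c * c) = Re (`|c| ^+ 2) by rewrite mulrC -sqr_normc.
have : Re (Cx P (fun x => conjc c * Z x)) <= Re `|c|.
 rewrite /= -[leRHS](Ex_cst P);apply: Ex_le.
 - exact: (bmC_mul (bmC_cst _) bZ).1.
 - exact: bm_cst.
 - move=> x;apply: le_trans (ler_norm _) _.
  have := normc_ge_Re (conjc c * Z x);rewrite normrM Z1 mulr1 normcJ. by rewrite lecE=> /andP[_].
rewrite CxZ // cc.
have [r ->] : exists r : R, `|c| = r%:C%C by exists (Re `|c|).
rewrite -rmorphXn /= lecR.
have [->//|r0] := eqVneq r 0=> H.
case: lerP=> r1;nra.
Qed.

End OneSpace.

Lemma bmC_comp d d' (T : measurableType d) (T' : measurableType d') (X : T -> T') (Z : T' -> C) :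
 measurable_fun setT X -> bmC Z -> bmC (fun x => Z (X x)).
by move=> mX [Z1 Z2];split;[exact: (bm_comp mX Z1)|exact: (bm_comp mX Z2)]. Qed.

Lemma Cx_distribution d d' (T : measurableType d) (T' : measurableType d') (P : probability T R)
 (X : {RV P >-> T'}) (Z : T' -> C) : bmC Z -> Cx (distribution P X) Z = Cx P (fun x => Z (X x)).
by move=> [Z1 Z2];rewrite /Cx !Ex_distribution. Qed.

Lemma Cx_prod d d' (T : measurableType d) (T' : measurableType d') (P : probability T R)
 (Q : probability T' R) (Z : T -> C) (W : T' -> C) : bmC Z -> bmC W ->
 Cx (P \x Q)%E (fun p => Z p.1 * W p.2) = Cx P Z * Cx Q W.
move=> bZ bW.
have b : bmC (fun p : T * T' => Z p.1 * W p.2).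
 by apply: bmC_mul;[apply: (bmC_comp _ bZ)|apply: (bmC_comp _ bW)].
have E x : Cx Q (fun y => Z x * W y) = Z x * Cx Q W by exact: CxZ.
rewrite [RHS]mulrC -(CxZ P _ bZ) [LHS]/Cx;congr Complex.
 rewrite (Ex_prod P Q b.1).2;congr Ex;ext x. by rewrite mulrC -(E x).
rewrite (Ex_prod P Q b.2).2;congr Ex;ext x.
by rewrite mulrC -(E x).
Qed.

End ComplexExpectation.

Section Layers.
Context {d : measure_display} {T : measurableType d} {R : realType} (P : probability T R).

Lemma layer_count (n : nat) (t : R) : 0 <= t -> t <= n%:R -> t - 1 <= \sum_(i < n) ((i.+1%:R <= t)%R : nat)%:R <= t.
elim: n t=> [|n IH] t t0 tn;first by rewrite big_ord0;apply/andP;lra.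
rewrite big_ord_recl;case: (lerP 1 )=> t1 /=.
 have /andP[] : t - 1 - 1 <= \sum_(i < n) ((i.+1%:R <= t - 1)%R : nat)%:R <= t - 1.
  by apply: IH;rewrite ?subr_ge0 // lerBlDr natr1.
 rewrite (eq_bigr (fun i : 'I_n => ((i.+2%:R <= t)%R : nat)%:R));last first.
  by move=> i _;rewrite lerBrDr natr1.
 by move=> H1 H2;apply/andP;split;lra.
rewrite big1 ?addr0;first by apply/andP;split;lra.
move=> i;rewrite (_ : _ t = false) //;apply/negbTE;rewrite -ltNge.
by apply: lt_le_trans t1 _;rewrite ler1n.
Qed.

Lemma layer_approx (f : T -> R) (e : R) : bm f -> 0 < e ->
 exists (n : nat) (c0 c : R) (B : 'I_n -> set R), (forall i, measurable (B i)) /\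
  forall x : T, `|f x - (c0 + c * \sum_(i < n) \1_(B i) (f x))| <= e.
move=> [mf [M0 HM0]] e0;pose M := `|M0| + 1.
have M1 : 1 <= M by rewrite /M lerDr.
have HM x : - M <= f x <= M.
 by rewrite -ler_norml;apply: le_trans (HM0 x) _;rewrite /M (le_trans (ler_norm _)) // lerDl.
have [n [n0 Hn]] : exists n : nat, (0 < n)%N /\ 2 * M / n%:R <= e.
 exists (Num.truncn (2 * M / e)).+1;split=> //. rewrite ler_pdivrMr ?ltr0n // -ler_pdivrMl // mulrC.
 by exact/ltW/truncnS_gt.
pose B (i : 'I_n) := [set t : R | (i.+1%:R <= n%:R * (t + M) / (2 * M))%R].
have mB i : measurable (B i).
 rewrite /B (_ : [set t | _] = `[(i.+1%:R * (2 * M) / n%:R - M), +oo[%classic) //.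
 apply/seteqP;split=> t /=;rewrite in_itv /= andbT ler_pdivlMr ?ler_subl_addr;try lra;
  rewrite lerBlDr ler_pdivrMr ?ltr0n // [leRHS]mulrC //.
exists n, (- M), (2 * M / n%:R), B;split=> // x.
have nR : (0 : R) < n%:R by rewrite ltr0n.
have /andP[H1 H2] := HM x.
have M0' : 0 < 2 * M by lra.
have := @layer_count n (n%:R * (f x + M) / (2 * M)).
have -> : \sum_(i < n) (((i.+1%:R <= n%:R * (f x + M) / (2 * M))%R : nat)%:R : R) = \sum_(i < n) \1_(B i) (f x).
 eqsum i;rewrite indicE;congr (nat_of_bool _)%:R. by apply/idP/idP=> H;[apply/mem_set|move/set_mem : H].
set S := \sum_(i < n) _;set t := n%:R * _ / _ => H.
have t0 : 0 <= t by rewrite /t divr_ge0 ?mulr_ge0 //;lra.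
have tn : t <= n%:R.
 by rewrite /t ler_pdivrMr // ler_wpM2l ?ler0n //;lra.
have /andP[H3 H4] := H t0 tn.
have ft : f x = - M + 2 * M / n%:R * t.
 by rewrite /t;field;rewrite ?gt_eqF //;lra.
have c0 : 0 < 2 * M / n%:R by rewrite divr_gt0.
rewrite {1}ft (_ : _ - _ = 2 * M / n%:R * (t - S));last by ring.
rewrite normrM gtr0_norm // ger0_norm ?subr_ge0 //.
by apply: le_trans Hn;rewrite -[leRHS]mulr1 ler_pM2l //;lra.
Qed.

End Layers.

Section Independence.
Context {d : measure_display} {T : measurableType d} {R : realType} (P : probability T R).
Local Notation C := (R[i]).

(** Step functions of [f] carry the factorisation from the events {f in B} over to [f] itself. *)
Lemma layer_eq (f h : T -> R) (c : R) : bm f -> bm h -> (forall B : set R, measurable B ->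
  Ex P (fun w => \1_B (f w) * h w) = Ex P (fun w => \1_B (f w)) * c) -> Ex P (fun w => f w * h w) = Ex P f * c.
move=> bf bh H;have [_ [Mh HMh]] := bh.
pose K := `|Mh| + `|c| + 1.
have K0 : 0 < K by rewrite ltr_wpDl.
have hc : Ex P h = c.
 have := H setT measurableT. rewrite (_ : (fun w => \1_setT (f w)) = fun=> 1) ?Ex_cst ?mul1r;last first.
  by ext w;rewrite indicT.
 by move=> <-;congr Ex;ext w;rewrite indicT mul1r.
suff S e : 0 < e -> `|Ex P (fun w => f w * h w) - Ex P f * c| <= K * e.
 apply/eqP;rewrite -subr_eq0 -normr_le0;apply/ler_addgt0Pl=> e e0;rewrite addr0.
 have := S (e / K);rewrite divr_gt0 // mulrCA divff ?gt_eqF // mulr1;exact.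
move=> e0;have [n [c0 [c1 [B [mB HB]]]]] := layer_approx bf e0.
pose g w := c0 + c1 * \sum_(i < n) \1_(B i) (f w).
have bi i : bm (fun w => \1_(B i) (f w) : R).
 have [mf _] := bf;split;last by exists 1=> x;rewrite indicE ger0_norm // lern1 leq_b1.
 exact: (measurableT_comp (measurable_indic (mB i)) mf).
have bs : bm (fun w => \sum_(i < n) \1_(B i) (f w) : R) by exact: bm_sum.
have bg : bm g.
 have := bm_lin 1 c1 (bm_cst c0) bs;congr bm;ext w;by rewrite mul1r.
have gE : Ex P (fun w => g w * h w) = Ex P g * c.
 have -> : Ex P (fun w => g w * h w) = c0 * Ex P h + c1 * Ex P (fun w => \sum_(i < n) (\1_(B i) (f w) * h w)).
  rewrite -Ex_lin //;last by apply: bm_sum=> i;exact: bm_mul. congr Ex;ext w;rewrite mulrDl -mulrA mulr_suml //.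
 have -> : Ex P g = c0 + c1 * Ex P (fun w => \sum_(i < n) \1_(B i) (f w)).
  rewrite -[X in X + _]mulr1 -[X in _ X + _](Ex_cst P) -Ex_lin //;last exact: bm_cst.
  by congr Ex;ext w;rewrite mulr1.
 rewrite !Ex_sum //;last by move=> i;exact: bm_mul. rewrite hc mulrDl -mulrA mulr_suml;congr (_ + _ * _);eqsum i.
 exact: H.
have H1 : `|Ex P (fun w => f w * h w) - Ex P (fun w => g w * h w)| <= `|Mh| * e.
 rewrite -ExB;try exact: bm_mul. apply: Ex_norm_le;first by apply: bmB;exact: bm_mul.
 move=> w;rewrite -mulrBl normrM mulrC ler_pM //. by rewrite (le_trans (HMh w)) // ler_norm.
have H2 : `|Ex P f * c - Ex P g * c| <= `|c| * e.
 rewrite -mulrBl normrM mulrC ler_wpM2l // -ExB //. by apply: Ex_norm_le=> //;exact: bmB.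
rewrite -gE in H2.
have := ler_normB (Ex P (fun w => f w * h w) - Ex P (fun w => g w * h w)) (Ex P f * c - Ex P (fun w => g w * h w)).
rewrite (_ : _ - _ = Ex P (fun w => f w * h w) - Ex P f * c);last by ring.
move=> /le_trans;apply;apply: le_trans (lerD H1 H2) _.
by rewrite -mulrDl ler_wpM2r ?(ltW e0) // /K lerDl.
Qed.

Context {d' : measure_display} {T' : measurableType d'} (xi : nat -> {RV P >-> T'}).
Hypothesis xi_indep : mutually_independent xi.

Let ev (J : {fset nat}) (A : nat -> set T') : set T := \bigcap_(j in [set` J]) (xi j @^-1` A j).

Let mev J A : (forall j, measurable (A j)) -> measurable (ev J A).
move=> mA;apply: fin_bigcap_measurable;first exact: finite_fset.
by move=> j _;rewrite -[X in measurable X]setTI;exact: measurable_funPT.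
Qed.

Let ev_add k (J : {fset nat}) A B : k \notin J ->
 ev (k |` J)%fset (fun j => if j == k then B else A j) = xi k @^-1` B `&` ev J A.
move=> kJ;apply/seteqP;split=> w /=.
 move=> H;split;first by have := H k;rewrite /= fset1U1 eqxx;exact.
 move=> j /= jJ;have := H j;rewrite /= fset1Ur // ifN;first exact. by apply: contraNneq kJ=> <-.
move=> [H1 H2] j /=;rewrite in_fset1U;case: eqP=> [-> //|_ ];exact: H2.
Qed.

Let ev_indep k (J : {fset nat}) A B : k \notin J -> (forall j, measurable (A j)) -> measurable B ->
 fine (P (xi k @^-1` B `&` ev J A)) = fine (P (xi k @^-1` B)) * fine (P (ev J A)).
move=> kJ mA mB;rewrite -ev_add // /ev xi_indep;last by move=> j;case: ifP.
rewrite xi_indep // big_fsetU1 //= eqxx fineM.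
- congr (_ * fine _);apply: eq_big_seq=> j jJ;rewrite ifN //.
 by apply: contraNneq kJ=> <-.
- by apply: fin_num_measure;rewrite -[X in measurable X]setTI;exact: measurable_funPT.
- rewrite -xi_indep;last by move=> j;case: ifP.
 by apply: fin_num_measure;apply: (@mev J (fun j => if j == k then B else A j))=> j;case: ifP.
Qed.

Variable Z : nat -> T' -> C.
Hypothesis bZ : forall j, bmC (Z j).

Let bZxi j : bmC (fun w => Z j (xi j w)).
by apply: (bmC_comp _ (bZ j));exact: measurable_funPT. Qed.

Let bprod k : bmC (fun w => \prod_(j < k) Z j (xi j w)).
elim: k=> [|k IH];first by under eq_fun do rewrite big_ord0;exact: bmC_cst.
by under eq_fun do rewrite big_ord_recr;exact: bmC_mul.
Qed.

(** Independence is given for events. The induction on the number of factors therefore carries along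
    an event on the variables of index at least [k]; the factor to be split off is first reduced by
    [layer_eq] to an event, which joins that one. *)
Let indep_prod_ev k : forall (J : {fset nat}) A, (forall j, measurable (A j)) ->
 (forall j, j \in J -> (k <= j)%N) -> Ex P (fun w => Re (\prod_(j < k) Z j (xi j w)) * \1_(ev J A) w) =
  Re (\prod_(j < k) Cx P (fun w => Z j (xi j w))) * fine (P (ev J A)) /\
 Ex P (fun w => Im (\prod_(j < k) Z j (xi j w)) * \1_(ev J A) w) =
  Im (\prod_(j < k) Cx P (fun w => Z j (xi j w))) * fine (P (ev J A)).
elim: k=> [|k IH] J A mA JA.
 have mE := mev J mA. split;rewrite big_ord0 /=.
  by rewrite mul1r -Ex_ind //;congr Ex;ext w;rewrite big_ord0 mul1r.
 by rewrite mul0r -[RHS](Ex_cst P);congr Ex;ext w;rewrite big_ord0 mul0r.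
have kJ : k \notin J by apply/negP=> /JA;rewrite ltnn.
set pr := \prod_(j < k) Cx P _ in IH.
have mE := mev J mA;have bE := @bm_ind _ _ R _ mE.
have key (g : C -> R) (f : T -> R) : (g = (fun z => Re z) \/ g = (fun z => Im z)) ->
  (exists2 h : T' -> R, bm h & f = fun w => h (xi k w)) ->
  Ex P (fun w => f w * (g (\prod_(j < k) Z j (xi j w)) * \1_(ev J A) w)) = Ex P f * (g pr * fine (P (ev J A))).
 move=> gRI [h bh ->];have mxi : measurable_fun setT (xi k) by []. apply: layer_eq.
 - by apply: bm_comp=> //.
 - by apply: bm_mul=> //;case: gRI=> ->;have [] := bprod k.
 move=> B mB. pose B' := h @^-1` B. have mB' : measurable B' by rewrite -[B']setTI;exact: bh.1.
 have mxB : measurable (xi k @^-1` B') by rewrite -[X in measurable X]setTI;exact: mxi.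
 have -> : Ex P (fun w => \1_B (h (xi k w))) = fine (P (xi k @^-1` B')) by rewrite -Ex_ind.
 have mA' j : measurable ((fun j => if j == k then B' else A j) j) by case: ifP.
 have JA' j : j \in (k |` J)%fset -> (k <= j)%N.
  by rewrite in_fset1U=> /orP[/eqP->//|/JA/ltnW].
 have [IH1 IH2] := IH (k |` J)%fset (fun j => if j == k then B' else A j) mA' JA'.
 rewrite ev_add // ev_indep // in IH1 IH2. rewrite mulrCA;case: gRI=> ->;[rewrite -IH1|rewrite -IH2];
  by congr Ex;ext w;rewrite indicI /=;ring.
have [ZR ZI] := bZxi k;have [QR QI] := bprod k.
have aR : exists2 h : T' -> R, bm h & (fun w => Re (Z k (xi k w))) = (fun w => h (xi k w)).
 by exists (fun x => Re (Z k x))=> //;exact: (bZ k).1.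
have aI : exists2 h : T' -> R, bm h & (fun w => Im (Z k (xi k w))) = (fun w => h (xi k w)).
 by exists (fun x => Im (Z k x))=> //;exact: (bZ k).2.
have k1 := key _ _ (or_introl erefl) aR;have k2 := key _ _ (or_intror erefl) aI.
have k3 := key _ _ (or_introl erefl) aI;have k4 := key _ _ (or_intror erefl) aR.
rewrite big_ord_recr /=.
set q := Cx P (fun w => Z k (xi k w)).
split.
- have -> : Re (pr * q) = Re pr * Re q - Im pr * Im q.
  by case: (pr) (q)=> ? ? [].
 have := congr2 (fun a b => a - b) k1 k2;rewrite -ExB;try by apply: bm_mul=> //;exact: bm_mul.
 rewrite [ q]/= => H;refine (etrans (etrans _ H) _);last by rewrite /q /Cx /=;ring.
 congr Ex;ext w;rewrite big_ord_recr /=. by case: (\prod_(i < k) _) (Z k (xi k w))=> a b [a' b'] /=;ring.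
- have -> : Im (pr * q) = Re pr * Im q + Im pr * Re q.
  by case: (pr) (q)=> ? ? [].
 have := congr2 (fun a b => a + b) k3 k4;rewrite -ExD;try by apply: bm_mul=> //;exact: bm_mul.
 rewrite [ q]/= => H;refine (etrans (etrans _ H) _);last by rewrite /q /Cx /=;ring.
 congr Ex;ext w;rewrite big_ord_recr /=. by case: (\prod_(i < k) _) (Z k (xi k w))=> a b [a' b'] /=;ring.
Qed.

Lemma indep_prod k : Cx P (fun w => \prod_(j < k) Z j (xi j w)) = \prod_(j < k) Cx P (fun w => Z j (xi j w)).
have [] := @indep_prod_ev k fset0 (fun=> setT) (fun=> measurableT).
 by move=> j;rewrite inE.
have evT : ev fset0 (fun=> setT) = setT by apply/seteqP.
have PT : fine (P setT) = 1 by rewrite -[RHS]/(fine 1%E);congr fine;exact: probability_setT.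
rewrite evT PT !mulr1=> H1 H2;apply/eqP;rewrite eq_complex /Cx /=.
apply/andP;split;apply/eqP;rewrite -?H1 -?H2;by congr Ex;ext w;rewrite indicT mulr1.
Qed.

End Independence.

Section Law.
Context {d d' : measure_display} {T : measurableType d} {T' : measurableType d'} {R : realType}.

Definition law (P : probability T R) (f : T -> T') (mf : measurable_fun setT f) : probability T' R :=
 distribution P (mfun_Sub (mem_set mf : f \in mfun)).

Lemma Ex_law (P : probability T R) (f : T -> T') (mf : measurable_fun setT f) (g : T' -> R) :
 bm g -> Ex (law P mf) g = Ex P (fun x => g (f x)).
by move=> bg;rewrite Ex_distribution. Qed.

Lemma Cx_law (P : probability T R) (f : T -> T') (mf : measurable_fun setT f) (Z : T' -> R[i]) :
 bmC Z -> Cx (law P mf) Z = Cx P (fun x => Z (f x)).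
by move=> bZ;rewrite Cx_distribution. Qed.

Lemma Ex_eq (P Q : probability T R) (f : T -> R) : (forall A, measurable A -> P A = Q A) -> Ex P f = Ex Q f.
by move=> H;rewrite /Ex /Rintegral;congr fine;apply: eq_measure_integral=> A mA _;exact: H.
Qed.

End Law.

(** The squared modulus as a real number; [|z| ^+ 2] lives in the complex field. *)
Definition nsq {R : realType} (z : R[i]) : R := Re z ^+ 2 + Im z ^+ 2.

Section SquaredNorm.
Context {R}.
Implicit Types z w : complex R.

Lemma nsqM z w : nsq (z * w) = nsq z * nsq w.
by rewrite /nsq;case: z=> a b;case: w=> c e /=;ring. Qed.

Lemma nsqJ z : nsq (conjc z) = nsq z.
by rewrite /nsq;case: z=> a b /=;ring. Qed.

Lemma nsq_ge0 z : 0 <= nsq z.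
by rewrite /nsq addr_ge0 // sqr_ge0. Qed.

Lemma nsq_eq0 z : (nsq z == 0) = (z == 0).
by rewrite /nsq paddr_eq0 ?sqr_ge0 // !sqrf_eq0 eq_complex. Qed.

Lemma nsq_gt0 z : (0 < nsq z) = (z != 0).
by rewrite lt_neqAle nsq_ge0 andbT eq_sym nsq_eq0. Qed.

Lemma nsq_norm z : `|z| ^+ 2 = ((nsq z)%:C)%C.
by rewrite sqr_normc /nsq;case: z=> a b /=;congr Complex;ring. Qed.

Lemma nsq_le1 z : `|z| <= 1 -> nsq z <= 1.
move=> z1;rewrite -lecR -nsq_norm;apply: le_trans (_ : 1 ^+ 2 <= _);last by rewrite expr1n.
by rewrite lerXn2r // nnegrE.
Qed.

Lemma nsq_unit z : `|z| = 1 -> nsq z = 1.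
by move=> z1;apply: (@complexI R);rewrite -nsq_norm z1 expr1n.
Qed.

Lemma nsq_prod (I : Type) (s : seq I) (z : I -> R[i]) : nsq (\prod_(i <- s) z i) = \prod_(i <- s) nsq (z i).
elim: s=> [|i s IH];last by rewrite !big_cons nsqM IH.
by rewrite !big_nil /nsq /= expr0n /= expr1n addr0.
Qed.

End SquaredNorm.

(** * Characteristic functions, convolution and automorphisms *)

Section CharacteristicFunctions.
Context {R} {X : topologicalZmodType}.
Hypothesis cX : @second_countable X.
Implicit Types (mu nu : prob X R) (y : character R X).

Lemma bmC_char y : @bmC R _ (borel X) (fun x => y x).
have H (x : borel X) : `|Re (y x)| <= 1 /\ `|Im (y x)| <= 1.
 have /nsq_unit := char_norm y x;rewrite /nsq. case: (y x)=> a b /= ab1;have := sqr_ge0 a;have := sqr_ge0 b=> b0 a0.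
 by split;rewrite -(@ler_pXn2r _ 2) ?nnegrE // expr1n real_normK ?num_real //;lra.
split;(split;last by exists 1=> x;have [] := H x); apply: continuous_borel_real=> x;apply: continuous_comp;
 [exact: char_continuous|exact: Re_continuous|exact: char_continuous|exact: Im_continuous].
Qed.

Lemma char0 y : y 0 = 1.
by apply: (mulfI (char_neq0 y 0));rewrite -charD addr0 mulr1. Qed.

Definition cf mu y : R[i] := Cx mu (fun x => y x).

Lemma cfE mu y : characteristic_function mu y = cf mu y.
by []. Qed.

Lemma cf_norm mu y : `|cf mu y| <= 1.
by apply: Cx_norm_le1;[exact: bmC_char|move=> x;exact: char_norm]. Qed.

Lemma cf0 mu : cf mu 0 = 1.
by rewrite /cf -[RHS](Cx_cst mu). Qed.

Lemma cfN mu y : cf mu (- y) = conjc (cf mu y).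
rewrite /cf -CxJ;last exact: bmC_char.
congr Cx;ext x;rewrite [LHS](_ : _ = (y x)^-1) //.
have := char_norm y x;have := char_neq0 y x=> y0 y1.
by apply: (mulfI y0);rewrite mulfV // -sqr_normc y1 expr1n.
Qed.

Definition conv mu nu : prob X R := law (mu \x nu)%E (measurable_borel_add cX).

Lemma conv_bm (f : borel X -> R) : bm f -> bm (fun p : borel X * borel X => f (p.1 + p.2)).
exact: (bm_comp (measurable_borel_add cX)). Qed.

Lemma Ex_conv mu nu (f : borel X -> R) : bm f ->
 Ex (conv mu nu) f = Ex mu (fun x => Ex nu (fun y : borel X => f (x + y))).
by move=> bf;rewrite Ex_law // (Ex_prod mu nu (conv_bm bf)).2. Qed.

Lemma bm_shift (f : borel X -> R) (x : X) : bm f -> bm (fun y : borel X => f (x + y)).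
move=> bf;apply: (@bm_comp _ _ _ _ _ (fun y : borel X => x + y : borel X))=> //.
by apply: measurable_borelD=> //;exact: measurable_cst.
Qed.

Lemma bm_Ex_shift nu (f : borel X -> R) : bm f -> bm (fun x : borel X => Ex nu (fun y : borel X => f (x + y))).
by move=> bf;exact: (Ex_prod nu nu (conv_bm bf)).1. Qed.

Lemma cf_conv mu nu y : cf (conv mu nu) y = cf mu y * cf nu y.
rewrite /cf Cx_law;last exact: bmC_char.
rewrite -Cx_prod;try exact: bmC_char.
by congr Cx;apply/funext=> -[a b] /=;rewrite charD.
Qed.

Definition image mu (g : borel X -> borel X) (cg : continuous g) : prob X R := law mu (continuous_borel cg).

Lemma Ex_image mu (g : borel X -> borel X) (cg : continuous g) (f : borel X -> R) : bm f ->
 Ex (image mu cg) f = Ex mu (fun x => f (g x)).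
by move=> bf;rewrite Ex_law. Qed.

Lemma cf_image mu (g : borel X -> borel X) (cg : continuous g) y (z : character R X) : (forall x, z x = y (g x)) ->
 cf (image mu cg) y = cf mu z.
move=> H;rewrite /cf Cx_law;last exact: bmC_char.
by congr Cx;ext x;rewrite -H.
Qed.

Lemma opp_continuousX : continuous (fun x : borel X => - x : borel X).
exact: (@opp_continuous X). Qed.

Definition reflect mu : prob X R := image mu opp_continuousX.

Lemma cf_reflect mu y : cf (reflect mu) y = conjc (cf mu y).
rewrite -cfN;apply: cf_image=> x;rewrite [LHS](_ : _ = (y x)^-1) //.
have y0 := char_neq0 y x.
by apply: (mulfI y0);rewrite mulfV // -charD subrr char0.
Qed.

Lemma translate_continuous (a : X) : continuous (fun x : borel X => a + x : borel X).
by move=> x;exact: cvg_comp2 (cvg_cst a) cvg_id (@add_continuous X (a, x)). Qed.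

Definition translate (a : X) mu : prob X R := image mu (@translate_continuous a).

Lemma cf_translate a mu y : cf (translate a mu) y = y a * cf mu y.
rewrite /cf Cx_law;last exact: bmC_char.
rewrite -CxZ;last exact: bmC_char.
by congr Cx;ext x;rewrite charD.
Qed.

Definition unit_mass : prob X R := law (dirac point : prob X R) (measurable_cst (0 : borel X)).

Lemma cf_unit_mass y : cf unit_mass y = 1.
rewrite /cf Cx_law;last exact: bmC_char.
by rewrite (_ : (fun x => _) = fun=> 1) ?Cx_cst //;ext x;rewrite /= char0.
Qed.

Definition convs (s : seq (prob X R)) : prob X R := foldr conv unit_mass s.

Lemma cf_convs s y : cf (convs s) y = \prod_(mu <- s) cf mu y.
elim: s=> [|mu s IH];first by rewrite big_nil cf_unit_mass.
by rewrite big_cons /= cf_conv IH.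
Qed.

(** Composition with [f] on the dual group, made total by the value 0 when [f] is not a continuous
    homomorphism. *)
Definition pull (f : X -> X) (y : character R X) : character R X :=
 if pselect (continuous f /\ {morph f : a b / a + b}) is left H then
  Character (fun x => continuous_comp (H.1 x) (@char_continuous _ _ y (f x)))
   (fun x => char_norm y (f x)) (fun a b => etrans (congr1 y (H.2 a b)) (charD y (f a) (f b))) else 0.

Lemma pullE f y x : auts X f -> pull f y x = y (f x).
by move=> [fD [cf _]];rewrite /pull;case: pselect=> // -[];split. Qed.

Lemma pullD f y z : auts X f -> pull f (y + z) = pull f y + pull f z.
by move=> Hf;apply: char_ext=> x /=;rewrite !pullE. Qed.

Lemma pull_comp f g y : auts X f -> auts X g -> auts X (f \o g) -> pull g (pull f y) = pull (f \o g) y.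
by move=> Hf Hg Hfg;apply: char_ext=> x /=;rewrite !pullE. Qed.

Lemma aut_comp f g : auts X f -> auts X g -> auts X (f \o g).
move=> [fD [fc [f' [ff' f'f f'c]]]] [gD [gc [g' [gg' g'g g'c]]]];split.
 by move=> x y /=;rewrite gD fD.
split;first by move=> x;apply: continuous_comp;[exact: gc|exact: fc].
exists (g' \o f');split;[exact: can_comp|exact: can_comp|move=> x].
by apply: continuous_comp;[exact: f'c|exact: g'c].
Qed.

Lemma aut_inv f : auts X f -> exists g, [/\ auts X g, cancel f g & cancel g f].
move=> [fD [fc [g [fg gf gc]]]];exists g;split=> //;split;last by split=> //;exists f;split.
by move=> x y;apply: (can_inj fg);rewrite fD !gf.
Qed.

Lemma aut_id : auts X id.
by split=> //;split;[move=> x;exact: cvg_id|exists id;split=> // x;exact: cvg_id]. Qed.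

Lemma aut_opp : auts X -%R.
split;first by move=> x y;rewrite opprD.
split;first exact: opp_continuous.
by exists -%R;split;[exact: opprK|exact: opprK|exact: opp_continuous].
Qed.

End CharacteristicFunctions.

Lemma lim_uniq {R : realType} {u : nat -> R} {a b : R} : u n @[n --> \oo] --> a -> u n @[n --> \oo] --> b -> a = b.
by move=> h1 h2;rewrite -(cvg_lim (@Rhausdorff R) h1) (cvg_lim (@Rhausdorff R) h2). Qed.

Lemma sum_cvg {R : realType} (I : Type) (s : seq I) (u : I -> nat -> R) (l : I -> R) :
 (forall i, u i n @[n --> \oo] --> l i) -> (\sum_(i <- s) u i n) @[n --> \oo] --> \sum_(i <- s) l i.
move=> H;elim: s=> [|i s IH].
 by under eq_fun do rewrite big_nil;rewrite big_nil;exact: cvg_cst.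
by under eq_fun do rewrite big_cons;rewrite big_cons;apply: cvgD.
Qed.

Lemma aut_enum (X : topologicalZmodType) : finite_set (auts X) -> exists (n : nat) (g : 'I_n -> X -> X),
 [/\ injective g, forall i, auts X (g i) & forall f, auts X f -> exists i, g i = f].
move=> finG;have [s Hs] := (@finite_seqP {classic X -> X} _).1 finG.
have H f : auts X f <-> (f : {classic (X -> X)}) \in undup s.
 by rewrite mem_undup Hs.
exists (size (undup s)), (fun i => tnth (in_tuple (undup s)) i);split.
- by move=> i j;apply/tuple_uniqP;exact: undup_uniq.
- by move=> i;apply/H;exact: mem_tnth.
- by move=> f /H/(tnthP (in_tuple (undup s)))[i ->];exists i.
Qed.

(** * Gram-Schmidt on an abelian group *)

Section GramSchmidt.
Context {R} {Y : zmodType}.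

(** Positive semidefinite biadditive forms. Only integral combinations exist in [Y], so the usual
    inequalities are reached by integer approximation. *)
Record psd (b : Y -> Y -> R) : Prop := Psd { psdD : forall u v w, b (u + v) w = b u w + b v w ;
 psdC : forall u v, b u v = b v u ; psd_ge0 : forall u, 0 <= b u u }.

Lemma psd0 b u : psd b -> b 0 u = 0.
by move=> pb;have := psdD pb 0 0 u;rewrite addr0=> H;lra. Qed.

Lemma psdMn b u v n : psd b -> b (u *+ n) v = n%:R * b u v.
move=> pb;elim: n=> [|n IH];first by rewrite mul0r psd0.
by rewrite mulrS (psdD pb) IH -natr1;ring.
Qed.

Lemma psdN b u v : psd b -> b (- u) v = - b u v.
by move=> pb;have := psdD pb u (- u) v;rewrite subrr psd0 // => H;lra. Qed.

Lemma psd_quad b u v (m n : nat) (s : bool) : psd b ->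
 0 <= m%:R ^+ 2 * b u u + 2 * ((-1) ^+ s * m%:R * n%:R * b u v) + n%:R ^+ 2 * b v v.
move=> pb;have H w : 0 <= m%:R ^+ 2 * b w w + 2 * (m%:R * n%:R * b w v) + n%:R ^+ 2 * b v v.
 have := psd_ge0 pb (w *+ m + v *+ n).
 rewrite (psdD pb) ![b _ (_ + _)](psdC pb) !(psdD pb) !psdMn // ![b _ (_ _)](psdC pb) !psdMn //.
 by rewrite (psdC pb v w);move=> /le_trans;apply;apply: eq_ler;ring.
case: s;last by have := H u;rewrite expr0 mul1r.
have := H (- u);rewrite !psdN // (psdC pb ) psdN // opprK expr1.
by move=> /le_trans;apply;apply: eq_ler;ring.
Qed.

Lemma psd_null b u v : psd b -> b u u = 0 -> b u v = 0.
move=> pb uu;apply/eqP;rewrite -normr_le0;apply/negP=> /negP;rewrite -ltNge=> p0.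
pose m := (Num.truncn (b v v / `|b u v|)).+1.
have Hm : b v v < m%:R * `|b u v| by rewrite -ltr_pdivrMr //;exact: truncnS_gt.
have := psd_quad u v m 1 (0 <= b u v) pb;rewrite uu mulr0 add0r expr1n mul1r mulr1.
have -> : (-1) ^+ (0 <= b u v)%R * m%:R * b u v = - (m%:R * `|b u v|).
 by case: (ger0P (b u v))=> _ /=;rewrite ?expr1 ?expr0;ring.
have := psd_ge0 pb v;lra.
Qed.

(** The optimal real coefficient is approximated by the quotient of integers [m] and [n]. Rounding
    costs at most [b u u], whereas a violation [D] would contribute n^2 D. *)
Lemma psd_cauchy_schwarz b u v : psd b -> b u v ^+ 2 / b u u <= b v v.
move=> pb;have a0 := psd_ge0 pb u.
have [a00|anz] := eqVneq (b u u) 0;first by rewrite a00 invr0 mulr0 psd_ge0.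
have {a0 anz} a0 : 0 < b u u by lra.
rewrite leNgt;apply/negP=> H.
set D := b u v ^+ 2 / b u u - b v v;have D0 : 0 < D by rewrite subr_gt0.
pose n := (Num.truncn (b u u / D)).+1.
have n1 : (1 : R) <= n%:R by rewrite ler1n.
have Hn : b u u < n%:R * D by rewrite -ltr_pdivrMr //;exact: truncnS_gt.
pose t := n%:R * (`|b u v| / b u u);have t0 : 0 <= t by rewrite mulr_ge0 // divr_ge0 // ltW.
pose m := Num.truncn t.
have mt : m%:R <= t by rewrite truncn_le.
have tm : t < m%:R + 1 by rewrite natr1;exact: truncnS_gt.
have := psd_quad u v m n (0 <= b u v) pb.
have -> : (-1) ^+ (0 <= b u v)%R * m%:R * n%:R * b u v = - (m%:R * (n%:R * `|b u v|)).
 by case: (ger0P (b u v))=> _ /=;rewrite ?expr1 ?expr0;ring.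
have E1 : n%:R * `|b u v| = t * b u u by rewrite /t;field;rewrite gt_eqF.
have E2 : n%:R ^+ 2 * b v v = t ^+ 2 * b u u - n%:R ^+ 2 * D.
 rewrite /D /t -[b u v ^+ 2](@real_normK ) ?num_real //. by field;rewrite gt_eqF.
rewrite E1 E2.
have -> : m%:R ^+ 2 * b u u + 2 * - (m%:R * (t * b u u)) + (t ^+ 2 * b u u - n%:R ^+ 2 * D) =
 (t - m%:R) ^+ 2 * b u u - n%:R * (n%:R * D) by ring.
have : (t - m%:R) ^+ 2 * b u u <= b u u.
 by rewrite ler_piMl // ?(ltW a0) // expr_le1 //;lra.
have : n%:R * D <= n%:R * (n%:R * D) by rewrite ler_peMl // mulr_ge0 // ltW.
lra.
Qed.

Variable (M : Y -> R).
Hypotheses (M_ge0 : forall u, 0 <= M u) (M_par : forall u v, M (u + v) + M (u - v) = 2 * (M u + M v)).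

Let M0 : M 0 = 0.
by have := M_par 0 0;rewrite addr0 subr0=> H;lra. Qed.

Let MN u : M (- u) = M u.
by have := M_par 0 u;rewrite add0r M0 sub0r=> H;lra. Qed.

Let B u v := M (u + v) - M u - M v.

(** The Jordan-von Neumann argument: additivity is a linear combination of nine parallelogram
    laws. *)
Let B_psd : psd B.
split;last by move=> u;rewrite /B;have := M_par u u;rewrite subrr M0;have := M_ge0 u=> *;lra.
 move=> u v w;rewrite /B. have h1 := M_par (u + v) w;have h2 := M_par (u + w) v;have h3 := M_par (v + w) u.
 have h4 := M_par u (v - w);have h5 := M_par w (u - v);have h6 := M_par v (u - w).
 have h7 := M_par u v;have h8 := M_par u w;have h9 := M_par v w. have e1 : u + w + v = u + v + w by rewrite addrAC.
 have e2 : v + w + u = u + v + w by rewrite addrC addrA. have e3 : u + (v - w) = u + v - w by rewrite addrA.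
 have e4 : u - (v - w) = u + w - v by rewrite opprB addrA.
 have e5 : w + (u - v) = u + w - v by rewrite addrA [w + u]addrC.
 have e6 : w - (u - v) = v + w - u by rewrite opprB addrCA addrA.
 have e7 : v + (u - w) = u + v - w by rewrite addrA [v + u]addrC.
 have e8 : v - (u - w) = v + w - u by rewrite opprB addrA.
 rewrite e1 in h2;rewrite e2 in h3;rewrite e3 e4 in h4;rewrite e5 e6 in h5;rewrite e7 e8 in h6. lra.
by move=> u v;rewrite /B [v + u]addrC;ring.
Qed.

Variable ys : nat -> Y.

(** What remains of the form once the first [k] vectors are projected out. A vector of norm 0
    contributes nothing, division by 0 giving 0. *)
Fixpoint gs_form k : Y -> Y -> R := if k is k'.+1 then let b := gs_form k' in
  fun u v => b u v - (b (ys k') u / Num.sqrt (b (ys k') (ys k'))) * (b (ys k') v / Num.sqrt (b (ys k') (ys k')))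
 else B.

Definition gs_coord k u : R := gs_form k (ys k) u / Num.sqrt (gs_form k (ys k) (ys k)).

Let gs_formS k u v : gs_form k.+1 u v = gs_form k u v - gs_coord k u * gs_coord k v.
by []. Qed.

Let gs_psd k : psd (gs_form k).
elim: k=> [|k IH];first exact: B_psd.
split.
- move=> u v w;rewrite !gs_formS /gs_coord (psdD IH) ![gs_form k _ (u + v)](psdC IH) (psdD IH).
 by rewrite ![gs_form k _ (ys k)](psdC IH);ring.
- by move=> u v;rewrite !gs_formS (psdC IH) [gs_coord k u * _]mulrC.
- move=> u;rewrite gs_formS subr_ge0;apply: le_trans (psd_cauchy_schwarz (ys k) u IH).
 rewrite mulrACA -expr2 -invfM -expr2 sqr_sqrtr //;exact: psd_ge0.
Qed.

Lemma gs_coordD k u v : gs_coord k (u + v) = gs_coord k u + gs_coord k v.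
have pk := gs_psd k.
by rewrite /gs_coord (psdC pk) (psdD pk) ![gs_form k _ (ys k)](psdC pk) mulrDl.
Qed.

(** The null space of the remaining form; it takes the place of the linear span of the first [n]
    vectors. *)
Definition gs_span n : set Y := [set u | forall v, gs_form n u v = 0].

Lemma gs_span_subgroup n : subgroup (gs_span n).
have pn := gs_psd n;split;first by move=> v;rewrite psd0.
by move=> u v Hu Hv w;rewrite (psdD pn) psdN // Hu Hv subrr.
Qed.

Let gs_coord0 n u : gs_span n u -> gs_coord n u = 0.
by move=> Hu;rewrite /gs_coord (psdC (gs_psd n)) Hu mul0r. Qed.

Lemma gs_spanS n : gs_span n `<=` gs_span n.+1.
by move=> u Hu v;rewrite gs_formS gs_coord0 // mul0r subr0. Qed.

Lemma gs_span_le m n : (m <= n)%N -> gs_span m `<=` gs_span n.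
move=> /subnKC <-;elim: (n - m)%N=> [|k IH];first by rewrite addn0.
by rewrite addnS;apply: subset_trans IH _;exact: gs_spanS.
Qed.

Lemma gs_span_ys i n : (i < n)%N -> gs_span n (ys i).
move=> /gs_span_le;apply=> v;rewrite gs_formS /gs_coord;have pk := gs_psd i.
have [b0|bn] := eqVneq (gs_form i (ys i) (ys i)) 0.
 by rewrite (psd_null _ pk b0) b0 !mul0r subr0.
rewrite mulrACA -invfM -expr2 sqr_sqrtr;last exact: psd_ge0.
by field.
Qed.

Lemma gs_coord_null n k u : gs_span n u -> (n <= k)%N -> gs_coord k u = 0.
by move=> Hu nk;apply: gs_coord0;exact: gs_span_le Hu. Qed.

(** The factor 2 comes from polarisation: [B u u = 2 * M u]. *)
Lemma gs_energy n u : gs_span n u -> 2 * M u = \sum_(k < n) gs_coord k u ^+ 2.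
move=> Hu;have E : forall k, B u u = \sum_(i < k) gs_coord i u ^+ 2 + gs_form k u u.
 elim=> [|k IH];first by rewrite big_ord0 add0r. by rewrite big_ord_recr gs_formS IH expr2 /=;ring.
have := E n;rewrite Hu addr0=> <-;rewrite /B;have := M_par u u;rewrite subrr M0=> H;lra.
Qed.

End GramSchmidt.

(** * Gaussian averages of trigonometric polynomials *)

Section GaussTrig.
Context {R} {U : set_system nat} (UU : UltraFilter U) (Uoo : forall n : nat, U [set m | (n <= m)%N]) {Y : zmodType}.
Variables (e : nat -> Y -> R) (S : nat -> set Y) (M : Y -> R).
Hypotheses (eD : forall k u v, e k (u + v) = e k u + e k v)
 (e_energy : forall n u, S n u -> 2 * M u = \sum_(k < n) e k u ^+ 2).

(** The additive function on [Y] with Gram-Schmidt coordinates [z]. For random [z] its exponential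
    [chi] imitates evaluation at a random point of X. *)
Definition lam n (z : nat -> R) u : R := \sum_(k < n) z k * e k u.

Lemma lamD n z u v : lam n z (u + v) = lam n z u + lam n z v.
by rewrite /lam -big_split;eqsum k;rewrite eD mulrDr. Qed.

Lemma lam_lin n (a b : R) z z' u : lam n (fun k => a * z k + b * z' k) u = a * lam n z u + b * lam n z' u.
by rewrite /lam !mulr_sumr -big_split;eqsum k=> /=;ring. Qed.

Definition chi n z : Y -> R[i] := fun u => cis (lam n z u).

Lemma chi_unitary n z : unitary_hom (chi n z).
by split=> [u|u v];rewrite /chi ?norm_cis // lamD cisD. Qed.

Lemma unitary_homM (f h : Y -> R[i]) : unitary_hom f -> unitary_hom h -> unitary_hom (fun u => f u * h u).
move=> [f1 fD] [h1 hD];split;first by move=> u;rewrite normrM f1 h1 mulr1.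
by move=> u v;rewrite fD hD mulrACA.
Qed.

(** By [gauss_cos] and [e_energy], on [S n] the phases have the transform exp(- M u) times the phase
    of the mean: that of the Gaussian law on X, shifted by [ts]. *)
Lemma gauss_re n ts (t1 : forall k, `|ts k| <= 1) (c : R[i]) u : S n u ->
 gauss U n ts (fun z => Re (c * chi n z u)) = Re (c * ((expR (- M u))%:C)%C * chi n ts u).
case: c=> a b Su.
have [gb gl gm gc] := gauss_prop UU n t1.
have bc s : bdd (fun z : nat -> R => cos (s + \sum_(k < n) z k * e k u)).
 by exists 1=> z;exact: cos_bounded.
have -> : (fun z => Re (Complex a b * chi n z u)) =
  fun z => a * cos (0 + \sum_(k < n) z k * e k u) + b * cos (pi / 2 + \sum_(k < n) z k * e k u).
 ext z;rewrite add0r [pi / 2 + _]addrC cosDpihalf /=;ring.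
rewrite (gl a b _ _ (bc 0) (bc (pi / 2))).
rewrite (gauss_cos UU Uoo n 0 (fun k => e k u) t1) (gauss_cos UU Uoo n (pi / 2) (fun k => e k u) t1) add0r.
have -> : - \sum_(k < n) e k u ^+ 2 / 2 = - M u.
 by rewrite -mulr_suml -(e_energy Su);congr (- _);field.
rewrite addrC [pi / 2 + _]addrC cosDpihalf /=;ring.
Qed.

Lemma gauss_trig n ts (t1 : forall k, `|ts k| <= 1) (L : seq (R[i] * Y)) : (forall p, p \in L -> S n p.2) ->
 gauss U n ts (fun z => trig_eval L (chi n z)) = \sum_(p <- L) Re (p.1 * ((expR (- M p.2))%:C)%C * chi n ts p.2).
have [gb gl gm gc] := gauss_prop UU n t1.
have bt (p : R[i] * Y) : bdd (fun z => Re (p.1 * chi n z p.2)).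
 exists (Re `|p.1|) => z. have := normc_ge_Re (p.1 * chi n z p.2);rewrite normrM (chi_unitary n z).1 mulr1.
 by rewrite lecE=> /andP[_].
rewrite /trig_eval;elim: L=> [|p L IH] SL.
 by under [X in gauss _ _ _ X]eq_fun do rewrite big_nil;rewrite big_nil gc.
under [X in _ _ _ X]eq_fun do rewrite big_cons.
have bs : bdd (fun z => \sum_(j <- L) Re (j.1 * chi n z j.2)).
 elim: L {IH SL}=> [|q L [K HK]].
  by exists 0=> z;rewrite big_nil normr0.
 have [K' HK'] := bt q;exists (K' + K)=> z;rewrite big_cons. by rewrite (le_trans (ler_normD _ _)) // lerD.
have := gl 1 1 _ _ (bt p) bs;under [X in _ X = _]eq_fun do rewrite !mul1r.
move=> ->;rewrite !mul1r big_cons IH;last by move=> q qL;apply: SL;rewrite inE qL orbT.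
by rewrite gauss_re //;apply: SL;rewrite inE eqxx.
Qed.

End GaussTrig.

Section TrigExpectation.
Context {R} {X : topologicalZmodType}.
Local Notation Y := (character R X).
Hypothesis cX : @second_countable X.

Definition evalc (x : X) : Y -> R[i] := fun y => y x.

Lemma evalc_unitary x : unitary_hom (evalc x).
by split=> [y|u v];rewrite /evalc ?char_norm. Qed.

Lemma Ex_trig (mu : prob X R) (L : seq (R[i] * Y)) (theta : Y -> R[i]) :
 bm (fun x : borel X => trig_eval L (fun y => evalc x y * theta y)) /\
 Ex mu (fun x : borel X => trig_eval L (fun y => evalc x y * theta y)) =
 \sum_(p <- L) Re (p.1 * cf mu p.2 * theta p.2).
have H (p : R[i] * Y) : bmC (fun x : borel X => p.1 * theta p.2 * p.2 x).
 by apply: bmC_mul;[exact: bmC_cst|exact: bmC_char].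
have E (p : R[i] * Y) : Ex mu (fun x : borel X => Re (p.1 * (evalc x p.2 * theta p.2))) =
  Re (p.1 * cf mu p.2 * theta p.2).
 rewrite mulrAC -CxZ;last exact: bmC_char. by rewrite /Cx /=;congr Ex;ext x;rewrite /evalc mulrA mulrAC.
have b (p : R[i] * Y) : bm (fun x : borel X => Re (p.1 * (evalc x p.2 * theta p.2))).
 have [+ _] := H p;congr bm;ext x;by rewrite mulrA mulrAC.
split;first exact: bm_sum.
by rewrite /trig_eval Ex_sum //;eqsum p.
Qed.

End TrigExpectation.

(** * Separating sequences, compactness and tightness *)

Section Separation.
Context {R} {X : topologicalZmodType}.
Hypotheses (hX : hausdorff_space X) (cX : @second_countable X) (lX : locally_compact [set: X]).
Local Notation Y := (character R X).

Definition separating (ys : nat -> Y) := forall x : X, (forall i, ys i x = 1) -> x = 0.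

(** One character is nontrivial on a whole basic neighbourhood, so a countable base needs only
    countably many. *)
Lemma separating_sequence : exists ys : nat -> Y, separating ys.
have [B /countable_injP[f finj] [Bo Bb]] := cX.
have /choice[ys Hys] : forall n, exists y : Y, forall W z, B W -> f W = n ->
  (forall x, W x -> (z : Y) x != 1) -> forall x, W x -> y x != 1.
 move=> n;have [[W [z [BW fW Wz]]]|nW] := pselect (exists W (z : Y), [/\ B W, f W = n & forall x, W x -> z x != 1]).
  exists z=> W' z' BW' fW';have -> // : W' = W. by apply: finj;[exact: mem_set|exact: mem_set|rewrite fW fW'].
 by exists 0=> W z BW fW Wz;exfalso;apply: nW;exists W, z.
exists ys=> x Hx;apply/eqP/negPn/negP=> x0.
have [z zx] := @characters_separate R X x hX lX cX x0.
have oz : nbhs x [set t | z t != 1].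
 apply: open_nbhs_nbhs;split=> //. rewrite (_ : [set t | _] = z @^-1` [set w : C R | w != 1]);last by [].
 apply: open_comp;first by move=> t _;exact: char_continuous.
 rewrite (_ : [set w : C R | w != 1] = ~` [set 1]);last by apply/seteqP;split=> w /eqP.
 by apply: closed_openC;apply: accessible_closed_set1;apply: hausdorff_accessible;exact: norm_hausdorff.
have [W [BW Wx] Wz] := Bb x _ oz.
by have := Hys (f W) W z BW erefl Wz x Wx;rewrite Hx eqxx.
Qed.

Lemma nat_ultrafilter : exists U : set_system nat, UltraFilter U /\ forall n, U [set m | (n <= m)%N].
have [U [UU HU]] := @ultraFilterLemma _ \oo;exists U;split=> // n;apply: HU.
by exists n.
Qed.

Lemma compact_ultra (U : set_system nat) (K : set X) (x_ : nat -> X) : UltraFilter U -> compact K ->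
 (forall n, K (x_ n)) -> exists2 x, K x & x_ n @[n --> U] --> x.
move=> UU cK Kx;have [x Hx] := ultra_fmap_cvg UU cK Kx;exists x=> //.
have clK := compact_closed hX cK;apply: clK=> V /Hx UV.
have : U (x_ @^-1` V) by exact: UV.
by move=> /filter_ex[n Vn];exists (x_ n).
Qed.

Lemma complex_lim_eq (U : set_system nat) (u : nat -> C R) (v w : C R) (r : nat -> R) : UltraFilter U ->
 (forall n, U [set m | (n <= m)%N]) -> u n @[n --> U] --> v -> r n @[n --> \oo] --> 0 ->
 (exists n0, forall n, (n0 <= n)%N -> (`|u n - w| <= (r n)%:C)%C) -> v = w.
move=> UU Uoo uv r0 [n0 H].
have Re_eq (p : C R -> R) : continuous p -> (forall z : C R, `|p z - p w| <= Re `|z - w|) -> p v = p w.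
 move=> pc pl;apply: (ultra_eq UU (u := fun n => p (u n)));first exact: (continuous_cvg _ (pc v) ).
 apply/(@cvgrPdist_le )=> e e0. have H1 := cvg_along UU Uoo r0. have U1 : U [set n | `|0 - r n| <= e].
  by move/(@cvgrPdist_le _ R^o) : H1=> /(_ e e0).
 apply: filterS (filterI U1 (Uoo n0))=> n [/= n1 n2].
 rewrite distrC;apply: le_trans (pl _) _;have := H n n2;rewrite lecE=> /andP[_ /= h].
 by apply: le_trans h _;apply: le_trans (ler_norm _) _;rewrite -normrN -sub0r.
have Re1 (z : R[i]) : `|Re z| <= Re `|z| /\ `|Im z| <= Re `|z|.
 case: z=> b;split;by rewrite -sqrtr_sqr ler_wsqrtr // ?lerDl ?lerDr sqr_ge0.
apply: eqC.
 apply: (Re_eq );first exact: Re_continuous. move=> z;have [ ] := Re1 (z - w);by case: (z) (w)=> a b [].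
apply: (Re_eq );first exact: Im_continuous.
move=> z;have [ ] := Re1 (z - w);by case: (z) (w)=> a b [].
Qed.

(** Approximate solutions of the first [n] equations accumulate, in the compact set, at an exact
    solution of all of them. *)
Lemma compact_solve (ys : nat -> Y) (K : set X) (w : nat -> C R) (r : nat -> R) : compact K ->
 r n @[n --> \oo] --> 0 -> (forall n, exists2 x, K x & forall i, (i < n)%N -> (`|ys i x - w i| <= (r n)%:C)%C) ->
 exists2 x, K x & forall i, ys i x = w i.
move=> cK r0 H.
have /choice[x_ Hx] : forall n, exists x, K x /\ forall i, (i < n)%N -> (`|ys i x - w i| <= (r n)%:C)%C.
 by move=> n;have [x Kx Hx] := H n;exists x.
have [U [UU Uoo]] := nat_ultrafilter.
have [x Kx xU] := compact_ultra UU cK (fun n => (Hx n).1);exists x=> // i.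
apply: (complex_lim_eq (u := fun n => ys i (x_ n)) UU Uoo _ r0).
 exact: (continuous_cvg _ (@char_continuous _ _ (ys i) x) xU).
by exists i.+1=> n ni;apply: (Hx n).2.
Qed.

Lemma invn_cvg0 : ((n.+1%:R : R)^-1) @[n --> \oo] --> (0 : R).
exact: cvg_harmonic. Qed.

(** A limit of counterexamples would be a point at which all [ys] equal 1, hence 0, while staying
    outside [V]. *)
Lemma separating_small (ys : nat -> Y) (K V : set X) : separating ys -> compact K -> nbhs 0 V ->
 exists n : nat, forall x, K x -> (forall i, (i < n)%N -> (`|ys i x - 1| <= ((n.+1%:R : R)^-1)%:C)%C) -> V x.
move=> sep cK V0;apply: contrapT=> /forallNP H.
have /choice[x_ Hx] : forall n, exists x, [/\ K x, ~ V x &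
  forall i, (i < n)%N -> (`|ys i x - 1| <= ((n.+1%:R : R)^-1)%:C)%C].
 move=> n;have := H n;apply: contra_notP=> /forallNP Hn x Kx Hi. by apply: contrapT=> nV;apply: (Hn x).
have [U [UU Uoo]] := nat_ultrafilter.
have Kx n : K (x_ n) by have [] := Hx n.
have [x _ xU] := compact_ultra UU cK Kx.
have x0 : x = 0.
 apply: sep=> i;apply: (complex_lim_eq (u := fun n => ys i (x_ n)) UU Uoo _ invn_cvg0).
  exact: (continuous_cvg _ (@char_continuous _ _ (ys i) x) xU).
 by exists i.+1=> n ni;have [_ _] := Hx n;apply.
have : U (x_ @^-1` V) by apply: xU;rewrite x0.
by move=> /filter_ex[n];have [] := Hx n.
Qed.

Lemma sigma_compact : exists C_ : nat -> set X,
 [/\ forall n, compact (C_ n), forall n, C_ n `<=` C_ n.+1 & forall x, exists n, C_ n x].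
have [C C0 [cC clC]] := @lX 0 I.
have {}C0 : nbhs (0 : X) C.
 have : nbhs (0 : X) (fun t => [set: X] t -> C t) := C0. by apply: filterS=> t;apply.
have [x_ Hx] := dense_sequence cX.
pose D i := [set x | C (x - x_ i)].
exists (fun n => \big[setU/set0]_(i < n) D i);split.
- by move=> n;apply: bigsetU_compact=> i _;exact: compact_shift.
- by move=> n x;rewrite big_ord_recr /=;left.
- move=> x;have [|i Vi] := Hx [set t | C (x - t)]° (open_interior _).
  exists x;apply: (nbhs_opp (U := fun t => C (x + t)))=> //.
  have := @nbhs_shift X (- x) x C;rewrite addNr=> /(_ C0). by apply: filterS=> t;rewrite /= addrC.
 by exists i.+1;rewrite big_ord_recr /=;right;exact: (interior_subset Vi).
Qed.

Lemma tight (mu : prob X R) (e : R) : 0 < e ->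
 exists K : set X, [/\ compact K, measurable (K : set (borel X)) & 1 - e <= Ex mu (fun x => \1_(K : set (borel X)) x)].
move=> e0;have [C_ [cC CS Cx]] := sigma_compact.
have mC n : measurable (C_ n : set (borel X)) by apply: closed_borel;exact: compact_closed.
have [_ H] : bm (fun _ : borel X => 1 : R) /\ Ex mu (fun x => \1_(C_ n : set (borel X)) x) @[n --> \oo] --> Ex mu (fun=> 1 : R).
 apply: (@Ex_dominated _ _ _ mu (fun n x => \1_(C_ n : set X) x) _ 1).
 - by move=> n;exact: bm_ind.
 - by move=> n x;rewrite indicE ger0_norm // lern1 leq_b1.
 - move=> x;have [n0 Hn] := Cx x;apply: cvg_near_cst;exists n0=> // n /= nn.
  rewrite indicE mem_set //.
  by elim: n nn=> [|n IH];[rewrite leqn0=> /eqP <-|rewrite leq_eqVlt => /orP[/eqP <- //|nn];apply: CS;exact: IH].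
rewrite Ex_cst in H.
move/(@cvgrPdist_le ) : H=> /(_ e e0) [n _ /(_ n (leqnn n)) H].
by exists (C_ n);split=> //;move: H=> /=;rewrite ler_norml=> /andP[_];lra.
Qed.

End Separation.

Lemma sqr_le {R : realType} (q c : R) : - c <= q -> q <= c -> q ^+ 2 <= c ^+ 2.
by move=> h1 h2;rewrite -subr_ge0 subr_sqr mulr_ge0 //;lra. Qed.

Lemma expR_sqr_le4 {R : realType} (t : R) : `|t| <= 1 -> expR (t ^+ 2) <= 4.
move=> t1;have t21 : t ^+ 2 <= 1 by rewrite -real_normK ?num_real // expr_le1.
have E2 : expR (t ^+ 2 / 2) <= 2.
 have := @expR_ge1Dx R (- (t ^+ 2 / 2));rewrite expRN=> Hx. have ep := expR_gt0 (t ^+ 2 / 2).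
 have : 1 / 2 <= 1 / expR (t ^+ 2 / 2) by rewrite div1r;lra. by rewrite ler_pdivlMr // => H;lra.
have -> : expR (t ^+ 2) = expR (t ^+ 2 / 2) ^+ 2 by rewrite -expRM_natl;congr expR;field.
by have := sqr_le _ E2;have := expR_gt0 (t ^+ 2 / 2)=> *;lra.
Qed.

(** The constants belong to mass 99/100 on the compact set and approximation error 1/20: 39/20 *
    99/100 - 1 >= 93/100 and 1 - (99/100)^2 <= 2/100. The bound 4 is for exp(t^2) with |t| <= 1. *)
Lemma cm_contra {R : realType} (a h E : R) : 93 / 100 <= a -> 0 <= h -> h <= 2 / 100 ->
 0 <= E -> E <= 4 -> a ^+ 2 <= E * h -> False.
move=> a1 h0 h1 E0 E1 aEh.
have : E * h <= 4 * (2 / 100) by apply: ler_pM.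
have : (93 / 100) ^+ 2 <= a ^+ 2 by rewrite lerXn2r // nnegrE;lra.
by rewrite (_ : (93 / 100) ^+ 2 = 8649 / 10000 :> R);[lra|field].
Qed.

(** * Cameron-Martin shifts and one-parameter subgroups *)

Section CameronMartin.
Context {R} {X : topologicalZmodType}.
Hypotheses (hX : hausdorff_space X) (cX : @second_countable X) (lX : locally_compact [set: X]).
Local Notation Y := (character R X).
Variables (e : nat -> Y -> R) (S : nat -> set Y) (M : Y -> R) (ys : nat -> Y).
Hypotheses (eD : forall k u v, e k (u + v) = e k u + e k v) (S_sub : forall n, subgroup (S n))
 (e_energy : forall n u, S n u -> 2 * M u = \sum_(k < n) e k u ^+ 2) (S_ys : forall i n, (i < n)%N -> S n (ys i))
 (ys_sep : separating ys) (gamma : prob X R) (cf_gamma : forall y, cf gamma y = ((expR (- M y))%:C)%C).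

(** If [K] and its translate by the phases cis(t e_k0) were [r]-apart, some trigonometric polynomial
    would be near 0 on the one and near 1 on the other. The Gaussian law and its shift by [t] in
    direction [k0] would be almost singular, against [gauss_sqr_le]. *)
Let cm_near (K : set X) (k0 : nat) (t : R) (n : nat) (r : R) : measurable (K : set (borel X)) ->
 99 / 100 <= Ex gamma (fun x => \1_(K : set (borel X)) x) -> `|t| <= 1 -> 0 < r <= 1 ->
 exists x x' : X, [/\ K x, K x' & forall i, (i < n)%N -> (`|ys i x - cis (t * e k0 (ys i)) * ys i x'| <= r%:C)%C].
move=> mK K99 t1 /andP[r0 r1];apply: contrapT=> /forallNP Hno.
have far x x' : K x -> K x' -> exists2 i, (i < n)%N & ~ (`|ys i x - cis (t * e k0 (ys i)) * ys i x'| <= r%:C)%C.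
 move=> Kx Kx';apply: contrapT=> H;apply: (Hno x);exists x';split=> // i ni.
 by apply: contrapT=> H';apply: H;exists i.
pose N := maxn n k0.+1.
pose ts k := if k == k0 then t else 0.
have ts1 k : `|ts k| <= 1 by rewrite /ts;case: ifP=> // _;rewrite normr0.
pose theta : Y -> R[i] := chi e N ts.
have theta_u : unitary_hom theta by exact: chi_unitary.
have k0N : (k0 < N)%N by rewrite /N leq_max ltnSn orbT.
have thetaE u : theta u = cis (t * e k0 u).
 rewrite /theta /chi /lam (bigD1 (Ordinal k0N)) //= /ts eqxx big1 ?addr0 // => i.
 by rewrite -val_eqE /= => /negbTE ->;rewrite mul0r.
have tsum : \sum_(k < N) ts k ^+ 2 = t ^+ 2.
 rewrite (bigD1 (Ordinal k0N)) //= /ts eqxx big1 ?addr0 // => i.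
 by rewrite -val_eqE /= => /negbTE ->;rewrite expr0n.
pose near (c : Y -> R[i]) x := forall i, (i < n)%N -> (`|c (ys i) - ys i x| <= (r / 2)%:C)%C.
pose F (c : Y -> R[i]) : R := if pselect (exists2 x, K x & near c x) then 0 else 1.
pose Bs := [set c : Y -> R[i] | exists2 x, K x & c = evalc x \/ c = (fun y => evalc x y * theta y)].
have r2 : (0 : R) < r / 2 <= 1 by apply/andP;split;lra.
have r2C : ((r / 2)%:C + (r / 2)%:C = r%:C :> R[i])%C by rewrite -rmorphD /=;congr (_%:C)%C;field.
have F0 x : K x -> F (evalc x) = 0.
 move=> Kx;rewrite /F;case: pselect=> // -[];exists x=> // i _. by rewrite /evalc subrr normr0 lecR;lra.
have F1 x : K x -> F (fun y => evalc x y * theta y) = 1.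
 move=> Kx;rewrite /F;case: pselect=> // -[x' Kx' Hn];exfalso. have [i ni []] := far _ _ Kx' Kx.
 rewrite distrC mulrC -thetaE;apply: le_trans (Hn i ni) _. by rewrite lecR;lra.
have Funi c : Bs c -> unitary_hom c.
 by move=> [x _ [->|->]];[exact: evalc_unitary|apply: unitary_homM => //;exact: evalc_unitary].
have Fb c : Bs c -> `|F c| <= 1.
 by move=> _;rewrite /F;case: pselect=> ?;rewrite ?normr0 ?normr1.
have e40 : (0 : R) < 1 / 40 by [].
have Fd c c' : Bs c -> Bs c' ->
  (forall i : 'I_n, (`|c (ys i) - c' (ys i)| <= (r / 2)%:C)%C) -> `|F c - F c'| <= 1 / 40.
 have asym c1 c2 x1 x2 : K x1 -> K x2 -> c1 = evalc x1 -> c2 = (fun y => evalc x2 y * theta y) ->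
   (forall i : 'I_n, (`|c1 (ys i) - c2 (ys i)| <= (r / 2)%:C)%C) -> False.
  move=> Kx1 Kx2 -> -> H;have [i ni []] := far _ _ Kx1 Kx2.
  have := H (Ordinal ni);rewrite /= /evalc mulrC thetaE=> /le_trans;apply. by rewrite lecR;lra.
 move=> [x Kx [cE|cE]] [x' Kx' [cE'|cE']] H.
 - by rewrite cE cE' !F0 // subrr normr0 ltW.
 - by exfalso;exact: (asym c c' x x').
 - exfalso;apply: (asym c' c x' x)=> // i;rewrite distrC;exact: H.
 - by rewrite cE cE' !F1 // subrr normr0 ltW.
have [p [[L [LS Lp]] p1 pF]] := trig_approx (S_sub N) r2 e40
 (fun i : 'I_n => S_ys (leq_trans (ltn_ord i) (leq_maxl n k0.+1))) Funi Fb Fd.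
have tp : trig_poly (S N) p by exists L.
have [L2 [L2S L2p]] := trig_poly_mul_in (S_sub N) tp tp.
pose f (x : borel X) := trig_eval L (fun y => @evalc R X x y * theta y).
have fE (x : X) : f x = p (fun y => evalc x y * theta y).
 by rewrite /f Lp //;apply: unitary_homM=> //;exact: evalc_unitary.
pose one : Y -> R[i] := fun=> 1.
pose h (x : borel X) := trig_eval L2 (fun y => @evalc R X x y * one y).
have hE (x : X) : h x = p (evalc x) ^+ 2.
 rewrite /h (_ : (fun y => _) = evalc x);first by rewrite -L2p ?expr2 //;exact: evalc_unitary.
 by ext y;rewrite /one mulr1.
have [bf Ef] := Ex_trig gamma L theta;have [bh Eh] := Ex_trig gamma L2 one.
rewrite -/f in bf Ef;rewrite -/h in bh Eh.
have b1 := @bm_ind _ _ R _ mK.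
have Ef1 : 93 / 100 <= Ex gamma f.
 have H : Ex gamma (fun x : borel X => 39 / 20 * \1_(K : set (borel X)) x + (- 1) * 1) <= Ex gamma f.
  apply: Ex_le=> //;first by apply: bm_lin=> //;exact: bm_cst.
  move=> x;rewrite fE indicE;have [Kx|nKx] := pselect (K x).
   rewrite mem_set //= !mulr1;have B : Bs (fun y => @evalc R X x y * theta y) by exists x=> //;right.
   by have := pF _ B;rewrite F1 // ler_norml=> /andP[h1 h2];lra.
  rewrite memNset // mulr0;have := p1 (fun y => @evalc R X x y * theta y).
  rewrite ler_norml=> /(_ (unitary_homM (@evalc_unitary R X x) theta_u)) /andP[h1 h2];lra.
 apply: le_trans H;rewrite Ex_lin ?Ex_cst //;last exact: bm_cst. lra.
have Eh1 : Ex gamma h <= 2 / 100.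
 have H : Ex gamma h <= Ex gamma (fun x : borel X => (- (99 / 100)) * \1_(K : set (borel X)) x + 1 * 1).
  apply: Ex_le=> //;first by apply: bm_lin=> //;exact: bm_cst.
  move=> x;rewrite hE indicE;have /p1 := @evalc_unitary R X x. rewrite ler_norml=> /andP[h1 h2].
  have [Kx|nKx] := pselect (K x).
   rewrite mem_set //=;have B : Bs (@evalc R X x) by exists x=> //;left.
   have := pF _ B;rewrite F0 // subr0 ler_norml=> /andP[h3 h4]. have := sqr_le h3 h4;lra.
  by have := sqr_le h1 h2;rewrite memNset //= expr1n;lra.
 apply: le_trans H _;rewrite Ex_lin ?Ex_cst //;last exact: bm_cst. lra.
have [U [UU Uoo]] := nat_ultrafilter.
have zero1 k : `|(fun=> 0 : R) (k : nat)| <= 1 by rewrite normr0.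
have G1 : gauss U N ts (fun z => p (chi e N z)) = Ex gamma f.
 rewrite (_ : (fun z => p (chi e N z)) = fun z => trig_eval L (chi e N z));last first.
  by ext z;rewrite Lp //;exact: chi_unitary.
 rewrite (gauss_trig UU Uoo eD e_energy ts1) // Ef;eqsum q. by rewrite cf_gamma.
have G2 : gauss U N (fun=> 0) (fun z => p (chi e N z) ^+ 2) = Ex gamma h.
 rewrite (_ : (fun z => _) = fun z => trig_eval L2 (chi e N z));last first.
  by ext z;rewrite -L2p ?expr2 //;exact: chi_unitary.
 rewrite (gauss_trig UU Uoo eD e_energy zero1) // Eh;eqsum q. rewrite cf_gamma /one /chi;congr (Re (_ * _)).
 rewrite /lam big1 ?/cis ?cos0 ?sin0 // => i _;exact: mul0r.
have bp : bdd (fun z => p (chi e N z)).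
 by exists 1=> z;apply: p1;exact: chi_unitary.
have := gauss_sqr_le UU N ts1 bp;rewrite G1 G2 tsum=> CS.
have ex4 := expR_sqr_le4 t1.
have h0 : 0 <= Ex gamma h by apply: Ex_ge0=> // x;rewrite hE sqr_ge0.
exact: (cm_contra Ef1 h0 Eh1 (expR_ge0 _) ex4 CS).
Qed.

(** The differences x - x' stay in the compact set K - K, the same for all [k] and [t], so that
    [compact_solve] makes the phases exact. *)
Lemma cm_points : exists C : set X, compact C /\ forall k t, `|t| <= 1 ->
 exists2 x, C x & forall i, ys i x = cis (t * e k (ys i)).
have e100 : (0 : R) < 1 / 100 by [].
have [K [cK mK K99]] := tight hX cX lX gamma e100.
exists [set x + y | x in K & y in [set z | K (- z)]];split.
 by apply: compact_add=> //;exact: compact_opp.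
move=> k t t1.
apply: (compact_solve hX (r := fun n => n.+1%:R^-1));last 1 first.
- move=> n;have [||x [x' [Kx Kx' H]]] := @cm_near K k t n (n.+1%:R^-1) mK _ t1.
 + lra.
 + by rewrite invr_gt0 ltr0n invf_le1 ?ltr0n // ler1n.
 exists (x - x');first by exists x=> //;exists (- x')=> //=;rewrite opprK. move=> i ni;apply: le_trans (H i ni).
 have y1 : `|ys i x'| = 1 by exact: char_norm. rewrite -[leLHS]mulr1 -[X in _ * X]y1 -normrM mulrBl -charD subrK //.
- by apply: compact_add=> //;exact: compact_opp.
- exact: invn_cvg0.
Qed.

(** Larger parameters are reached by multiples of points with |t| <= 1. Additivity in [t] holds
    because [ys] separates points. *)
Lemma one_parameter : exists (C : set X) (c : nat -> R -> X), [/\ compact C,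
 forall k t, `|t| <= 1 -> C (c k t), forall k t s, c k (t + s) = c k t + c k s &
 forall k t i, ys i (c k t) = cis (t * e k (ys i))].
have [C [cC HC]] := cm_points.
have H k t : exists x : X, (`|t| <= 1 -> C x) /\ forall i, ys i x = cis (t * e k (ys i)).
 have [t1|t1] := leP `|t|;first by have [x Cx Hx] := HC k t t1;exists x. pose m := (Num.truncn `|t|).+1.
 have m0 : (0 : R) < m%:R by []. have [|x Cx Hx] := HC k (t / m%:R).
  by rewrite normrM normfV [X in _ / X]ger0_norm // ler_pdivrMr // mul1r ltW //;exact: truncnS_gt.
 exists (x *+ m);split=> [//|i]. have -> : t * e k (ys i) = (t / m%:R * e k (ys i)) *+ m.
  by rewrite -[RHS]mulr_natr;field;rewrite gt_eqF.
 rewrite cisMn -Hx;elim: (m)=> [|q IH];first by rewrite char0. by rewrite mulrS charD IH exprS.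
have /choice[c' Hc'] : forall kt : nat * R, exists x : X,
  (`|kt.2| <= 1 -> C x) /\ forall i, ys i x = cis (kt.2 * e kt.1 (ys i)) by [].
pose c k t := c' (k, t);have Hc k t := Hc' (k, t);rewrite /= in Hc.
exists C, c;split=> //.
- by move=> k t;exact: (Hc k t).1.
- move=> k t s;apply: subr0_eq;apply: ys_sep=> i.
 rewrite charD (Hc k (t + s)).2 mulrDl cisD. have -> : ys i (- (c k t + c k s)) = (ys i (c k t + c k s))^-1.
  by apply: (mulfI (char_neq0 (ys i) (c k t + c k s)));rewrite -charD subrr char0 mulfV // char_neq0.
 by rewrite charD !(Hc k _).2 mulfV // -cisD -normr_eq0 norm_cis oner_neq0.
- by move=> k t i;exact: (Hc k t).2.
Qed.

End CameronMartin.

(** * Deciding identities in abelian groups by reflection *)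

Section ZmodReflection.
Variable X : zmodType.

Inductive zexp := ZVar of nat | ZZero | ZAdd of zexp & zexp | ZOpp of zexp.

Fixpoint zeval (env : seq X) e : X := match e with
 | ZVar n => env`_n | ZZero => 0 | ZAdd a b => zeval env a + zeval env b | ZOpp a => - zeval env a end.

Fixpoint zcoef e (i : nat) : int := match e with
 | ZVar n => (n == i)%:Z | ZZero => 0 | ZAdd a b => zcoef a i + zcoef b i | ZOpp a => - zcoef a i end.

Lemma zevalE env e : zeval env e = \sum_(i < size env) env`_i *~ zcoef e i.
elim: e=> [n||a IHa b IHb|a IH] /=.
- have [nlt|nge] := ltnP n (size env).
  rewrite (bigD1 (Ordinal nlt)) //= eqxx big1 ?addr0 // => i.
  by rewrite -val_eqE /= eq_sym=> /negbTE ->;rewrite mulr0z.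
 rewrite nth_default // big1 // => i _.
 by rewrite (_ : (n == i) = false) ?mulr0z //;apply/eqP=> E;move: (ltn_ord i);rewrite -E ltnNge nge.
- by rewrite big1 // => i _;rewrite mulr0z.
- by rewrite IHa IHb -big_split;eqsum i;rewrite mulrzDr.
- by rewrite IH -sumrN;eqsum i;rewrite mulrNz.
Qed.

Lemma zmod_correct env a b : all (fun i => zcoef a i == zcoef b i) (iota 0 (size env)) -> zeval env a = zeval env b.
move=> /allP H;rewrite !zevalE;eqsum i;congr (_ _).
by apply/eqP/H;rewrite mem_iota add0n ltn_ord.
Qed.

End ZmodReflection.

Ltac zindex x l := match l with | (x :: _)%SEQ => constr:(0%N)
 | (_ :: ?l')%SEQ => let n := zindex x l' in constr:(S n) end.
Ltac zinsert x l := match l with | _ => let n := zindex x l in l | _ => constr:((x :: l)%SEQ) end.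
Ltac zatoms t l := match t with | (?a + ?b)%R => let l1 := zatoms a l in zatoms b l1 | (- ?a)%R => zatoms a l
 | 0%R => l | _ => zinsert t l end.
Ltac zreify t l := match t with | (?a + ?b)%R => let a' := zreify a l in let b' := zreify b l in constr:(ZAdd a' b')
 | (- ?a)%R => let a' := zreify a l in constr:(ZOpp a') | 0%R => constr:(ZZero)
 | _ => let n := zindex t l in constr:(ZVar n) end.
(* Decides equalities that hold in every abelian group. *)
Ltac zmod := match goal with | |- @eq ?T ?a ?b => let l0 := zatoms a (@nil T) in let l := zatoms b l0 in
  let ea := zreify a l in let eb := zreify b l in exact (@zmod_correct _ l ea eb isT) end.

(** * Finitely generated subgroups and extension of homomorphisms *)

Section IntegerSpan.
Context {X : zmodType}.

Lemma subgroupN (H : set X) x : subgroup H -> H x -> H (- x).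
by move=> [H0 HB] Hx;rewrite -sub0r;exact: HB. Qed.

Lemma subgroupD (H : set X) x y : subgroup H -> H x -> H y -> H (x + y).
by move=> sH Hx Hy;rewrite -[y]opprK;apply: sH.2=> //;exact: subgroupN. Qed.

Lemma subgroupMn (H : set X) x n : subgroup H -> H x -> H (x *+ n).
move=> sH Hx;elim: n=> [|n IH];first by rewrite mulr0n;exact: sH.1.
by rewrite mulrS;exact: subgroupD.
Qed.

Fixpoint zspan (zs : seq X) : set X :=
 if zs is z :: zs' then [set x | exists m : int, zspan zs' (x - z *~ m)] else [set 0].

Lemma zspan_subgroup zs : subgroup (zspan zs).
elim: zs=> [|z zs IH] /=;first by split=> // x y -> ->;rewrite subrr.
split;first by exists 0;rewrite mulr0z subr0;exact: IH.1.
move=> x y [m Hm] [n Hn];exists (m - n).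
have -> : x - y - z *~ (m - n) = (x - z *~ m) - (y - z *~ n).
 by rewrite mulrzBr;zmod.
exact: IH.2.
Qed.

Lemma zspan_mem zs z : z \in zs -> zspan zs z.
elim: zs=> [//|w zs IH];rewrite inE=> /orP[/eqP ->|/IH Hz] /=.
 by exists 1;rewrite mulr1z subrr;exact: (zspan_subgroup zs).1.
by exists 0;rewrite mulr0z subr0.
Qed.

End IntegerSpan.

Section HomExtension.
Context {X : zmodType} {R : realType}.
Variables (X0 : set X) (phi : X -> R).
Hypotheses (sX0 : subgroup X0) (phiD : forall x y, X0 x -> X0 y -> phi (x + y) = phi x + phi y).

Let P (G : set (X * R)) : Prop := G = set0 \/ [/\ forall x, X0 x -> G (x, phi x),
   forall p q, G p -> G q -> G (p.1 - q.1, p.2 - q.2) & forall t : R, G (0, t) -> t = 0].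

Lemma hom_extension : exists L : X -> R, (forall x y, L (x + y) = L x + L y) /\ (forall x, X0 x -> L x = phi x).
have phi0 : phi 0 = 0 by have := phiD sX0.1 sX0.1;rewrite addr0=> H;lra.
have phiB x y : X0 x -> X0 y -> phi (x - y) = phi x - phi y.
 move=> Hx Hy;have := phiD (sX0.2 _ _ Hx Hy) Hy;rewrite subrK=> ->;ring.
pose G0 : set (X * R) := [set p | X0 p.1 /\ p.2 = phi p.1].
have PG0 : P G0.
 right;split=> //;last by move=> t [_ /= ->].
 by move=> [x s] [y t] [/= Hx ->] [/= Hy ->];split=> //=;[exact: sX0.2|rewrite phiB].
have [|A [PA Amax]] := @Zorn_bigcup _ P.
 move=> F FP tF;have [[B [FB B0]]|nF] := pselect (exists B, F B /\ B !=set0);last first.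
  left;apply/seteqP;split=> // p [B FB Bp];apply: nF;exists B;split=> //;by exists p.
 right;have PB C : F C -> C !=set0 -> [/\ forall x, X0 x -> C (x, phi x),
   forall p q, C p -> C q -> C (p.1 - q.1, p.2 - q.2) & forall t : R, C (0, t) -> t = 0].
  by move=> FC [p Cp];have [C0|//] := FP C FC;rewrite C0 in Cp.
 split.
 - by move=> x Hx;exists B=> //;have [+ _ _] := PB B FB B0;apply.
 - move=> p q [C FC Cp] [D FD Dq];have [CD|DC] := tF C D FC FD.
   by exists D=> //;have [_ + _] := PB D FD (ex_intro _ q Dq);apply=> //;exact: CD.
  by exists C=> //;have [_ + _] := PB C FC (ex_intro _ p Cp);apply=> //;exact: DC.
 - by move=> t [C FC C0t];have [_ _ +] := PB C FC (ex_intro _ (0, t) C0t);apply.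
have [AX AB A0] : [/\ forall x, X0 x -> A (x, phi x),
   forall p q, A p -> A q -> A (p.1 - q.1, p.2 - q.2) & forall t : R, A (0, t) -> t = 0].
 case: PA=> // A0;exfalso;apply: (Amax G0)=> //;rewrite A0;split;first exact: sub0set.
 by move=> /(_ (0, phi 0));apply;split=> //=;exact: sX0.1.
have A00 : A (0, 0) by have := AX 0 sX0.1;rewrite phi0.
have AD p q : A p -> A q -> A (p.1 + q.1, p.2 + q.2).
 move=> Ap Aq;have := AB _ _ A00 Aq;rewrite !sub0r=> /(AB _ _ Ap) /=. by rewrite !opprK.
have AMn x s n : A (x, s) -> A (x *+ n, s *+ n).
 by move=> H;elim: n=> [|n IH];rewrite ?mulr0n // !mulrS;exact: (AD (x, s) (x *+ n, s *+ n)).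
have AMz x s (m : int) : A (x, s) -> A (x *~ m, s *~ m).
 move=> H;case: m=> n;first exact: AMn.
 by rewrite NegzE !mulrNz;have := AB _ _ A00 (AMn x s n.+1 H);rewrite /= !sub0r.
have Auniq x s t : A (x, s) -> A (x, t) -> s = t.
 move=> H1 H2;have := AB _ _ H1 H2;rewrite /= subrr=> /A0;lra.
suff dom x : exists s : R, A (x, s).
 have /choice[L HL] : forall x, exists s : R, A (x, s) by [].
 exists L;split;last by move=> x Hx;apply: (Auniq x)=> //;exact: AX.
 by move=> x y;apply: (Auniq (x + y))=> //;exact: (AD _ _ (HL x) (HL y)).
apply: contrapT=> nx.
(* The value at [x] is forced, by division in R, once a nonzero multiple of [x] lies in the domain;
   otherwise it is free, and 0 will do. *)
have [t Ht] : exists t : R, forall (m : int) s, A (x *~ m, s) -> s = t *~ m.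
 have [[m [s [m0 Hm]]]|nm] := pselect (exists (m : int) s, m != 0 /\ A (x *~ m, s)).
  have mR : (m%:~R : R) != 0 by rewrite intr_eq0. exists (s / m%:~R)=> n r Hn.
  have := Auniq _ _ _ (AMz _ _ m Hn) (eq_ind _ (fun a => A (a, s *~ n)) (AMz _ _ n Hm) _ _).
  rewrite -!mulrzA [m * n]mulrC=> /(_ erefl) E. rewrite -mulrzr mulrAC -[r](mulfK mR) mulrzr E mulrzr //.
 exists 0=> m s Hm;have [m0|m0] := eqVneq m 0;last by exfalso;apply: nm;exists m, s.
 by move: Hm;rewrite m0 mulr0z mul0rz=> /A0.
pose A' : set (X * R) := [set p | exists m : int, A (p.1 - x *~ m, p.2 - t *~ m)].
apply: (Amax A').
 split.
  by move=> [y s] Ay;exists 0;rewrite /= !mulr0z !subr0.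
 move=> H;apply: nx;exists t;apply: H. by exists 1;rewrite /= !mulr1z !subrr.
right;split.
- by move=> y Hy;exists 0;rewrite /= !mulr0z !subr0;exact: AX.
- move=> [y s] [y' s'] [m Hm] [m' Hm'];exists (m - m')=> /=.
 have := AB _ _ Hm Hm'=> /=;congr A;congr pair.
  by rewrite mulrzBr;zmod.
 by rewrite mulrzBr;ring.
- move=> s [m];rewrite sub0r=> /(AB _ _ A00);rewrite /= !sub0r !opprK opprB=> /Ht;lra.
Qed.

End HomExtension.

(** * Weil's lemma on cyclic subgroups, relative to a subgroup *)

Section Weil.
Context {R} {X : topologicalZmodType}.
Hypothesis hX : hausdorff_space X.

Lemma nbhs0_split (U : set X) : nbhs 0 U -> exists W : set X, [/\ nbhs 0 W, (forall x, W x -> W (- x)) &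
 forall x y z, W x -> W y -> W z -> U (x + y + z)].
move=> U0;have [V [V0 VN VB]] := nbhs0_sub U0;have [W [W0 WN WB]] := nbhs0_sub V0.
exists W;split=> // x y z Wx Wy Wz.
have Vxy : V (x + y) by rewrite -[y]opprK;apply: WB=> //;exact: WN.
have Vz : V (- z) by rewrite -sub0r;apply: WB=> //;exact: nbhs_singleton.
by rewrite -[z]opprK;exact: VB.
Qed.

Variables (H : set X) (z : X) (C : set X).
Hypotheses (sH : subgroup H) (cC : compact C).
Hypothesis unb : forall b : nat, exists m : int, (b < `|m|)%N /\ exists2 c, C c & H (z *~ m - c).

(** Two exponents far apart have nearly equal positions in the compact set [C]; their difference is
    a large return time. *)
Let returns (V : set X) (b : nat) : nbhs 0 V -> exists p : nat, (b < p)%N /\ exists2 v, V v & H (z *+ p - v).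
move=> V0;have [W [W0 WN WB]] := nbhs0_split V0.
have /choice[m Hm] := unb.
have /choice[c Hc] : forall n, exists c, C c /\ H (z *~ m n - c) by move=> n;have [_ [c ? ?]] := Hm n;exists c.
have [U [UU Uoo]] := nat_ultrafilter.
have [c0 _ cU] := compact_ultra hX UU cC (fun n => (Hc n).1).
have UW : U [set n | W (c n - c0)].
 by apply: (cU [set t | W (t - c0)]);apply: (@nbhs_shift X c0 (- c0) W);rewrite subrr.
have [n1 W1] := filter_ex UW.
have [n2 [/= W2 n12]] := filter_ex (filterI UW (Uoo (`|m n1| + b)%N)).
have d : (b < `|m n2 - m n1|)%N.
 have := (Hm n2).1;lia.
have Hd : H (z *~ (m n2 - m n1) - (c n2 - c n1)).
 have := sH.2 _ _ (Hc n2).2 (Hc n1).2;congr H. by rewrite mulrzBr;zmod.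
have Wd : V (c n2 - c n1) /\ V (c n1 - c n2).
 have W0' := nbhs_singleton W0;split.
  have -> : c n2 - c n1 = (c n2 - c0) + - (c n1 - c0) + 0 by zmod. by apply: WB=> //;exact: WN.
 have -> : c n1 - c n2 = (c n1 - c0) + - (c n2 - c0) + 0 by zmod. by apply: WB=> //;exact: WN.
case: (m n2 - m n1) d Hd=> [p|p] bp Hp.
 by exists p;split=> //;exists (c n2 - c n1);[exact: Wd.1|].
exists p.+1;split=> //;exists (c n1 - c n2);first exact: Wd.2.
have := subgroupN sH Hp;congr H;rewrite NegzE mulrNz pmulrn;zmod.
Qed.

(** By compactness each return to [U] modulo [H] is preceded by another whose exponent is smaller by
    at most [N]. Descending from a large return, every integer is at most [N] below some return. *)
Lemma relative_weil (U : set X) : nbhs 0 U -> compact U ->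
 exists2 C' : set X, compact C' & forall m : int, exists2 c, C' c & H (z *~ m - c).
move=> U0 cU.
pose A := [set u | U u /\ exists p : int, H (z *~ p - u)].
have [N HN] : exists N : nat, forall u, A u -> exists (q : nat), [/\ (0 < q)%N, (q <= N)%N &
  exists h, H h /\ U (u - (z *+ q + h))].
 apply: contrapT=> /forallNP Hno.
 have /choice[u_ Hu] : forall N, exists u, A u /\ forall q : nat, (0 < q)%N -> (q <= N)%N -> forall h, H h -> ~ U (u - (z *+ q + h)).
  move=> N;have := Hno N;apply: contra_notP=> /forallNP Hn u Au.
  apply: contrapT=> H1;apply: (Hn u);split=> // q q0 qN h Hh Uh;apply: H1. by exists q;split=> //;exists h.
 have [F [UF Foo]] := nat_ultrafilter. have [u Uu uF] := compact_ultra hX UF cU (fun n => (Hu n).1.1).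
 have [W [W0 WN WB]] := nbhs0_split U0. have FW : F [set n | W (u_ n - u)].
  by apply: (uF [set t | W (t - u)]);apply: (@nbhs_shift X u (- u) W);rewrite subrr.
 have [n1 W1] := filter_ex FW. have [p1 Hp1] := (Hu n1).1.2. have [p [bp [v Wv Hv]]] := returns `|p1| W0.
 have [q Eq q0] : exists2 q : nat, (q%:Z = p1 + p%:Z)%R & (0 < q)%N.
  exists `|(p1 + p%:Z)%R|%N;lia.
 have [n2 [/= W2 qn2]] := filter_ex (filterI FW (Foo q)).
 apply: ((Hu n2).2 q q0 qn2 (- ((z *~ p1 - u_ n1) + (z *+ p - v)))).
  by apply: subgroupN=> //;exact: subgroupD.
 have -> : u_ n2 - (z *+ q - (z *~ p1 - u_ n1 + (z *+ p - v))) = (u_ n2 - u) + - (u_ n1 - u) + - v.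
  rewrite (_ : z *+ q = z *~ p1 + z *+ p);last by rewrite pmulrn Eq mulrzDr. zmod.
 by apply: WB=> //;exact: WN.
exists (\big[setU/set0]_(j < N.+1) [set x | U (x + z *+ j)]).
 by apply: bigsetU_compact=> j _;exact: compact_shift.
move=> m.
have desc k : forall p : int, (m <= p)%R -> (`|p - m| <= k)%N -> (exists2 v, U v & H (z *~ p - v)) ->
  exists j : nat, (j <= N)%N /\ exists2 v, U v & H (z *~ (m + j%:Z) - v).
 elim: k=> [|k IH] p mp pk [v Uv Hv].
  exists 0%N;split=> //;exists v=> //;by have -> : m + 0%:Z = p by lia.
 have [pN|pN] := leqP `|p - m| N.
  by exists `|p - m|%N;split=> //;exists v=> //;have -> : m + `|p - m|%N%:Z = p by lia.
 have [q [q0 qN [h [Hh Uh]]]] := HN v (conj Uv (ex_intro _ p Hv)). apply: (IH (p - q%:Z));[lia|lia|].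
 exists (v - (z *+ q + h))=> //. have -> : z *~ (p - q%:Z) - (v - (z *+ q + h)) = (z *~ p - v) + h.
  by rewrite mulrzBr [z *+ q]pmulrn;zmod.
 exact: subgroupD.
have [p [bp [v Uv Hv]]] := returns `|m| U0.
have [|||j [jN [w Uw Hw]]] := desc `|p%:Z - m|%N p%:Z;[lia|done|by exists v|].
exists (w - z *+ j).
 by rewrite -(bigcup_mkord _ (fun j => [set x | U (x + z *+ j)]));exists j=> //=;rewrite subrK.
have -> : z *~ m - (w - z *+ j) = z *~ (m + j%:Z) - w by rewrite mulrzDr [z *+ j]pmulrn;zmod.
exact: Hw.
Qed.

End Weil.

Lemma absz_step (a b c e : int) (m n : nat) : (absz (b - e)%R <= m)%N ->
 (absz (a + b - c)%R <= n)%N -> (absz (c - (e + a))%R <= n + m)%N.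
lia. Qed.

(** * Compact open subgroups *)

Section CompactlyGenerated.
Context {R} {X : topologicalZmodType}.
Hypothesis hX : hausdorff_space X.

Lemma additive_continuous (L : X -> R) (V : set X) (b : R) : (forall x y, L (x + y) = L x + L y) ->
 nbhs 0 V -> (forall x, V x -> `|L x| <= b) -> continuous L.
move=> LD V0 Vb x;apply/(@cvgrPdist_le )=> e e0.
have LMn y n : L (y *+ n) = L y *+ n.
 elim: n=> [|n IH];last by rewrite !mulrS LD IH. by rewrite !mulr0n;have := LD 0 0;rewrite addr0=> H;lra.
have LB y y' : L (y - y') = L y - L y' by have := LD (y - y') y';rewrite subrK=> ->;ring.
pose n := (Num.truncn (b / e)).+1.
have nb : b <= n%:R * e by rewrite -ler_pdivrMr // ltW //;exact: truncnS_gt.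
have Vn : forall n, nbhs 0 [set y : X | V (y *+ n)].
 elim=> [|k IH];first by apply: filterS filterT=> y _ /=;rewrite mulr0n;exact: nbhs_singleton V0.
 suff : forall k (W : set X), nbhs 0 W -> nbhs 0 [set y : X | W (y *+ k)] by move=> H;exact: (H k.+1).
 elim=> [|j IHj] W W0;first by apply: filterS filterT=> y _ /=;rewrite mulr0n;exact: nbhs_singleton.
 have [W' [W'0 _ W'D]] := nbhs0_split W0. apply: filterS (filterI W'0 (IHj W' W'0))=> y [/= Wy Wjy].
 by rewrite mulrS -[y + _]addr0;apply: W'D=> //;exact: nbhs_singleton W'0.
have : nbhs x [set y | V ((y - x) *+ n)].
 by apply: (@nbhs_shift X x (- x) [set y | V (y *+ n)]);rewrite subrr.
apply: filterS=> y /Vb;rewrite LMn LB -mulr_natl normrM ger0_norm // distrC=> H.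
have n0 : (0 : R) < n%:R by [].
by rewrite -(ler_pM2l n0);exact: le_trans nb.
Qed.

Hypothesis no_hom : forall L : X -> R, continuous L -> (forall x y, L (x + y) = L x + L y) -> forall x, L x = 0.

Lemma open_subgroup_closed (X0 : set X) : subgroup X0 -> nbhs 0 X0 -> closed X0.
move=> sX0 X00;have : open (~` X0).
 rewrite openE=> x nx. have : nbhs x [set y | X0 (y - x)].
  by apply: (@nbhs_shift X x (- x) X0);rewrite subrr.
 apply: filterS=> y /= Hy X0y;apply: nx. by have := sX0.2 _ _ X0y Hy;rewrite opprB addrC subrK.
by move/open_closedC;rewrite setCK.
Qed.

Let add3 (K L : set X) := [set x + y | x in K & y in L].

(** Induction on the generators. Either the multiples of [z] return to a compact set modulo the
    other generators, and [relative_weil] absorbs [z]; or the exponent of [z] is determined up to a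
    bounded error. In the latter case the exponent is a quasimorphism [q], and the limit of q(n x) /
    n is a homomorphism with value 1 at [z], which [no_hom] excludes. *)
Lemma generated_compact (X0 : set X) (zs : seq X) (K U0 : set X) : subgroup X0 -> nbhs 0 X0 ->
 nbhs 0 U0 -> compact U0 -> compact K -> (forall z, z \in zs -> X0 z) ->
 (forall x, X0 x -> exists2 k, K k & zspan zs (x - k)) -> compact X0.
move=> sX0 X00 U00 cU0;elim: zs K=> [|z zs IH] K cK zsX0 HK.
 apply: (subclosed_compact _ cK);first exact: open_subgroup_closed.
 by move=> x /HK[k Kk /= /eqP];rewrite subr_eq0=> /eqP ->.
have X0z : X0 z by apply: zsX0;rewrite inE eqxx.
have zsX0' w : w \in zs -> X0 w by move=> ws;apply: zsX0;rewrite inE ws orbT.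
have sH := zspan_subgroup zs;set H := zspan zs in IH HK sH.
have [[C [cC unb]]|bd] := pselect (exists C : set X, compact C /\
  forall b : nat, exists m : int, (b < `|m|)%N /\ exists2 c, C c & H (z *~ m - c)).
 have [C' cC' HC'] := relative_weil hX sH cC unb U00 cU0. apply: (IH (add3 K C'))=> //;first exact: compact_add.
 move=> x /HK[k Kk [m Hm]];have [c Cc Hc] := HC' m. exists (k + c);first by exists k=> //;exists c.
 have -> : x - (k + c) = (x - k - z *~ m) + (z *~ m - c) by zmod. exact: subgroupD.
exfalso.
have {}bd C : compact C -> exists b : nat, forall m : int, (exists2 c, C c & H (z *~ m - c)) -> (`|m| <= b)%N.
 move=> cC;apply: contrapT=> /forallNP Hb;apply: bd;exists C;split=> // b.
 have := Hb b;apply: contra_notP=> /forallNP Hn m Hm;rewrite leqNgt;apply/negP=> bm. by apply: (Hn m).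
have /choice[q Hq] : forall x, exists m : int, X0 x -> exists2 k, K k & H (x - k - z *~ m).
 move=> x;have [Hx|nx] := pselect (X0 x);last by exists 0. by have [k Kk [m Hm]] := HK x Hx;exists m=> _;exists k.
pose nK := [set x | K (- x)];have cnK : compact nK by exact: compact_opp.
have [b1 Hb1] := bd _ (compact_add (compact_add cK cnK) cnK).
have [b2 Hb2] := bd _ cnK.
have [b3 Hb3] := bd _ (compact_add cU0 cnK).
have q_quasi x y : X0 x -> X0 y -> (absz (q x + q y - q (x + y))%R <= b1)%N.
 move=> Hx Hy;apply: Hb1.
 have [k Kk Hk] := Hq _ Hx;have [l Kl Hl] := Hq _ Hy;have [r Kr Hr] := Hq _ (subgroupD sX0 Hx Hy).
 exists (r - k - l).
  exists (r + - k);first by exists r=> //;exists (- k)=> //;rewrite /nK /= opprK.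
  by exists (- l)=> //;rewrite /nK /= opprK.
 have -> : z *~ (q x + q y - q (x + y)) - (r - k - l) =
   (x + y - r - z *~ q (x + y)) - (x - k - z *~ q x) - (y - l - z *~ q y).
  by rewrite mulrzBr mulrzDr;zmod.
 by apply: sH.2=> //;exact: sH.2.
have qz n : (absz (q (z *+ n) - n%:Z)%R <= b2)%N.
 apply: Hb2;have [k Kk Hk] := Hq _ (subgroupMn n sX0 X0z);exists (- k);first by rewrite /nK /= opprK.
 have := subgroupN sH Hk;congr H;rewrite mulrzBr [z *+ n]pmulrn;zmod.
have qU x : X0 x -> U0 x -> (`|q x| <= b3)%N.
 move=> Hx Ux;apply: Hb3;have [k Kk Hk] := Hq _ Hx.
 exists (x + - k);first by exists x=> //;exists (- k)=> //;rewrite /nK /= opprK.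
 by have := subgroupN sH Hk;congr H;zmod.
have qn x n : X0 x -> (absz (q (x *+ n.+1) - q x * n.+1%:Z)%R <= n * b1)%N.
 move=> Hx;elim: n=> [|n IHn];first by rewrite mulr1 subrr.
 have := q_quasi x (x *+ n.+1) Hx (subgroupMn n.+1 sX0 Hx);rewrite -mulrS.
 rewrite (_ : q x * n.+2%:Z = q x * n.+1%:Z + q x);last by lra. by rewrite mulSn=> H1;exact: absz_step IHn H1.
have [U [UU Uoo]] := nat_ultrafilter.
have toR (a b : int) (c : nat) : (absz (a - b)%R <= c)%N -> `|a%:~R - b%:~R| <= c%:R :> R.
 by rewrite -intrB -intr_norm pmulrn ler_int;lia.
pose u x n : R := (q (x *+ n.+1))%:~R / n.+1%:R.
have n0 n : (0 : R) < n.+1%:R by [].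
have uq x n : X0 x -> `|u x n - (q x)%:~R| <= b1%:R.
 move=> Hx;rewrite -(ler_pM2r (n0 n)) -[X in _ X <= _](gtr0_norm (n0 n)) -normrM mulrBl divfK //.
 have := toR _ _ _ (qn x n Hx);rewrite intrM=> /le_trans;apply. by rewrite natrM mulrC ler_wpM2l ?ler0n // ler_nat.
have /choice[phi Hphi] : forall x, exists l : R, X0 x -> u x n @[n --> U] --> l.
 move=> x;have [Hx|nx] := pselect (X0 x);last by exists 0.
 have [|l Hl] := ultra_lim UU (u := u x) (M := b1%:R + `|(q x)%:~R|);last by exists l.
 by move=> n;rewrite -[u x n](subrK (q x)%:~R) (le_trans (ler_normD _ _)) // lerD2r;exact: uq.
have inv0 (c : R) : (c / n.+1%:R) @[n --> U] --> 0.
 apply: (cvg_along UU Uoo);rewrite -[X in _ --> X](mulr0 c). by apply: cvgM;[exact: cvg_cst|exact: cvg_harmonic].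
have squeeze (v : nat -> R) (l c : R) : v n @[n --> U] --> l -> (forall n, `|v n| <= c / n.+1%:R) -> l = 0.
 move=> vl vc;apply: (ultra_eq UU vl);apply/(@cvgrPdist_le )=> e e0.
 have := inv0 c=> /(@cvgrPdist_le ) /(_ e e0);apply: filterS=> n;rewrite !sub0r !normrN=> Hn.
 by apply: le_trans (vc n) (le_trans (ler_norm _) Hn).
have phiD x y : X0 x -> X0 y -> phi (x + y) = phi x + phi y.
 move=> Hx Hy;apply: subr0_eq. apply: (squeeze (fun n => u (x + y) n - (u x n + u y n)) _ b1%:R).
  by apply: cvgB;[exact: Hphi (subgroupD sX0 Hx Hy)|apply: cvgD;exact: Hphi].
 move=> n;rewrite -(ler_pM2r (n0 n)) divfK // -[X in _ X <= _](gtr0_norm (n0 n)) -normrM.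
 rewrite mulrBl mulrDl !divfK // mulrnDl distrC -intrD.
 exact: toR (q_quasi _ _ (subgroupMn n.+1 sX0 Hx) (subgroupMn n.+1 sX0 Hy)).
have phiz : phi z = 1.
 apply: subr0_eq. apply: (squeeze (fun n => u z n - 1) _ b2%:R).
  by apply: cvgB;[exact: Hphi|exact: cvg_cst].
 move=> n;rewrite -(ler_pM2r (n0 n)) divfK // -[ in _ _](gtr0_norm (n0 n)) -normrM.
 rewrite mulrBl mul1r !divfK ?gt_eqF //. exact: (toR _ n.+1%:Z _ (qz n.+1)).
(* [no_hom] speaks of X, so the homomorphism is extended from [X0]; continuity follows from its
   bound on the neighbourhood where [q] is bounded. *)
have [L [LD Lphi]] := hom_extension sX0 phiD.
have cL : continuous L.
 apply: (@additive_continuous L (X0 `&` U0) (b1%:R + b3%:R) LD);first exact: filterI.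
 move=> x [Hx Ux];rewrite Lphi //. have H1 n : `|u x n| <= b1%:R + b3%:R.
  rewrite -[u x n](subrK (q x)%:~R) (le_trans (ler_normD _ _)) // lerD //;first exact: uq.
  by have := toR (q x) 0 b3;rewrite !subr0;apply;exact: qU.
 rewrite ler_norml;apply/andP;split.
  by apply: (ultra_ge UU (Hphi x Hx))=> n;have := H1 n;rewrite ler_norml=> /andP[].
 by apply: (ultra_le UU (Hphi x Hx))=> n;have := H1 n;rewrite ler_norml=> /andP[].
have := no_hom cL LD z;rewrite Lphi // => H1;have := oner_neq0;by lra.
Qed.

(** The group generated by a symmetric compact neighbourhood [U]. Finitely many translates of [U]
    cover U + U, so each of its elements is one of [U] plus an integral combination of the centres,
    which is what [generated_compact] takes as input. *)
Lemma compact_open_subgroup : locally_compact [set: X] ->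
 exists X0 : set X, [/\ subgroup X0, nbhs 0 X0 & compact X0].
move=> lX;have [C C0 [cC clC]] := @lX 0 I.
have {}C0 : nbhs (0 : X) C.
 have : nbhs (0 : X) (fun t => [set: X] t -> C t) := C0. by apply: filterS=> t;apply.
pose U := C `&` [set x | C (- x)].
have cNC := compact_opp cC.
have U0 : nbhs 0 U.
 by apply: filterI=> //;apply: (@nbhs_opp X 0 C);rewrite oppr0.
have UN x : U x -> U (- x) by move=> [Cx Cnx];split=> //=;rewrite opprK.
have cU : compact U.
 apply: (subclosed_compact _ cC);last by move=> x []. by apply: closedI=> //;exact: (compact_closed hX cNC).
pose X0 := [set x | exists s : seq X, (forall y, y \in s -> U y) /\ x = \sum_(y <- s) y].
have UX0 x : U x -> X0 x.
 by move=> Ux;exists [:: x];split;[move=> y;rewrite inE=> /eqP ->|rewrite big_seq1].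
have sX0 : subgroup X0.
 split;first by exists [::];rewrite big_nil.
 move=> _ _ [s [Hs ->]] [t [Ht ->]];exists (s ++ [seq - y | y <- t]);split.
  by move=> y;rewrite mem_cat=> /orP[/Hs//|/mapP[w /Ht Uw ->]];exact: UN.
 by rewrite big_cat big_map sumrN.
have [s Hs] := compact_cover_shifts (compact_add cU cU) U0.
pose zs := [seq z <- s | `[< X0 z >]].
have zsX0 z : z \in zs -> X0 z by rewrite mem_filter=> /andP[/asboolP].
exists X0;split=> //;first by apply: filterS U0.
apply: (@generated_compact X0 zs U U)=> //;first by apply: filterS U0.
move=> _ [t [Ht ->]];elim: t Ht=> [|y t IH] Ht.
 by exists 0;[exact: nbhs_singleton U0|rewrite big_nil subrr;exact: (zspan_subgroup zs).1].
have [|k Uk Hk] := IH;first by move=> w wt;apply: Ht;rewrite inE wt orbT.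
have Uy : U y by apply: Ht;rewrite inE eqxx.
have [z zs' Uz] := Hs (y + k) (ex_intro2 _ _ y Uy (ex_intro2 _ _ k Uk erefl)).
exists (y + k - z)=> //.
have zz : zspan zs z.
 apply: zspan_mem;rewrite mem_filter zs' andbT;apply/asboolP. have -> : z = y - (- k) - (y + k - z) by zmod.
 by apply: sX0.2;[apply: sX0.2;apply: UX0=> //;exact: UN|exact: UX0].
rewrite big_cons;have -> : y + \sum_(j <- t) j - (y + k - z) = \sum_(j <- t) j - k + z by zmod.
exact: (subgroupD (zspan_subgroup zs)).
Qed.

End CompactlyGenerated.

(** * Estimates for phases *)

Section Phases.
Context {R}.

Lemma cisN (t : R) : cis (- t) = (cis t)^-1.
have n0 : cis t != 0 by rewrite -normr_eq0 norm_cis.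
by apply: (mulfI n0);rewrite mulfV // -cisD subrr cis0.
Qed.

Lemma cis_small_eq1 (t : R) : `|t| < 1 -> cis t = 1 -> t = 0.
move=> t1 ct;apply/eqP/negPn/negP=> tn0.
have pi2 := pi_ge2 R.
have key (s : R) : 0 < s -> s < 1 -> cis s = 1 -> False.
 by move=> s0 s1 cs;have := @cis_eq1 R s;rewrite cs eqxx=> /(_ _)/negP;apply=> //;rewrite s0 mulr2n;lra.
have [tp|tm|t0] := ltrgtP 0 t;last by lra.
 by apply: (key t)=> //;rewrite gtr0_norm in t1.
apply: (key (- t));rewrite ?oppr_gt0 //;first by rewrite ltr0_norm in t1.
by rewrite cisN ct invr1.
Qed.

Lemma cis_surj (w : R[i]) : `|w| = 1 -> exists t, cis t = w.
move=> /unit_complexE;case: w=> x y /= xy.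
have x1 : -1 <= x <= 1.
 by rewrite -ler_norml -(@expr_le1 _ 2) // real_normK ?num_real //;have := sqr_ge0 y;lra.
have yE : Num.sqrt (1 - x ^+ 2) = `|y| by rewrite -[X in Num.sqrt X](_ : y ^+ 2 = _) ?sqrtr_sqr;lra.
have [y0|y0] := leP 0 y.
 by exists (acos x);rewrite /cis acosK // sin_acos // yE ger0_norm.
by exists (- acos x);rewrite /cis cosN sinN acosK // sin_acos // yE ltr0_norm // opprK.
Qed.

Lemma cis_sub1_le (t : R) : `|t| <= 1 -> (`|cis t - 1| <= (2 * `|t|)%:C)%C.
move=> t1;have := complex_norm_le (cos t - 1) (sin t).
have -> : ((cos t - 1) +i* sin t)%C = cis t - 1 by apply/eqP;rewrite eq_complex /= subr0 !eqxx.
move=> /le_trans;apply;rewrite lecR.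
have := cos_sub1_le t;rewrite distrC=> h1;have h2 := sin_le_id t.
have : t ^+ 2 / 2 <= `|t|.
 rewrite -real_normK ?num_real // expr2 ler_pdivrMr //. by apply: ler_wpM2l=> //;lra.
lra.
Qed.

Lemma unit_expr_dist (v w : R[i]) n : `|v| = 1 -> `|w| = 1 -> `|v ^+ n - w ^+ n| <= `|v - w| *+ n.
move=> v1 w1;elim: n=> [|n IH];first by rewrite subrr normr0.
have -> : v ^+ n.+1 - w ^+ n.+1 = (v - w) * v ^+ n + w * (v ^+ n - w ^+ n) by rewrite !exprS;ring.
rewrite mulrS (le_trans (ler_normD _ _)) // !normrM normrX v1 w1 expr1n mulr1 mul1r.
by rewrite lerD2l.
Qed.

End Phases.

(** * One-parameter subgroups and the exponential map *)

Section OneParameter.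
Context {R} {X : topologicalZmodType}.
Hypotheses (hX : hausdorff_space X).
Local Notation Y := (character R X).
Variables (ys : nat -> Y) (ys_sep : separating ys).

Lemma one_parameter_continuous (C : set X) (c : R -> X) (l : nat -> R) : compact C ->
 (forall t, `|t| <= 1 -> C (c t)) -> (forall t s, c (t + s) = c t + c s) ->
 (forall t i, ys i (c t) = cis (t * l i)) -> forall V, nbhs (0 : X) V -> \forall t \near (0 : R), V (c t).
move=> cC cb cD cE V V0;have [n Hn] := separating_small hX ys_sep cC V0.
pose B := 1 + \sum_(i < n) `|l i|.
have B1 : 1 <= B by rewrite lerDl sumr_ge0.
have lB i : (i < n)%N -> `|l i| <= B.
 by move=> ni;rewrite /B (bigD1 (Ordinal ni)) //= addrCA lerDl addr_ge0 // sumr_ge0.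
have r0 : 0 < (n.+1%:R * 2 * B)^-1 by rewrite invr_gt0 !mulr_gt0 //;lra.
have rB : (n.+1%:R * 2 * B)^-1 * B = (n.+1%:R * 2)^-1 by field;rewrite !gt_eqF //;lra.
have n1 : (1 : R) <= n.+1%:R by rewrite ler1n.
have : nbhs (0 : R) [set t | `|t| <= (n.+1%:R * 2 * B)^-1].
 have := @nbhsx_ballx R R 0 _ r0;apply: filterS=> t;rewrite /ball /= sub0r normrN;exact: ltW.
apply: filterS=> t /= tr.
have t1 : `|t| * B <= (n.+1%:R * 2)^-1 by rewrite -rB ler_wpM2r //;lra.
have n2 : (n.+1%:R * 2)^-1 <= 1 / 2 :> R.
 by rewrite div1r lef_pV2 ?posrE ?mulr_gt0 ?ltr0n // ler_pMl.
apply: Hn=> [|i ni].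
 apply: cb;apply: le_trans (le_trans t1 (le_trans n2 _));first by rewrite ler_peMr. by lra.
have tl : `|t * l i| <= (n.+1%:R * 2)^-1.
 by rewrite normrM (le_trans _ t1) // ler_wpM2l // lB.
rewrite cE;apply: le_trans (cis_sub1_le _) _;first by rewrite (le_trans tl) // (le_trans n2) //;lra.
by rewrite lecR mulrC -ler_pdivlMr // -invfM.
Qed.

End OneParameter.

Section NoHomomorphisms.
Context {R} {X : topologicalZmodType}.
Hypotheses (hX : hausdorff_space X) (finG : finite_set (auts X)).
Local Notation Y := (character R X).
Variables (ys : nat -> Y) (ys_sep : separating ys) (C : set X) (c : R -> X) (l : nat -> R).
Hypotheses (cC : compact C) (cb : forall t, `|t| <= 1 -> C (c t)) (cD : forall t s, c (t + s) = c t + c s)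
 (cE : forall t i, ys i (c t) = cis (t * l i)).

(** f(x) - x f(1) is additive and vanishes at 1, so its bound on [-1, 1] holds everywhere; a bounded
    additive function is 0. *)
Lemma additive_linear (f : R -> R) (b : R) : (forall x y, f (x + y) = f x + f y) ->
 (forall x, `|x| <= 1 -> `|f x| <= b) -> forall x, f x = x * f 1.
move=> fD fb;pose g x := f x - x * f 1.
have gD x y : g (x + y) = g x + g y by rewrite /g fD;ring.
have g1 : g 1 = 0 by rewrite /g mul1r subrr.
have gMn x n : g (x *+ n) = g x *+ n.
 elim: n=> [|n IH];last by rewrite !mulrS gD IH. by rewrite !mulr0n;have := gD 0 0;rewrite addr0=> H;lra.
have gN x : g (- x) = - g x.
 have := gD x (- x);rewrite subrr;have := gMn 0 0;rewrite !mulr0n=> H;lra.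
have gb x : `|g x| <= b + `|f 1|.
 have pos y : 0 <= y -> `|g y| <= b + `|f 1|.
  move=> y0;pose n := Num.truncn y. have h1 : n%:R <= y by rewrite truncn_le.
  have h2 : y < n%:R + 1 by rewrite natr1;exact: truncnS_gt.
  have -> : g y = g (y - n%:R) by rewrite gD gN gMn g1 mul0rn oppr0 addr0.
  have y1 : `|y - n%:R| <= 1 by rewrite ger0_norm;lra.
  rewrite (le_trans (ler_normB _ _)) // lerD ?fb // normrM -[leRHS]mul1r ler_wpM2r //.
 by have [x0|x0] := leP 0 x;[exact: pos|rewrite -normrN -gN;apply: pos;rewrite oppr_ge0 ltW].
move=> x;apply/eqP;rewrite -subr_eq0 -/(g x) -normr_le0;apply/negP=> /negP;rewrite -ltNge=> p0.
have := gb (x *+ (Num.truncn ((b + `|f 1|) / `|g x|)).+1).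
rewrite gMn normrMn -mulr_natl -ler_pdivlMr // leNgt truncnS_gt //.
Qed.

(** A nonzero [L] and a nontrivial one-parameter subgroup produce shears x + c(r L(x)), which would
    be infinitely many automorphisms of X. *)
Lemma no_homomorphism i0 (L : X -> R) : l i0 != 0 -> continuous L ->
 (forall x y, L (x + y) = L x + L y) -> forall x, L x = 0.
move=> li0 cL LD x0;apply/eqP/negPn/negP=> Lx0.
have L0 : L 0 = 0 by have := LD 0 0;rewrite addr0=> H;lra.
have LN x : L (- x) = - L x by have := LD x (- x);rewrite subrr L0=> H;lra.
have cont0 := one_parameter_continuous hX ys_sep cC cb cD cE.
have c0 : c 0 = 0 by apply: (addrI (c 0));rewrite -cD !addr0.
have cN t : c (- t) = - c t by apply: (addrI (c t));rewrite -cD !subrr c0.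
have [b Hb] : exists b : R, forall t, `|t| <= 1 -> `|L (c t)| <= b.
 have cLC : compact (L @` C) by apply: continuous_compact=> //;exact: continuous_subspaceT.
 have [b [_ Hb]] := compact_bounded cLC. exists (b + 1)=> t t1;apply: (Hb (b + 1));first by rewrite ltrDl.
 by exists (c t)=> //;exact: cb.
have lin t : L (c t) = t * L (c 1).
 by apply: (@additive_linear (fun t => L (c t)) b)=> // x y;rewrite cD LD.
set tau := L (c 1) in lin.
pose f r x := x + c (r * L x).
have faut r : 1 + r * tau != 0 -> auts X (f r).
 move=> r0. have fcont s : continuous (fun x => x + c (s * L x)).
  move=> x V Vx;have [W [W0 WN WB]] := nbhs0_split (nbhs_shift (x := 0) (a := x + c (s * L x)) (U := V) (eq_ind_r (fun a => nbhs a V) Vx (add0r _))).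
  have N1 : nbhs x [set y | W (y - x)] by apply: (@nbhs_shift X x (- x) W);rewrite subrr.
  have N2 : nbhs x [set y | W (c (s * L (y - x)))].
   have H : (s * L (y - x)) @[y --> x] --> (0 : R).
    rewrite -[X in _ --> X](mulr0 s);apply: cvgM;first exact: cvg_cst.
    have -> : (fun y => L (y - x)) = (fun y => L y - L x) by ext y;rewrite LD LN.
    by rewrite -[X in _ --> X](subrr (L x));apply: cvgB;[exact: cL|exact: cvg_cst].
   exact: (H _ (cont0 _ W0)).
  apply: filterS (filterI N1 N2)=> y [/= W1 W2].
  have -> : y + c (s * L y) = (y - x) + c (s * L (y - x)) + 0 + (x + c (s * L x)).
   have -> : c (s * L (y - x)) = c (s * L y) - c (s * L x) by rewrite LD LN mulrDr mulrN cD cN. zmod.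
  by apply: WB=> //;exact: nbhs_singleton W0.
 split;first by move=> x y;rewrite /f LD mulrDr cD;zmod. split;first exact: fcont.
 (* The shear multiplies [L] by 1 + r tau, which determines its inverse. *)
 exists (fun x => x + c (- (r / (1 + r * tau)) * L x));split;last exact: fcont.
 - move=> x;rewrite /f LD lin -addrA -cD -[RHS]addr0 -[X in _ = _ + X]c0;congr (x + c _).
  by field.
 - move=> x;rewrite /f LD lin -addrA -cD -[RHS]addr0 -[X in _ = _ + X]c0;congr (x + c _).
  by field.
have [n [g [ginj gaut gall]]] := aut_enum finG.
(* The parameters 1 / ((k + 2) B) keep 1 + r tau away from 0 and the phases small enough for
   [cis_small_eq1]; already n + 1 of the shears are too many. *)
pose B := 1 + `|tau| + `|L x0 * l i0|.
have B1 : 1 <= B by rewrite /B -addrA lerDl addr_ge0.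
pose r (k : nat) := (k.+2%:R * B)^-1.
have rpos k : 0 < r k by rewrite invr_gt0 mulr_gt0 ?ltr0n //;lra.
have rB k : r k * B = k.+2%:R^-1 by rewrite /r;field;rewrite gt_eqF ?ltr0n //;lra.
have k2 k : k.+2%:R^-1 <= 1 / 2 :> R.
 by rewrite div1r lef_pV2 ?posrE ?ltr0n // ler_nat.
have rbound k a : `|a| <= B -> `|r k * a| <= 1 / 2.
 move=> aB;rewrite normrM gtr0_norm // (le_trans _ (k2 k)) // -rB ler_wpM2l //. exact: ltW.
have tB : `|tau| <= B by rewrite /B addrC addrA lerDr addr_ge0.
have lB : `|L x0 * l i0| <= B by rewrite /B lerDr addr_ge0.
have rn k : 1 + r k * tau != 0.
 have := rbound k tau tB;rewrite ler_norml=> /andP[h _];rewrite gt_eqF //;lra.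
have /choice[s Hs] : forall k : nat, exists i, g i = f (r k) by move=> k;apply: gall;exact: faut.
pose s' (k : 'I_n.+1) : 'I_n := s k.
have sinj : injective s'.
 move=> i j /(congr1 g);rewrite /s' !Hs=> /(congr1 (fun h => ys i0 (h x0))).
 rewrite /f !charD !cE=> /(mulfI (char_neq0 _ _)) E. have : cis (r i * L x0 * l i0 - r j * L x0 * l i0) = 1.
  by rewrite cisD cisN E mulfV // -normr_eq0 norm_cis oner_neq0.
 move=> /cis_small_eq1;rewrite -!mulrA=> H. have {}H : r i * (L x0 * l i0) - r j * (L x0 * l i0) = 0.
  apply: H;have := rbound i _ lB;have := rbound j _ lB.
  have rr (k : nat) : 0 < `|r k * (L x0 * l i0)| by rewrite normr_gt0 !mulf_neq0 // gt_eqF.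
  have := rr i;have := rr j. have same : 0 <= (r i * (L x0 * l i0)) * (r j * (L x0 * l i0)).
   by rewrite mulrACA -expr2 mulr_ge0 ?sqr_ge0 // mulr_ge0 // ltW.
  move: same;set a := r i * _;set b' := r j * _ => same. have [a0|a0] := leP 0 a;have [b0|b0] := leP 0 b'.
  - rewrite (ger0_norm a0) (ger0_norm b0)=> *;rewrite ltr_norml;apply/andP;split;lra.
  - rewrite (ger0_norm a0) (ltr0_norm b0)=> *;exfalso;nra.
  - rewrite (ltr0_norm a0) (ger0_norm b0)=> *;exfalso;nra.
  - rewrite (ltr0_norm a0) (ltr0_norm b0)=> *;rewrite ltr_norml;apply/andP;split;lra.
 move: H;rewrite -mulrBl=> /eqP;rewrite mulf_eq0 mulf_eq0 (negbTE Lx0) (negbTE li0) !orbF subr_eq0=> /eqP.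
 rewrite /r=> /invr_inj /(mulIf _) H;apply: val_inj=> /=.
 have /eqP : (i.+2%:R : R) = j.+2%:R by apply: H;rewrite gt_eqF //;lra. by rewrite eqr_nat=> /eqP [].
by have := leq_card s' sinj;rewrite !card_ord ltnn.
Qed.

End NoHomomorphisms.

Section ExponentialMap.
Context {R} {X : topologicalZmodType}.
Hypotheses (hX : hausdorff_space X) (lX : locally_compact [set: X]) (finG : finite_set (auts X))
 (no_circle : forall H : set X, subgroup H -> ~ isomorphic_to_circle R H).
Local Notation Y := (character R X).
Variables (ys : nat -> Y) (ys_sep : separating ys) (e : nat -> Y -> R) (K1 : set X) (c : nat -> R -> X).
Hypotheses (e_ys : forall i k, (i < k)%N -> e k (ys i) = 0)
 (cC : compact K1) (cb : forall k t, `|t| <= 1 -> K1 (c k t)) (cD : forall k t s, c k (t + s) = c k t + c k s)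
 (cE : forall k t i, ys i (c k t) = cis (t * e k (ys i))).

(** The phase at [ys i] of the point with coordinates [z]. The sum is finite for every infinite
    sequence [z], as [e k (ys i)] vanishes for k > i. *)
Definition l z i := lam e i.+1 z (ys i).

Lemma lam_ys n z i : (i < n)%N -> lam e n z (ys i) = l z i.
move=> /subnKC <-;rewrite /l;elim: (n - i.+1)%N=> [|k IH];first by rewrite addn0.
rewrite addnS /lam big_ord_recr /= -/(lam e _ z _) IH e_ys ?mulr0 ?addr0 //.
by rewrite ltnS leq_addr.
Qed.

(** A compact open subgroup contains all the one-parameter subgroups, hence finite sums of their
    points, whatever the size of [z]; [compact_solve] passes to infinite sums. *)
Lemma exp_exists : exists2 K0 : set X, compact K0 & forall z, exists2 x, K0 x & forall i, ys i x = cis (l z i).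
have [[k0 [i0 ke]]|e0] := pselect (exists k i, e k (ys i) != 0);last first.
 exists [set 0];first exact: compact_set1. move=> z;exists 0=> // i;rewrite char0 /l /lam big1 ?cis0 // => k _.
 suff -> : e k (ys i) = 0 by rewrite mulr0. by apply/eqP/negPn/negP=> H;apply: e0;exists k, i.
have nohom := no_homomorphism hX finG ys_sep cC (cb k0) (cD k0) (cE k0) ke.
have [X0 [sX0 X00 cX0]] := compact_open_subgroup hX (fun L cL LD => nohom L cL LD) lX.
have cX0' k t : X0 (c k t).
 have /(@nbhs_ballP _ R^o)[r /= r0 Hr] := one_parameter_continuous hX ys_sep cC (cb k) (cD k) (cE k) X00.
 pose m := (Num.truncn (`|t| / r)).+1. have m0 : (0 : R) < m%:R by rewrite ltr0n.
 have -> : t = (t / m%:R) *+ m by rewrite -[RHS]mulr_natr divfK // gt_eqF. have cMn s j : c k (s *+ j) = c k s *+ j.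
  elim: j=> [|j IH];last by rewrite !mulrS cD IH. by rewrite !mulr0n;apply: (addrI (c k 0));rewrite -cD !addr0.
 rewrite cMn;apply: subgroupMn=> //;apply: Hr.
 rewrite /ball /= sub0r normrN normrM normfV [X in _ / X]gtr0_norm // ltr_pdivrMr // mulrC -ltr_pdivrMr //.
 exact: truncnS_gt.
exists X0=> // z;apply: (compact_solve hX (r := fun=> 0) cX0);first exact: cvg_cst.
move=> n;exists (\sum_(k < n) c k (z k)).
 by elim/big_ind: _ => // [|x y Hx Hy];[exact: sX0.1|exact: subgroupD].
move=> i ni;rewrite -(lam_ys _ ni) /lam.
suff -> : ys i (\sum_(k < n) c k (z k)) = cis (\sum_(k < n) z k * e k (ys i)) by rewrite subrr normr0.
elim: (n)=> [|m IH];first by rewrite !big_ord0 char0 cis0.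
by rewrite !big_ord_recr /= charD IH cE cisD.
Qed.

Lemma l_scale t z i : l (fun k => t * z k) i = t * l z i.
by rewrite /l /lam mulr_sumr;eqsum k;rewrite mulrA. Qed.

(** Otherwise t |-> exp(t w) is periodic and nonconstant. The frequencies of characters along it
    form a discrete subgroup of R, and a character of least positive frequency maps the image
    homeomorphically onto the circle. *)
Lemma exp_injective w : (forall i, cis (l w i) = 1) -> forall i, l w i = 0.
move=> w1 i0;apply/eqP/negPn/negP=> wi0.
have [K0 cK0 HK0] := exp_exists.
have /choice[h Hh] : forall t : R, exists x, K0 x /\ forall i, ys i x = cis (t * l w i).
 by move=> t;have [x Kx Hx] := HK0 (fun k => t * w k);exists x;split=> // i;rewrite Hx l_scale.
have eqX x y : (forall i, ys i x = ys i y) -> x = y.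
 move=> H;apply: subr0_eq;apply: ys_sep=> i. by apply: (mulIf (char_neq0 (ys i) y));rewrite -charD subrK H mul1r.
have hE t i : ys i (h t) = cis (t * l w i) := (Hh t).2 i.
have hD t s : h (t + s) = h t + h s by apply: eqX=> i;rewrite charD !hE mulrDl cisD.
have h0 : h 0 = 0 by apply: (addrI (h 0));rewrite -hD !addr0.
have hN t : h (- t) = - h t by apply: (addrI (h t));rewrite -hD !subrr h0.
have h1 : h 1 = 0 by apply: eqX=> i;rewrite hE mul1r w1 char0.
pose A := [set a : R | exists y : Y, forall t, y (h t) = cis (a * t)].
have AN a : A a -> A (- a).
 move=> [y Hy];exists (- y)=> t;rewrite mulNr cisN -Hy //.
have AD a b : A a -> A b -> A (a + b).
 by move=> [y Hy] [y' Hy'];exists (y + y')=> t;rewrite mulrDl cisD -Hy -Hy'.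
have A0 : A 0 by exists 0=> t;rewrite mul0r cis0.
have AMn a n : A a -> A (a *+ n).
 by move=> Aa;elim: n=> [|n IH];rewrite ?mulr0n // mulrS;exact: AD.
have Al i : A (l w i) by exists (ys i)=> t;rewrite hE mulrC.
have Acis a : A a -> cis a = 1 by move=> [y Hy];have := Hy 1;rewrite h1 char0 mulr1.
have Adisc a : A a -> `|a| < 1 -> a = 0 by move=> /Acis ca a1;exact: cis_small_eq1.
have [a0 [Aa0 a0pos]] : exists a, A a /\ 0 < a.
 have [lp|ln|l0] := ltrgtP 0 (l w i0);first by exists (l w i0).
  by exists (- l w i0);split;[exact: AN|rewrite oppr_gt0].
 by rewrite -l0 eqxx in wi0.
(* A least frequency is found through integer parts, since frequencies less than 1 apart
   coincide. *)
pose Q (n : nat) : bool := `[< exists a, [/\ A a, 0 < a & Num.truncn a = n] >].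
have exQ : exists n, Q n by exists (Num.truncn a0);apply/asboolP;exists a0.
have [n /asboolP[dd [Ad d0 dn]] nmin] := ex_minnP exQ.
have dmin a : A a -> 0 <= a -> a < dd -> a = 0.
 move=> Aa age ad;apply/eqP/negPn/negP=> an0. have apos : 0 < a by rewrite lt_neqAle eq_sym an0.
 have /nmin na : Q (Num.truncn a) by apply/asboolP;exists a. have : `|dd - a| < 1.
  have h2 : dd < n%:R + 1 by rewrite natr1 -dn;exact: truncnS_gt.
  have h3 : (Num.truncn a)%:R <= a by rewrite truncn_le.
  have h4 : (n%:R : R) <= (Num.truncn a)%:R by rewrite ler_nat. by rewrite gtr0_norm ?subr_gt0 //;lra.
 by move=> /(Adisc _ (AD _ _ Ad (AN _ Aa))) H;move: ad;rewrite -subr_gt0 H ltxx.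
have Amul a : A a -> exists m : nat, a = dd *+ m \/ a = - (dd *+ m).
 have pos b : A b -> 0 <= b -> exists m : nat, b = dd *+ m.
  move=> Ab b0;pose m := Num.truncn (b / dd);exists m. have bd0 : 0 <= b / dd by rewrite divr_ge0 // ltW.
  have h2 : m%:R <= b / dd by rewrite truncn_le. have h3 : b / dd < m%:R + 1 by rewrite natr1;exact: truncnS_gt.
  rewrite ler_pdivlMr // in h2;rewrite ltr_pdivrMr // in h3. apply: subr0_eq;apply: dmin.
  - by apply: AD=> //;apply: AN;exact: AMn.
  - by rewrite subr_ge0 -mulr_natl.
  - by rewrite ltrBlDr -mulr_natl;lra.
 move=> Aa;have [age|alt] := leP 0 a.
  by have [m ->] := pos a Aa age;exists m;left.
 have [|m Hm] := pos _ (AN _ Aa);first by rewrite oppr_ge0 ltW. by exists m;right;rewrite -Hm opprK.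
have [yd Hyd] := Ad.
have /choice[mi Hmi] : forall i, exists m : nat, l w i = dd *+ m \/ l w i = - (dd *+ m) by move=> i;exact: Amul.
have hcis t s : cis (dd * t) = cis (dd * s) -> h t = h s.
 move=> ts;apply: eqX=> i;rewrite !hE;have [->|->] := Hmi i.
  by rewrite ![_ * (dd *+ _)]mulrC !mulrnAl !cisMn ts.
 by rewrite ![_ * - _]mulrC !mulNr !cisN !mulrnAl !cisMn ts.
have /choice[g0 Hg0] : forall z : C R, exists t : R, circle R z -> cis (dd * t) = z.
 move=> z;have [z1|nz] := pselect (circle R z);last by exists 0.
 by have [t Ht] := cis_surj z1;exists (t / dd)=> _;rewrite mulrCA divff ?mulr1 // gt_eqF.
pose H := range h.
have sH : subgroup H.
 split;first by exists 0. by move=> _ _ [t _ <-] [s _ <-];exists (t - s)=> //;rewrite hD hN.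
apply: (no_circle sH);exists yd, (fun z => h (g0 z));split.
- split;first by move=> x _;exact: char_norm.
 by move=> z z1;exists (g0 z).
- split;last by move=> z z1;rewrite Hyd Hg0.
 move=> _ [t _ <-];apply: hcis;rewrite Hg0 ?Hyd //. exact: norm_cis.
- by move=> x y _ _;exact: charD.
- by apply: continuous_subspaceT;exact: char_continuous.
apply/subspace_continuousP=> z z1 V Vz.
have V0 : nbhs 0 [set x | V (x + h (g0 z))] by apply: (@nbhs_shift X 0 (h (g0 z)) V);rewrite add0r.
pose D := [set x + y | x in K0 & y in [set x | K0 (- x)]].
have cD' : compact D by apply: compact_add=> //;exact: compact_opp.
(* Continuity of the inverse: on a compact set finitely many phases decide, and these are powers of
   [z] with fixed exponents, up to inversion. *)
have [N HN] := separating_small hX ys_sep cD' V0.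
pose B : R := 1 + \sum_(i < N) (mi i)%:R.
have B1 : 1 <= B by rewrite lerDl sumr_ge0 // => i _;exact: ler0n.
have miB i : (i < N)%N -> (mi i)%:R <= B.
 move=> iN;rewrite /B (bigD1 (Ordinal iN)) //= addrCA lerDl addr_ge0 // sumr_ge0 // => j _;exact: ler0n.
have r0 : 0 < (N.+1%:R * B)^-1 by rewrite invr_gt0 mulr_gt0 ?ltr0n //;lra.
have r0C : 0 < (((N.+1%:R * B)^-1)%:C)%C :> C R by rewrite ltcR.
have near_z : nbhs z [set z' : C R | `|z - z'| < (((N.+1%:R * B)^-1)%:C)%C].
 by have := @nbhsx_ballx _ (C R) z _ r0C;apply: filterS=> z'.
rewrite /=;apply: filterS near_z=> z' /= zz z'1.
have VN := HN (h (g0 z') - h (g0 z));rewrite /= subrK in VN;apply: VN.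
 exists (h (g0 z'));first exact: (Hh _).1. by exists (- h (g0 z))=> //=;rewrite opprK;exact: (Hh _).1.
move=> i iN.
have unit_sub (a b : R[i]) : `|a| = 1 -> `|b| = 1 -> `|a / b - 1| = `|a - b|.
 move=> a1 b1;have b0 : b != 0 by rewrite -normr_eq0 b1 oner_neq0.
 by rewrite -[1](mulfV b0) -mulrBl normrM normfV b1 invr1 mulr1.
have gz : ys i (h (g0 z)) != 0 by exact: char_neq0.
have -> : ys i (h (g0 z') - h (g0 z)) = ys i (h (g0 z')) / ys i (h (g0 z)).
 by apply: (mulIf gz);rewrite -charD subrK divfK.
rewrite unit_sub ?char_norm // !hE.
have key : `|cis (g0 z' * l w i) - cis (g0 z * l w i)| = `|z' ^+ mi i - z ^+ mi i|.
 have E (u : C R) : circle R u -> cis (g0 u * (dd *+ mi i)) = u ^+ mi i.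
  by move=> u1;rewrite mulrC mulrnAl cisMn Hg0.
 have [->|->] := Hmi i;first by rewrite !E. rewrite !mulrN !cisN !E //.
 have n1 : `|z ^+ mi i| = 1 by rewrite normrX z1 expr1n. have n2 : `|z' ^+ mi i| = 1 by rewrite normrX z'1 expr1n.
 have q1 : z ^+ mi i != 0 by rewrite -normr_eq0 n1 oner_neq0.
 have q2 : z' ^+ mi i != 0 by rewrite -normr_eq0 n2 oner_neq0.
 have -> : (z' ^+ mi i)^-1 - (z ^+ mi i)^-1 = (z ^+ mi i - z' ^+ mi i) / (z ^+ mi i * z' ^+ mi i).
  by field;rewrite q1 q2.
 by rewrite normrM normfV normrM n1 n2 mulr1 invr1 mulr1 distrC.
rewrite key;apply: le_trans (unit_expr_dist _ _ _) _ => //.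
apply: (@le_trans _ _ ((((N.+1%:R * B)^-1)%:C)%C *+ mi i)).
 by rewrite lerMn2r distrC ltW // orbT.
rewrite -[leLHS](_ : (((N.+1%:R * B)^-1 *+ mi i)%:C)%C = _);last by rewrite -rmorphMn.
rewrite lecR invfM -mulrnAr ler_piMr ?invr_ge0 ?ler0n //.
by rewrite -mulr_natl ler_pdivrMr ?mul1r ?miB //;lra.
Qed.

End ExponentialMap.

(** * Taylor expansion of sine and cosine *)

Section TaylorPhases.
Context {R}.

(** Real part of the n-th power of the imaginary unit; [rs] is the imaginary part, and [rcsD] the
    multiplication rule. *)
Definition rc (n : nat) : R := (~~ odd n)%:R * (-1) ^+ n./2.
Definition rs (n : nat) : R := (odd n)%:R * (-1) ^+ n./2.

Lemma rcS n : rc n.+1 = - rs n.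
rewrite /rc /rs /= negbK uphalf_half;case: odd;last by rewrite !mul0r oppr0.
by rewrite add1n exprS !mul1r mulN1r.
Qed.

Lemma rsS n : rs n.+1 = rc n.
by rewrite /rc /rs /= uphalf_half;case: (odd n)=> /=;rewrite ?mul0r.
Qed.

Lemma rcsD m n : rc (m + n) = rc m * rc n - rs m * rs n /\ rs (m + n) = rc m * rs n + rs m * rc n.
elim: m=> [|m [IH1 IH2]];first by rewrite /rc /rs /=;split;ring.
by rewrite addSn !rcS !rsS IH1 IH2;split;ring.
Qed.

Lemma rc_le1 n : `|rc n| <= 1.
by rewrite /rc normrM normrX normrN1 expr1n mulr1 normr_nat lern1 leq_b1. Qed.

Lemma rs_le1 n : `|rs n| <= 1.
by have := rc_le1 n.+1;rewrite rcS normrN. Qed.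

Lemma pow_fact_le (x : R) n : 0 <= x -> x ^+ n / n`!%:R <= expR x.
move=> x0;have := @nondecreasing_cvgn_le R (series (exp_coeff x)) _ (is_cvg_series_exp_coeff x) n.+1.
rewrite -/(expR x)=> H;apply: le_trans (H _);last first.
 by apply: nondecreasing_series=> k _ _;exact: exp_coeff_ge0.
rewrite /series /= big_nat_recr //= lerDr;apply: sumr_ge0=> k _;exact: exp_coeff_ge0.
Qed.

Lemma taylor_entire (c : nat -> R) : (forall n, `|c n| <= 1) ->
 forall r : R, 0 <= r -> forall n, `|c n / n`!%:R| * r ^+ n <= expR r.
move=> c1 r r0 n;apply: le_trans (pow_fact_le n r0).
rewrite normrM normfV normr_nat -mulrA [_^-1 * _]mulrC ler_piMl //.
by rewrite mulr_ge0 ?invr_ge0 ?ler0n ?exprn_ge0.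
Qed.

Lemma cos_taylor (x : R) K : `|cos x - \sum_(n < K) rc n / n`!%:R * x ^+ n| <=
 expR (2 * (`|x| + 1)) * 2 * 2^-1 ^+ K.
have [_ H] := @entire_tail R (fun n => rc n / n`!%:R) x _
 (taylor_entire rc_le1 (mulr_ge0 (ler0n _ 2) (addr_ge0 (normr_ge0 x) ler01))).
have := H K;rewrite /psum_at (_ : _ x = series (cos_coeff x));last first.
 by rewrite cos_coeffE /pseries;congr series;ext n;rewrite /rc;congr (_ * _).
by rewrite [X in `|X - _| <= _ -> _](_ : _ = cos x) // unlock.
Qed.

Lemma sin_taylor (x : R) K : `|sin x - \sum_(n < K) rs n / n`!%:R * x ^+ n| <=
 expR (2 * (`|x| + 1)) * 2 * 2^-1 ^+ K.
have [_ H] := @entire_tail R (fun n => rs n / n`!%:R) x _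
 (taylor_entire rs_le1 (mulr_ge0 (ler0n _ 2) (addr_ge0 (normr_ge0 x) ler01))).
have := H K;rewrite /psum_at (_ : _ x = series (sin_coeff x));last first.
 rewrite sin_coeffE;congr series;ext n;rewrite /rs;congr (_ * _).
 by case: n=> [|n] //=;rewrite uphalf_half;case: (odd n);rewrite ?mul0r.
by rewrite [X in `|X - _| <= _ -> _](_ : _ = sin x) // unlock.
Qed.

End TaylorPhases.

Lemma Ex_norm_dom d (T : measurableType d) R (P : probability T R) (f h : T -> R) :
 bm f -> bm h -> (forall x, `|f x| <= h x) -> `|Ex P f| <= Ex P h.
move=> bf bh fh;rewrite ler_norml;apply/andP;split;last first.
 by apply: Ex_le=> // x;exact: le_trans (ler_norm _) (fh x).
rewrite -mulN1r -(ExZ P (-1) bh);apply: Ex_le=> //.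
 by have := bm_lin (-1) 0 bh bh;congr bm;ext x;rewrite mul0r addr0.
by move=> x;rewrite mulN1r;have := fh x;rewrite ler_norml=> /andP[].
Qed.

Lemma bmZ d (T : measurableType d) R (c : R) (f : T -> R) : bm f -> bm (fun x => c * f x).
by move=> bf;have := bm_lin c 0 bf bf;congr bm;ext x;rewrite mul0r addr0.
Qed.

Lemma expRN_nat_cvg0 R : expR (- (n%:R : R)) @[n --> \oo] --> (0 : R).
apply: (@squeeze_cvgr _ _ _ _ (fun=> 0) (fun n : nat => (n.+1%:R : R)^-1));last 2 first.
- exact: cvg_cst.
- exact: cvg_harmonic.
apply: nearW=> n;rewrite expR_ge0 /= expRN lef_pV2 ?posrE //.
by rewrite -natr1 addrC;exact: expR_ge1Dx.
Qed.

Lemma tpow_continuous R (g : R) n : continuous (fun x : R => (x - g) ^+ n / n`!%:R).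
move=> x;apply: cvgM;last exact: cvg_cst.
apply: (@continuous_comp _ _ _ (fun x => x - g) (fun y => y ^+ n));last exact: exprn_continuous.
by apply: cvgB;[exact: cvg_id|exact: cvg_cst].
Qed.

Lemma entire_scale R (c a : nat -> R) : (forall n, `|c n| <= 1) -> entire a -> entire (fun n => c n * a n).
move=> c1 ea t t0;have [C HC] := ea t t0;exists C=> n;apply: le_trans (HC n).
by rewrite ler_wpM2r ?exprn_ge0 ?(ltW t0) // normrM ler_piMl.
Qed.

(** * Truncated moments along an ultrafilter *)

Section TruncatedMoments.
Context {R} {U : set_system nat} (UU : UltraFilter U) (Uoo : forall n : nat, U [set m | (n <= m)%N]).
Local Notation RR := (measurableTypeR R).

(** With truncation in the exponent, exponential averages exist before any moment is known to be
    finite. *)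
Definition cut (T x : R) : R := Num.min `|x| T.
Definition trunc_ind (T : nat) (x : R) : R := (`|x| <= T%:R)%R%:R.

Lemma bm_continuous (f : R -> R) : continuous f -> bdd f -> bm (f : RR -> R).
by move=> cf bf;split=> //;exact: continuous_measurable_fun. Qed.

Lemma trunc_indE T x : trunc_ind T x = \1_(`[- T%:R, T%:R]%classic : set R) x.
congr (nat_of_bool _)%:R.
by apply/idP/idP=> [H|];[apply/mem_set;rewrite /= in_itv /= -ler_norml|move/set_mem;rewrite /= in_itv /= -ler_norml].
Qed.

Lemma bm_trunc_ind T : bm (trunc_ind T : RR -> R).
have := @bm_ind _ RR R (`[- T%:R, T%:R]%classic : set R) (measurable_itv _).
by congr bm;ext x;rewrite trunc_indE.
Qed.

Lemma bm_truncated T (f : R -> R) : continuous f -> bm (fun x : RR => f x * trunc_ind T x : R).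
move=> cf;have [mt _] := bm_trunc_ind T;split.
 by apply: measurable_funM=> //;exact: continuous_measurable_fun.
have cI : compact (f @` `[- T%:R, T%:R]%classic).
 by apply: continuous_compact;[exact: continuous_subspaceT|exact: segment_compact].
have [b [_ Hb]] := compact_bounded cI.
exists (b + 1 + 1)=> x;rewrite /trunc_ind;case: (boolP (`|x| <= T%:R)) => Hx /=.
 rewrite mulr1;have : `|f x| <= b + 1 + 1 by apply: Hb;[rewrite -addrA ltrDl|exists x => //=;rewrite in_itv -ler_norml].
 by [].
rewrite mulr0 normr0;have : `|f 0| <= b + 1 + 1.
 by apply: (Hb (b + 1 + 1));[rewrite -addrA ltrDl|exists 0 => //=;rewrite in_itv /= oppr_le0 ler0n].
exact: le_trans.
Qed.

Lemma cut_continuous T : continuous (cut T).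
by move=> x;apply: continuous_min;[exact: norm_continuous|exact: cvg_cst]. Qed.

Lemma bm_exp_cut r T : 0 <= r -> 0 <= T -> bm (fun x : RR => expR (r * cut T x)).
move=> r0 T0;apply: bm_continuous.
 move=> x;apply: continuous_comp;last exact: continuous_expR. by apply: cvgM;[exact: cvg_cst|exact: cut_continuous].
exists (expR (r * T))=> x;rewrite gtr0_norm ?expR_gt0 // ler_expR ler_wpM2l //.
by rewrite /cut ge_min lexx orbT.
Qed.

Lemma bm_trig (f : R -> R) s g : continuous f -> (forall x, `|f x| <= 1) -> bm (fun x : RR => f (s * (x - g)) : R).
move=> cf f1;apply: bm_continuous;last by exists 1=> x.
move=> x;apply: (@continuous_comp _ _ _ (fun x => s * (x - g)) );last exact: cf.
by apply: cvgM;[exact: cvg_cst|apply: cvgB;[exact: cvg_id|exact: cvg_cst]].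
Qed.

Lemma bm_cos s : bm (fun x : RR => cos (s * x) : R).
have := bm_trig s 0 (@continuous_cos R) (@cos_bounded R).
by congr bm;ext x;rewrite subr0.
Qed.

Lemma bm_sin s : bm (fun x : RR => sin (s * x) : R).
have := bm_trig s 0 (@continuous_sin R) (@sin_bounded R).
by congr bm;ext x;rewrite subr0.
Qed.

Lemma trunc_cut (r : R) T x : trunc_ind T x * expR (r * `|x|) <= expR (r * cut T%:R x).
rewrite /trunc_ind;case: (leP `|x| ) => Hx /=;last by rewrite mul0r.
by rewrite mul1r /cut min_l.
Qed.

Lemma tail_cut T x : 1 - trunc_ind T x <= expR (- T%:R) * expR (1 * cut T%:R x).
rewrite /trunc_ind;case: (leP `|x| ) => Hx /=;first by rewrite subrr.
by rewrite subr0 /cut min_r ?mul1r -?expRD ?addNr ?expR0 // ltW.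
Qed.

Variables (nu : nat -> probability RR R) (B : nat -> R) (g : R).

(** The law [nu T] may change with the truncation level; only the limits along the ultrafilter are
    used as coefficients. *)
Definition tmoment T n : R := Ex (nu T) (fun x => (x - g) ^+ n / n`!%:R * trunc_ind T x).

Let cpow n : continuous (fun x : R => (x - g) ^+ n / n`!%:R).
exact: tpow_continuous. Qed.

Let bm_expd (r T : nat) : bm (fun x : RR => expR (r%:R * `|x - g|) * trunc_ind T x : R).
apply: bm_truncated=> x.
apply: (@continuous_comp _ _ _ (fun x => r%:R * `|x - g|) );last exact: continuous_expR.
apply: cvgM;first exact: cvg_cst.
by apply: cvg_norm;apply: cvgB;[exact: cvg_id|exact: cvg_cst].
Qed.

Let bexp0 (r : nat) T : Ex (nu T) (fun x => expR (r%:R * `|x - g|) * trunc_ind T x) <=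
 expR (r%:R * `|g|) * Ex (nu T) (fun x => expR (r%:R * cut T%:R x)).
have bc := bm_exp_cut (ler0n R r) (ler0n R T).
have b2 : bm (fun x : RR => expR (r%:R * `|g|) * expR (r%:R * cut T%:R x) : R).
 exact: bmZ.
apply: (@le_trans _ _ (Ex (nu T) (fun x => expR (r%:R * `|g|) * expR (r%:R * cut T%:R x)))).
 apply: Ex_le=> // x;apply: le_trans (ler_wpM2l (expR_ge0 _) (trunc_cut r%:R T x)).
 rewrite mulrCA mulrC ler_wpM2l // -expRD ler_expR -mulrDr ler_wpM2l //.
 by apply: le_trans (ler_normB (x : R) g) _;rewrite addrC.
by rewrite ExZ.
Qed.

Lemma tmoment_le (r T n : nat) : `|tmoment T n| * r%:R ^+ n <=
 expR (r%:R * `|g|) * Ex (nu T) (fun x => expR (r%:R * cut T%:R x)).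
apply: le_trans (bexp0 r T).
have b0 := bm_truncated T (@cpow n).
have H x : `|r%:R ^+ n * ((x - g) ^+ n / n`!%:R * trunc_ind T x)| <= expR (r%:R * `|x - g|) * trunc_ind T x.
 rewrite mulrA normrM [X in _ X <= _]ger0_norm // ler_wpM2r //.
 apply: le_trans (pow_fact_le n (mulr_ge0 (ler0n R r) (normr_ge0 (x - g)))).
 by rewrite mulrA -exprMn normrM normrX normfV normr_nat normrM normr_nat.
rewrite mulrC -[X in X * _](ger0_norm (exprn_ge0 n (ler0n R r))) -normrM -ExZ //.
by apply: Ex_norm_dom=> //;exact: bmZ.
Qed.

Hypothesis bd : forall r T : nat, Ex (nu T) (fun x => expR (r%:R * cut T%:R x)) <= B r.

Let bexp (r : nat) T : Ex (nu T) (fun x => expR (r%:R * `|x - g|) * trunc_ind T x) <= expR (r%:R * `|g|) * B r.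
by apply: le_trans (bexp0 r T) _;rewrite ler_wpM2l ?expR_ge0. Qed.

Lemma tmoment_bound (r T n : nat) : `|tmoment T n| * r%:R ^+ n <= expR (r%:R * `|g|) * B r.
by apply: le_trans (tmoment_le r T n) _;rewrite ler_wpM2l ?expR_ge0. Qed.

Lemma tmoment_lim : exists a : nat -> R, (forall n, tmoment T n @[T --> U] --> a n) /\
 (forall (r : nat) n, `|a n| * r%:R ^+ n <= expR (r%:R * `|g|) * B r).
have /choice[a Ha] : forall n, exists l : R, tmoment T n @[T --> U] --> l.
 move=> n;apply: (ultra_lim UU (M := expR (1%:R * `|g|) * B 1)) => T.
 by have := tmoment_bound 1 T n;rewrite expr1n mulr1.
exists a;split=> // r n.
apply: (ultra_le UU (u := fun T => `|tmoment T n| * r%:R ^+ n));last by move=> T;exact: tmoment_bound.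
by apply: cvgM;[exact: cvg_norm|exact: cvg_cst].
Qed.

(** Taylor expansion under the expectation, cut at level [T] and degree [K]. Exponential moments
    with r >= 2 |s| make the remainder geometric in [K], and the mass beyond [T] is O(exp(- T)). *)
Lemma transform_psum (f : R -> R) (c : nat -> R) (a : nat -> R) s l : continuous f -> (forall x, `|f x| <= 1) ->
 (forall n, `|c n| <= 1) ->
 (forall x K, `|f x - \sum_(n < K) c n / n`!%:R * x ^+ n| <= expR (2 * (`|x| + 1)) * 2 * 2^-1 ^+ K) ->
 (forall n, tmoment T n @[T --> U] --> a n) -> entire a ->
 Ex (nu T) (fun x => f (s * (x - g))) @[T --> U] --> l -> psum_at (fun n => c n * a n) s = l.
move=> cf f1 c1 ft aT ea fl.
pose r := (Num.truncn (2 * `|s|)).+1.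
have rs2 : 2 * `|s| <= r%:R by exact/ltW/truncnS_gt.
pose D := expR 2 * (expR (r%:R * `|g|) * B r) * 2.
have bf := bm_trig s g cf f1.
have step K T : `|Ex (nu T) (fun x => f (s * (x - g))) - \sum_(n < K) c n * tmoment T n * s ^+ n| <=
  D * 2^-1 ^+ K + expR (- T%:R) * B 1%N.
 have bt := bm_trunc_ind T. have bft : bm (fun x : RR => f (s * (x - g)) * trunc_ind T x : R) by exact: bm_mul.
 have bn n : bm (fun x : RR => (x - g) ^+ n / n`!%:R * trunc_ind T x : R) by exact: bm_truncated.
 have bcn n : bm (fun x : RR => c n * s ^+ n * ((x - g) ^+ n / n`!%:R * trunc_ind T x) : R).
  exact: bmZ.
 have bs : bm (fun x : RR => \sum_(n < K) c n * s ^+ n * ((x - g) ^+ n / n`!%:R * trunc_ind T x) : R).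
  exact: (@bm_sum _ _ _ _ _ (fun (i : 'I_K) (x : RR) => c i * s ^+ i * ((x - g) ^+ i / i`!%:R * trunc_ind T x))).
 have E1 : \sum_(n < K) c n * tmoment T n * s ^+ n =
   Ex (nu T) (fun x => \sum_(n < K) c n * s ^+ n * ((x - g) ^+ n / n`!%:R * trunc_ind T x)).
  rewrite (Ex_sum (nu T) _ (f := fun (i : 'I_K) x => c i * s ^+ i * ((x - g) ^+ i / i`!%:R * trunc_ind T x))) //.
  by eqsum i;rewrite ExZ // /tmoment mulrAC.
 have h1 : `|Ex (nu T) (fun x => f (s * (x - g))) - Ex (nu T) (fun x => f (s * (x - g)) * trunc_ind T x)| <= expR (- T%:R) * B 1%N.
  rewrite -ExB //;have b3 : bm (fun x : RR => expR (- T%:R) * expR (1 * cut T%:R x) : R).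
   have bc := bm_exp_cut ler01 (ler0n R T). exact: bmZ.
  have pt x : `|f (s * (x - g)) - f (s * (x - g)) * trunc_ind T x| <= expR (- T%:R) * expR (1 * cut T%:R x).
   apply: le_trans (tail_cut T x);rewrite -[X in `|X - _|]mulr1 -mulrBr normrM.
   have : 0 <= 1 - trunc_ind T x by rewrite /trunc_ind subr_ge0 lern1 leq_b1.
   by move=> h;rewrite (ger0_norm h) ler_piMl.
  have Eb : Ex (nu T) (fun x : RR => expR (- T%:R) * expR (1 * cut T%:R x)) <= expR (- T%:R) * B 1%N.
   rewrite ExZ;last exact: bm_exp_cut. by rewrite ler_wpM2l ?expR_ge0 //;exact: (bd 1 T).
  by apply: le_trans Eb;apply: Ex_norm_dom=> //;exact: bmB.
 have h2 : `|Ex (nu T) (fun x => f (s * (x - g)) * trunc_ind T x) -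
   Ex (nu T) (fun x => \sum_(n < K) c n * s ^+ n * ((x - g) ^+ n / n`!%:R * trunc_ind T x))| <= D * 2^-1 ^+ K.
  rewrite -ExB //.
  have pt x : `|f (s * (x - g)) * trunc_ind T x - \sum_(n < K) c n * s ^+ n * ((x - g) ^+ n / n`!%:R * trunc_ind T x)| <=
    (expR 2 * 2 * 2^-1 ^+ K) * (expR (r%:R * `|x - g|) * trunc_ind T x).
   have -> : \sum_(n < K) c n * s ^+ n * ((x - g) ^+ n / n`!%:R * trunc_ind T x) =
     (\sum_(n < K) c n / n`!%:R * (s * (x - g)) ^+ n) * trunc_ind T x.
    by rewrite mulr_suml;eqsum i;rewrite exprMn;ring.
   rewrite -mulrBl normrM [X in _ X <= _]ger0_norm // mulrA ler_wpM2r //. apply: le_trans (ft _ K) _.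
   rewrite -![_ * 2 * _]mulrA [leRHS]mulrAC ler_wpM2r //.
   rewrite -expRD ler_expR mulrDr mulr1 addrC lerD2l normrM mulrA ler_wpM2r //.
  have bK : bm (fun x : RR => (expR 2 * 2 * 2^-1 ^+ K) * (expR (r%:R * `|x - g|) * trunc_ind T x) : R).
   exact: bmZ.
  have Eb : Ex (nu T) (fun x : RR => (expR 2 * 2 * 2^-1 ^+ K) * (expR (r%:R * `|x - g|) * trunc_ind T x)) <= D * 2^-1 ^+ K.
   rewrite ExZ // (_ : D * _ = expR 2 * 2 * 2^-1 ^+ K * (expR (r%:R * `|g|) * B r));last by rewrite /D;ring.
   by rewrite ler_wpM2l // !mulr_ge0 ?expR_ge0 ?exprn_ge0 ?invr_ge0.
  by apply: le_trans Eb;apply: Ex_norm_dom=> //;exact: bmB.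
 rewrite E1;apply: le_trans (ler_distD (Ex (nu T) (fun x => f (s * (x - g)) * trunc_ind T x)) _ _) _.
 by rewrite addrC lerD.
have lim K : `|l - \sum_(n < K) c n * a n * s ^+ n| <= D * 2^-1 ^+ K.
 have cK : (`|Ex (nu T) (fun x => f (s * (x - g))) - \sum_(n < K) c n * tmoment T n * s ^+ n| - expR (- T%:R) * B 1%N)
   @[T --> U] --> `|l - \sum_(n < K) c n * a n * s ^+ n| - 0 * B 1%N.
  apply: cvgB.
   apply: cvg_norm;apply: cvgB=> //;apply: ultra_sum=> i.
   by apply: cvgM;[apply: cvgM;[exact: cvg_cst|exact: aT]|exact: cvg_cst].
  apply: cvgM;last exact: cvg_cst. exact: (cvg_along UU Uoo (@expRN_nat_cvg0 R)).
 rewrite mul0r subr0 in cK;apply: (ultra_le UU cK)=> T;have := step K T;lra.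
have eca := entire_scale c1 ea.
have [|C HC] := eca (2 * (`|s| + 1));first by [].
have [_ tail] := entire_tail HC.
have key K : `|psum_at (fun n => c n * a n) s - l| <= 0 + (C * 2 + D) * 2^-1 ^+ K.
 rewrite add0r mulrDl;apply: le_trans (ler_distD (\sum_(n < K) c n * a n * s ^+ n) _ _) _.
 by rewrite lerD // distrC.
have := @le_of_geometric R _ 0 (C * 2 + D) 0 (fun L _ => key L).
by rewrite normr_le0 subr_eq0=> /eqP.
Qed.

End TruncatedMoments.

(** * Identities between entire series *)

Section EntireSums.
Context {R}.

Lemma psum_at_sub (a b : nat -> R) x : entire a -> entire b ->
 psum_at (fun n => a n - b n) x = psum_at a x - psum_at b x.
move=> ea eb;apply/cvg_lim=> //.
have -> : pseries (fun n => a n - b n) x = (fun N => pseries a x N - pseries b x N).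
 by ext N;rewrite /pseries /series /= -sumrB;eqsum i;rewrite mulrBl.
by apply: cvgB;exact: entire_cvg.
Qed.

Lemma psum_at_zero x : psum_at (fun=> 0 : R) x = 0.
have e0 : entire (fun=> 0 : R) by move=> r r0;exists 0=> k;rewrite normr0 mul0r.
have := psum_at_sub x e0 e0;rewrite (_ : (fun => _) = fun=> 0);last by ext k;rewrite subr0.
by rewrite subrr.
Qed.

Lemma entire_eq (a b : nat -> R) : entire a -> entire b -> (forall x, psum_at a x = psum_at b x) -> a = b.
move=> ea eb ab;have : (fun n => a n - b n) = fun=> 0.
 apply: entire_eq0;last by move=> x;rewrite psum_at_sub // ab subrr.
 move=> r r0;have [C HC] := ea r r0;have [D HD] := eb r r0;exists (C + D)=> n.
 apply: le_trans (ler_wpM2r (exprn_ge0 n (ltW r0)) (ler_normB _ _)) _. by rewrite mulrDl lerD.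
by move=> H;ext n;apply/eqP;rewrite -subr_eq0 (congr1 (fun f => f n) H).
Qed.

Lemma gauss_coeff_entire (c : R) : entire (gauss_coeff c).
move=> r r0;exists (expR (`|c| * r ^+ 2)) => n;rewrite /gauss_coeff.
case: (boolP (odd n))=> on;first by rewrite normr0 mul0r.
have nE : n = (n./2.*2)%N by lia.
rewrite [X in r ^+ X]nE -muln2 mulnC exprM normrM normfV normr_nat normrX mulrAC -exprMn.
by apply: pow_fact_le;rewrite mulr_ge0 ?sqr_ge0.
Qed.

Lemma psum_at_gauss (c x : R) : psum_at (gauss_coeff c) x = expR (c * x ^+ 2).
have [|C HC] := gauss_coeff_entire c (r := 2 * (`|x| + 1));first by [].
have [_ t1] := entire_tail HC.
have c1 (n : nat) : `|1 : R| <= 1 by rewrite normr1.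
have y0 : 0 <= 2 * (`|c * x ^+ 2| + 1) by [].
have [_ t2] := @entire_tail R (fun n => 1 / n`!%:R) (c * x ^+ 2) _ (taylor_entire c1 y0).
have E : psum_at (fun n => 1 / n`!%:R) (c * x ^+ 2) = expR (c * x ^+ 2).
 congr (lim (_ @ \oo));congr series. by ext n;rewrite /exp_coeff /= div1r mulrC.
rewrite E in t2.
have S K : \sum_(n < K.*2) gauss_coeff c n * x ^+ n = \sum_(n < K) 1 / n`!%:R * (c * x ^+ 2) ^+ n.
 elim: K=> [|K IH];first by rewrite !big_ord0.
 rewrite doubleS !big_ord_recr IH /gauss_coeff /= odd_double mul0r addr0 doubleK.
 by rewrite exprMn -exprM mul2n;congr (_ + _);rewrite div1r;ring.
set D := expR (2 * _) in t2.
have key K : `|psum_at (gauss_coeff c) x - expR (c * x ^+ 2)| <= 0 + (C * 2 + D * 2) * 2^-1 ^+ K.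
 rewrite add0r mulrDl;apply: le_trans (ler_distD (\sum_(n < K.*2) gauss_coeff c n * x ^+ n) _ _) _.
 apply: lerD;last by rewrite S distrC. apply: le_trans (t1 _) _;rewrite ler_wpM2l //.
  rewrite mulr_ge0 //;apply: le_trans (HC 0%N);rewrite //.
 by rewrite -addnn exprD ler_piMr ?exprn_ge0 ?invr_ge0 // exprn_ile1 ?invr_ge0 // invf_le1 // ler1n.
have := @le_of_geometric R _ 0 (C * 2 + D * 2) 0 (fun L _ => key L).
by rewrite normr_le0 subr_eq0=> /eqP.
Qed.

(** The real and imaginary parts of the product of the series with coefficients i^k a_k and i^k
    b_k. *)
Lemma phase_prod (a b : nat -> R) n : cauchy_prod (fun k => rc k * a k) (fun k => rc k * b k) n -
 cauchy_prod (fun k => rs k * a k) (fun k => rs k * b k) n = rc n * cauchy_prod a b n /\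
 cauchy_prod (fun k => rc k * a k) (fun k => rs k * b k) n +
 cauchy_prod (fun k => rs k * a k) (fun k => rc k * b k) n = rs n * cauchy_prod a b n.
rewrite -sumrB -big_split /= !mulr_sumr;split;eqsum i.
 have := (rcsD i (n - i)).1;rewrite subnKC -1?ltnS // => ->;ring.
have := (rcsD i (n - i)).2;rewrite subnKC -1?ltnS // => ->;ring.
Qed.

Lemma gauss_phase (m : R) (c : nat -> R) : (forall n, rc n * c n = gauss_coeff (- m) n) ->
 (forall n, rs n * c n = 0) -> c = gauss_coeff m.
move=> H1 H2;ext n;have := H1 n;have := H2 n.
rewrite /rc /rs /gauss_coeff;case: odd;rewrite /= mul1r.
 by move=> /eqP;rewrite mulf_eq0 expf_eq0 oppr_eq0 oner_eq0 andbF /= => /eqP ->.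
move=> _ H;have s0 : (-1) ^+ n./2 != 0 :> R by rewrite expf_eq0 oppr_eq0 oner_eq0 andbF.
by apply: (mulfI s0);rewrite H [(- m) ^+ _]exprNn mulrA.
Qed.

Lemma gauss_phaseE (v : R) n : rc n * gauss_coeff v n = gauss_coeff (- v) n /\ rs n * gauss_coeff v n = 0.
rewrite /rc /rs /gauss_coeff;case: odd;rewrite /= ?mulr0 ?mul0r //.
by split;rewrite // mul1r [(- v) ^+ _]exprNn mulrA.
Qed.

End EntireSums.

(** * Cramer's theorem on the line with a varying second factor *)

Section CramerProbability.
Context {R}.
Local Notation RR := (measurableTypeR R).

Lemma bm_sum2 (f : R -> R) : bm (f : RR -> R) -> bm (fun p : RR * RR => f (p.1 + p.2) : R).
move=> [mf [M HM]];split;last by exists M=> p.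
apply: (measurableT_comp mf (g := fun p : RR * RR => p.1 + p.2 : RR)).
by apply: measurable_funD;[exact: measurable_fst|exact: measurable_snd].
Qed.

Lemma bm_shiftR (f : R -> R) (x : R) : bm (f : RR -> R) -> bm (fun y : RR => f (x + y) : R).
move=> [mf [M HM]];split;last by exists M=> y.
apply: (measurableT_comp mf (g := fun y : RR => x + y : RR)).
by apply: measurable_funD;[exact: measurable_cst|exact: measurable_id].
Qed.

Lemma ultra_le_ev (U : set_system nat) (u : nat -> R) (l c : R) : UltraFilter U ->
 u n @[n --> U] --> l -> U [set n | u n <= c] -> l <= c.
move=> UU ul Uc;apply/ler_addgt0Pr=> e e0.
move/(@cvgrPdist_le ) : ul=> /(_ e e0) Ue.
have [n [/= h1 h2]] := filter_ex (filterI Uc Ue).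
by move: h2;rewrite ler_norml=> /andP[_ h2];lra.
Qed.

Variables (P : probability RR R) (Q : nat -> probability RR R) (m G c : R).
Hypotheses (G0 : 0 <= G) (c0 : 0 <= c).
Let E2 T (f : R -> R) := Ex P (fun x => Ex (Q T) (fun y => f (x + y))).
Hypotheses (cos_lim : forall s, E2 T (fun z => cos (s * z)) @[T --> \oo] --> (expR (- m * s ^+ 2) : R))
 (sin_lim : forall s, E2 T (fun z => sin (s * z)) @[T --> \oo] --> (0 : R))
 (exp_bd : forall r T : nat, (r <= T)%N -> E2 T (fun z => expR (r%:R * cut T%:R z)) <= G * expR (c * r%:R ^+ 2)).

Let cut_triangle T (x y : R) : cut T y <= `|x| + cut T (x + y).
rewrite /cut;have h : `|y| <= `|x| + `|x + y|.
 by rewrite -{1}[y](addKr x) (le_trans (ler_normD _ _)) // normrN.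
have [h1|h1] := leP `|x + y|;first by rewrite ge_min h.
by rewrite ge_min;apply/orP;right;rewrite lerDr.
Qed.

Let tr01 (T : nat) (x : R) : 0 <= (trunc_ind T x : R) <= 1.
by rewrite /trunc_ind ler0n lern1 leq_b1. Qed.

Let ind_cvg : Ex P (trunc_ind n) @[n --> \oo] --> (1 : R).
rewrite -[X in _ --> X](Ex_cst P).
apply: (@Ex_dominated _ RR R P trunc_ind _ 1 _ _ _).2.
- by move=> n;exact: bm_trunc_ind.
- by move=> n x;have /andP[h1 h2] := tr01 n x;rewrite ger0_norm.
move=> x;apply: cvg_near_cst;exists (Num.truncn `|x|).+1 => // n /= nn.
rewrite /trunc_ind (_ : `|x| <= n%:R) //.
by apply: le_trans (ltW (truncnS_gt _)) _;rewrite ler_nat.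
Qed.

Let half_ind : exists T0 : nat, 1 / 2 <= Ex P (trunc_ind T0).
have e2 : (0 : R) < 1 / 2 by [].
move/(@cvgrPdist_le ) : ind_cvg=> /(_ _ e2)[n _ /(_ n (leqnn n))].
by rewrite ler_norml=> /andP[_ h];exists n;lra.
Qed.

(** On an event |x| <= T0 of mass at least 1/2, |y| exceeds |x + y| by at most [T0]: hence the
    factor 2 exp(r T0). *)
Let exp_cut_le (mu nu : probability RR R) T0 (r T : nat) : 1 / 2 <= Ex mu (trunc_ind T0) ->
 Ex nu (fun y => expR (r%:R * cut T%:R y)) <= 2 * expR (r%:R * T0%:R) *
  Ex mu (fun x => Ex nu (fun y => expR (r%:R * cut T%:R (x + y)))).
move=> hT;have bc := bm_exp_cut (ler0n R r) (ler0n R T);have bt := @bm_trunc_ind R T0.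
have bn := (Ex_prod mu nu (bm_sum2 bc)).1.
have e0 : 0 <= Ex nu (fun y => expR (r%:R * cut T%:R y)) by apply: Ex_ge0=> // y;exact: expR_ge0.
set q := Ex nu _ in e0 *.
have : Ex mu (fun x => q * trunc_ind T0 x) <=
  Ex mu (fun x => expR (r%:R * T0%:R) * Ex nu (fun y => expR (r%:R * cut T%:R (x + y)))).
 apply: Ex_le;[exact: bmZ|exact: bmZ|move=> x]. have bs := bm_shiftR x bc.
 have e1 : 0 <= Ex nu (fun y => expR (r%:R * cut T%:R (x + y))).
  by apply: Ex_ge0=> // y;exact: expR_ge0.
 rewrite /trunc_ind;case: (leP `|x| ) => xT;last by rewrite mulr0 mulr_ge0. rewrite mulr1 -ExZ //.
 apply: Ex_le=> //;first exact: bmZ. move=> y;rewrite -expRD ler_expR -mulrDr ler_wpM2l //.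
 by apply: le_trans (cut_triangle _ x y) _;rewrite lerD2r.
rewrite !ExZ // => h.
have : q * (1 / 2) <= q * Ex mu (trunc_ind T0) by rewrite ler_wpM2l.
lra.
Qed.

Lemma Q_bound T0 (r T : nat) : 1 / 2 <= Ex P (trunc_ind T0) -> (r <= T)%N ->
 Ex (Q T) (fun y => expR (r%:R * cut T%:R y)) <= 2 * expR (r%:R * T0%:R) * (G * expR (c * r%:R ^+ 2)).
move=> hT rT;apply: le_trans (exp_cut_le (Q T) r T hT) _.
by rewrite ler_wpM2l ?mulr_ge0 ?expR_ge0 //;exact: exp_bd.
Qed.

Lemma P_bound T1 (r T : nat) : 1 / 2 <= Ex (Q T) (trunc_ind T1) -> (r <= T)%N ->
 Ex P (fun y => expR (r%:R * cut T%:R y)) <= 2 * expR (r%:R * T1%:R) * (G * expR (c * r%:R ^+ 2)).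
move=> hT rT;apply: le_trans (exp_cut_le P r T hT) _;rewrite ler_wpM2l //.
have bc := bm_exp_cut (ler0n R r) (ler0n R T).
apply: le_trans (exp_bd rT);rewrite /E2 (Ex_swap P (Q T) (bm_sum2 bc));apply: eq_ler.
by apply: (congr1 (Ex (Q T)));ext y;apply: (congr1 (Ex P));ext x;rewrite addrC.
Qed.

(** Markov's inequality, from the exponential bound with r = 1. *)
Lemma Q_half T0 : 1 / 2 <= Ex P (trunc_ind T0) -> exists T1 : nat, forall T, (T1 <= T)%N -> 1 / 2 <= Ex (Q T) (trunc_ind T1).
move=> hT;pose D := 2 * expR (1%:R * T0%:R) * (G * expR (c * 1%:R ^+ 2)).
pose T1 := (Num.truncn (2 * D)).+1.
have T1D : 2 * D <= expR T1%:R.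
 by apply: le_trans (ltW (truncnS_gt _)) _;apply: le_trans (expR_ge1Dx _);rewrite lerDr.
exists T1=> T T1T;have T1' : (1 <= T)%N by lia.
have qb := Q_bound hT T1';rewrite -/D in qb.
have bc := bm_exp_cut (ler0n R 1) (ler0n R T);have bt := @bm_trunc_ind R T1.
have pt (y : R) : 1 - expR (- T1%:R) * expR (1%:R * cut T%:R y) <= trunc_ind T1 y.
 rewrite /trunc_ind /cut;case: (leP `|y| ) => yT /=.
  by rewrite gerBl mulr_ge0 ?expR_ge0.
 by rewrite !mul1r subr_le0 -expRD -[leLHS]expR0 ler_expR addrC subr_ge0 le_min (ltW yT) ler_nat.
have : Ex (Q T) (fun y => 1 - expR (- T1%:R) * expR (1%:R * cut T%:R y)) <= Ex (Q T) (trunc_ind T1).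
 by apply: Ex_le=> //;apply: bmB;[exact: bm_cst|exact: bmZ].
rewrite ExB;[|exact: bm_cst|exact: bmZ];rewrite Ex_cst ExZ // => h.
have : expR (- T1%:R) * Ex (Q T) (fun y => expR (1%:R * cut T%:R y)) <= 1 / 2.
 rewrite expRN mulrC ler_pdivrMr ?expR_gt0;lra.
lra.
Qed.

(** Exponential moments pass from the sum to [Q T], because [P] has half its mass in an interval,
    and then back to [P] in the same way. The series [a] and [b] of the centred factors multiply to
    exp(m x^2), so [a] has an entire inverse and Gaussian growth, as [cramer_coeff] asks. *)
Lemma cramer_probability : exists g v : R, forall s,
 Ex P (fun x => cos (s * x)) = expR (- v * s ^+ 2) * cos (g * s) /\
 Ex P (fun x => sin (s * x)) = expR (- v * s ^+ 2) * sin (g * s).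
have [T0 hT0] := half_ind;have [T1 hT1] := Q_half hT0.
have [U [UU Uoo]] := nat_ultrafilter.
(* The last summand covers the levels T <= r + T1, where [Q_half] or [exp_bd] may be silent; there
   the truncated exponential is at most exp(r T). *)
pose B (r : nat) : R := 2 * expR (r%:R * (T0 + T1)%:R) * (G * expR (c * r%:R ^+ 2)) + expR (r%:R * (r + T1)%:R).
have triv (nu : probability RR R) (r T : nat) : (T <= r + T1)%N -> Ex nu (fun y => expR (r%:R * cut T%:R y)) <= B r.
 move=> Tr;apply: (@le_trans _ _ (expR (r%:R * (r + T1)%:R)));last first.
  by rewrite /B lerDr !mulr_ge0 ?expR_ge0.
 rewrite -[leRHS](Ex_cst nu);apply: Ex_le;[exact: bm_exp_cut|exact: bm_cst|move=> y].
 rewrite ler_expR ler_wpM2l ?ler0n // /cut ge_min ler_nat Tr orbT //.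
have mono (t r : nat) : (t <= T0 + T1)%N -> 2 * expR (r%:R * t%:R) * (G * expR (c * r%:R ^+ 2)) <= B r.
 move=> tT;rewrite /B (le_trans _ (_ : 2 * expR (r%:R * (T0 + T1)%:R) * (G * expR (c * r%:R ^+ 2)) <= _)) //.
  by rewrite ler_wpM2r ?mulr_ge0 ?expR_ge0 // ler_wpM2l // ler_expR ler_wpM2l ?ler0n // ler_nat.
 by rewrite lerDl expR_ge0.
have bdQ (r T : nat) : Ex (Q T) (fun y => expR (r%:R * cut T%:R y)) <= B r.
 have [Tr|rT] := leqP T (r + T1);first exact: triv.
 by apply: le_trans (mono T0 r (leq_addr _ _));apply: Q_bound=> //;lia.
have bdP (r T : nat) : Ex P (fun y => expR (r%:R * cut T%:R y)) <= B r.
 have [Tr|rT] := leqP T (r + T1);first exact: triv.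
 by apply: le_trans (mono T1 r (leq_addl _ _));apply: P_bound;[apply: hT1|];lia.
have [a' [a'l _]] := tmoment_lim UU (nu := fun=> P) 0 bdP.
(* The mean of [P]. [Q T] is centred at - g, so that the two centrings cancel in the sum. *)
pose g := a' 1%N.
have [a [al ab]] := tmoment_lim UU (nu := fun=> P) g bdP.
have [b [bl bb]] := tmoment_lim UU (- g) bdQ.
have ent (u : nat -> R) h : (forall (r : nat) n, `|u n| * r%:R ^+ n <= expR (r%:R * `|h|) * B r) -> entire u.
 move=> H r r0;pose k := (Num.truncn r).+1;exists (expR (k%:R * `|h|) * B k) => n.
 apply: le_trans (H k n);rewrite ler_wpM2l // lerXn2r ?nnegrE ?(ltW r0) //. by exact/ltW/truncnS_gt.
have ea : entire a := @ent _ _ _ ab;have eb : entire b := @ent _ _ _ bb.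
have a0 : a 0%N = 1.
 have trl := cvg_along UU Uoo ind_cvg.
 apply: (ultra_eq UU (al 0%N));rewrite (_ : (fun => _) = fun T => Ex P (trunc_ind T)) //. ext T;congr Ex;ext x.
 by rewrite expr0 fact0 divr1 mul1r.
have a1 : a 1%N = 0.
 have lim1 : (tmoment (fun=> P) 0 T 1 - g * tmoment (fun=> P) g T 0) @[T --> U] --> g - g * 1.
  by apply: cvgB;[exact: a'l|apply: cvgM;[exact: cvg_cst|rewrite -a0;exact: al]].
 apply: (ultra_eq UU (al 1%N));rewrite mulr1 subrr in lim1.
 rewrite (_ : (fun => _) = fun T => tmoment (fun=> P) 0 T 1 - g * tmoment (fun=> P) g T 0) //.
 ext T;rewrite /tmoment. have b1 := @bm_truncated R T (fun x => (x - 0) ^+ 1 / 1`!%:R) (@tpow_continuous R 0 1).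
 have b2 := @bm_truncated R T (fun x => (x - g) ^+ 0 / 0`!%:R) (@tpow_continuous R g 0).
 rewrite -ExZ // -ExB //;last exact: bmZ. congr Ex;ext x;rewrite expr0 !expr1 fact0 !divr1 subr0;ring.
have growth0 (r n : nat) : `|a n| * r%:R ^+ n <= expR (r%:R * `|g|) * (2 * expR (r%:R * T1%:R) * (G * expR (c * r%:R ^+ 2))).
 apply: (ultra_le_ev (u := fun T => `|tmoment (fun=> P) g T n| * r%:R ^+ n) ).
  by apply: cvgM;[apply: cvg_norm;exact: al|exact: cvg_cst].
 apply: filterS (Uoo (r + T1)%N)=> T /= rT. apply: le_trans (tmoment_le _ _ _ _ _) _;rewrite ler_wpM2l //.
 by apply: P_bound;[apply: hT1|];lia.
(* Absorbs the linear exponents as well as the rounding of r up to an integer k, for which k^2 <= 2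
   r^2 + 2. *)
pose h := `|g| + T1%:R + c.
have h0 : 0 <= h by rewrite !addr_ge0.
have growth (r : R) n : 0 <= r -> `|a n| * r ^+ n <= (2 * G * expR (2 * h)) * expR (2 * h * r ^+ 2).
 move=> r0;pose k := (Num.truncn r).+1. have rk : r <= k%:R by exact/ltW/truncnS_gt.
 have k1 : (1 : R) <= k%:R by rewrite ler1n. have kr : k%:R <= r + 1 by rewrite -natr1 lerD2r truncn_le.
 apply: (@le_trans _ _ (`|a n| * k%:R ^+ n));first by rewrite ler_wpM2l // lerXn2r ?nnegrE.
 apply: le_trans (growth0 k n) _.
 have -> : expR (k%:R * `|g|) * (2 * expR (k%:R * T1%:R) * (G * expR (c * k%:R ^+ 2))) =
  2 * G * expR (k%:R * `|g| + k%:R * T1%:R + c * k%:R ^+ 2) by rewrite !expRD;ring.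
 rewrite -[leRHS]mulrA -expRD ler_wpM2l ?mulr_ge0 // ler_expR.
 have k2 : k%:R <= k%:R ^+ 2 :> R by rewrite ler_peMr // (le_trans _ k1). have k3 : k%:R ^+ 2 <= 2 * r ^+ 2 + 2.
  have : k%:R ^+ 2 <= (r + 1) ^+ 2 by rewrite lerXn2r ?nnegrE ?ler0n ?addr_ge0.
  have := sqr_ge0 (r - 1);rewrite !sqrrD !expr1n sqrrN expr1n;lra.
 have e1 : k%:R * `|g| <= k%:R ^+ 2 * `|g| by rewrite ler_wpM2r.
 have e2 : k%:R * T1%:R <= k%:R ^+ 2 * T1%:R :> R by rewrite ler_wpM2r.
 have e3 : k%:R ^+ 2 * h <= (2 * r ^+ 2 + 2) * h by rewrite ler_wpM2r.
 have : k%:R ^+ 2 * h = k%:R ^+ 2 * `|g| + k%:R ^+ 2 * T1%:R + c * k%:R ^+ 2 by rewrite /h;ring.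
 move=> e4;rewrite (le_trans (_ : _ <= k%:R ^+ 2 * h)) //;first by lra. by apply: le_trans e3 _;apply: eq_ler;ring.
have cosb := @cos_bounded R.
have sinb := @sin_bounded R.
have limQ (f : R -> R) s : (forall x, `|f x| <= 1) -> continuous f ->
  exists l : R, Ex (Q T) (fun y => f (s * (y - - g))) @[T --> U] --> l.
 by move=> f1 cf;apply: (ultra_lim UU (M := 1))=> T;apply: Ex_norm_le=> //;exact: bm_trig.
have cc : continuous (@cos R) by exact: continuous_cos.
have cs : continuous (@sin R) by exact: continuous_sin.
pose ca n := rc n * a n;pose sa n := rs n * a n;pose cb n := rc n * b n;pose sb n := rs n * b n.
have Pc s : psum_at ca s = Ex P (fun x => cos (s * (x - g))).
 by apply: (transform_psum UU Uoo bdP cc cosb (@rc_le1 R) (@cos_taylor R) al ea);exact: cvg_cst.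
have Ps s : psum_at sa s = Ex P (fun x => sin (s * (x - g))).
 by apply: (transform_psum UU Uoo bdP cs sinb (@rs_le1 R) (@sin_taylor R) al ea);exact: cvg_cst.
have Qc s : Ex (Q T) (fun y => cos (s * (y - - g))) @[T --> U] --> psum_at cb s.
 have [l Hl] := limQ _ s cosb cc.
 by rewrite (transform_psum UU Uoo bdQ cc cosb (@rc_le1 R) (@cos_taylor R) bl eb Hl).
have Qs s : Ex (Q T) (fun y => sin (s * (y - - g))) @[T --> U] --> psum_at sb s.
 have [l Hl] := limQ _ s sinb cs.
 by rewrite (transform_psum UU Uoo bdQ cs sinb (@rs_le1 R) (@sin_taylor R) bl eb Hl).
have btc s k : bm (fun x : RR => cos (s * (x - k)) : R) := bm_trig s k cc cosb.
have bts s k : bm (fun x : RR => sin (s * (x - k)) : R) := bm_trig s k cs sinb.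
have split (s x y : R) : s * (x + y) = s * (x - g) + s * (y - - g) by ring.
have E2c s T : E2 T (fun z => cos (s * z)) =
  psum_at ca s * Ex (Q T) (fun y => cos (s * (y - - g))) - psum_at sa s * Ex (Q T) (fun y => sin (s * (y - - g))).
 rewrite /E2 Pc Ps;set u := Ex (Q T) _;set w := Ex (Q T) _.
 have -> : (fun x => Ex (Q T) (fun y => cos (s * (x + y)))) = (fun x : RR => u * cos (s * (x - g)) + (- w) * sin (s * (x - g))).
  ext x.
  rewrite (_ : (fun y => _) = (fun y : RR => cos (s * (x - g)) * cos (s * (y - - g)) + (- sin (s * (x - g))) * sin (s * (y - - g))));last first.
   by ext y;rewrite split cosD;ring.
  by rewrite Ex_lin;[|exact: btc|exact: bts];rewrite -/u -/w;ring.
 by rewrite Ex_lin;[|exact: btc|exact: bts];ring.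
have E2s s T : E2 T (fun z => sin (s * z)) =
  psum_at ca s * Ex (Q T) (fun y => sin (s * (y - - g))) + psum_at sa s * Ex (Q T) (fun y => cos (s * (y - - g))).
 rewrite /E2 Pc Ps;set u := Ex (Q T) _;set w := Ex (Q T) _.
 have -> : (fun x => Ex (Q T) (fun y => sin (s * (x + y)))) = (fun x : RR => u * cos (s * (x - g)) + w * sin (s * (x - g))).
  ext x.
  rewrite (_ : (fun y => _) = (fun y : RR => cos (s * (x - g)) * sin (s * (y - - g)) + sin (s * (x - g)) * cos (s * (y - - g))));last first.
   by ext y;rewrite split sinD;ring.
  by rewrite Ex_lin;[|exact: bts|exact: btc];rewrite -/u -/w;ring.
 by rewrite Ex_lin;[|exact: btc|exact: bts];ring.
have id1 s : psum_at ca s * psum_at cb s - psum_at sa s * psum_at sb s = expR (- m * s ^+ 2).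
 apply: (ultra_eq UU (u := fun T => E2 T (fun z => cos (s * z))));last first.
  by apply: cvg_along=> //;exact: cos_lim.
 rewrite (funext (E2c s)). by apply: cvgB;(apply: cvgM;[exact: cvg_cst|]).
have id2 s : psum_at ca s * psum_at sb s + psum_at sa s * psum_at cb s = 0.
 apply: (ultra_eq UU (u := fun T => E2 T (fun z => sin (s * z))));last first.
  by apply: cvg_along=> //;exact: sin_lim.
 rewrite (funext (E2s s)). by apply: cvgD;(apply: cvgM;[exact: cvg_cst|]).
have eca : entire ca by exact: entire_scale rc_le1 ea.
have esa : entire sa by exact: entire_scale rs_le1 ea.
have ecb : entire cb by exact: entire_scale rc_le1 eb.
have esb : entire sb by exact: entire_scale rs_le1 eb.
have eab := entire_cauchy_prod ea eb.
have abE : cauchy_prod a b = gauss_coeff m.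
 apply: gauss_phase=> n.
  suff /(congr1 (fun f => f n)) : (fun n => rc n * cauchy_prod a b n) = gauss_coeff (- m) by [].
  apply: entire_eq;[exact: entire_scale rc_le1 eab|exact: gauss_coeff_entire|].
  move=> s;rewrite psum_at_gauss -id1 -!psum_at_prod // -psum_at_sub;try exact: entire_cauchy_prod.
  by congr psum_at;ext k;rewrite (phase_prod a b k).1.
 suff /(congr1 (fun f => f n)) : (fun n => rs n * cauchy_prod a b n) = fun=> 0 by [].
 apply: entire_eq0;first exact: entire_scale rs_le1 eab. move=> s;rewrite -(id2 s) -!psum_at_prod //.
 have eN : entire (fun n => - cauchy_prod sa cb n).
  move=> t t0;have [K HK] := entire_cauchy_prod esa ecb t0;exists K=> k;rewrite normrN;exact: HK.
 have eN0 : entire (fun n => 0 - cauchy_prod sa cb n).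
  by move=> t t0;have [K HK] := eN t t0;exists K=> k;rewrite sub0r.
 have e00 : entire (fun=> 0 : R) by move=> t t0;exists 0=> k;rewrite normr0 mul0r.
 have -> : psum_at (cauchy_prod sa cb) s = - psum_at (fun n => 0 - cauchy_prod sa cb n) s.
  by rewrite psum_at_sub ?psum_at_zero ?sub0r ?opprK //;exact: entire_cauchy_prod.
 rewrite -psum_at_sub //;last exact: entire_cauchy_prod.
 by congr psum_at;ext k;rewrite sub0r opprK (phase_prod a b k).2.
have aE : a = gauss_coeff (a 2).
 apply: (@cramer_coeff R a (cauchy_prod b (gauss_coeff (- m))) (2 * G * expR (2 * h)) (2 * h))=> //.
 - by apply: entire_cauchy_prod=> //;exact: gauss_coeff_entire.
 - by rewrite cauchy_prodA abE gauss_coeff_inv.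
 - by rewrite mulr_ge0.
exists g, (a 2)=> s.
have c1 : Ex P (fun x => cos (s * (x - g))) = expR (- a 2 * s ^+ 2).
 rewrite -Pc -psum_at_gauss;congr psum_at;ext n. by rewrite /ca {1}aE (gauss_phaseE (a 2) n).1.
have s1 : Ex P (fun x => sin (s * (x - g))) = 0.
 rewrite -Ps (_ : sa = fun=> 0);last first.
  by ext n;rewrite /sa aE (gauss_phaseE (a 2) n).2.
 exact: psum_at_zero.
have split' (x : R) : s * x = s * (x - g) + g * s by ring.
split.
 rewrite (_ : (fun x => _) = (fun x : RR => cos (g * s) * cos (s * (x - g)) + - sin (g * s) * sin (s * (x - g))));last first.
  by ext x;rewrite split' cosD;ring.
 by rewrite Ex_lin;[|exact: btc|exact: bts];rewrite c1 s1;ring.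
rewrite (_ : (fun x => _) = (fun x : RR => sin (g * s) * cos (s * (x - g)) + cos (g * s) * sin (s * (x - g))));last first.
 by ext x;rewrite split' sinD;ring.
by rewrite Ex_lin;[|exact: btc|exact: bts];rewrite c1 s1;ring.
Qed.

End CramerProbability.

Lemma Ex_as d (T : measurableType d) R (P : probability T R) (V : set T) (f h : T -> R) :
 measurable V -> Ex P (fun x => \1_V x) = 1 -> bm f -> bm h -> (forall x, V x -> f x = h x) -> Ex P f = Ex P h.
move=> mV V1 bf bh fh;apply/eqP;rewrite -subr_eq0 -normr_le0 -ExB //.
have [[_ [a Ha]] [_ [b Hb]]] := (bf, bh).
have bV := @bm_ind _ _ R _ mV;have b1 : bm (fun x => 1 - \1_V x : R) by apply: bmB=> //;exact: bm_cst.
have : Ex P (fun x => (a + b) * (1 - \1_V x)) = 0.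
 by rewrite ExZ // ExB ?V1 ?Ex_cst ?subrr ?mulr0 //;exact: bm_cst.
move=> <-;apply: Ex_norm_dom;[exact: bmB|exact: bmZ|move=> x;rewrite indicE].
have [Vx|nVx] := pselect (V x);first by rewrite mem_set // fh // !subrr normr0 mulr0.
by rewrite memNset //= subr0 mulr1;apply: le_trans (ler_normB _ _) _;rewrite lerD.
Qed.

Lemma Ex_zero d (T : measurableType d) R (P : probability T R) (f : T -> R) :
 bm f -> (forall x, 0 <= f x) -> Ex P f = 0 -> exists x, f x = 0.
move=> bf f0 E0;apply: contrapT=> /forallNP fn.
have fp x : 0 < f x by rewrite lt_neqAle f0 eq_sym andbT;apply/eqP.
pose h (n : nat) x : R := \1_[set x | n%:R^-1 <= f x] x.
have mh n : measurable [set x | n%:R^-1 <= f x].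
 rewrite -[X in measurable X]setTI (_ : _ `&` _ = setT `&` f @^-1` `[n%:R^-1, +oo[%classic).
  by apply: bf.1=> //;exact: measurable_itv.
 by congr (_ `&` _);apply/seteqP;split=> x /=;rewrite in_itv /= andbT.
have bh n : bm (h n) by exact: bm_ind.
have [_] : bm (fun _ : T => 1 : R) /\ Ex P (h n) @[n --> \oo] --> Ex P (fun=> 1 : R).
 apply: (@Ex_dominated _ T R P h _ 1 bh)=> [n x|x];first by rewrite /h ger0_norm.
 apply: cvg_near_cst;exists (Num.truncn (f x)^-1).+1=> // n /= nn.
 rewrite /h indicE mem_set //= invf_ple ?posrE ?ltr0n ?(leq_ltn_trans _ nn) //.
 by apply: le_trans (ltW (truncnS_gt _)) _;rewrite ler_nat.
rewrite Ex_cst=> /(@cvgrPdist_le )/(_ (1 / 2))[];first by [].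
move=> n _ /(_ n.+1 (leqnSn n));rewrite (_ : Ex P (h n.+1) = 0) ?subr0 ?normr1;first lra.
apply/eqP;rewrite eq_le Ex_ge0 ?andbT //.
rewrite -(mulr0 n.+1%:R) -E0 -ExZ //;apply: Ex_le=> //;first exact: bmZ.
move=> x;rewrite /h indicE;case: (boolP (x \in _))=> [/set_mem /= H|_];last by rewrite mulr_ge0.
by rewrite mulrC -ler_pdivrMr ?ltr0n // div1r.
Qed.

Lemma cis_cvg R (U : set_system nat) (t : nat -> R) (s : R) : UltraFilter U ->
 t n @[n --> U] --> s -> (cis (t n) : C R) @[n --> U] --> (cis s : C R).
by move=> UU ts;apply: cvg_complex;apply: continuous_cvg ts;[exact: continuous_cos|exact: continuous_sin].
Qed.

(** * Coordinates on the linear part of the group *)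

Section LinearPart.
Context {R} {X : topologicalZmodType} {U : set_system nat} (UU : UltraFilter U)
 (Uoo : forall n : nat, U [set m | (n <= m)%N]).
Hypothesis cX : @second_countable X.
Local Notation Y := (character R X).
Context {ys : nat -> Y} {e : nat -> Y -> R}.
Hypothesis inj : forall w, (forall i, cis (l ys e w i) = 1) -> forall i, l ys e w i = 0.
Local Notation lz z i := (l ys e z i).

Lemma l_lin a b z z' i : lz (fun k => a * z k + b * z' k) i = a * lz z i + b * lz z' i.
exact: lam_lin. Qed.

Lemma l_cvg (zn : nat -> nat -> R) z i : (forall k, zn n k @[n --> U] --> z k) -> lz (zn n) i @[n --> U] --> lz z i.
by move=> H;apply: (ultra_sum UU)=> k;apply: cvgM;[exact: H|exact: cvg_cst]. Qed.

(** The sides grow like 2^k: the cube stays compact for coordinatewise limits, while the Gaussian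
    mass outside it is O(1 / t^2) uniformly in the dimension. *)
Definition cube (t : R) : set (nat -> R) := [set z | forall k, `|z k| <= t * 2 ^+ k].
Definition compact_cube (Z : set (nat -> R)) := forall zn : nat -> nat -> R, (forall n, Z (zn n)) ->
 exists2 z, Z z & forall k, zn n k @[n --> U] --> z k.

Lemma cube_compact t : compact_cube (cube t).
move=> zn zb;have /choice[z Hz] : forall k, exists l : R, zn n k @[n --> U] --> l.
 by move=> k;apply: (ultra_lim UU (M := t * 2 ^+ k))=> n;exact: zb.
exists z=> // k;apply: (ultra_le UU (u := fun n => `|zn n k|)) => [|n];last exact: zb.
by apply: cvg_norm;exact: Hz.
Qed.

Lemma cube_halfspace_compact t i c : compact_cube (cube t `&` [set z | c <= lz z i]).
move=> zn zb;have [z zB Hz] := cube_compact (fun n => (zb n).1).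
by exists z=> //;split=> //;apply: (ultra_ge UU (l_cvg Hz))=> n;exact: (zb n).2.
Qed.

Lemma cubeD t s z z' a b : `|a| <= 1 -> `|b| <= 1 -> cube t z -> cube s z' -> cube (t + s) (fun k => a * z k + b * z' k).
move=> a1 b1 zb zb' k;rewrite mulrDl;apply: le_trans (ler_normD _ _) _.
by apply: lerD;[apply: le_trans (zb k)|apply: le_trans (zb' k)];rewrite normrM ler_piMl.
Qed.

(** Open approximations of [exps Z]; their intersection shows that the image of a compact cube is
    Borel. *)
Definition exp_near n (Z : set (nat -> R)) : set X :=
 [set x | exists2 z, Z z & forall i, (i < n)%N -> (`|ys i x - cis (lz z i)| < ((n.+1%:R)^-1)%:C)%C].
Definition exps (Z : set (nat -> R)) : set X := [set x | exists2 z, Z z & forall i, ys i x = cis (lz z i)].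

Lemma exp_near_measurable n Z : measurable (exp_near n Z : set (borel X)).
apply: open_borel.
have -> : exp_near n Z = \bigcup_(z in Z) \bigcap_(i in `I_n) [set x | (`|ys i x - cis (lz z i)| < ((n.+1%:R)^-1)%:C)%C].
 by apply/seteqP;split=> x [z Zz H];exists z=> // i;exact: H.
apply: bigcup_open=> z _;rewrite openE=> x Hx.
have : forall i : 'I_n, \forall y \near x, (`|ys i y - cis (lz z i)| < ((n.+1%:R)^-1)%:C)%C.
 move=> i;have := Hx i (ltn_ord i);set c := (_%:C)%C=> /= Hi.
 have H : (ys i y - cis (lz z i) : C R) @[y --> x] --> (ys i x - cis (lz z i) : C R).
  by apply: cvgB;[exact: char_continuous|exact: cvg_cst].
 have c0 : (0 : C R) < c - `|ys i x - cis (lz z i)| by rewrite subr_gt0.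
 move/cvgrPdist_lt : H=> /(_ _ c0);apply: filterS=> y. rewrite ltrBrDl;apply: le_lt_trans.
 by rewrite -[X in `|X| <= _](subKr (ys i x - cis (lz z i) : C R));exact: ler_normB.
move=> /filter_forall;apply: filterS=> y Hy i ni;exact: Hy (Ordinal ni).
Qed.

Lemma exps_cap Z : compact_cube Z -> exps Z = \bigcap_n exp_near n Z.
move=> cZ;apply/seteqP;split=> [x [z Zz H] n _|x H].
 by exists z=> // i _;rewrite H subrr normr0 ltcR invr_gt0.
have /choice[zn Hn] : forall n, exists z, Z z /\ forall i, (i < n)%N -> (`|ys i x - cis (lz z i)| < ((n.+1%:R)^-1)%:C)%C.
 by move=> n;have [z ? ?] := H n I;exists z.
have [z Zz Hz] := cZ zn (fun n => (Hn n).1).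
exists z=> // i;apply/esym.
apply: (complex_lim_eq (u := fun n => cis (lz (zn n) i) : C R) UU Uoo);[|exact: invn_cvg0|].
 by apply: (cis_cvg UU);exact: l_cvg.
by exists i.+1=> n ni;rewrite distrC ltW //;exact: (Hn n).2.
Qed.

Lemma exps_measurable Z : compact_cube Z -> measurable (exps Z : set (borel X)).
by move=> /exps_cap ->;apply: bigcapT_measurable=> n;exact: exp_near_measurable. Qed.

Definition linear_part : set X := \bigcup_(t : nat) exps (cube t%:R).
Local Notation V := (linear_part : set (borel X)).

Lemma linear_part_measurable : measurable V.
by apply: bigcupT_measurable=> t;apply: exps_measurable;exact: cube_compact. Qed.

(** Some preimage under the exponential map. Only its pairings [coord i] are used as coordinates,
    and on the linear part [inj] makes them independent of the choice. *)
Definition log (x : X) : nat -> R :=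
 xget (fun=> 0) [set z | (exists t : nat, cube t%:R z) /\ forall i, ys i x = cis (lz z i)].
Definition coord i (x : borel X) : R := lz (log x) i.

Lemma log_cube x : exists t : nat, cube t%:R (log x).
by rewrite /log;case: xgetP=> [z _ []|_] //;exists 0%N=> k;rewrite normr0 mul0r. Qed.

Lemma logE x i : V x -> ys i x = cis (lz (log x) i).
move=> [t _ [z zb zE]];rewrite /log;case: xgetP=> [z' _ []|/(_ z) []] //.
by split=> //;exists t.
Qed.

Lemma coordE x z i : (forall i, ys i x = cis (lz z i)) -> V x -> coord i x = lz z i.
move=> zE Vx;apply/eqP;rewrite -subr_eq0 -[X in X - _]mul1r -[X in - X]mul1r -mulNr -l_lin.
apply/eqP;apply: inj=> j;rewrite l_lin mul1r mulN1r cisD cisN -logE // -zE divff //.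
exact: (@char_neq0 R X).
Qed.

Lemma char_coord x i : V x -> ys i x = cis (coord i x). exact: logE. Qed.

Lemma linear_part0 : V 0.
exists 0%N=> //;exists (fun=> 0)=> [k|i];first by rewrite normr0.
by rewrite char0 /l /lam big1 ?cis0 // => k _;rewrite mul0r.
Qed.

Lemma linear_partB x y : V x -> V y -> V (x - y) /\ forall i, coord i (x - y) = coord i x - coord i y.
move=> Vx Vy;have [[t tb] [s sb]] := (log_cube x, log_cube y).
pose z k := 1 * log x k + (-1) * log y k.
have zE i : ys i (x - y) = cis (lz z i).
 rewrite l_lin mul1r mulN1r cisD cisN -!logE // charD;congr (_ _).
 by apply: (mulIf (@char_neq0 R X (ys i) y));rewrite -charD addNr char0 mulVf // (@char_neq0 R X).
have zb : cube (t + s)%:R z by rewrite natrD;apply: cubeD;rewrite ?normrN ?normr1.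
have Vxy : V (x - y) by exists (t + s)%N=> //;exists z.
by split=> // i;rewrite (coordE _ zE) // /z l_lin mul1r mulN1r.
Qed.

Lemma linear_partN x : V x -> V (- x) /\ forall i, coord i (- x) = - coord i x.
move=> Vx;have := linear_partB linear_part0 Vx;rewrite sub0r=> -[Vn H];split=> // i.
rewrite H;have := linear_partB Vx Vx;rewrite subrr=> -[_ /(_ i)];rewrite subrr=> ->.
by rewrite sub0r.
Qed.

Lemma linear_partD x y : V x -> V y -> V (x + y) /\ forall i, coord i (x + y) = coord i x + coord i y.
move=> Vx /linear_partN[Vy H];have [V1 H1] := linear_partB Vx Vy.
by move: V1 H1;rewrite opprK=> V1 H1;split=> // i;rewrite H1 H opprK.
Qed.

(** Within the linear part a half-space is a countable union of images of compact half-cubes. Off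
    the linear part [coord i] takes the default value 0, hence the distinction by the sign of
    [c]. *)
Lemma coord_measurable i : measurable_fun setT (coord i).
apply: (measurability _ (RGenCInfty.measurableE R))=> _ [_ [c ->] <-].
rewrite setTI;pose A := \bigcup_(t : nat) exps (cube t%:R `&` [set z | c <= lz z i]).
have mA : measurable (A : set (borel X)).
 by apply: bigcupT_measurable=> t;apply: exps_measurable;exact: cube_halfspace_compact.
have VA x : V x -> (c <= coord i x <-> A x).
 move=> Vx;split=> [cx|[t _ [z [zb cz] zE]]];last by rewrite (coordE _ zE).
 by have [t tb] := log_cube x;exists t=> //;exists (log x)=> // j;exact: logE.
have AV : A `<=` V by move=> x [t _ [z [zb _] zE]];exists t=> //;exists z.
have nV x : ~ V x -> coord i x = 0.
 move=> nVx;rewrite /coord /log;case: xgetP=> [z _ [[t tb] zE]|_];first by case: nVx;exists t=> //;exists z.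
 by rewrite /l /lam big1 // => k _;rewrite mul0r.
case: (boolP (c <= 0))=> c0.
 rewrite (_ : _ _ = A `|` ~` V);first by apply: measurableU=> //;apply: measurableC;exact: linear_part_measurable.
 apply/seteqP;split=> x /=;rewrite in_itv /= andbT.
  by have [Vx|nVx] := pselect (V x);[left;apply/VA|right].
 by move=> [Ax|nVx];[apply/VA=> //;exact: AV|rewrite nV].
rewrite (_ : _ _ = A) //;apply/seteqP;split=> x /=;rewrite in_itv /= andbT;last first.
 by move=> Ax;apply/VA=> //;exact: AV.
have [Vx|nVx] := pselect (V x);first by move/VA;apply.
by rewrite nV // (negbTE c0).
Qed.

Context {S : nat -> set Y} {M : Y -> R}.
Hypotheses (eD : forall k u v, e k (u + v) = e k u + e k v) (S_sub : forall n, subgroup (S n))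
 (e_energy : forall n u, S n u -> 2 * M u = \sum_(k < n) e k u ^+ 2)
 (S_ys : forall i n, (i < n)%N -> S n (ys i)) (e_ys : forall i k, (i < k)%N -> e k (ys i) = 0).

Let nrm (c : R[i]) : R := Re `|c|.

Let nrmE c : `|c| = ((nrm c)%:C)%C. by case: c. Qed.

Let nrm_ge0 c : 0 <= nrm c. by have := normr_ge0 c;rewrite nrmE lecR. Qed.

Let sum_ge0 n th z : 0 <= \sum_(i < n) nrm (th (ys i) - cis (lz z i)).
by apply: sumr_ge0=> i _;exact: nrm_ge0. Qed.

Let nrm_triangle a b c : nrm (a - b) <= nrm (a - c) + nrm (c - b).
by have := ler_distD c a b;rewrite !nrmE -rmorphD lecR. Qed.

(** Defined for every function of characters and not only for points of X, because it is averaged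
    both over measures on X and over the Gaussian functional. *)
Definition cube_dist t n (th : Y -> R[i]) : R :=
 inf [set \sum_(i < n) nrm (th (ys i) - cis (lz z i)) | z in cube t].

Let cube0 (t : R) : 0 <= t -> cube t (fun=> 0).
by move=> t0 k;rewrite normr0 mulr_ge0 ?exprn_ge0. Qed.

Let dist_set (t : R) n (th : Y -> R[i]) : 0 <= t -> has_inf [set \sum_(i < n) nrm (th (ys i) - cis (lz z i)) | z in cube t].
move=> t0;split;first by exists (\sum_(i < n) nrm (th (ys i) - cis (lz (fun=> 0) i))), (fun=> 0)=> //;exact: cube0.
by exists 0=> _ [z _ <-].
Qed.

Let cube_dist_le (t : R) n th z : 0 <= t -> cube t z -> cube_dist t n th <= \sum_(i < n) nrm (th (ys i) - cis (lz z i)).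
by move=> t0 zb;apply: ge_inf;[exact: (dist_set n th t0).2|exists z]. Qed.

Let cube_dist_lt (t : R) n (th : Y -> R[i]) (r : R) : 0 <= t -> cube_dist t n th < r ->
 exists2 z, cube t z & \sum_(i < n) nrm (th (ys i) - cis (lz z i)) < r.
by move=> t0 /(inf_lt (dist_set n th t0).1)[_ [z zb <-] zr];exists z. Qed.

Let cube_dist_ge0 (t : R) n th : 0 <= t -> 0 <= cube_dist t n th.
by move=> t0;apply: lb_le_inf;[exact: (dist_set n th t0).1|move=> _ [z _ <-]]. Qed.

Let cube_dist_lip (t : R) n th th' : 0 <= t ->
 cube_dist t n th <= \sum_(i < n) nrm (th (ys i) - th' (ys i)) + cube_dist t n th'.
move=> t0;rewrite -lerBlDl;apply: lb_le_inf;first exact: (dist_set n th' t0).1.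
move=> _ [z zb <-];rewrite lerBlDl;apply: le_trans (cube_dist_le n th t0 zb) _.
by rewrite -big_split /=;lesum i;exact: nrm_triangle.
Qed.

Let F t n th : R := Num.min 1 (n.+1%:R * cube_dist t n th).

Let F01 (t : R) n th : 0 <= t -> 0 <= F t n th <= 1.
by move=> t0;rewrite /F le_min ler01 mulr_ge0 ?cube_dist_ge0 //= ge_min lexx. Qed.

Let F_lip (t : R) n th th' : 0 <= t ->
 `|F t n th - F t n th'| <= n.+1%:R * \sum_(i < n) nrm (th (ys i) - th' (ys i)).
move=> t0;have half a b : F t n a <= n.+1%:R * \sum_(i < n) nrm (a (ys i) - b (ys i)) + F t n b.
 have s0 : 0 <= n.+1%:R * \sum_(i < n) nrm (a (ys i) - b (ys i)) by rewrite mulr_ge0 ?sumr_ge0.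
 rewrite addr_minr le_min;apply/andP;split.
  by have /andP[_ h] := F01 n a t0;apply: le_trans h _;rewrite lerDr.
 by rewrite -mulrDr /F ge_min;apply/orP;right;rewrite ler_wpM2l ?cube_dist_lip.
rewrite ler_norml lerBlDr half andbT lerNl opprB lerBlDr.
rewrite (eq_bigr (fun i : 'I_n => nrm (th' (ys i) - th (ys i)))) // => i _.
by rewrite /nrm distrC.
Qed.

(** If [x + b] and [x' + b] are both near the image of the cube, then x - x' is near that of the
    doubled cube; the common shift [b] cancels. *)
Let F_near (t : R) n (x x' b : X) : 0 <= t ->
 1 - \1_(exp_near n (cube (t + t))) (x - x') <= F t n (evalc (x + b)) + F t n (evalc (x' + b)).
move=> t0;have F0 a : 0 <= F t n a by case/andP: (F01 n a t0).
rewrite indicE;have [h|h] := pselect (exp_near n (cube (t + t)) (x - x')).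
 by rewrite mem_set // subrr addr_ge0.
rewrite memNset //= subr0 leNgt;apply/negP=> lt1;apply: h.
have [f0 f0'] := (F0 (evalc (x + b)), F0 (evalc (x' + b))).
have n0 : 0 < n.+1%:R :> R by [].
have FE a : F t n a < 1 -> cube_dist t n a = F t n a / n.+1%:R.
 rewrite /F;have [|h] := leP 1 (n.+1%:R * cube_dist t n a);first by lra. by rewrite mulrAC divff ?mul1r // gt_eqF.
pose r := (1 - F t n (evalc (x + b)) - F t n (evalc (x' + b))) / n.+1%:R / 2.
have r0 : 0 < r by rewrite !divr_gt0;lra.
have [z zb zs] := @cube_dist_lt t n (evalc (x + b)) (cube_dist t n (evalc (x + b)) + r) t0 (ltr_pwDr r0 (lexx _)).
have [z' zb' zs'] := @cube_dist_lt t n (evalc (x' + b)) (cube_dist t n (evalc (x' + b)) + r) t0 (ltr_pwDr r0 (lexx _)).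
rewrite FE in zs;last lra. rewrite FE in zs';last lra.
exists (fun k => 1 * z k + (-1) * z' k);first by apply: cubeD;rewrite ?normrN ?normr1.
move=> i ni;rewrite l_lin mul1r mulN1r cisD cisN.
have u0 : cis (lz z' i) != 0 by rewrite -normr_eq0 norm_cis.
set y := ys i;have -> : y (x - x') = y (x + b) / y (x' + b).
 by apply: (mulIf (char_neq0 y (x' + b)));rewrite divfK ?char_neq0 // -charD;congr (char_fun y _);zmod.
have -> : y (x + b) / y (x' + b) - cis (lz z i) / cis (lz z' i) =
  (y (x + b) - cis (lz z i)) / y (x' + b) - cis (lz z i) * ((y (x' + b) - cis (lz z' i)) / (y (x' + b) * cis (lz z' i))).
 by field;rewrite u0 char_neq0.
have term (th : Y -> R[i]) w s : \sum_(j < n) nrm (th (ys j) - cis (lz w j)) < s -> nrm (th y - cis (lz w i)) < s.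
 by apply: le_lt_trans;rewrite (bigD1 (Ordinal ni)) //= lerDl sumr_ge0.
apply: le_lt_trans (ler_normB _ _) _;rewrite !normrM !normfV !normrM !char_norm !norm_cis !(invr1, mulr1, mul1r).
rewrite !nrmE -rmorphD ltcR.
have := ltrD (term _ _ _ zs) (term _ _ _ zs');rewrite /evalc=> /lt_le_trans;apply.
apply: eq_ler;rewrite /r;field;exact: lt0r_neq0.
Qed.

Let tail (t : R) n : 0 < t -> \sum_(k < n) (t * 2 ^+ k) ^- 2 <= 2 / t ^+ 2.
move=> t0;have H m : \sum_(k < m) (t * 2 ^+ k) ^- 2 = 4 / 3 * (1 - 4^-1 ^+ m) / t ^+ 2.
 elim: m=> [|m IH];first by rewrite big_ord0 subrr mulr0 mul0r. have E : (t * 2 ^+ m) ^- 2 = 4^-1 ^+ m / t ^+ 2.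
  by rewrite exprMn invfM mulrC -exprM mulnC exprM exprVn (_ : 2 ^+ 2 = 4 :> R) //;ring.
 by rewrite big_ord_recr /= IH E [4^-1 ^+ m.+1]exprS -mulrDl;congr (_ / _);move: (4^-1 ^+ m)=> q;field.
rewrite H ler_wpM2r ?invr_ge0 ?sqr_ge0 //.
have : 0 <= 4^-1 ^+ n :> R by rewrite exprn_ge0.
lra.
Qed.

(** Chebyshev's inequality: [F] vanishes inside the cube and is at most 1 outside, where some
    summand is at least 1. *)
Let gauss_far (t : R) n (z : nat -> R) : 0 < t -> F t n (chi e n z) <= \sum_(k < n) (t * 2 ^+ k) ^- 2 * z k ^+ 2.
move=> t0;have s0 (k : 'I_n) : 0 <= (t * 2 ^+ k) ^- 2 * z k ^+ 2 by rewrite mulr_ge0 ?invr_ge0 ?sqr_ge0.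
have [h|] := pselect (forall k : 'I_n, `|z k| <= t * 2 ^+ k).
 apply: le_trans (sumr_ge0 _ (fun k _ => s0 k));rewrite ge_min;apply/orP;right.
 rewrite -(mulr0 n.+1%:R) ler_wpM2l //;pose z' k := if (k < n)%N then z k else 0. have zb : cube t z'.
  move=> k;rewrite /z';case: ifP=> kn;first exact: h (Ordinal kn). by rewrite normr0 mulr_ge0 ?exprn_ge0 // ltW.
 apply: le_trans (cube_dist_le n _ (ltW t0) zb) _;rewrite big1 // => i _.
 rewrite /chi (lam_ys e_ys _ (ltn_ord i)) (_ : lz z' i = lz z i) ?subrr /nrm ?normr0 //.
 by eqsum k;rewrite /z' (leq_trans (ltn_ord k) (ltn_ord i)).
move=> /existsNP[k /negP];rewrite -ltNge=> zk.
have /andP[_ F1] := F01 n (chi e n z) (ltW t0);apply: (le_trans F1).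
rewrite (bigD1 k) //= (le_trans _ (_ : (t * 2 ^+ k) ^- 2 * z k ^+ 2 <= _)) ?lerDl ?sumr_ge0 //.
have a0 : 0 < t * 2 ^+ k by rewrite mulr_gt0.
have : (t * 2 ^+ k) ^+ 2 <= `|z k| ^+ 2 by rewrite lerXn2r ?nnegrE ?(ltW a0) ?(ltW zk).
by rewrite real_normK ?num_real // => h;rewrite mulrC ler_pdivlMr ?exprn_gt0 // mul1r.
Qed.

Lemma gauss_far_le (t : R) n : 0 < t -> gauss U n (fun=> 0) (fun z => F t n (chi e n z)) <= 2 / t ^+ 2.
move=> t0;apply: le_trans (tail n t0);rewrite -[leRHS]add0r.
apply: (gauss_quadratic UU (v := fun k => (t * 2 ^+ k) ^- 2));last by move=> z;rewrite add0r;exact: gauss_far.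
by exists 1=> z;have /andP[h1 h2] := F01 n (chi e n z) (ltW t0);rewrite ger0_norm.
Qed.

Let trig_sum (L : seq (R[i] * Y)) (v : Y -> R) := \sum_(p <- L) Re p.1 * v p.2.

Let Re_mulr (c : R[i]) (r : R) : Re (c * (r%:C)%C) = Re c * r.
by case: c=> a b /=;rewrite mulr0 subr0. Qed.

Let trig_sum_cvg L (En : nat -> Y -> R) : (forall y, En K y @[K --> \oo] --> M y) ->
 trig_sum L (fun y => expR (- En K y)) @[K --> \oo] --> trig_sum L (fun y => expR (- M y)).
move=> H;apply: sum_cvg=> p;apply: cvgM;first exact: cvg_cst.
by apply: continuous_cvg;[exact: continuous_expR|apply: cvgN;exact: H].
Qed.

Let trig_Ex (mu : prob X R) L v : (forall y, cf mu y = ((v y)%:C)%C) ->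
 bm (fun x : borel X => trig_eval L (@evalc R X x)) /\ Ex mu (fun x : borel X => trig_eval L (@evalc R X x)) = trig_sum L v.
move=> H;have := Ex_trig mu L (fun=> 1).
have -> : (fun x : borel X => trig_eval L (fun y => @evalc R X x y * 1)) = (fun x : borel X => trig_eval L (@evalc R X x)).
 by ext x;congr trig_eval;ext y;rewrite mulr1.
by move=> [? ->];split=> //;eqsum p;rewrite H mulr1 Re_mulr.
Qed.

Let gauss_trig0 n (L : seq (R[i] * Y)) : (forall p, p \in L -> S n p.2) ->
 gauss U n (fun=> 0) (fun z => trig_eval L (chi e n z)) = trig_sum L (fun y => expR (- M y)).
move=> LS;rewrite (gauss_trig UU Uoo eD e_energy _ LS)=> [|];last by rewrite normr0.
by eqsum p;rewrite /chi /lam big1 ?cis0 ?mulr1 ?Re_mulr // => k _;exact: mul0r.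
Qed.

(** Only the convolution of [rho] with [tau K] is nearly Gaussian. Comparing two independent copies
    of [rho] at one and the same value [b] of the second factor transfers concentration to the
    symmetrisation of [rho], at twice the Gaussian bound 2 / t^2. *)
Lemma concentration_near (rho : prob X R) (tau : nat -> prob X R) (En : nat -> Y -> R) (t : R) n :
 (forall y, En K y @[K --> \oo] --> M y) ->
 (exists K0, forall K, (K0 <= K)%N -> forall y, cf rho y * cf (tau K) y = ((expR (- En K y))%:C)%C) -> 0 < t ->
 1 - 4 / t ^+ 2 <= Ex (conv cX rho (reflect rho)) (fun x => \1_(exp_near n (cube (t + t))) x).
move=> EM [K0 rt] t0;have t0' := ltW t0.
pose f (x : borel X) : R := 1 - \1_(exp_near n (cube (t + t))) x.
have b1 := @bm_ind _ _ R _ (exp_near_measurable n (cube (t + t))).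
have bf : bm f by apply: bmB=> //;exact: bm_cst.
suff : Ex (conv cX rho (reflect rho)) f <= 4 / t ^+ 2.
 by rewrite ExB ?Ex_cst //;[lra|exact: bm_cst].
(* Eight errors [ep] add up: four in [step], and twice the two of [gg]. *)
apply/ler_addgt0Pr=> e' e'0;pose ep := e' / 8;have ep0 : 0 < ep by rewrite divr_gt0.
pose a : R := n.+1%:R * n.+1%:R;have a0 : 0 < a by rewrite mulr_gt0.
pose d := Num.min 1 (ep / a).
have d01 : 0 < d <= 1 by rewrite lt_min ltr01 divr_gt0 //= ge_min lexx.
have Fb th : unitary_hom th -> `|F t n th| <= 1.
 by move=> _;have /andP[h1 h2] := F01 n th t0';rewrite ger0_norm.
have Fd th th' : unitary_hom th -> unitary_hom th' ->
  (forall i : 'I_n, (`|th (ys i) - th' (ys i)| <= d%:C)%C) -> `|F t n th - F t n th'| <= ep.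
 move=> _ _ H;apply: le_trans (F_lip n th th' t0') _. apply: (@le_trans _ _ (n.+1%:R * \sum_(i < n) d)).
  by rewrite ler_wpM2l //;lesum i;have := H i;rewrite nrmE lecR.
 rewrite sumr_const card_ord -[d *+ n]mulr_natr. have d1 : d <= ep / a by rewrite ge_min lexx orbT.
 have dn : d * n%:R <= d * n.+1%:R by lra. apply: (@le_trans _ _ (d * a));last by rewrite -ler_pdivlMr.
 by rewrite /a [n.+1%:R * (d * _)]mulrCA ler_wpM2l ?(ltW (andP d01).1) // ler_wpM2l ?ler_nat.
have [p [[L [LS Lp]] p1 pF]] := trig_approx (S_sub n) (Bs := [set th | unitary_hom th])
 d01 ep0 (fun i => S_ys (ltn_ord i)) (fun _ h => h) Fb Fd.
pose g (x : borel X) := trig_eval L (@evalc R X x).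
have gp (x : X) : `|g x - F t n (evalc x)| <= 2 * ep.
 by rewrite /g -Lp ?pF //;exact: evalc_unitary.
have bg : bm g.
 have := (Ex_trig rho L (fun=> 1)).1;congr bm;ext x. by rewrite /g;congr trig_eval;ext y;rewrite mulr1.
have bgb (b : borel X) : bm (fun x : borel X => g (x + b)).
 by have := bm_shift cX b bg;congr bm;ext x;rewrite addrC.
have bfx (x : borel X) : bm (fun x' : borel X => f (x - x')).
 have := bm_comp (continuous_borel opp_continuousX) (bm_shift cX x bf);exact.
have step K : Ex (conv cX rho (reflect rho)) f <= 2 * Ex (conv cX (tau K) rho) g + 4 * ep.
 rewrite !Ex_conv // -(Ex_cst (tau K) (4 * ep)) -ExZ;last exact: bm_Ex_shift.
 rewrite -ExD;[|by apply: bmZ;exact: bm_Ex_shift|exact: bm_cst].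
 rewrite -[leLHS](Ex_cst (tau K));apply: Ex_le;first exact: bm_cst.
  by apply: bmD;[apply: bmZ;exact: bm_Ex_shift|exact: bm_cst].
 move=> b;have -> : Ex rho (fun y : borel X => g (b + y)) = Ex rho (fun x : borel X => g (x + b)).
  by congr Ex;ext x;rewrite addrC.
 set G := Ex rho (fun x : borel X => g (x + b));rewrite (_ : 2 * G + 4 * ep = G + (G + 4 * ep));last by ring.
 rewrite -[X in _ + X](Ex_cst rho) /G -ExD //;last exact: bm_cst. apply: Ex_le;first exact: bm_Ex_shift.
  by apply: bmD=> //;exact: bm_cst.
 move=> x;rewrite Ex_image;last exact: bm_shift.
 rewrite (_ : g (x + b) + (G + 4 * ep) = G + (g (x + b) + 4 * ep));last by ring.
 rewrite -[X in _ <= _ X](Ex_cst rho) -ExD //;last exact: bm_cst.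
 apply: Ex_le;[exact: bfx|by apply: bmD => //;exact: bm_cst|move=> x'].
 have := F_near n x x' b t0';have := gp (x + b);have := gp (x' + b).
 rewrite /f !ler_norml=> /andP[h1 _] /andP[ ];lra.
have lim : Ex (conv cX rho (reflect rho)) f <= 2 * trig_sum L (fun y => expR (- M y)) + 4 * ep.
 have cv : 2 * trig_sum L (fun y => expR (- En K y)) + 4 * ep @[K --> \oo] --> 2 * trig_sum L (fun y => expR (- M y)) + 4 * ep.
  by apply: cvgD;[apply: cvgM;[exact: cvg_cst|exact: trig_sum_cvg]|exact: cvg_cst].
 rewrite leNgt;apply/negP=> lt;have lt' := lt;rewrite -subr_gt0 in lt'.
 move/(@cvgrPdist_lt ) : cv=> /(_ _ lt')[K1 _ /(_ (maxn K0 K1))] /=;rewrite leq_maxr=> /(_ erefl).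
 have := step (maxn K0 K1);rewrite (trig_Ex (v := fun y => expR (- En (maxn K0 K1) y)) _ _).2;last first.
  by move=> y;rewrite cf_conv mulrC rt // leq_maxl.
 by rewrite ltr_norml=> h1 /andP[h2 h3];lra.
have gg : trig_sum L (fun y => expR (- M y)) <= 2 / t ^+ 2 + 2 * ep.
 have u0 k : `|(fun _ : nat => 0 : R) k| <= 1 by rewrite normr0. have [_ glin gle gcst] := gauss_prop UU n u0.
 have bF : bdd (fun z => F t n (chi e n z)) by exists 1=> z;apply: Fb;exact: chi_unitary.
 have b0 (k : R) : bdd (fun _ : nat -> R => k) by exists `|k| => z.
 rewrite -(gauss_trig0 LS);apply: (@le_trans _ _ (gauss U n (fun=> 0) (fun z => 1 * F t n (chi e n z) + 2 * ep * 1))).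
  apply: gle;[|by apply: bdd_lin|move=> z].
   by exists 1=> z;rewrite -Lp ?p1 //;exact: chi_unitary.
  have := pF _ (chi_unitary eD n z);rewrite Lp;last exact: chi_unitary.
  by rewrite mul1r mulr1 ler_norml lerBlDl=> /andP[_];rewrite addrC.
 by rewrite glin // gcst mul1r mulr1 lerD2r gauss_far_le.
have -> : 4 / t ^+ 2 = 2 * (2 / t ^+ 2) by ring.
have -> : e' = 8 * ep by rewrite /ep;field.
lra.
Qed.

Lemma concentration (rho : prob X R) (tau : nat -> prob X R) (En : nat -> Y -> R) (t : R) :
 (forall y, En K y @[K --> \oo] --> M y) ->
 (exists K0, forall K, (K0 <= K)%N -> forall y, cf rho y * cf (tau K) y = ((expR (- En K y))%:C)%C) -> 0 < t ->
 1 - 4 / t ^+ 2 <= Ex (conv cX rho (reflect rho)) (fun x => \1_(exps (cube (t + t))) x).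
move=> EM rt t0;have E := exps_cap (@cube_compact (t + t)).
have [_ H] : bm (fun x : borel X => \1_(exps (cube (t + t))) x : R) /\
  Ex (conv cX rho (reflect rho)) (fun x => \1_(exp_near n (cube (t + t))) x) @[n --> \oo] -->
  Ex (conv cX rho (reflect rho)) (fun x => \1_(exps (cube (t + t))) x).
 apply: (@Ex_dominated _ _ R _ _ _ 1)=> [n|n x|x].
 - by apply: bm_ind;exact: exp_near_measurable.
 - by rewrite indicE ger0_norm ?ler0n ?lern1 ?leq_b1.
 apply: cvg_near_cst;have [h|] := pselect (exps (cube (t + t)) x).
  by apply: nearW=> n;rewrite !indicE !mem_set //;move: h;rewrite E;exact.
 rewrite {1}E=> /existsNP[m /not_implyP[_ h]];exists m=> // n /= mn.
 rewrite !indicE !memNset //;first by rewrite E=> /(_ m I).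
 move=> [z zb zE];apply: h;exists z=> // i im;apply: lt_le_trans (zE i (leq_trans im mn)) _.
 by rewrite lecR lef_pV2 ?posrE ?ltr0n // ler_nat.
rewrite leNgt;apply/negP=> lt;have lt' := lt;rewrite -subr_gt0 in lt'.
move/(@cvgrPdist_lt ) : H=> /(_ _ lt')[m _ /(_ m (leqnn m))].
have := concentration_near m EM rt t0;rewrite ltr_norml=> h1 /andP[ ];lra.
Qed.

Let tcut (eta : R) : 0 < eta -> exists2 T : nat, (0 < T)%N & 4 / (T%:R : R) ^+ 2 <= eta.
move=> e0;pose T := (Num.truncn (4 / eta)).+1;exists T=> //.
have T1 : 1 <= T%:R :> R by rewrite ler1n.
have TT : 4 / eta <= T%:R by exact/ltW/truncnS_gt.
rewrite ler_pdivrMr ?exprn_gt0 //;rewrite ler_pdivrMr // mulrC in TT.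
by apply: le_trans TT _;rewrite ler_wpM2l ?(ltW e0) // expr2 ler_peMr.
Qed.

(** A compactness argument: counterexamples would converge to two points of the cube with equal
    phases but different coordinates, against [inj]. *)
Let cube_modulus (t : R) i (h : R -> R) (eta : R) : continuous h -> 0 < eta -> exists n : nat, forall z z', cube t z -> cube t z' ->
 (forall j, (j < n)%N -> (`|cis (lz z j) - cis (lz z' j)| <= ((n.+1%:R)^-1)%:C)%C) ->
 `|h (lz z i) - h (lz z' i)| <= eta.
move=> ch e0;apply: contrapT=> /forallNP H.
have /choice[zz Hz] : forall n, exists p : (nat -> R) * (nat -> R), [/\ cube t p.1, cube t p.2,
  forall j, (j < n)%N -> (`|cis (lz p.1 j) - cis (lz p.2 j)| <= ((n.+1%:R)^-1)%:C)%C &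
  eta <= `|h (lz p.1 i) - h (lz p.2 i)|].
 move=> n;apply: contrapT=> /forallNP H';apply: (H n)=> z z' zb zb' zz.
 by rewrite leNgt;apply/negP=> lt;apply: (H' (z, z'));split=> //;exact: ltW.
have [b1 b2] : (forall n, cube t (zz n).1) /\ forall n, cube t (zz n).2 by split=> n;have [] := Hz n.
have [[z zb zl] [z' zb' zl']] := (cube_compact b1, cube_compact b2).
have zE j : cis (lz (fun k => 1 * z k + (-1) * z' k) j) = 1.
 rewrite l_lin mul1r mulN1r.
 apply: (complex_lim_eq (u := fun n => cis (lz (zz n).1 j - lz (zz n).2 j) : C R) UU Uoo);[|exact: invn_cvg0|].
  by apply: (cis_cvg UU);apply: cvgB;exact: l_cvg.
 exists j.+1=> n jn;have [_ _ /(_ j jn) h1 _] := Hz n;apply: le_trans h1.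
 rewrite -[leRHS]mulr1 -{2}(norm_cis (- lz (zz n).2 j)) -normrM mulrBl -!cisD.
 by rewrite -[lz _ j + - _]/(lz _ j - _) subrr cis0.
have lE : lz z i = lz z' i.
 by have := inj zE i;rewrite l_lin mul1r mulN1r=> /eqP;rewrite subr_eq0=> /eqP.
have : `|h (lz (zz n).1 i) - h (lz (zz n).2 i)| @[n --> U] --> `|h (lz z i) - h (lz z' i)|.
 have c1 := @l_cvg (fun n => (zz n).1) z i zl;have c2 := @l_cvg (fun n => (zz n).2) z' i zl'.
 by apply: cvg_norm;apply: cvgB;[exact: continuous_cvg (ch _) c1|exact: continuous_cvg (ch _) c2].
move=> /(ultra_ge )-/(_ eta);rewrite lE subrr normr0 leNgt=> /(_ _)/negP[] // n.
by have [] := Hz n.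
Qed.

(** [mu] is the summand under study, [rest N] collects the other factors of a finite product
    [theta N], and [tau N K] completes [theta N] to a symmetrised product with exponent [En K],
    which tends to [M]. *)
Context {mu : prob X R} {rest : nat -> prob X R} {tau : nat -> nat -> prob X R} {En : nat -> Y -> R}.
Local Notation theta N := (conv cX mu (rest N)).
Local Notation gam N := (conv cX (theta N) (reflect (theta N))).
Hypotheses (EM : forall y, En K y @[K --> \oo] --> M y)
 (theta_tau : forall N K, (N <= K)%N -> forall y, cf (theta N) y * cf (tau N K) y = ((expR (- En K y))%:C)%C)
 (cf_gam : forall N y, cf (gam N) y = ((expR (- En N y))%:C)%C).

Let gam_exps N (t : R) : 0 < t -> 1 - 4 / t ^+ 2 <= Ex (gam N) (fun x => \1_(exps (cube (t + t))) x).
by move=> t0;apply: (concentration (tau := tau N) EM _ t0);exists N=> K;exact: theta_tau. Qed.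

Let bm_exps (t : R) : bm (fun x : borel X => \1_(exps (cube t)) x : R).
by apply: bm_ind;apply: exps_measurable;exact: cube_compact. Qed.

Let bmV : bm (fun x : borel X => \1_V x : R).
by apply: bm_ind;exact: linear_part_measurable. Qed.

Let gam_V N : Ex (gam N) (fun x => \1_V x) = 1.
apply/eqP;rewrite eq_le;apply/andP;split.
 rewrite -[leRHS](Ex_cst (gam N));apply: Ex_le;[exact: bmV|exact: bm_cst|move=> x]. by rewrite indicE lern1 leq_b1.
apply/ler_addgt0Pl=> r r0;have [T T0 Tr] := tcut r0.
have := @gam_exps N T%:R;rewrite ltr0n=> /(_ T0) h.
have : Ex (gam N) (fun x => \1_(exps (cube (T%:R + T%:R))) x) <= Ex (gam N) (fun x => \1_V x).
 apply: Ex_le=> // x;rewrite ler_nat;case: (boolP (x \in _))=> // /set_mem h'.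
 by rewrite mem_set //;exists (T + T)%N=> //;rewrite natrD.
lra.
Qed.

Let bm_coord i (h : R -> R) : continuous h -> bdd h -> bm (fun x : borel X => h (coord i x)).
by move=> ch bh;apply: bm_comp (coord_measurable i) (bm_continuous ch bh). Qed.

(** Trigonometric polynomials link the two sides, their averages being functions of the transforms.
    One that approximates [h] of the coordinate on the image of a cube is bounded by 1 elsewhere, so
    the exceptional sets cost O(1 / t^2) on either side. *)
Lemma transfer i (h : R -> R) (eps : R) : continuous h -> (forall x, `|h x| <= 1) -> 0 < eps ->
 exists n, (i < n)%N /\ exists N0, forall N, (N0 <= N)%N ->
 `|Ex (gam N) (fun x => h (coord i x)) - gauss U n (fun=> 0) (fun z => h (lam e n z (ys i)))| <= eps.
(* The errors are 5 [eta] for [gam N], 4 [eta] for the Gaussian functional and [eta] for the limit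
   in [N]. *)
move=> ch h1 e0;have [eta eta0 epsE] : exists2 eta : R, 0 < eta & eps = 16 * eta.
 by exists (eps / 16);[rewrite divr_gt0|field].
have [T T0 Te] := tcut eta0;pose t : R := T%:R;have t0 : 0 < t by rewrite ltr0n.
have [n0 Hn] := cube_modulus (t + t) i ch eta0;pose m := maxn n0 i.+1.
have im : (i < m)%N by rewrite leq_max leqnn orbT.
pose d : R := (n0.+1%:R)^-1;have d01 : 0 < d <= 1 by rewrite invr_gt0 ltr0n invf_le1 ?ltr0n // ler1n.
pose rep (th : Y -> R[i]) z := cube (t + t) z /\ forall j, (j < m)%N -> th (ys j) = cis (lz z j).
pose Bs := [set th : Y -> R[i] | unitary_hom th /\ exists z, rep th z].
pose zf th := xget (fun=> 0) [set z | rep th z];pose Fh th := h (lz (zf th) i).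
have zfE th : (exists z, rep th z) -> rep th (zf th).
 by move=> [z zr];rewrite /zf;case: xgetP=> [z' _ //|/(_ z)] /(_ zr).
have cmp th th' z z' : rep th z -> rep th' z' -> (forall j : 'I_m, (`|th (ys j) - th' (ys j)| <= d%:C)%C) ->
  `|h (lz z i) - h (lz z' i)| <= eta.
 move=> [zb zE] [zb' zE'] H;apply: Hn=> // j jn. have jm : (j < m)%N by rewrite (leq_trans jn) // leq_maxl.
 by rewrite -zE // -zE' //;exact: (H (Ordinal jm)).
have [p [[L [LS Lp]] p1 pF]] := trig_approx (S_sub m) (ys := fun i : 'I_m => ys i) (Bs := Bs)
 (F := Fh) d01 eta0 (fun i => S_ys (ltn_ord i)) (fun _ b => b.1) (fun _ _ => h1 _)
 (fun th th' b b' => cmp th th' _ _ (zfE _ b.2) (zfE _ b'.2)).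
have key th z : unitary_hom th -> rep th z -> `|trig_eval L th - h (lz z i)| <= 3 * eta.
 move=> tu tz;have zr : exists z, rep th z by exists z. have := pF th (conj tu zr);rewrite Lp // => k1.
 have k2 := cmp th th _ _ (zfE _ zr) tz (fun j => _). rewrite (_ : 3 * eta = 2 * eta + eta);last by ring.
 apply: le_trans (ler_distD (Fh th) _ _) (lerD k1 (k2 _))=> j. by rewrite subrr normr0 lecR;case/andP: d01=> /ltW.
have L1 th : unitary_hom th -> `|trig_eval L th| <= 1 by move=> tu;rewrite -Lp ?p1.
pose g (x : borel X) := trig_eval L (@evalc R X x).
have bh : bdd h by exists 1.
have bhc := bm_coord i ch bh.
have H1 N : `|Ex (gam N) g - Ex (gam N) (fun x => h (coord i x))| <= 5 * eta.
 have [bg _] := trig_Ex L (cf_gam N);rewrite -/g in bg. have be := bm_exps (t + t).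
 rewrite -ExB //;have bb : bm (fun x : borel X => 2 * (1 - \1_(exps (cube (t + t))) x) + 3 * eta : R).
  by apply: bmD;[apply: bmZ;apply: bmB=> //|];exact: bm_cst.
 apply: le_trans (Ex_norm_dom (gam N) (bmB bg bhc) bb _) _ => [x|];last first.
  rewrite ExD ?ExZ ?ExB ?Ex_cst //;try exact: bm_cst;[|by apply: bmB => //;exact: bm_cst|by apply: bmZ;apply: bmB=> //;exact: bm_cst].
  have hg : 1 - 4 / t ^+ 2 <= Ex (gam N) \1_(exps (cube (t + t))) := gam_exps N t0. by rewrite -/t in Te;lra.
 rewrite indicE;have [[z zb zE]|nx] := pselect (exps (cube (t + t)) x).
  have xe : exps (cube (t + t)) x by exists z. rewrite mem_set // subrr mulr0 add0r (coordE _ zE).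
   by apply: key;[exact: evalc_unitary|split => // j _;exact: zE].
  by exists (T + T)%N=> //;rewrite natrD.
 rewrite memNset //= subr0 mulr1;apply: le_trans (ler_normB _ _) _.
 have := L1 _ (@evalc_unitary R X x);have := h1 (coord i x);rewrite -/(g x). by have := ltW eta0;lra.
pose G := gauss U m (fun=> 0) (fun z => trig_eval L (chi e m z)).
pose Gh := gauss U m (fun=> 0) (fun z => h (lam e m z (ys i))).
have H2 : `|G - Gh| <= 4 * eta.
 have u0 k : `|(fun _ : nat => 0 : R) k| <= 1 by rewrite normr0. have [_ glin _ _] := gauss_prop UU m u0.
 have bt : bdd (fun z => trig_eval L (chi e m z)) by exists 1=> z;apply: L1;exact: chi_unitary.
 have bl : bdd (fun z => h (lam e m z (ys i))) by exists 1.
 have pt z : `|trig_eval L (chi e m z) - h (lam e m z (ys i))| <= 3 * eta + \sum_(k < m) (2 * (t * 2 ^+ k) ^- 2) * z k ^+ 2.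
  have s0 (k : 'I_m) : 0 <= (2 * (t * 2 ^+ k) ^- 2) * z k ^+ 2 by rewrite mulr_ge0 ?sqr_ge0 // mulr_ge0 // invr_ge0 sqr_ge0.
  rewrite (lam_ys e_ys _ im). have [hz|] := pselect (forall k : 'I_m, `|z k| <= t * 2 ^+ k).
   pose z' k := if (k < m)%N then z k else 0. have lE j : (j < m)%N -> lz z j = lz z' j.
    move=> jm;eqsum k;rewrite /z' (leq_ltn_trans _ jm) //. by rewrite -ltnS.
   rewrite lE // (le_trans (key _ z' (chi_unitary eD m z) _)) ?lerDl ?sumr_ge0 //.
   split=> [k|j jm];last by rewrite /chi (lam_ys e_ys _ jm) lE.
   rewrite mulrDl ler_wpDr ?mulr_ge0 ?exprn_ge0 ?(ltW t0) // /z';case: ifP=> km;first exact: (hz (Ordinal km)).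
   by rewrite normr0 mulr_ge0 ?exprn_ge0 ?(ltW t0).
  move=> /existsNP[k /negP];rewrite -ltNge=> zk. have a0 : 0 < t * 2 ^+ k by rewrite mulr_gt0 ?exprn_gt0.
  have : (t * 2 ^+ k) ^+ 2 <= `|z k| ^+ 2 by rewrite lerXn2r ?nnegrE ?(ltW a0) ?(ltW zk).
  rewrite real_normK ?num_real // => hk. rewrite (bigD1 k) //=;have : 2 <= 2 * (t * 2 ^+ k) ^- 2 * z k ^+ 2.
   by rewrite -mulrA ler_peMr // mulrC ler_pdivlMr ?exprn_gt0 // mul1r.
  have : 0 <= \sum_(j < m | j != k) (2 * (t * 2 ^+ j) ^- 2) * z j ^+ 2 by apply: sumr_ge0.
  move=> y0 x2;apply: (@le_trans _ _ (0 + (2 + 0)));last by rewrite !lerD ?mulr_ge0 ?(ltW eta0).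
  rewrite addr0 add0r -[2](natrD _ 1 1);apply: le_trans (ler_normB _ _) _.
  by rewrite lerD ?h1 // L1 //;exact: chi_unitary.
 have bd : 3 * eta + \sum_(k < m) 2 * (t * 2 ^+ k) ^- 2 <= 4 * eta.
  rewrite -mulr_sumr;have := tail m t0;rewrite -/t in Te=> tl.
  have h2 : 2 * (2 / t ^+ 2) <= eta by apply: le_trans Te;apply: eq_ler;ring.
  rewrite (_ : 4 * eta = 3 * eta + eta);last by ring. by rewrite lerD2l;apply: le_trans h2;rewrite ler_wpM2l.
 have gq (a b : R) : (forall z, a * trig_eval L (chi e m z) + b * h (lam e m z (ys i)) <=
   3 * eta + \sum_(k < m) (2 * (t * 2 ^+ k) ^- 2) * z k ^+ 2) -> a * G + b * Gh <= 4 * eta.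
  move=> Hz;apply: le_trans bd;rewrite /G /Gh -glin //.
  by apply: (gauss_quadratic UU (v := fun k => 2 * (t * 2 ^+ k) ^- 2))=> //;exact: bdd_lin.
 have q1 : 1 * G + (-1) * Gh <= 4 * eta.
  by apply: gq=> z;apply: le_trans (pt z);rewrite mul1r mulN1r;exact: ler_norm.
 have q2 : (-1) * G + 1 * Gh <= 4 * eta.
  by apply: gq=> z;apply: le_trans (pt z);rewrite mul1r mulN1r addrC distrC;exact: ler_norm.
 rewrite mul1r mulN1r in q1;rewrite mul1r mulN1r addrC in q2.
 by rewrite ler_norml;apply/andP;split;rewrite // lerNl opprB.
have [N0 HN] : exists N0, forall N, (N0 <= N)%N -> `|G - Ex (gam N) g| <= eta.
 have := @trig_sum_cvg L En EM;rewrite -(gauss_trig0 LS) -/G=> /(@cvgrPdist_le _ R^o)/(_ _ eta0)[N0 _ H].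
 by exists N0=> N /H /=;rewrite (trig_Ex L (cf_gam N)).2.
exists m;split=> //;exists N0=> N /HN h3.
rewrite -/Gh.
have q1 := H1 N;rewrite distrC in q1;rewrite distrC in h3.
apply: le_trans (ler_distD (Ex (gam N) g) _ _) _;apply: le_trans (lerD q1 (ler_distD G _ _)) _.
apply: le_trans (lerD (lexx _) (lerD h3 H2)) _.
rewrite epsE -subr_ge0 (_ : _ - _ = 6 * eta);last by ring.
by rewrite mulr_ge0 ?ltW.
Qed.

Let M_ge0 i : 0 <= M (ys i).
have := e_energy (S_ys (ltnSn i));have : 0 <= \sum_(k < i.+1) e k (ys i) ^+ 2 by apply: sumr_ge0=> k _;exact: sqr_ge0.
lra.
Qed.

Let gauss_phase_lim i s c : Ex (gam N) (fun x => cos (c + s * coord i x)) @[N --> \oo] -->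
 (expR (- M (ys i) * s ^+ 2) * cos c : R).
apply/(@cvgrPdist_le _ R^o)=> r r0;have hc : continuous (fun x : R => cos (c + s * x)).
 move=> x;apply: (@continuous_comp _ _ _ (fun x => c + s * x) cos);last exact: continuous_cos.
 by apply: cvgD;[exact: cvg_cst|apply: cvgM;[exact: cvg_cst|exact: cvg_id]].
have h1 (x : R) : `|cos (c + s * x)| <= 1 by exact: cos_bounded.
have [n [ni [N0 H]]] := transfer i hc h1 r0;exists N0=> // N /= /H.
have -> : gauss U n (fun=> 0) (fun z => cos (c + s * lam e n z (ys i))) = expR (- M (ys i) * s ^+ 2) * cos c;last by rewrite distrC.
have u0 k : `|(fun _ : nat => 0 : R) k| <= 1 by rewrite normr0.
have := gauss_cos UU Uoo n c (fun k => s * e k (ys i)) u0.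
rewrite [X in cos (c + X)]big1 ?addr0=> [|k _];last exact: mul0r.
have -> : \sum_(k < n) (s * e k (ys i)) ^+ 2 / 2 = M (ys i) * s ^+ 2.
 rewrite -mulr_suml (eq_bigr (fun k : 'I_n => s ^+ 2 * e k (ys i) ^+ 2))=> [|k _];last by rewrite exprMn.
 by rewrite -mulr_sumr -(e_energy (S_ys ni));field.
rewrite mulNr=> <-;congr gauss;ext z;rewrite /lam mulr_sumr;congr (cos (_ + _)).
by eqsum k;ring.
Qed.

(** Two exponentials dominate exp(r |x|), and a third unit pays for [transfer], whose error is taken
    as exp(- r T) to survive the rescaling. The exponent is 2 r^2 times the sum of the e_k(ys i)^2,
    which is 2 M. *)
Let cut_exp_bound i (r T : nat) : exists N0, forall N, (N0 <= N)%N ->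
 Ex (gam N) (fun x => expR (r%:R * cut T%:R (coord i x))) <= 3 * expR (4 * M (ys i) * r%:R ^+ 2).
pose a : R := r%:R * T%:R;pose h (x : R) := expR (- a) * expR (r%:R * cut T%:R x).
have bc : bm (fun x : measurableTypeR R => expR (r%:R * cut T%:R x)) := bm_exp_cut (ler0n R r) (ler0n R T).
have hc : continuous h.
 move=> x;apply: cvgM;first exact: cvg_cst.
 apply: (@continuous_comp _ _ _ (fun x => r%:R * cut T%:R x) expR);last exact: continuous_expR.
 by apply: cvgM;[exact: cvg_cst|exact: cut_continuous].
have h1 x : `|h x| <= 1.
 rewrite ger0_norm ?mulr_ge0 ?expR_ge0 // /h -expRD -[leRHS]expR0 ler_expR addrC subr_le0 /a.
 by rewrite ler_wpM2l // /cut ge_min lexx orbT.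
have [n [ni [N0 H]]] := transfer i hc h1 (expR_gt0 (- a));exists N0=> N /H.
pose q (s : R) (z : nat -> R) := Num.min 1 (expR (- a + \sum_(k < n) z k * (s * r%:R * e k (ys i)))).
have qb s : bdd (q s) by exists 1=> z;rewrite ger0_norm ?le_min ?ler01 ?expR_ge0 // /q ge_min lexx.
have u0 k : `|(fun _ : nat => 0 : R) k| <= 1 by rewrite normr0.
have [_ glin gle _] := gauss_prop UU n u0.
have gq s : s ^+ 2 = 1 -> gauss U n (fun=> 0) (q s) <= expR (- a) * expR (4 * M (ys i) * r%:R ^+ 2).
 move=> s2;apply: le_trans (gauss_exp UU Uoo (qb s) (c := - a) (e := fun k => s * r%:R * e k (ys i)) _) _.
  by move=> z;rewrite /q ge_min lexx orbT.
 rewrite -expRD ler_expR lerD2l (eq_bigr (fun k : 'I_n => r%:R ^+ 2 * e k (ys i) ^+ 2)).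
  by rewrite -mulr_sumr -(e_energy (S_ys ni));apply: eq_ler;ring.
 by move=> k _;rewrite !exprMn s2 mul1r.
have gh : gauss U n (fun=> 0) (fun z => h (lam e n z (ys i))) <= 2 * (expR (- a) * expR (4 * M (ys i) * r%:R ^+ 2)).
 apply: (@le_trans _ _ (gauss U n (fun=> 0) (fun z => 1 * q 1 z + 1 * q (-1) z))).
  apply: gle=> [||z];[by exists 1=> z;exact: h1|exact: bdd_lin|rewrite !mul1r].
  have qE s : \sum_(k < n) z k * (s * r%:R * e k (ys i)) = s * r%:R * lam e n z (ys i).
   by rewrite /lam mulr_sumr;eqsum k;ring.
  rewrite /q !qE;move: (lam e n z (ys i))=> x.
  have hx (y : R) : `|x| = y -> h x <= Num.min 1 (expR (- a + r%:R * y)).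
   move=> xy;rewrite le_min (le_trans (ler_norm _) (h1 x)) /h -expRD ler_expR lerD2l ler_wpM2l //.
   by rewrite /cut xy ge_min lexx.
  have [x0|x0] := leP 0 x.
   by apply: le_trans (hx _ (ger0_norm x0)) _;rewrite mul1r lerDl.
  by apply: le_trans (hx _ (ltr0_norm x0)) _;rewrite !mulN1r mulNr mulrN lerDr.
 by rewrite glin // !mul1r (_ : 2 * _ = expR (- a) * expR (4 * M (ys i) * r%:R ^+ 2) + expR (- a) * expR (4 * M (ys i) * r%:R ^+ 2)) ?lerD ?gq //;ring.
have bi : bm (fun x : borel X => expR (r%:R * cut T%:R (coord i x))) := bm_comp (coord_measurable i) bc.
rewrite /h ExZ // ler_norml=> /andP[_ h2].
rewrite -(ler_pM2l (expR_gt0 (- a))).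
have : expR (- a) <= expR (- a) * expR (4 * M (ys i) * r%:R ^+ 2).
 by rewrite ler_peMr ?expR_ge0 // -[leLHS]expR0 ler_expR !mulr_ge0 ?sqr_ge0.
have h3 := lerD h2 gh;rewrite subrK in h3=> h4;apply: le_trans h3 _.
have lin (x y : R) : x <= y -> x + 2 * y <= 3 * y by move=> xy;rewrite (_ : 3 * y = y + 2 * y) ?lerD2r //;ring.
by apply: le_trans (lin _ _ h4) _;apply: eq_ler;ring.
Qed.

(** [cut_exp_bound] yields an index for each pair (r, T); a maximum over r <= T gives one index per
    level, as [exp_bd] in the one-dimensional theorem requires. *)
Let diagonal i : exists Nf : nat -> nat, forall T, (T <= Nf T)%N /\ forall r, (r <= T)%N ->
 Ex (gam (Nf T)) (fun x => expR (r%:R * cut T%:R (coord i x))) <= 3 * expR (4 * M (ys i) * r%:R ^+ 2).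
suff /choice[Nf HN] : forall T, exists N, (T <= N)%N /\ forall r, (r <= T)%N ->
  Ex (gam N) (fun x => expR (r%:R * cut T%:R (coord i x))) <= 3 * expR (4 * M (ys i) * r%:R ^+ 2) by exists Nf.
move=> T;have /choice[N0 H] := cut_exp_bound i ^~ T.
exists (maxn T (\max_(r < T.+1) N0 r));split=> [|r rT];first exact: leq_maxl.
apply: H;apply: leq_trans (leq_maxr _ _);exact: (leq_bigmax (Ordinal (rT : (r < T.+1)%N))).
Qed.

Let Ex_gam_split N (f : borel X -> R) : bm f ->
 Ex (gam N) f = Ex mu (fun x => Ex (conv cX (rest N) (reflect (theta N))) (fun y : borel X => f (x + y))).
move=> bf;rewrite Ex_conv // Ex_conv;last exact: bm_Ex_shift.
congr Ex;ext x;rewrite Ex_conv;last exact: bm_shift.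
by congr Ex;ext y;congr Ex;ext z;rewrite addrA.
Qed.

(** [gam 0] lives on the linear part, so by Fubini some translate of [mu] by [a] does. The linear
    part being a group, the same [a] then moves the complementary factor into it for every [N]. *)
Lemma shifts_exist : exists a : X, forall N,
 let mu' := translate a mu in let kap := translate (- a) (conv cX (rest N) (reflect (theta N))) in
 [/\ Ex mu' (fun x => \1_V x) = 1, Ex kap (fun x => \1_V x) = 1 &
  forall f, bm f -> Ex (gam N) f = Ex mu' (fun x => Ex kap (fun y : borel X => f (x + y)))].
pose k N := conv cX (rest N) (reflect (theta N)).
have bS (nu : prob X R) : bm (fun x : borel X => Ex nu (fun y : borel X => \1_V (x + y))) by exact: bm_Ex_shift.
have sw N : Ex (k N) (fun y : borel X => Ex mu (fun x : borel X => \1_V (x + y))) = 1.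
 by rewrite -(gam_V N) (Ex_gam_split N bmV) (Ex_swap mu (k N) (conv_bm cX bmV)).
have bT : bm (fun y : borel X => Ex mu (fun x : borel X => \1_V (x + y))).
 have := bS mu;congr bm;ext x;congr Ex;ext y;by rewrite addrC.
have [|||a Ha] := @Ex_zero _ _ _ (k 0%N) (fun y : borel X => 1 - Ex mu (fun x : borel X => \1_V (x + y))).
- by apply: bmB=> //;exact: bm_cst.
- move=> y;rewrite subr_ge0 -[leRHS](Ex_cst mu);apply: Ex_le;[|exact: bm_cst|].
  by have := bm_shift cX y bmV;congr bm;ext x;rewrite addrC.
 by move=> x;rewrite indicE lern1 leq_b1.
- by rewrite ExB ?Ex_cst ?sw ?subrr //;exact: bm_cst.
exists a=> N mu' kap.
have tr (c : X) (nu : prob X R) (h : borel X -> R) : bm h -> Ex (translate c nu) h = Ex nu (fun y : borel X => h (c + y)) by exact: Ex_image.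
have split f : bm f -> Ex (gam N) f = Ex mu' (fun x => Ex kap (fun y : borel X => f (x + y))).
 move=> bf;rewrite (tr a);last exact: bm_Ex_shift.
 apply: etrans (Ex_gam_split N bf) _;apply: (congr1 (Ex mu));ext x.
 apply: etrans (esym (tr (- a) _ _ (bm_shift cX (a + x) bf))). by apply: (congr1 (Ex _));ext y;congr f;zmod.
have mu1 : Ex mu' (fun x => \1_V x) = 1.
 rewrite (tr a) //;move/eqP: Ha;rewrite subr_eq0=> /eqP ->. by congr Ex;ext x;rewrite addrC.
split=> //;rewrite -(gam_V N) (split _ bmV) -[LHS](Ex_cst mu').
apply: (Ex_as linear_part_measurable mu1);[exact: bm_cst|exact: bS|move=> x Vx].
congr Ex;ext y;rewrite !indicE;congr (nat_of_bool _)%:R;apply/idP/idP=> /set_mem h;apply/mem_set.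
 exact: (linear_partD Vx h).1.
by have := (linear_partB h Vx).1;rewrite addrAC subrr add0r.
Qed.

(** Coordinates add on the linear part, so the coordinate laws of the two shifted factors convolve
    to that of [gam (Nf T)]; the complementary factor plays the role of [Q T]. *)
Lemma coord_gaussian : exists a : X, Ex (translate a mu) (fun x => \1_V x) = 1 /\ forall i, exists g v : R, forall s,
 Ex (translate a mu) (fun x => cos (s * coord i x)) = expR (- v * s ^+ 2) * cos (g * s) /\
 Ex (translate a mu) (fun x => sin (s * coord i x)) = expR (- v * s ^+ 2) * sin (g * s).
have [a Ha] := shifts_exist;exists a;have [mu1 _ _] := Ha 0%N;split=> // i.
have [Nf HN] := diagonal i.
pose kap T := translate (- a) (conv cX (rest (Nf T)) (reflect (theta (Nf T)))).
pose P : probability (measurableTypeR R) R := @law _ _ (borel X) (measurableTypeR R) R (translate a mu) (coord i) (coord_measurable i).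
pose Q T : probability (measurableTypeR R) R := @law _ _ (borel X) (measurableTypeR R) R (kap T) (coord i) (coord_measurable i).
have E2 T (f : R -> R) : bm (f : measurableTypeR R -> R) ->
  Ex P (fun x => Ex (Q T) (fun y => f (x + y))) = Ex (gam (Nf T)) (fun x => f (coord i x)).
 move=> bf;have [_ k1 sp] := Ha (Nf T);rewrite -/(kap T) in k1 sp.
 have bfc : bm (fun x : borel X => f (coord i x)) := bm_comp (coord_measurable i) bf.
 have bn : bm (fun x : measurableTypeR R => Ex (Q T) (fun y => f (x + y))) := (Ex_prod P (Q T) (bm_sum2 bf)).1.
 rewrite sp // Ex_law //;apply: (Ex_as linear_part_measurable mu1).
 - exact: (bm_comp (coord_measurable i) bn).
 - exact: (bm_Ex_shift cX (kap T) bfc).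
 move=> x Vx;rewrite Ex_law;last exact: bm_shiftR. apply: (Ex_as linear_part_measurable k1).
 - exact: (bm_comp (coord_measurable i) (bm_shiftR (coord i x) bf)).
 - exact: (bm_shift cX x bfc).
 by move=> y Vy;rewrite (linear_partD Vx Vy).2.
have Nfoo (u : nat -> R) (b : R) : u n @[n --> \oo] --> b -> u (Nf T) @[T --> \oo] --> b.
 move=> ub A /ub[m _ Hm];exists m=> // T /= mT;apply: Hm;exact: leq_trans mT (HN T).1.
have [bcos bsin] := (@bm_cos R, @bm_sin R).
have [|||||g [v H]] := @cramer_probability R P Q (M (ys i)) 3 (4 * M (ys i)).
- by [].
- by rewrite mulr_ge0.
- move=> s;rewrite (_ : (fun T => _) = fun T => Ex (gam (Nf T)) (fun x => cos (s * coord i x)));last by ext T;exact: (E2 T _ (bcos s)).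
 have lim := @gauss_phase_lim i s 0;rewrite cos0 mulr1 in lim.
 have E : (fun N => Ex (gam N) (fun x => cos (0 + s * coord i x))) = fun N => Ex (gam N) (fun x => cos (s * coord i x)).
  by ext N;congr Ex;ext x;rewrite add0r.
 by rewrite E in lim;exact: (Nfoo _ _ lim).
- move=> s;rewrite (_ : (fun T => _) = fun T => Ex (gam (Nf T)) (fun x => sin (s * coord i x)));last by ext T;exact: (E2 T _ (bsin s)).
 have lim := @gauss_phase_lim i s (- (pi / 2));rewrite cosN cos_pihalf mulr0 in lim.
 have E : (fun N => Ex (gam N) (fun x => cos (- (pi / 2) + s * coord i x))) = fun N => Ex (gam N) (fun x => sin (s * coord i x)).
  by ext N;congr Ex;ext x;rewrite cosD cosN sinN cos_pihalf sin_pihalf;ring.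
 by rewrite E in lim;exact: (Nfoo _ _ lim).
- move=> r T rT;have bc : bm (fun x : measurableTypeR R => expR (r%:R * cut T%:R x)) := bm_exp_cut (ler0n R r) (ler0n R T).
 by rewrite (E2 T (fun z => expR (r%:R * cut T%:R z)) bc);exact: (HN T).2.
exists g, v=> s;have [<- <-] := H s.
by split;apply: esym;[exact: (Ex_law _ _ (bcos s))|exact: (Ex_law _ _ (bsin s))].
Qed.

(** * Means and the covariance form *)

Section Barycentre.
Variables (nu : prob X R) (g v : nat -> R).
Hypotheses (hX : hausdorff_space X) (nu1 : Ex nu (fun x => \1_V x) = 1)
 (nu_cos : forall i s, Ex nu (fun x => cos (s * coord i x)) = expR (- v i * s ^+ 2) * cos (g i * s))
 (nu_sin : forall i s, Ex nu (fun x => sin (s * coord i x)) = expR (- v i * s ^+ 2) * sin (g i * s)).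
Variable K0 : set X.
Hypotheses (cK0 : compact K0) (K0E : forall z, exists2 x, K0 x & forall i, ys i x = cis (lz z i)).

Let bcos i s : bm (fun x : borel X => cos (s * coord i x)).
exact: bm_comp (coord_measurable i) (bm_cos s). Qed.

Let bsin i s : bm (fun x : borel X => sin (s * coord i x)).
exact: bm_comp (coord_measurable i) (bm_sin s). Qed.

Let powers n : let P := convs cX (nseq n nu) in Ex P (fun x => \1_V x) = 1 /\ forall i s,
 Ex P (fun x => cos (s * coord i x)) = expR (- v i * s ^+ 2) ^+ n * cos (n%:R * (g i * s)) /\
 Ex P (fun x => sin (s * coord i x)) = expR (- v i * s ^+ 2) ^+ n * sin (n%:R * (g i * s)).
elim: n=> [|n [IH1 IH]] P;[have {P}-> : P = unit_mass by []|have {P}-> : P = conv cX nu (convs cX (nseq n nu)) by []].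
 have c0 i : coord i (0 : borel X) = 0 by have := linear_partB linear_part0 linear_part0;rewrite subrr=> -[_ ->];exact: subrr.
 have u (f : borel X -> R) : bm f -> Ex (unit_mass : prob X R) f = f 0.
  by move=> bf;transitivity (Ex (dirac point : prob X R) (fun _ : borel X => f 0));[exact: Ex_law|exact: Ex_cst].
 split=> [|i s];first by rewrite u // indicE mem_set //;exact: linear_part0.
 by rewrite !u // c0 mulr0 cos0 sin0 expr0 mul0r cos0 sin0 mulr1 mulr0.
set P := convs cX _ in IH1 IH *.
split=> [|i s].
 rewrite Ex_conv // -[RHS](Ex_cst nu);apply: (Ex_as linear_part_measurable nu1);[exact: bm_Ex_shift|exact: bm_cst|].
 move=> x Vx;rewrite -[RHS](Ex_cst P);apply: (Ex_as linear_part_measurable IH1);[exact: bm_shift|exact: bm_cst|].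
 by move=> y Vy;rewrite indicE mem_set //;exact: (linear_partD Vx Vy).1.
have [Ic Is] := IH i s.
have comb (f : borel X -> R) (a b : R) (h1 h2 : borel X -> R) : bm f -> bm h1 -> bm h2 ->
  (forall x y, V x -> V y -> f (x + y) = h1 x * cos (s * coord i y) + h2 x * sin (s * coord i y)) ->
  Ex (conv cX nu P) f = Ex nu (fun x => (expR (- v i * s ^+ 2) ^+ n * cos (n%:R * (g i * s))) * h1 x +
   (expR (- v i * s ^+ 2) ^+ n * sin (n%:R * (g i * s))) * h2 x).
 move=> bf b1 b2 H;rewrite Ex_conv //;apply: (Ex_as linear_part_measurable nu1);[exact: bm_Ex_shift|exact: bm_lin|].
 move=> x Vx;rewrite -Ic -Is mulrC [X in _ + X]mulrC -Ex_lin //.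
 apply: (Ex_as linear_part_measurable IH1);[exact: bm_shift|exact: bm_lin|by move=> y Vy;exact: H].
split.
 rewrite (comb _ 0 0 (fun x => cos (s * coord i x)) (fun x => - sin (s * coord i x))) //.
 - rewrite (_ : (fun x => _) = fun x : borel X => (expR (- v i * s ^+ 2) ^+ n * cos (n%:R * (g i * s))) * cos (s * coord i x) +
   (- (expR (- v i * s ^+ 2) ^+ n * sin (n%:R * (g i * s)))) * sin (s * coord i x));last by ext x;ring.
  by rewrite Ex_lin // nu_cos nu_sin -natr1 mulrDl mul1r cosD [_ ^+ n.+1]exprSr;ring.
 - have := bmZ (-1) (bsin i s);congr bm;ext x;exact: mulN1r.
 - by move=> x y Vx Vy;rewrite (linear_partD Vx Vy).2 mulrDr cosD;ring.
rewrite (comb _ 0 0 (fun x => sin (s * coord i x)) (fun x => cos (s * coord i x))) //.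
- by rewrite Ex_lin // nu_cos nu_sin -natr1 mulrDl mul1r sinD [_ ^+ n.+1]exprSr;ring.
- by move=> x y Vx Vy;rewrite (linear_partD Vx Vy).2 mulrDr sinD;ring.
Qed.

(** X has no scalar multiplication, so the average of [n] independent copies is formed on
    logarithms. A point of the linear part with coordinates near n g i exists by the law of large
    numbers; 1 / n times its logarithm has an exponential in [K0] with the desired phases,
    approximately. *)
Lemma barycentre : exists x, forall i, ys i x = cis (g i).
suff [x _ xE] : exists2 x, K0 x & forall i, ys i x = cis (g i) by exists x.
apply: (compact_solve hX cK0 (@invn_cvg0 R))=> m.
pose de : R := (m.+1%:R)^-1;have de0 : 0 < de by rewrite invr_gt0 ltr0n.
pose A := \sum_(i < m) `|v i|;have A0 : 0 <= A by apply: sumr_ge0.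
(* Chosen so that the mean of [f] is at most half of the threshold de^2 / 2 below. *)
pose n := (Num.truncn (4 * A / de ^+ 2)).+1.
have n0 : 0 < n%:R :> R by rewrite ltr0n.
have nA : A / n%:R <= de ^+ 2 / 4.
 have := ltW (truncnS_gt (4 * A / de ^+ 2));rewrite -/n ler_pdivrMr ?exprn_gt0 // => h.
 by rewrite ler_pdivrMr //;lra.
have [P1 PE] := powers n;set P := convs cX _ in P1 PE.
(* This is 1 - cos(g i - coord i x / n), expanded so that [PE] applies. *)
pose f1 i (x : borel X) : R := 1 + ((- cos (g i)) * cos (n%:R^-1 * coord i x) + (- sin (g i)) * sin (n%:R^-1 * coord i x)).
have bf1 i : bm (f1 i) by apply: bmD;[exact: bm_cst|exact: bm_lin].
pose f x := \sum_(i < m) f1 i x;have bf : bm f by exact: (@bm_sum _ _ _ _ _ (fun i : 'I_m => f1 i)).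
have Ef : Ex P f <= A / n%:R.
 rewrite (@Ex_sum _ _ _ P _ _ (fun i : 'I_m => f1 i)) // /f1.
 rewrite mulr_suml;lesum i;rewrite ExD;[|exact: bm_cst|exact: bm_lin].
 rewrite Ex_cst Ex_lin //;have [-> ->] := PE i n%:R^-1.
 have -> : n%:R * (g i / n%:R) = g i by rewrite mulrC divfK // gt_eqF.
 have := cos2Dsin2 (g i)=> cs;set q := expR _ ^+ n.
 have -> : 1 + (- cos (g i) * (q * cos (g i)) + - sin (g i) * (q * sin (g i))) = 1 - q by rewrite -[X in _ - X](mulr1 q) -cs;ring.
 have -> : q = expR (- (v i / n%:R)).
  rewrite /q -expRM_natl;congr expR;rewrite expr2;field;exact: lt0r_neq0.
 have := expR_ge1Dx (- (v i / n%:R));have : v i / n%:R <= `|v i| / n%:R by rewrite ler_wpM2r ?invr_ge0 ?ler_norm ?ltW.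
 lra.
have [x Vx fx] : exists2 x, V x & f x <= de ^+ 2 / 2.
 apply: contrapT=> H;have : de ^+ 2 / 2 <= Ex P f.
  rewrite (_ : de ^+ 2 / 2 = Ex P (fun x => de ^+ 2 / 2 * \1_V x));last by rewrite ExZ // P1 mulr1.
  have bVf : bm (fun x : borel X => \1_V x * f x : R) by exact: bm_mul.
  have -> : Ex P f = Ex P (fun x : borel X => \1_V x * f x).
   by apply: (Ex_as linear_part_measurable P1)=> // x Vx;rewrite indicE mem_set // mul1r.
  apply: Ex_le=> //;first exact: bmZ.
  move=> x;rewrite indicE;have [Vx|nVx] := pselect (V x);last by rewrite memNset //= mulr0 mul0r.
  rewrite mem_set //= mulr1 mul1r leNgt;apply/negP=> lt;apply: H;exists x=> //;exact: ltW.
 have : 0 < de ^+ 2 by rewrite exprn_gt0. lra.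
have [w K0w wE] := K0E (fun k => n%:R^-1 * log x k).
exists w=> // i im;rewrite wE l_scale -/(coord i x).
apply: unit_dist_le;rewrite ?norm_cis ?(ltW de0) // -/de.
rewrite -[(cis (g i))^*]/(conjc (cis (g i))) /cis /=.
have f0 j : 0 <= f1 j x by have := cos_le1 (g j - n%:R^-1 * coord j x);rewrite cosB /f1;lra.
have : f1 i x <= de ^+ 2 / 2 by apply: le_trans fx;rewrite /f (bigD1 (Ordinal im)) //= lerDl sumr_ge0.
rewrite /f1;lra.
Qed.

(** In the difference of two independent copies the mean drops out and the variance doubles. *)
Let pair_cos i s : Ex nu (fun x => Ex nu (fun y : borel X => cos (s * (coord i x - coord i y)))) = expR (- (v i * (2 * s ^+ 2))).
have E : (fun x => Ex nu (fun y : borel X => cos (s * (coord i x - coord i y)))) = (fun x : borel X =>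
  (expR (- v i * s ^+ 2) * cos (g i * s)) * cos (s * coord i x) + (expR (- v i * s ^+ 2) * sin (g i * s)) * sin (s * coord i x)).
 ext x;rewrite -nu_cos -nu_sin mulrC [X in _ = _ + X]mulrC -Ex_lin //.
 by apply: (congr1 (Ex nu));ext y;rewrite mulrBr cosB.
rewrite E Ex_lin // nu_cos nu_sin (_ : - (v i * _) = - v i * s ^+ 2 + - v i * s ^+ 2);last by ring.
by rewrite expRD -[RHS]mulr1 -(cos2Dsin2 (g i * s));ring.
Qed.

Let bm_pair (a b : R) p q : bm (fun z : borel X * borel X => cos (a * (coord p z.1 - coord p z.2) + b * (coord q z.1 - coord q z.2))).
split;last by exists 1=> z;exact: cos_bounded.
have m2 i (c : R) : measurable_fun setT (fun z : borel X * borel X => c * (coord i z.1 - coord i z.2)).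
 apply: measurable_funM;first exact: measurable_cst.
 by apply: measurable_funB;apply: (measurableT_comp (coord_measurable i)).
by apply: (measurableT_comp (f := cos));[exact: (continuous_measurable_fun (@continuous_cos R))|exact: measurable_funD].
Qed.

Let pair_mean (a b c : R) p q r : (forall x, c * coord r x = a * coord p x + b * coord q x) ->
 Ex (nu \x nu)%E (fun z : borel X * borel X => cos (a * (coord p z.1 - coord p z.2) + b * (coord q z.1 - coord q z.2))) =
 expR (- (v r * (2 * c ^+ 2))).
move=> H;rewrite (Ex_prod nu nu (bm_pair a b p q)).2 -pair_cos /=.
apply: (congr1 (Ex nu));ext x;apply: (congr1 (Ex nu));ext y.
by congr cos;rewrite [RHS]mulrBr !H;ring.
Qed.

Lemma coord_variance_ge0 i : 0 <= v i.
have h : forall x, 1 * coord i x = 1 * coord i x + 0 * coord i x by move=> x;ring.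
have : expR (- (v i * (2 * 1 ^+ 2))) <= 1.
 rewrite -(pair_mean h) -[leRHS](Ex_cst (nu \x nu)%E);apply: Ex_le;[exact: bm_pair|exact: bm_cst|].
 by move=> z;exact: cos_le1.
by rewrite -[leRHS]expR0 ler_expR expr1n;lra.
Qed.

(* The average of [2 (cos A - cos B)^2 >= 0], with [A] and [B] the increments
  of two coordinates scaled by [s], expanded to second order in [s]. *)
Let half_parallelogram p q r t (c : R) : (forall x, c * coord r x = coord p x + coord q x) ->
 (forall x, c * coord t x = coord p x - coord q x) -> 2 * (v p + v q) <= c ^+ 2 * (v r + v t).
move=> Hr Ht;have v0 := coord_variance_ge0.
pose K := (8 * v p) ^+ 2 + (8 * v q) ^+ 2.
have Kge0 : 0 <= K by rewrite addr_ge0 ?sqr_ge0.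
have main s : 2 * expR (- (v r * (2 * (s * c) ^+ 2))) + 2 * expR (- (v t * (2 * (s * c) ^+ 2))) <=
  1 * (2 * 1 + 1 * expR (- (v p * (2 * (2 * s) ^+ 2)))) + 1 * expR (- (v q * (2 * (2 * s) ^+ 2))).
 rewrite -(@pair_mean s s (s * c) p q r)=> [|x];last by rewrite -mulrA Hr;ring.
 rewrite -(@pair_mean s (- s) (s * c) p q t)=> [|x];last by rewrite -mulrA Ht;ring.
 rewrite -(@pair_mean (2 * s) 0 (2 * s) p q p)=> [|x];last by ring.
 rewrite -(@pair_mean 0 (2 * s) (2 * s) p q q)=> [|x];last by ring. rewrite -(Ex_lin _ 2 2);try exact: bm_pair.
 rewrite -[X in 2 * X + 1 * _](Ex_cst (nu \x nu)%E 1) -(Ex_lin _ 2 1);[|exact: bm_cst|exact: bm_pair].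
 have b1 : bm (fun z : borel X * borel X => 2 * 1 + 1 * cos (2 * s * (coord p z.1 - coord p z.2) + 0 * (coord q z.1 - coord q z.2)) : R).
  by apply: bm_lin;[exact: bm_cst|exact: bm_pair].
 rewrite -(Ex_lin _ 1 1) //;try exact: bm_pair.
 apply: Ex_le;[by apply: bm_lin;exact: bm_pair|by apply: bm_lin => //;exact: bm_pair|move=> z].
 set A := coord p z.1 - _;set B := coord q z.1 - _. rewrite (_ : 2 * s * A + 0 * B = s * A + s * A);last by ring.
 rewrite (_ : 0 * A + 2 * s * B = s * B + s * B);last by ring. rewrite !mulNr -/(s * B) cosB !cosD.
 have := sqr_ge0 (cos (s * A) - cos (s * B));have := cos2Dsin2 (s * A);have := cos2Dsin2 (s * B).
 rewrite -!expr2 sqrrB;nra.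
have key w : 0 < w -> 8 * (v p + v q) - 4 * (c ^+ 2 * (v r + v t)) <= K * w.
 move=> w0;have := main (Num.sqrt w);rewrite !exprMn sqr_sqrtr ?(ltW w0) //.
 have := expRN_le (mulr_ge0 (mulr_ge0 (ler0n _ 8) (v0 p)) (ltW w0)).
 have := expRN_le (mulr_ge0 (mulr_ge0 (ler0n _ 8) (v0 q)) (ltW w0)).
 have := expR_ge1Dx (- (v r * (2 * (w * c ^+ 2))));have := expR_ge1Dx (- (v t * (2 * (w * c ^+ 2)))).
 have -> : v p * (2 * (2 ^+ 2 * w)) = 8 * v p * w by ring. have -> : v q * (2 * (2 ^+ 2 * w)) = 8 * v q * w by ring.
 rewrite !ler_norml=> h1 h2 /andP[_ h3] /andP[_ h4] h5.
 rewrite -(ler_pM2r w0) (_ : K * w * w = (8 * v p * w) ^+ 2 + (8 * v q * w) ^+ 2);last by rewrite /K;ring.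
 rewrite (_ : (8 * (v p + v q) - 4 * (c ^+ 2 * (v r + v t))) * w = 8 * v p * w + 8 * v q * w -
  2 * (v r * (2 * (w * c ^+ 2))) - 2 * (v t * (2 * (w * c ^+ 2))));last by ring.
 by move: h1 h2 h3 h4 h5;lra.
suff : 8 * (v p + v q) - 4 * (c ^+ 2 * (v r + v t)) <= 0 by lra.
apply/ler_addgt0Pr=> d d0;rewrite add0r.
have K1 : 0 < K + 1 by rewrite ltr_wpDl.
apply: le_trans (key (d / (K + 1)) _) _;first by rewrite divr_gt0.
by rewrite mulrCA ger_pMr // ler_pdivrMr // mul1r lerDl.
Qed.

Let coordD i j k x : ys k = ys i + ys j -> coord k x = coord i x + coord j x.
move=> kE;pose n := maxn k (maxn i j);have E p : (p <= n)%N -> coord p x = lam e n.+1 (log x) (ys p).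
 by move=> pn;rewrite (lam_ys e_ys _ (pn : (p < n.+1)%N)).
by rewrite !E ?kE ?lamD //;rewrite /n;lia.
Qed.

(** The half inequality is used twice: for [i], [j] with c = 1, and for their sum and difference
    with c = 2, whose own sum and difference are twice the coordinates [i] and [j]. *)
Lemma coord_parallelogram i j k m : ys k = ys i + ys j -> ys m = ys i - ys j -> v k + v m = 2 * (v i + v j).
move=> kE mE;have iE : ys i = ys m + ys j by rewrite mE subrK.
have Hk x := coordD x kE;have Hm x : coord m x = coord i x - coord j x by rewrite (coordD x iE) addrK.
have h1 : 2 * (v i + v j) <= 1 ^+ 2 * (v k + v m) by apply: half_parallelogram=> x;rewrite mul1r.
have h2 : 2 * (v k + v m) <= 2 ^+ 2 * (v i + v j) by apply: half_parallelogram=> x;rewrite Hk Hm;ring.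
lra.
Qed.

Lemma cf_coord i : cf nu (ys i) = cis (g i) * ((expR (- v i))%:C)%C.
have [bR bI] := bmC_char (ys i).
have -> : cf nu (ys i) = Complex (Ex nu (fun x => cos (1 * coord i x))) (Ex nu (fun x => sin (1 * coord i x))).
 congr Complex;apply: (Ex_as linear_part_measurable nu1)=> // x Vx;by rewrite mul1r char_coord.
rewrite nu_cos nu_sin expr1n !mulr1 /cis;apply/eqP;rewrite eq_complex /=.
by apply/andP;split;apply/eqP;ring.
Qed.

End Barycentre.

Lemma gaussian_on_sequence (K0 : set X) : hausdorff_space X -> compact K0 ->
 (forall z, exists2 x, K0 x & forall i, ys i x = cis (lz z i)) ->
 exists (x : X) (v : nat -> R), (forall i, cf mu (ys i) = ys i x * ((expR (- v i))%:C)%C) /\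
  forall i j k m, ys k = ys i + ys j -> ys m = ys i - ys j -> v k + v m = 2 * (v i + v j).
move=> hX cK K0E;have [a [a1 /choice[g /choice[v H]]]] := coord_gaussian.
have Hc i s := (H i s).1;have Hs i s := (H i s).2.
have [x xE] := barycentre hX a1 Hc Hs cK K0E.
exists (x - a), v;split=> [i|i j k m];last exact: (coord_parallelogram Hc Hs).
have := cf_coord a1 Hc Hs i;rewrite cf_translate -xE=> h.
apply: (mulfI (char_neq0 (ys i) a));rewrite h mulrA -charD;congr (char_fun (ys i) _ * _);zmod.
Qed.

End LinearPart.

(** * Continuity in the compact-open topology *)

Section CompactOpen.
Context {R} {X : topologicalZmodType}.
Hypotheses (hX : hausdorff_space X) (cX : @second_countable X) (lX : locally_compact [set: X]).
Local Notation Y := (character R X).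

Lemma near_char (y0 : Y) (K : set X) (r : R) : compact K -> 0 < r ->
 nbhs y0 [set y : Y | forall x, K x -> (`|y0 x - y x| < r%:C)%C].
have FF : Filter (nbhs y0) := nbhs_filter y0.
move=> cK r0;have r0' : (0 : C R) < (r%:C)%C by rewrite ltcR.
have H : {compact-open, (@char_fun R X : Y -> X -> C R) @ nbhs y0 --> (char_fun y0 : X -> C R)}.
 exact: (@initial_continuous _ _ (@char_fun R X : Y -> {compact-open, X -> C R}) y0).
move/(compact_open_fam_compactP (@char_continuous R X y0) _) : H=> /fam_cvgP/(_ K cK) H.
have H2 : nbhs (char_fun y0 : {uniform` K -> C R}) [set h : {uniform` K -> C R} | forall x, K x -> (`|y0 x - h x| < r%:C)%C].
 apply/uniform_nbhs;exists [set p | ball p.1 (PosNum r0')%:num p.2];split;first exact: entourage_ball.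
 by move=> h Hh x Kx;have := Hh x Kx;rewrite /= -ball_normE.
exact: (H _ H2).
Qed.

(** Tightness leaves a compact set, on which nearby characters are uniformly close. *)
Let Ex_char_continuous (mu : prob X R) (part : R[i] -> R) :
 (forall y : Y, bm (fun x : borel X => part (y x))) -> (forall z, `|z| = 1 -> `|part z| <= 1) ->
 (forall z w (r : R), (`|z - w| < r%:C)%C -> `|part z - part w| <= r) ->
 continuous (fun y : Y => Ex mu (fun x => part (y x))).
move=> bp p1 pl y0;have FF : Filter (nbhs y0) := nbhs_filter y0.
apply/(@cvgrPdist_le _ R^o)=> e e0;have e3 : 0 < e / 3 by rewrite divr_gt0.
have [K [cK mK K1]] := tight hX cX lX mu e3.
have := near_char y0 cK e3;apply: filterS=> y Hy /=.
have bK := @bm_ind _ _ R _ mK.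
have bg : bm (fun x : borel X => e / 3 + 2 * (1 - \1_(K : set (borel X)) x) : R).
 by apply: bmD;[exact: bm_cst|apply: bmZ;apply: bmB=> //;exact: bm_cst].
rewrite -ExB //;apply: le_trans (Ex_norm_dom mu (bmB (bp y0) (bp y)) bg _) _.
 move=> x;rewrite indicE;have [Kx|nKx] := pselect (K x).
  by rewrite mem_set //= subrr mulr0 addr0;apply: pl;exact: Hy.
 rewrite memNset //= subr0 mulr1;apply: le_trans (ler_normB _ _) _.
 have := p1 _ (char_norm y0 x);have := p1 _ (char_norm y x);lra.
rewrite ExD;[|exact: bm_cst|by apply: bmZ;apply: bmB=> //;exact: bm_cst].
rewrite (ExZ mu 2);last by apply: bmB=> //;exact: bm_cst.
rewrite ExB //;last exact: bm_cst.
by rewrite !Ex_cst;move: K1;set E := Ex mu _;lra.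
Qed.

Lemma nsq_cf_continuous (mu : prob X R) : continuous (fun y : Y => nsq (cf mu y)).
have Re_le (z : R[i]) : `|Re z| <= Re `|z| /\ `|Im z| <= Re `|z|.
 case: z=> a b /=;split;rewrite -[leLHS]sqrtr_sqr ler_sqrt ?addr_ge0 ?sqr_ge0 //.
  by rewrite lerDl sqr_ge0.
 by rewrite lerDr sqr_ge0.
have lip (z w : R[i]) (r : R) : (`|z - w| < r%:C)%C -> `|Re z - Re w| <= r /\ `|Im z - Im w| <= r.
 have [h1 h2] := Re_le (z - w);rewrite ltcE=> /andP[_ /= /ltW h3].
 by move: h1 h2 h3;case: z w=> ? ? [? ?] /= h1 h2 h3;split;[exact: le_trans h1 h3|exact: le_trans h2 h3].
have sqr_cvg (f : Y -> R) : continuous f -> continuous (fun y => f y ^+ 2).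
 by move=> cf y;have FF : Filter (nbhs y) := nbhs_filter y;apply: cvgM;exact: cf.
move=> y;have FF : Filter (nbhs y) := nbhs_filter y;apply: cvgD;apply: sqr_cvg.
 apply: Ex_char_continuous=> [y'|z z1|z w r zw];[exact: (bmC_char y').1| |exact: (lip _ _ _ zw).1].
 by have := (Re_le z).1;rewrite z1.
apply: Ex_char_continuous=> [y'|z z1|z w r zw];[exact: (bmC_char y').2| |exact: (lip _ _ _ zw).2].
by have := (Re_le z).2;rewrite z1.
Qed.

End CompactOpen.

Lemma mul_conjc_nsq R (z : R[i]) : z * conjc z = ((nsq z)%:C)%C.
by case: z=> a b;apply/eqP;rewrite eq_complex /nsq /=;apply/andP;split;apply/eqP;ring. Qed.

Lemma expR_sumN R (I : Type) (s : seq I) (f : I -> R) : \prod_(i <- s) expR (- f i) = expR (- \sum_(i <- s) f i).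
by elim/big_rec2: _ => [|i x y _ ->];rewrite ?oppr0 ?expR0 // opprD expRD. Qed.

(** * The linear forms and the conclusion *)

Section LinearForms.
Context {R} {X : topologicalZmodType}.
Hypotheses (hX : hausdorff_space X) (cX : @second_countable X) (lX : locally_compact [set: X])
 (no_circle : forall H : set X, subgroup H -> ~ isomorphic_to_circle R H) (finG : finite_set (auts X)).
Context {alpha beta : nat -> X -> X}.
Hypotheses (alpha_aut : forall j, auts X (alpha j)) (beta_aut : forall j, auts X (beta j)).
Context {d : measure_display} {T : measurableType d} {P : probability T R} {xi : nat -> {RV P >-> borel X}}.
Hypothesis xi_indep : mutually_independent xi.
Context {d' : measure_display} {T' : measurableType d'} {Q : probability T' R} {L1 L2 : {RV Q >-> borel X}}.
Hypotheses (L12 : pair_cvg_in_distribution alpha beta xi L1 L2) (L_indep : independent_pair L1 L2)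
 (L1_nz : forall y : character R X, characteristic_function (distribution Q L1) y != 0)
 (L2_nz : forall y : character R X, characteristic_function (distribution Q L2) y != 0).
Local Notation Y := (character R X).
Local Notation nu1 := (distribution Q L1).
Local Notation nu2 := (distribution Q L2).
Local Notation mu j := (distribution P (xi j)).

Lemma partial_sum_measurable a N : (forall j, auts X (a j)) -> measurable_fun setT (partial_sum a xi N).
move=> Ha;rewrite /partial_sum;elim: N=> [|N IH].
 by under eq_fun do rewrite big_ord0;exact: measurable_cst.
under eq_fun do rewrite big_ord_recr /=;apply: measurable_borelD=> //.
apply: (measurableT_comp (f := a N : borel X -> borel X)).
 by apply: continuous_borel;have [_ []] := Ha N.
exact: measurable_funPT.
Qed.

(** The character through which [xi j] enters the product of [u] at the first form and [v] at the
    second. *)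
Let w (u v : Y) j : Y := pull (alpha j) u + pull (beta j) v.

Lemma form_charE (u v : Y) N t :
 u (partial_sum alpha xi N t) * v (partial_sum beta xi N t) = \prod_(j < N) w u v j (xi j t).
rewrite /partial_sum;elim: N=> [|N IH];first by rewrite !big_ord0 !char0 mulr1.
by rewrite !big_ord_recr /= !charD mulrACA IH !pullE.
Qed.

Let uv (u v : Y) (p : borel X * borel X) : R[i] := u p.1 * v p.2.

Let uv_bm u v : bmC (uv u v).
apply: bmC_mul;[apply: bmC_comp (bmC_char u)|apply: bmC_comp (bmC_char v)] => //.
Qed.

Let uv_cvg (part : R[i] -> R) u v : (forall z : R[i], {for (z : C R), continuous (part : C R -> R)}) ->
 bm (fun p => part (uv u v p)) -> (fun N => Ex P (fun t => part (\prod_(j < N) w u v j (xi j t)))) @ \oo -->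
 Ex (nu1 \x nu2)%E (fun p => part (uv u v p)).
move=> cpart bp.
have mS N : measurable_fun setT (fun t => (partial_sum alpha xi N t, partial_sum beta xi N t)).
 by apply: measurable_fun_pair;exact: partial_sum_measurable.
have mL : measurable_fun setT (fun t => (L1 t, L2 t)).
 by apply: measurable_fun_pair;exact: measurable_funPT.
have H := L12 (f := fun p => part (uv u v p)).
have {H} : (\int[joint_distribution P (partial_sum alpha xi n) (partial_sum beta xi n)]_x (part (uv u v x))%:E)%E
  @[n --> \oo] --> (\int[joint_distribution Q L1 L2]_x (part (uv u v x))%:E)%E.
 apply: H;last by have [_ ?] := bp.
 move=> x;have H1 : (u y.1 * v y.2) @[y --> (x : X * X)] --> (u x.1 * v x.2 : C R).
  apply: (@cvgM (C R)).
   by apply: (@continuous_comp (X * X)%type X (C R) fst u);[exact: cvg_fst|exact: char_continuous].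
  by apply: (@continuous_comp (X * X)%type X (C R) snd v);[exact: cvg_snd|exact: char_continuous].
 exact: (cvg_comp _ _ H1 (cpart _)).
rewrite /joint_distribution (Ex_pushforward Q mL bp).
have -> : (fun n => (\int[pushforward P (fun t => (partial_sum alpha xi n t, partial_sum beta xi n t))]_x (part (uv u v x))%:E)%E) =
  (fun N => (Ex P (fun t => part (\prod_(j < N) w u v j (xi j t))))%:E).
 ext N;rewrite (Ex_pushforward P (mS N) bp);congr (Ex _ _)%:E. by ext t;rewrite -form_charE.
move=> /fine_cvgP[_];rewrite -(Ex_law Q mL bp).
rewrite (@Ex_eq _ _ _ (law Q mL) (nu1 \x nu2)%E) //.
Qed.

(** Independence of the summands gives the products, independence of [L1] and [L2] the factorised
    limit. Squared moduli discard the phases, that is, the unknown shifts. *)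
Lemma form_cvg u v : (fun N => \prod_(j < N) nsq (cf (mu j) (w u v j))) @ \oo --> nsq (cf nu1 u) * nsq (cf nu2 v).
have b (j : nat) : @bmC R _ (borel X) (fun x => w u v j x) by exact: bmC_char.
have c1 := uv_cvg (fun z => @Re_continuous R z) (uv_bm u v).1.
have c2 := uv_cvg (fun z => @Im_continuous R z) (uv_bm u v).2.
have E N := indep_prod xi_indep b N.
set f1 := (fun N => Ex P _) in c1;set f2 := (fun N => Ex P _) in c2.
have : (fun N => f1 N * f1 N + f2 N * f2 N) @ \oo --> Ex (nu1 \x nu2)%E (fun p => Re (uv u v p)) *
  Ex (nu1 \x nu2)%E (fun p => Re (uv u v p)) + Ex (nu1 \x nu2)%E (fun p => Im (uv u v p)) *
  Ex (nu1 \x nu2)%E (fun p => Im (uv u v p)).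
 by apply: cvgD;apply: cvgM.
have -> : Ex (nu1 \x nu2)%E (fun p => Re (uv u v p)) = Re (cf nu1 u * cf nu2 v).
 by rewrite /cf -Cx_prod //;exact: bmC_char.
have -> : Ex (nu1 \x nu2)%E (fun p => Im (uv u v p)) = Im (cf nu1 u * cf nu2 v).
 by rewrite /cf -Cx_prod //;exact: bmC_char.
rewrite -/(nsq _) nsqM;rewrite (_ : (fun N => f1 N * f1 N + f2 N * f2 N) = fun N => \prod_(j < N) nsq (cf (mu j) (w u v j))) //.
ext N;rewrite /f1 /f2 -!expr2.
apply/esym;transitivity (nsq (\prod_(j < N) cf (mu j) (w u v j)));first by rewrite nsq_prod.
rewrite (eq_bigr (fun j : 'I_N => Cx P (fun t => w u v j (xi j t)))) -?E //.
by move=> j _;rewrite /cf Cx_distribution.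
Qed.

Let lim_gt0 u v : 0 < nsq (cf nu1 u) * nsq (cf nu2 v).
by rewrite mulr_gt0 // nsq_gt0;[exact: L1_nz|exact: L2_nz]. Qed.

Let prod_gt0 u v j : 0 < nsq (cf (mu j) (w u v j)).
rewrite lt_neqAle nsq_ge0 andbT;apply/eqP=> H.
have : (fun N => \prod_(j < N) nsq (cf (mu j) (w u v j))) @ \oo --> (0 : R).
 apply: cvg_near_cst;exists j.+1=> // N /= jN. by rewrite (bigD1 (Ordinal jN)) //= -H mul0r.
move=> /(lim_uniq (@form_cvg u v));have := lim_gt0 u v;by lra.
Qed.

(** A vanishing factor would annihilate all later products, whose limit is not 0. Every character is
    reached, as [alpha j] is invertible. *)
Lemma summand_cf_neq0 j y : cf (mu j) y != 0.
have [h [Hh hK _]] := aut_inv (alpha_aut j).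
rewrite -nsq_gt0;have := prod_gt0 (pull h y) 0 j;congr (_ < nsq (cf _ _)).
apply: char_ext=> x /=;by rewrite !pullE // hK mulr1.
Qed.

Definition psi j (y : Y) : R := - ln (nsq (cf (mu j) y)).

Lemma psi_ge0 j y : 0 <= psi j y.
by rewrite /psi oppr_ge0 ln_le0 // nsq_le1 // cf_norm. Qed.

Let A1 u : R := - ln (nsq (cf nu1 u)).
Let A2 u : R := - ln (nsq (cf nu2 u)).

Let psi_cvg u v : (fun N => \sum_(j < N) psi j (w u v j)) @ \oo --> A1 u + A2 v.
have -> : (fun N => \sum_(j < N) psi j (w u v j)) = (fun N => - ln (\prod_(j < N) nsq (cf (mu j) (w u v j)))).
 apply/funext;elim=> [|N IH];first by rewrite !big_ord0 ln1 oppr0.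
 have p1 : 0 < \prod_(j < N) nsq (cf (mu j) (w u v j)) by apply: prodr_gt0=> j.
 by rewrite !big_ord_recr /= IH lnM ?opprD // posrE;exact: prod_gt0.
rewrite -opprD -lnM ?posrE ?nsq_gt0;try exact: L1_nz;try exact: L2_nz.
apply: cvgN;exact: continuous_cvg (continuous_ln (lim_gt0 u v)) (@form_cvg u v).
Qed.

Context {n : nat} {g : 'I_n -> X -> X}.
Hypotheses (ginj : injective g) (gaut : forall i, auts X (g i)) (gall : forall f, auts X f -> exists i, g i = f).

(** Right multiplication permutes the finite group Aut(X). *)
Lemma aut_reindex (V : zmodType) (F : (X -> X) -> V) f : auts X f ->
 \sum_(i < n) F (g i \o f) = \sum_(i < n) F (g i).
move=> Hf;have /choice[s Hs] : forall i, exists j, g j = g i \o f.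
 by move=> i;apply: gall;exact: aut_comp.
have sinj : injective s.
 move=> i j sij;apply: ginj;have [h [_ _ fh]] := aut_inv Hf. have : g i \o f = g j \o f by rewrite -!Hs sij.
 by move=> /(congr1 (fun k => k \o h)) E;ext x;have := congr1 (fun k => k x) E;rewrite /= fh.
rewrite [RHS](reindex_inj sinj);apply: eq_bigr=> i;by rewrite Hs.
Qed.

Definition energy N (u : Y) : R := \sum_(j < N) \sum_(i < n) psi j (pull (g i) u).
Definition limit_energy (u : Y) : R := \sum_(i < n) A1 (pull (g i) u).

Let pull_pull f h (y : Y) : auts X f -> auts X h -> pull h (pull f y) = pull (f \o h) y.
by move=> Hf Hh;apply: pull_comp=> //;exact: aut_comp. Qed.

Let w0 u j : w u 0 j = pull (alpha j) u.
by apply: char_ext=> x;rewrite /w /= !pullE //= mulr1. Qed.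

Let w0' v j : w 0 v j = pull (beta j) v.
by apply: char_ext=> x;rewrite /w /= !pullE //= mul1r. Qed.

Let A10 : A1 0 = 0. by rewrite /A1 cf0 /nsq /= expr1n expr0n addr0 ln1 oppr0. Qed.
Let A20 : A2 0 = 0. by rewrite /A2 cf0 /nsq /= expr1n expr0n addr0 ln1 oppr0. Qed.

Lemma energy_cvg u : energy N u @[N --> \oo] --> limit_energy u.
have -> : (fun N => energy N u) = (fun N => \sum_(i < n) \sum_(j < N) psi j (w (pull (g i) u) 0 j)).
 ext N;rewrite exchange_big /=;eqsum j. rewrite -(aut_reindex (fun f => psi j (pull f u)) (alpha_aut j)).
 by eqsum i;rewrite w0 pull_pull.
rewrite /limit_energy;under eq_bigr do rewrite -[A1 _]addr0 -A20.
apply: sum_cvg=> i;exact: psi_cvg.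
Qed.

Let energy_cvg2 v : energy N v @[N --> \oo] --> \sum_(i < n) A2 (pull (g i) v).
have -> : (fun N => energy N v) = (fun N => \sum_(i < n) \sum_(j < N) psi j (w 0 (pull (g i) v) j)).
 ext N;rewrite exchange_big /=;eqsum j. rewrite -(aut_reindex (fun f => psi j (pull f v)) (beta_aut j)).
 by eqsum i;rewrite w0' pull_pull.
under eq_bigr do rewrite -[A2 _]add0r -A10.
apply: sum_cvg=> i;exact: psi_cvg.
Qed.

Lemma limit_energy_ge0 u : 0 <= limit_energy u.
by apply: sumr_ge0=> i _;rewrite /A1 oppr_ge0 ln_le0 // nsq_le1 // cf_norm. Qed.

Lemma limit_energyN u : limit_energy (- u) = limit_energy u.
eqsum i;have -> : pull (g i) (- u) = - pull (g i) u.
 by apply: char_ext=> x;rewrite /= !pullE.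
by rewrite /A1 cfN nsqJ.
Qed.

(** Under summation over the group in both arguments, [g i] and [g k] may be replaced by
    [g i \o alpha j] and [g k \o beta j], separately for each [j], so the coefficients disappear.
    The limit then splits into a part in [u] and a part in [v], and the latter is again
    [limit_energy] because both are limits of [energy]. *)
Lemma limit_energy_mean u v :
 \sum_(k < n) limit_energy (u + pull (g k) v) = n%:R * (limit_energy u + limit_energy v).
have L : (\sum_(k < n) energy N (u + pull (g k) v)) @[N --> \oo] --> \sum_(k < n) limit_energy (u + pull (g k) v).
 by apply: sum_cvg=> k;exact: energy_cvg.
have L' : (fun N => \sum_(k < n) energy N (u + pull (g k) v)) @ \oo -->
  \sum_(i < n) \sum_(k < n) (A1 (pull (g i) u) + A2 (pull (g k) v)).
 have -> : (fun N => \sum_(k < n) energy N (u + pull (g k) v)) =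
   (fun N => \sum_(i < n) \sum_(k < n) \sum_(j < N) psi j (w (pull (g i) u) (pull (g k) v) j)).
  ext N;rewrite exchange_big /=.
  rewrite [RHS](eq_bigr (fun i => \sum_(j < N) \sum_(k < n) psi j (w (pull (g i) u) (pull (g k) v) j)));last first.
   by move=> i _;rewrite exchange_big.
  rewrite [RHS]exchange_big /=;eqsum j. rewrite exchange_big /=.
  transitivity (\sum_(i < n) \sum_(k < n) psi j (pull (g i) u + pull (g k) v)).
   eqsum i;rewrite -(aut_reindex (fun f => psi j (pull (g i) u + pull f v)) (gaut i)).
   by eqsum k;rewrite pullD // pull_pull.
  rewrite -(aut_reindex (fun f => \sum_(k < n) psi j (pull f u + pull (g k) v)) (alpha_aut j)). eqsum i.
  rewrite -(aut_reindex (fun f => psi j (pull (g i \o alpha j) u + pull f v)) (beta_aut j)).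
  by eqsum k;rewrite /w !pull_pull.
 by apply: sum_cvg=> i;apply: sum_cvg=> k;exact: psi_cvg.
rewrite (lim_uniq L L').
have -> : limit_energy v = \sum_(k < n) A2 (pull (g k) v).
 exact: (lim_uniq (@energy_cvg v) (@energy_cvg2 v)).
under eq_bigr do rewrite big_split /= sumr_const card_ord.
by rewrite big_split /= sumr_const card_ord sumrMnl -/(limit_energy u) -mulrnDl mulr_natl.
Qed.

Lemma limit_energy_parallelogram u v :
 limit_energy (u + v) + limit_energy (u - v) = 2 * (limit_energy u + limit_energy v).
have [i0 H0] := gall aut_id;have [i1 H1] := gall aut_opp.
apply: (@mean_parallelogram _ _ n (fun i => pull (g i)) i0 i1).
- by move=> i x y;rewrite pullD.
- by move=> y;apply: char_ext=> x;rewrite pullE // H0.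
- move=> y;apply: char_ext=> x;rewrite pullE // H1 /=.
 by apply: (mulfI (char_neq0 y x));rewrite mulfV ?char_neq0 // -charD subrr char0.
- exact: limit_energy_ge0.
- exact: limit_energyN.
- exact: limit_energy_mean.
Qed.

Local Notation M := limit_energy.

Let images (nu : prob X R) i := image nu ((gaut i).2.1 : continuous (g i : borel X -> borel X)).

Let cf_images nu i y : cf (images nu i) y = cf nu (pull (g i) y).
by apply: cf_image=> x;rewrite pullE. Qed.

(** The convolution of the images of summands under selected automorphisms; over all automorphisms
    its squared modulus realises [energy]. *)
Let orbit (ps : seq (nat * 'I_n)) := convs cX [seq images (mu p.1) p.2 | p <- ps].
Let pairs N K := [seq (j, i) | j <- index_iota N K, i <- enum 'I_n].

Let cf_orbit ps y : cf (orbit ps) y = \prod_(p <- ps) cf (mu p.1) (pull (g p.2) y).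
by rewrite cf_convs big_map;eqsum p;exact: cf_images. Qed.

Let nsq_orbit N y : nsq (cf (orbit (pairs 0 N)) y) = expR (- energy N y).
have psiE j (u : Y) : nsq (cf (mu j) u) = expR (- psi j u).
 rewrite opprK lnK // posrE nsq_gt0. exact: summand_cf_neq0.
rewrite cf_orbit nsq_prod (eq_bigr _ (fun p _ => psiE p.1 _)) expR_sumN big_allpairs big_mkord.
by congr (expR (- _));eqsum j;rewrite big_enum.
Qed.

(** The law of [L1] is at hand, so the symmetrised convolution of its images under Aut(X) gives the
    Gaussian law without an infinite convolution. *)
Lemma gaussian_convolution : exists gamma : prob X R, forall y, cf gamma y = ((expR (- M y))%:C)%C.
pose G := convs cX [seq images nu1 i | i <- enum 'I_n].
exists (conv cX G (reflect G))=> y;rewrite cf_conv cf_reflect mul_conjc_nsq;congr (_%:C)%C.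
rewrite cf_convs big_map nsq_prod /limit_energy -expR_sumN big_enum;eqsum i.
by rewrite cf_images opprK lnK // posrE nsq_gt0 -cfE L1_nz.
Qed.

Let M_ge0 u : 0 <= M u. exact: limit_energy_ge0. Qed.

Let M_par u v : M (u + v) + M (u - v) = 2 * (M u + M v).
exact: limit_energy_parallelogram. Qed.

Lemma summand_on_sequence j0 (ys : nat -> Y) : separating ys ->
 exists (x : X) (v : nat -> R), (forall i, cf (mu j0) (ys i) = ys i x * ((expR (- v i))%:C)%C) /\
  forall i j k m, ys k = ys i + ys j -> ys m = ys i - ys j -> v k + v m = 2 * (v i + v j).
move=> sep;have [gamma cfg] := gaussian_convolution.
have eD := gs_coordD M_ge0 M_par ys;have S_sub := gs_span_subgroup M_ge0 M_par ys.
have eE n' u := @gs_energy R Y M M_par ys n' u.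
have S_ys i n' (h : (i < n')%N) := gs_span_ys M_ge0 M_par ys h.
have e_ys i k (ik : (i < k)%N) : gs_coord M ys k (ys i) = 0 := gs_coord_null M_ge0 M_par (S_ys i k ik) (leqnn k).
have [K1 [c [cK1 cb cD cE]]] := one_parameter hX cX lX eD S_sub eE S_ys sep cfg.
have [K0 cK0 K0E] := exp_exists hX lX finG sep e_ys cK1 cb cD cE.
have inj := exp_injective hX lX finG no_circle sep e_ys cK1 cb cD cE.
have [U [UU Uoo]] := nat_ultrafilter.
have [i0 gi0] := gall (@aut_id X).
(* The offset ensures that the summand [j0] occurs in every [theta N]. *)
pose sh N := (N + j0.+1)%N;pose theta N := orbit (pairs 0 (sh N)).
(* [g i0] is the identity, so removing the pair (j0, i0) splits off exactly [mu j0]. *)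
pose rest N := orbit (rem (j0, i0) (pairs 0 (sh N))).
(* The factors between N and K complete [theta N] to [theta K], and the reflection makes the product
   symmetric. *)
pose tau N K := conv cX (orbit (pairs (sh N) (sh K))) (reflect (theta K)).
have thetaE N y : cf (conv cX (mu j0) (rest N)) y = cf (theta N) y.
 rewrite cf_conv !cf_orbit [RHS](big_rem (j0, i0)) /=;last first.
  by apply/allpairsP;exists (j0, i0);rewrite /= mem_index_iota mem_enum /sh;split=> //;lia.
 by congr (cf _ _ * _);apply: char_ext=> x;rewrite pullE ?gi0 //;exact: aut_id.
have gamE N y : cf (theta N) y * conjc (cf (theta N) y) = ((expR (- energy (sh N) y))%:C)%C.
 by rewrite mul_conjc_nsq nsq_orbit.
apply: (gaussian_on_sequence UU Uoo (cX := cX) inj eD S_sub eE S_ys e_ys (rest := rest) (tau := tau)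
 (En := fun N => energy (sh N)) _ _ _ hX cK0 K0E).
- move=> y;have h := @energy_cvg y.
 by move=> A /h[m _ Hm];exists m=> // N /= mN;apply: Hm;rewrite /= /sh;exact: leq_trans mN (leq_addr _ _).
- move=> N K NK y;rewrite thetaE cf_conv cf_reflect -gamE mulrA;congr (_ * _).
 by rewrite !cf_orbit !big_allpairs -big_cat_nat //= /sh leq_add2r.
- by move=> N y;rewrite cf_conv cf_reflect thetaE gamE.
Qed.

(** The conclusion is available along one separating sequence at a time. Putting u, z, u + z, u - z
    in front of a fixed one yields every instance of the parallelogram law; the shift is always the
    same since the fixed part separates points, and the exponent [phi] is determined by the
    modulus. *)
Lemma summand_gaussian j0 : gaussian (mu j0).
have [zs zsep] := separating_sequence (R := R) hX cX lX.
pose phi (y : Y) : R := - ln (nsq (cf (mu j0) y)) / 2.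
have nz y : 0 < nsq (cf (mu j0) y).
 by rewrite nsq_gt0;exact: summand_cf_neq0.
have phiE (y : Y) x v : cf (mu j0) y = y x * ((expR (- v))%:C)%C -> v = phi y.
 move=> h;rewrite /phi h nsqM nsq_unit ?char_norm // mul1r /nsq /= expr0n addr0 -expRM_natl expRK.
 by rewrite mulr2n;field.
have [x0 [v0 [H0 _]]] := summand_on_sequence j0 zsep.
have all u z : exists v, [/\ forall y, y \in [:: u;z;u + z;u - z] -> cf (mu j0) y = y x0 * ((expR (- phi y))%:C)%C
  & v = phi (u + z) + phi (u - z) /\ v = 2 * (phi u + phi z)].
 pose ws i := nth (zs (i - 4)%N) [:: u;z;u + z;u - z] i.
 have wsE i : ws (i + 4)%N = zs i by rewrite /ws nth_default ?addnK // leq_addl.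
 have wsep : separating ws by move=> x Hx;apply: zsep=> i;rewrite -wsE.
 have [x [v [H Hp]]] := summand_on_sequence j0 wsep. have xE : x = x0.
  apply: subr0_eq;apply: zsep=> i. have e1 := H (i + 4)%N;have q1 := phiE _ _ _ e1;rewrite q1 wsE in e1.
  have e2 := H0 i;have q2 := phiE _ _ _ e2;rewrite q2 e1 in e2.
  have n0 : ((expR (- phi (zs i)))%:C)%C != 0 :> R[i] by rewrite eq_complex /= eqxx andbT gt_eqF ?expR_gt0.
  apply: (mulIf (char_neq0 (zs i) x0));rewrite -charD subrK mul1r;exact: (mulIf n0).
 exists (phi (u + z) + phi (u - z));split;last first.
  split=> //;rewrite -(phiE _ _ _ (H 0%N)) -(phiE _ _ _ (H 1%N)) -(phiE _ _ _ (H 2%N)) -(phiE _ _ _ (H 3%N)).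
  exact: Hp.
 by move=> y;rewrite !inE=> /or4P[]/eqP->;rewrite -xE;
  [rewrite -(phiE _ _ _ (H 0%N));exact: (H 0%N)|rewrite -(phiE _ _ _ (H 1%N));exact: (H 1%N)|
   rewrite -(phiE _ _ _ (H 2%N));exact: (H 2%N)|rewrite -(phiE _ _ _ (H 3%N));exact: (H 3%N)].
exists x0, phi;split=> [y|y|u z|y].
- have FF : Filter (nbhs y) := nbhs_filter y;rewrite /continuous_at /phi.
 have c1 := @nsq_cf_continuous R X hX cX lX (mu j0) y.
 apply: (@cvgM _ _ (nbhs y) FF (fun y => - ln (nsq (cf (mu j0) y))) (fun=> 2^-1));last exact: cvg_cst.
 by apply: (@cvgN _ R^o _ (nbhs y) FF);exact: (continuous_cvg _ (continuous_ln (nz y)) c1).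
- by rewrite /phi divr_ge0 //;exact: psi_ge0.
- by have [v [_ [<- <-]]] := all u z.
- by have [v [H _]] := all y y;rewrite cfE H // inE eqxx.
Qed.

End LinearForms.

Theorem proposition4p5
  R (X : topologicalZmodType)
  (X_hausdorff : hausdorff_space X)
  (X_second_countable : @second_countable X)
  (X_locally_compact : locally_compact [set: X])
  (X_no_circle : forall H : set X, subgroup H -> ~ isomorphic_to_circle R H)
  (Aut_finite : finite_set (topological_automorphisms X))
  (alpha beta : nat -> X -> X)
  (alpha_aut : forall j, topological_automorphisms X (alpha j))
  (beta_aut : forall j, topological_automorphisms X (beta j))
  (d : measure_display) (T : measurableType d) (P : probability T R)
  (xi : nat -> {RV P >-> borel X})
  (xi_independent : mutually_independent xi)
  (d' : measure_display) (T' : measurableType d') (Q : probability T' R)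
  (L1 L2 : {RV Q >-> borel X})
  (L1_series : series_cvg_in_distribution alpha xi L1)
  (L2_series : series_cvg_in_distribution beta xi L2)
  (L1L2_series : pair_cvg_in_distribution alpha beta xi L1 L2)
  (L1L2_independent : independent_pair L1 L2)
  (L1_nonvanishing : forall y : character R X,
    characteristic_function (distribution Q L1) y != 0)
  (L2_nonvanishing : forall y : character R X,
    characteristic_function (distribution Q L2) y != 0) :
  forall j, gaussian (distribution P (xi j)).
Proof.
have [n [g [ginj gaut gall]]] := aut_enum Aut_finite.
move=> j; exact: (summand_gaussian X_hausdorff X_second_countable X_locally_compact X_no_circle Aut_finite
  alpha_aut beta_aut xi_independent L1L2_series L1L2_independent L1_nonvanishing L2_nonvanishing ginj gaut gall).
Qed.
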